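(* Let $L>0$, $m\in\mathbb N$, and let $f:\mathbb R^m\to\mathbb R^{m\times m}$ and $g:\mathbb R^m\to\mathbb R^m$ be $C^\infty$ functions with compact support. With $\Phi=[H_0^1(0,L)]^m$ and $\varphi,F_1,F_2$ as in the context, for all sufficiently large $K\in\mathbb N$ the equation $$\partial_t v-\partial_x^2 v=\varphi(\|v\|^2_{H^1})F_1(v)\partial_x v+\varphi(\|v\|^2_{H^1})F_2(v),\qquad v|_{x=0}=v|_{x=L}=0,$$ possesses an inertial manifold $\mathcal M\subset\Phi$ of smoothness $C^{1+\varepsilon}$ for some $\varepsilon>0$.
   Context: All spaces are of $\mathbb R^m$- (or matrix-) valued functions on $(0,L)$. $P_K$ denotes the $L^2$-orthoprojector onto the span of the first $K$ eigenfunctions $e_1,\dots,e_K$ of $-\partial_x^2$ on $(0,L)$ with Dirichlet boundary conditions (componentwise), with eigenvalues $\lambda_k=(\pi k/L)^2$; $(\cdot,\cdot)$ is the $L^2$ inner product (componentwise). $B(\rho,0,X)$ is the ball of radius $\rho$ centered at $0$ in $X$. The maps $V$, $a$, $U$. For $u\in H^1$ let $V(u)=V_K(u):=\alpha^{-1}u$, where the matrix $\alpha(x)$ solves $\alpha'=\frac12 f(P_Ku)\alpha$, $\alpha(0)=\mathrm{Id}$. For every $\rho>0$ there is $K_0(\rho)$ such that for $K\ge K_0(\rho)$ and $v\in B(\rho,0,H^1)$ the problem $\partial_x a=\frac12 f(P_K(av))a$, $a|_{x=0}=\mathrm{Id}$, has a unique solution $a=a(v):[0,L]\to GL(m,\mathbb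 R)$; put $U(v):=a(v)v$, which inverts $V$. Choice of parameters. $\mathbb B=\{u\in\Phi:\|u\|_\Phi\le R/2\}$, where $R$ is large enough that $\mathbb B$ is an absorbing ball for the solution semigroup in $\Phi$ of $\partial_t u+f(u)\partial_x u-\partial_x^2u+g(u)=0$, $u|_{x=0,L}=0$. The number $r_1$ is such that $V_K(\mathbb B)\subset B(r_1,0,H^1_0)$ for all $K$; $r>r_1$; $K_0=K_0(r)$ is such that for every $K\ge K_0$ the map $U$ is well defined and is a $C^\infty$-diffeomorphism from $B(r,0,H^1_0)$ onto its image, with bounds on $U$, $V=U^{-1}$ and their derivatives independent of $K$. $\varphi$ is a smooth cut-off function with $\varphi(z)=1$ for $z\le r_1^2$ and $\varphi(z)=0$ for $z\ge r^2$. The nonlinearities, for $v\in B(r,0,H^1_0)$, $K\ge K_0$, $a=a(v)$: $$F_1(v)=a^{-1}\,[f(P_K(av))-f(av)]\,a,$$ $$F_2(v)=[a^{-1}\partial_x^2a-a^{-1}\partial_ta-a^{-1}f(av)\partial_xa]\,v-a^{-1}g(av),$$ where $\partial_t a=\partial_ta(v)$ is by definition the solution of $$\tfrac{d}{dx}\partial_ta=\tfrac12 f(P_Ku)\partial_ta+\tfrac12 \big(f'(P_Ku)[P_K\partial_tu]\big)a,\qquad \partial_ta|_{x=0}=0,$$ with $u=U(v)$ and $P_K\partial_tu:=\sum_{k=1}^K[(u,\partial_x^2e_k)-(f(u)\partial_xu,e_k)-(g(u),e_k)]e_k$. The products $\varphi(\|v\|_{H^1}^2)F_i(v)$ are understood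 as $0$ when $\|v\|_{H^1}\ge r$. Inertial manifold: a finite-dimensional submanifold $\mathcal M\subset\Phi$ such that, with $\tilde S(t)$ the solution semigroup of the equation in the claim, (1) $\tilde S(t)\mathcal M=\mathcal M$ for all $t\ge0$; (2) $\mathcal M$ is the graph of a Lipschitz continuous function $M:P_n\Phi\to Q_n\Phi$ for some $n\in\mathbb N$, $Q_n=\mathrm{Id}-P_n$; (3) there are positive $C,\theta$ such that for every trajectory $v(t)$, $t\ge0$, there is a trajectory $\tilde v(t)$ in $\mathcal M$ with $\|v(t)-\tilde v(t)\|_\Phi\le C\|v(0)-\tilde v(0)\|_\Phi e^{-\theta t}$. Smoothness $C^{1+\varepsilon}$ means that $M$ is continuously Fréchet differentiable with locally $\varepsilon$-Hölder derivative. *)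

(* Defs.v *)
From HB Require Import structures.
From mathcomp Require Import all_boot all_order all_algebra.
From mathcomp Require Import all_classical all_reals all_analysis.
From mathcomp Require Import measurable_realfun.
From mathcomp Require Import ring lra.
Import Order.TTheory GRing.Theory Num.Theory.
Import numFieldTopology.Exports numFieldNormedType.Exports.

Set Implicit Arguments.
Unset Strict Implicit.
Unset Printing Implicit Defensive.

Local Open Scope classical_set_scope.
Local Open Scope ring_scope.

Section L2.
Context {R : realType}.
Variable L : R.
Implicit Types (h : R -> R).

Local Notation mu := (@lebesgue_measure R).

(* [0, L] and (0, L) differ by a null set; all integrals are over [0, L]. *)
Definition L2 h : Prop := h \_ `[0, L] \in Lfun mu 2%:E.

Lemma L2_lin (a : R) h1 h2 :
  L2 h1 -> L2 h2 -> L2 (fun x => a * h1 x + h2 x).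
Proof.
rewrite /L2 => H1 H2.
rewrite (_ : _ \_ _ = a *: (h1 \_ `[0, L]) + h2 \_ `[0, L]).
  have h2le : (1 <= 2%:E :> \bar R)%E by rewrite lee1n.
  have [_ /(_ a _ _ H1 H2)] := @Lfun_submod_closed _ _ R mu 2%:E h2le.
  by [].
apply/funext => x; rewrite !fctE/= !patchE.
by case: ifPn => // _; rewrite [a *: _]mulr0 addr0.
Qed.

Lemma L2_0 : L2 (fun=> 0).
Proof.
have h2le : (1 <= 2%:E :> \bar R)%E by rewrite lee1n.
have [+ _] := @Lfun_submod_closed _ _ R mu 2%:E h2le.
rewrite /L2 (_ : _ \_ _ = 0)//.
by apply/funext => x; rewrite patchE; case: ifP.
Qed.

Lemma L2_measurable h : L2 h -> measurable_fun `[0, L] h.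
Proof.
rewrite /L2 inE => /andP[/[!inE]/= mh _].
by apply/(measurable_restrictT _ _).2.
Qed.

Lemma L2_integrableM h1 h2 : L2 h1 -> L2 h2 ->
  mu.-integrable `[0, L] (EFin \o (fun x => h1 x * h2 x)).
Proof.
rewrite /L2 => H1 H2.
have /Lfun1_integrable := Lfun2_mul_Lfun1 H1 H2.
rewrite [X in _ -> X]integrable_mkcond//.
congr (mu.-integrable _ _); apply/funext => x/=.
by rewrite !patchE; case: ifPn => //; rewrite mulr0.
Qed.

Lemma L2_integrable h : L2 h -> mu.-integrable `[0, L] (EFin \o h).
Proof.
move=> H.
have m2 : mu.-integrable `[0, L] (EFin \o (fun x => 1 + h x * h x)).
  have -> : EFin \o (fun x => 1 + h x * h x) =
     ((EFin \o cst 1%R) \+ (EFin \o (fun x => h x * h x)%R))%E.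
    by apply/funext => x.
  apply: integrableD => //; last exact: L2_integrableM.
  apply: continuous_compact_integrable; first exact: segment_compact.
  by apply: continuous_subspaceT => x; exact: cst_continuous.
apply: le_integrable m2 => //.
  by apply/measurable_EFinP; exact: L2_measurable.
move=> x _ /=; rewrite lee_fin [leRHS]ger0_norm; last first.
  by rewrite addr_ge0// -expr2 sqr_ge0.
have := sqr_ge0 (`|h x| - 1); rewrite sqrrB1 real_normK ?num_real//.
rewrite -expr2; have := normr_ge0 (h x); set y := `|h x|; set z := h x ^+ 2.
have : 0 <= z by rewrite sqr_ge0.
rewrite mulr2n; lra.
Qed.


Lemma ae_eq0_primitive h : L2 h ->
  (forall x, x \in `[0, L] -> \int[mu]_(y in `[0, x]) h y = 0) ->
  {ae mu, forall x, x \in `[0, L] -> h x = 0}.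
Proof.
move=> H h0.
have mI : measurable (`[0, L] : set R) by [].
pose k := h \_ `[0, L].
have ik : mu.-integrable setT (EFin \o k).
  move: (L2_integrable H); rewrite integrable_mkcond//.
  congr (mu.-integrable _ _); apply/funext => x/=.
  by rewrite /k !patchE; case: ifPn.
have lk : locally_integrable setT k.
  by apply: integrable_locally => //; exact: L2_integrable.
have iky y : mu.-integrable [set` Interval (BLeft 0) (BRight y)] (EFin \o k).
  exact: integrableS ik.
have := FTC1 iky lk.
have ae1 : {ae mu, forall x, x != 0 /\ x != L}.
  exists [set 0; L]; split.
  - exact: measurableU.
  - exact/countable_lebesgue_measure0/finite_set_countable/finite_set2.
  - move=> x /= /not_andP[/negP/negPn/eqP ->|/negP/negPn/eqP ->]; by [left|right].
apply: filterS2 ae1; first exact: (ae_filter_ringOfSetsType mu).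
move=> x [x0 xL] xk /= Ix.
have {Ix} : x \in `]0, L[.
  move: Ix; rewrite /= !in_itv/= => /andP[x0' xL'].
  by rewrite !lt_neqAle x0' xL' xL eq_sym x0.
move=> Ix.
case: xk.
  by move: Ix; rewrite in_itv/= lte_fin => /andP[].
move=> _.
rewrite {2}/k patchE mem_set; last first.
  by move: Ix; rewrite /= !in_itv/= => /andP[/ltW -> /ltW ->].
move=> <-; rewrite derive1E.
rewrite -[RHS](@derive_cst R R R 0 1 x).
apply: near_eq_derive; near=> y.
rewrite -[RHS](h0 y); last first.
  have : y \in `]0, L[ by near: y; exact: near_in_itvoo.
  by rewrite !in_itv/= => /andP[/ltW -> /ltW ->].
apply: eq_Rintegral => z; rewrite inE/= in_itv/= => /andP[z0 zy].
rewrite /k patchE mem_set//= in_itv/= z0/= (le_trans zy)//.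
have : y \in `]0, L[ by near: y; exact: near_in_itvoo.
by rewrite in_itv/= => /andP[_ /ltW].
Unshelve. all: by end_near. Qed.

End L2.

Section H10.
Context {R : realType}.
Variables (L : R) (m : nat).
Implicit Types (u v w g h : R -> 'cV[R]_m).

Local Notation mu := (@lebesgue_measure R).

Definition L2v u : Prop := forall i, L2 L (fun x => u x i 0).

(* The L^2(0, L)^m inner product. *)
Definition l2 u v : R :=
  \sum_(i < m) \int[mu]_(x in `[0, L]) (u x i 0 * v x i 0).

(* In one space dimension, u has the weak derivative g in L^2 iff (its continuous
   representative) u is a primitive of g. *)
Definition weak_derivative u g : Prop :=
  L2v g /\ forall i x, x \in `[0, L] ->
    u x i 0 = u 0 i 0 + \int[mu]_(y in `[0, x]) g y i 0.

(* [H^1_0(0, L)]^m: an element is the continuous representative, extended by 0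
   outside (0, L), so that equality in H^1_0 is Leibniz equality. *)
Definition is_H10 u : Prop :=
  [/\ forall x, x \notin `]0, L[ -> u x = 0,
      L2v u & exists g, weak_derivative u g].

(* One representative of the weak derivative, which is unique only a.e. *)
Definition dx u : R -> 'cV[R]_m := xget (cst 0) (weak_derivative u).

Let linE a u v x i : (a *: u + v) x i 0 = a * u x i 0 + v x i 0.
Proof. by rewrite !fctE !mxE. Qed.

Let integrableMl a (D : set (measurableTypeR R)) (k : R -> R) : measurable D ->
  mu.-integrable D (EFin \o k) -> mu.-integrable D (EFin \o (fun x => a * k x)).
Proof.
move=> mD ik; have := integrableZl mD a ik.
by congr (mu.-integrable D _); apply/funext => x.
Qed.

Let L2v0 : L2v 0.
Proof.
move=> i; rewrite (_ : (fun x => _) = (fun=> 0)); first exact: L2_0.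
by apply/funext => x; rewrite mxE.
Qed.

Let L2v_lin a u v : L2v u -> L2v v -> L2v (a *: u + v).
Proof.
move=> Lu Lv i; rewrite (_ : (fun x => _) = (fun x => a * u x i 0 + v x i 0)).
  exact: L2_lin.
by apply/funext => x; rewrite linE.
Qed.

Lemma weak_derivative_lin a u v g h :
  weak_derivative u g -> weak_derivative v h ->
  weak_derivative (a *: u + v) (a *: g + h).
Proof.
move=> [Lg ug] [Lh vh]; split; first exact: L2v_lin.
move=> i x xL; rewrite !linE (ug i x xL) (vh i x xL).
have sub : [set` `[0, x]] `<=` [set` `[0, L] : interval R].
  by apply: subset_itvl; rewrite bnd_simp; move: xL; rewrite in_itv/= => /andP[].
have ig : mu.-integrable `[0, x] (EFin \o (fun y => g y i 0)).
  by apply: integrableS (L2_integrable (Lg i)) => //; exact: sub.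
have ih : mu.-integrable `[0, x] (EFin \o (fun y => h y i 0)).
  by apply: integrableS (L2_integrable (Lh i)) => //; exact: sub.
under [in RHS]eq_Rintegral do rewrite linE.
rewrite RintegralD//; last exact: integrableMl.
by rewrite RintegralZl// mulrDr addrACA.
Qed.

Lemma weak_derivative_uniq u g h i :
  weak_derivative u g -> weak_derivative u h ->
  {ae mu, forall x, x \in `[0, L] -> g x i 0 = h x i 0}.
Proof.
move=> ug uh; have [Ld ud] := weak_derivative_lin (-1) ug uh.
have : {ae mu, forall x, x \in `[0, L] -> (-1 *: g + h) x i 0 = 0}.
  apply: ae_eq0_primitive (Ld i) _ => x xL.
  by have := ud i x xL; rewrite !linE mulN1r addNr mulN1r addNr add0r.
apply: filterS; first exact: (ae_filter_ringOfSetsType mu).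
move=> x + xL => /(_ xL); rewrite linE mulN1r => /eqP.
by rewrite addrC subr_eq0 => /eqP ->.
Qed.

Lemma l2C u v : l2 u v = l2 v u.
Proof. by apply: eq_bigr => i _; apply: eq_Rintegral => x _; rewrite mulrC. Qed.

Lemma l2_lin a u v w : L2v u -> L2v v -> L2v w ->
  l2 (a *: u + v) w = a * l2 u w + l2 v w.
Proof.
move=> Lu Lv Lw; rewrite /l2 mulr_sumr -big_split/=; apply: eq_bigr => i _.
have iu := L2_integrableM (Lu i) (Lw i).
have iv := L2_integrableM (Lv i) (Lw i).
under eq_Rintegral do rewrite linE mulrDl -mulrA.
rewrite RintegralD//; last exact: integrableMl.
by rewrite RintegralZl.
Qed.

Lemma l2_ge0 u : 0 <= l2 u u.
Proof.
by apply: sumr_ge0 => i _; apply: Rintegral_ge0 => x _; rewrite -expr2 sqr_ge0.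
Qed.

Lemma l2_ae g h w : L2v g -> L2v h -> L2v w ->
  (forall i, {ae mu, forall x, x \in `[0, L] -> g x i 0 = h x i 0}) ->
  l2 g w = l2 h w.
Proof.
move=> Lg Lh Lw gh; apply: eq_bigr => i _; congr fine.
apply: ae_eq_integral => //=.
- by have /integrableP[] := L2_integrableM (Lg i) (Lw i).
- by have /integrableP[] := L2_integrableM (Lh i) (Lw i).
apply: filterS (gh i); first exact: (ae_filter_ringOfSetsType mu).
by move=> x /[apply] ->.
Qed.

Lemma l2_eq0 g i : L2v g -> l2 g g = 0 ->
  {ae mu, forall x, x \in `[0, L] -> g x i 0 = 0}.
Proof.
move=> Lg /eqP; rewrite psumr_eq0; last first.
  by move=> j _; apply: Rintegral_ge0 => x _; rewrite -expr2 sqr_ge0.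
move=> /allP/(_ i); rewrite mem_index_enum => /(_ isT)/= /eqP gi.
have ig := L2_integrableM (Lg i) (Lg i).
have [mg _] := integrableP _ _ _ ig.
have mI : measurable (`[0, L]%classic : set (measurableTypeR R)) by [].
have [ae _] := ae_eq_integral_abs mu mI mg.
suff ae0 : ae_eq mu `[0, L]%classic (EFin \o (fun x => g x i 0 * g x i 0)) (cst 0%E).
  case: ae0 => N [mN N0 sN]; exists N; split => //.
  apply: subset_trans sN; apply: subsetC => x /= + xL => /(_ xL)[] /eqP.
  by rewrite mulf_eq0 orbb => /eqP.
apply: ae; rewrite -[RHS](congr1 EFin gi) /Rintegral fineK; last first.
  exact: integrable_fin_num.
by apply: eq_integral => x _; rewrite gee0_abs// lee_fin -expr2 sqr_ge0.
Qed.

Definition H10_pred : {pred R -> 'cV[R]_m} := mem [set u | is_H10 u].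

Lemma H10_submod_closed : submod_closed H10_pred.
Proof.
split.
  rewrite inE/=; split; [by []|exact: L2v0|].
  exists 0; split; first exact: L2v0.
  move=> i x xL; under eq_Rintegral do rewrite mxE.
  by rewrite Rintegral_cst// mul0r addr0.
move=> a u v; rewrite !inE => -[u0 Lu [g ug]] [v0 Lv [h vh]]; split.
- by move=> x xL; rewrite !fctE u0// v0// scaler0 addr0.
- exact: L2v_lin.
- by exists (a *: g + h); exact: weak_derivative_lin.
Qed.

HB.instance Definition _ :=
  GRing.isSubmodClosed.Build _ _ H10_pred H10_submod_closed.

Record H10 := MkH10 { H10_val :> R -> 'cV[R]_m; _ : H10_val \in H10_pred }.

HB.instance Definition _ := [isSub for H10_val].
HB.instance Definition _ := [Choice of H10 by <:].
HB.instance Definition _ := [SubChoice_isSubLmodule of H10 by <:].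

Definition H1dot (u v : H10) : R := l2 u v + l2 (dx u) (dx v).

Definition H1norm (u : H10) : R := Num.sqrt (H1dot u u).

Let H10P (u : H10) : is_H10 u.
Proof. by have := valP u; rewrite inE. Qed.

Lemma dxP (u : H10) : weak_derivative u (dx u).
Proof. by have [_ _ [g ug]] := H10P u; exact: (xgetPex _ (ex_intro _ g ug)). Qed.

Let H10_lin a (u v : H10) : (a *: u + v : H10) = a *: (u : R -> _) + v :> (R -> _).
Proof. by []. Qed.

Lemma H1dotC (u v : H10) : H1dot u v = H1dot v u.
Proof. by rewrite /H1dot l2C [X in _ + X]l2C. Qed.

Lemma H1dot_lin a (u v w : H10) : H1dot (a *: u + v) w = a * H1dot u w + H1dot v w.
Proof.
have [_ Lu _] := H10P u; have [_ Lv _] := H10P v; have [_ Lw _] := H10P w.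
have [Lu' _] := dxP u; have [Lv' _] := dxP v; have [Lw' _] := dxP w.
rewrite /H1dot; have -> : l2 (a *: u + v : H10) w = a * l2 u w + l2 v w.
  by rewrite H10_lin l2_lin.
suff -> : l2 (dx (a *: u + v : H10)) (dx w) =
    a * l2 (dx u) (dx w) + l2 (dx v) (dx w) by rewrite mulrDr addrACA.
rewrite -l2_lin//; apply: l2_ae => //.
- by have [] := dxP (a *: u + v).
- exact: L2v_lin.
- move=> i; apply: weak_derivative_uniq (dxP _) _; rewrite H10_lin.
  by apply: weak_derivative_lin; exact: dxP.
Qed.

Lemma H1dot_ge0 (u : H10) : 0 <= H1dot u u.
Proof. by rewrite addr_ge0// l2_ge0. Qed.

Lemma H1dot_CS (u v : H10) : H1dot u v <= H1norm u * H1norm v.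
Proof.
have E t : H1dot (t *: u + v) (t *: u + v) =
    t ^+ 2 * H1dot u u + 2 * t * H1dot u v + H1dot v v.
  rewrite H1dot_lin ![H1dot _ (t *: u + v)]H1dotC !H1dot_lin (H1dotC v u).
  by ring.
have P t : 0 <= t ^+ 2 * H1dot u u + 2 * t * H1dot u v + H1dot v v.
  by rewrite -E H1dot_ge0.
rewrite /H1norm -sqrtrM ?H1dot_ge0//.
have [uv0|uv0] := leP (H1dot u v) 0.
  by rewrite (le_trans uv0)// sqrtr_ge0.
rewrite -[leLHS]ger0_norm ?(ltW uv0)// -sqrtr_sqr ler_sqrt ?mulr_ge0 ?H1dot_ge0//.
have := H1dot_ge0 u; rewrite le_eqVlt => /predU1P[u0|u0].
  have := P (- (H1dot v v + 1) / (2 * H1dot u v)).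
  rewrite -u0 mulr0 add0r.
  have -> : 2 * (- (H1dot v v + 1) / (2 * H1dot u v)) * H1dot u v =
            - (H1dot v v + 1) by field; rewrite gt_eqF.
  by move=> ?; exfalso; lra.
have := P (- H1dot u v / H1dot u u).
have -> : (- H1dot u v / H1dot u u) ^+ 2 * H1dot u u +
   2 * (- H1dot u v / H1dot u u) * H1dot u v + H1dot v v =
   (H1dot u u * H1dot v v - H1dot u v ^+ 2) / H1dot u u.
  by field; rewrite gt_eqF.
by rewrite pmulr_lge0 ?invr_gt0// subr_ge0.
Qed.

Lemma H1normD (u v : H10) : H1norm (u + v) <= H1norm u + H1norm v.
Proof.
rewrite -(@ler_pXn2r _ 2)// ?nnegrE ?addr_ge0 ?sqrtr_ge0//.
rewrite sqrrD !sqr_sqrtr ?H1dot_ge0//.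
have -> : u + v = 1 *: u + v by rewrite scale1r.
rewrite H1dot_lin ![H1dot _ (1 *: u + v)]H1dotC !H1dot_lin (H1dotC v u).
have := H1dot_CS u v; lra.
Qed.

Lemma H1normZ a (u : H10) : H1norm (a *: u) = `|a| * H1norm u.
Proof.
rewrite /H1norm -[a *: u]addr0 H1dot_lin [X in a * X]H1dotC H1dot_lin.
have Z (w : H10) : H1dot 0 w = 0.
  have := H1dot_lin 1 0 0 w; rewrite scale1r addr0 mul1r => /eqP.
  by rewrite -subr_eq0 opprD addNKr oppr_eq0 => /eqP.
by rewrite !Z !addr0 mulrA -expr2 sqrtrM ?sqr_ge0// sqrtr_sqr.
Qed.

Lemma H1norm_eq0 (u : H10) : H1norm u = 0 -> u = 0.
Proof.
move=> /eqP; rewrite sqrtr_eq0 => u0.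
have {u0} : l2 (dx u) (dx u) = 0.
  apply/eqP; rewrite eq_le l2_ge0 andbT (le_trans _ u0)//.
  by rewrite lerDr l2_ge0.
have [Lg ug] := dxP u; move=> g0.
have [uo _ _] := H10P u.
apply/val_inj/funext => x /=; rewrite [RHS](_ : _ = 0)//.
have [xL|xL] := boolP (x \in `]0, L[); last exact: uo.
have xL' : x \in `[0, L].
  by move: xL; rewrite !in_itv/= => /andP[/ltW -> /ltW ->].
apply/colP => i; rewrite ug// uo ?in_itv/= ?ltxx// mxE add0r.
have sub : [set` `[0, x]] `<=` [set` `[0, L] : interval R].
  by apply: subset_itvl; rewrite bnd_simp; move: xL'; rewrite in_itv/= => /andP[].
rewrite /Rintegral (@ae_eq_integral _ _ _ mu _ (cst 0%E))//.
- by rewrite integral0.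
- apply/measurable_EFinP; apply: measurable_funS sub _ => //.
  exact: L2_measurable.
- have [N [mN N0 sN]] := l2_eq0 i Lg g0; exists N; split => //.
  apply: subset_trans sN; apply: subsetC => y /= yE yx.
  by rewrite yE//; exact: sub.
Qed.

HB.instance Definition _ :=
  @Lmodule_isNormed.Build R H10 H1norm H1normD H1normZ H1norm_eq0.

Lemma H10_normE (u : H10) :
  `|u| = Num.sqrt (l2 u u + l2 (dx u) (dx u)).
Proof. by []. Qed.

End H10.

Section Calculus.
Context {R : realType}.

Definition iter_derive (V W : normedModType R) (vs : seq V) (h : V -> W) :
  V -> W := foldr (fun v k => 'D_v k) h vs.

(* On a finite-dimensional V this is C^oo on the open set A; on a Banach space
   it is C^oo in the Frechet sense as soon as each iter_derive is bounded on A
   by C_n times the product of the norms of the n directions. *)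
Definition smooth_on (V W : normedModType R) (A : set V) (h : V -> W) : Prop :=
  forall vs x, A x -> differentiable (iter_derive vs h) x.

Definition smooth (V W : normedModType R) (h : V -> W) : Prop :=
  smooth_on setT h.

Definition compactly_supported (V W : normedModType R) (h : V -> W) : Prop :=
  compact (closure [set x | h x != 0]).

End Calculus.

Section Spectral.
Context {R : realType}.
Variables (L : R) (m : nat).
Implicit Type w : R -> 'cV[R]_m.

Local Notation mu := (@lebesgue_measure R).

Definition eigf (k : nat) (x : R) : R :=
  Num.sqrt (2 / L) * sin (k%:R * pi * x / L).

(* Componentwise L^2 pairing with a scalar function. *)
Definition pairing w (h : R -> R) : 'cV[R]_m :=
  \col_i \int[mu]_(x in `[0, L]) (w x i 0 * h x).

Definition proj (K : nat) w (x : R) : 'cV[R]_m :=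
  \sum_(1 <= k < K.+1) eigf k x *: pairing w (eigf k).

(* Junk value 0 when w, restricted to [0, L], is not in H10. *)
Definition embed w : H10 L m := insubd 0 (w \_ `[0, L]).

Definition projH (n : nat) (u : H10 L m) : H10 L m := embed (proj n u).

End Spectral.

Section Transformation.
Context {R : realType}.
Variables (L : R) (m : nat) (f : 'cV[R]_m -> 'M[R]_m) (g : 'cV[R]_m -> 'cV[R]_m).
Variable K : nat.
Implicit Types (a : R -> 'M[R]_m) (u v : R -> 'cV[R]_m).

Definition ivp (F : R -> 'M[R]_m -> 'M[R]_m) (y0 : 'M[R]_m) (y : R -> 'M[R]_m) :
    Prop :=
  [/\ y 0 = y0, {within `[0, L], continuous y} &
      forall x, x \in `]0, L[ -> is_derive x 1 y (F x (y x))].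

Definition act a v (x : R) : 'cV[R]_m := a x *m v x.

Definition is_alpha u : set (R -> 'M[R]_m) :=
  ivp (fun x y => 2^-1 *: (f (proj L K u x) *m y)) 1%:M.

(* xget selects a solution of the problem; solutions are determined only on
   [0, L], and nothing below depends on their values elsewhere. *)
Definition alpha u : R -> 'M[R]_m := xget (cst 1%:M) (is_alpha u).

Definition Vmap (u : H10 L m) : H10 L m := embed L (act (invmx \o alpha u) u).

Definition is_gauge v a : Prop :=
  ivp (fun x y => 2^-1 *: (f (proj L K (act a v) x) *m y)) 1%:M a /\
  forall x, x \in `[0, L] -> a x \in unitmx.

Definition gauge v : R -> 'M[R]_m := xget (cst 1%:M) (is_gauge v).

Definition Umap (v : H10 L m) : H10 L m := embed L (act (gauge v) v).

(* P_K d_t u, with d_t u expressed through the reaction-advection equation. *)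
Definition proj_dt u (x : R) : 'cV[R]_m :=
  \sum_(1 <= k < K.+1) eigf L k x *:
    (pairing L u (derive1n 2 (eigf L k))
     - pairing L (fun y => f (u y) *m dx L u y) (eigf L k)
     - pairing L (g \o u) (eigf L k)).

Definition is_dt_gauge u a : set (R -> 'M[R]_m) :=
  ivp (fun x b => 2^-1 *: (f (proj L K u x) *m b) +
         2^-1 *: ('d f (proj L K u x) (proj_dt u x) *m a x)) 0.

Definition dt_gauge (v : H10 L m) : R -> 'M[R]_m :=
  xget (cst 0) (is_dt_gauge (Umap v) (gauge v)).

Definition F1 (v : H10 L m) (x : R) : 'M[R]_m :=
  let a := gauge v in
  invmx (a x) *m (f (proj L K (act a v) x) - f (a x *m v x)) *m a x.

Definition F2 (v : H10 L m) (x : R) : 'cV[R]_m :=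
  let a := gauge v in
  (invmx (a x) *m derive1n 2 a x - invmx (a x) *m dt_gauge v x
   - invmx (a x) *m f (a x *m v x) *m derive1 a x) *m v x
  - invmx (a x) *m g (a x *m v x).

Definition cutoff_rhs (phi : R -> R) (r : R) (v : H10 L m) (x : R) : 'cV[R]_m :=
  if `|v| < r then
    phi (`|v| ^+ 2) *: (F1 v x *m dx L v x) + phi (`|v| ^+ 2) *: F2 v x
  else 0.

(* N in  d_t u - d_x^2 u = N u  for  d_t u + f(u) d_x u - d_x^2 u + g(u) = 0. *)
Definition rda_rhs (u : H10 L m) (x : R) : 'cV[R]_m :=
  - (f (u x) *m dx L u x) - g (u x).

End Transformation.

Section Dynamics.
Context {R : realType}.
Variables (L : R) (m : nat).
Local Notation Phi := (H10 L m).

(* Weak formulation of  d_t v - d_x^2 v = N v,  v = 0 at x = 0, L. *)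
Definition solution (N : Phi -> R -> 'cV[R]_m) (v : R -> Phi) : Prop :=
  {within `[0, +oo[, continuous v} /\
  forall (psi : Phi) (t : R), 0 < t ->
    is_derive t 1 (fun s => l2 L (v s) psi)
      (l2 L (N (v t)) psi - l2 L (dx L (v t)) (dx L psi)).

(* Existence and uniqueness are part of being the solution semigroup. *)
Definition solution_semigroup (N : Phi -> R -> 'cV[R]_m) (S : R -> Phi -> Phi) :
    Prop :=
  (forall u0, S 0 u0 = u0 /\ solution N (S^~ u0)) /\
  (forall v, solution N v -> forall t, 0 <= t -> v t = S t (v 0)).

Definition absorbing (S : R -> Phi -> Phi) (B : set Phi) : Prop :=
  forall D : set Phi, bounded_set D ->
    exists T, forall t, T <= t -> 0 <= t -> S t @` D `<=` B.

(* M is a function on P_n Phi; it is represented by M : Phi -> Phi, of which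
   only the values on range (projH n) matter. *)
Definition C1_Holder (n : nat) (eps : R) (M : Phi -> Phi) : Prop :=
  let h := M \o projH n in
  (forall p, differentiable h p) /\
  forall p0, exists delta C : R, 0 < delta /\
    forall p q, ball p0 delta p -> ball p0 delta q -> forall w,
      `|'d h p w - 'd h q w| <= C * `|p - q| `^ eps * `|w|.

Definition inertial_manifold (S : R -> Phi -> Phi) (eps : R) (MM : set Phi) :
    Prop :=
  [/\ forall t, 0 <= t -> S t @` MM = MM,
      exists (n : nat) (M : Phi -> Phi), [/\ (0 < n)%N,
        forall p, range (projH n) p -> projH n (M p) = 0,
        [lipschitz M p | p in range (projH n)],
        C1_Holder n eps M &
        MM = [set p + M p | p in range (projH n)]] &
      exists C theta : R, [/\ 0 < C, 0 < theta &
        forall v0, exists2 w0, MM w0 &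
          forall t, 0 <= t ->
            `|S t v0 - S t w0| <= C * `|v0 - w0| * expR (- theta * t)]].

End Dynamics.

Section Diffeo.
Context {R : realType}.
Variables (L : R) (m : nat) (f : 'cV[R]_m -> 'M[R]_m).
Local Notation Phi := (H10 L m).

(* For K >= K0, U_K is well defined and a C^oo diffeomorphism from the ball of
   radius r onto its (open) image, with inverse V_K, and the n-th derivatives of
   U_K and V_K, as multilinear maps, are bounded independently of K. *)
Definition U_diffeo (r : R) (K0 : nat) : Prop :=
  let B := ball (0 : Phi) r in
  [/\ forall K, (K0 <= K)%N -> forall v : Phi, B v ->
        (exists a, is_gauge L f K v a) /\
        (forall a b, is_gauge L f K v a -> is_gauge L f K v b ->
           {in `[0, L], a =1 b}),
      forall K, (K0 <= K)%N ->
        [/\ open (Umap f K @` B), forall v, B v -> Vmap f K (Umap f K v) = v,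
            smooth_on B (Umap f K : Phi -> Phi) &
            smooth_on (Umap f K @` B) (Vmap f K : Phi -> Phi)] &
      forall n, exists C : R, forall K, (K0 <= K)%N ->
        forall vs : seq Phi, size vs = n ->
        (forall v, B v ->
           `|iter_derive vs (Umap f K) v| <= C * \prod_(w <- vs) `|w|) /\
        (forall u, (Umap f K @` B) u ->
           `|iter_derive vs (Vmap f K) u| <= C * \prod_(w <- vs) `|w|)].

End Diffeo.

(* Main.v *)
(* In the coordinates v = V(u) the only term of the nonlinearity which loses a derivative
   is F_1(v) v', and F_1 = O(K^(-1/2)) uniformly, because P_K u converges to u at that rate
   in C([0, L]) on bounded sets of H^1.  Hence the derivative of the truncated nonlinearity
   splits as D1 + D2, where D1 has norm O(K^(-1/2)) as a map from H^1 to L^2 and D2 takes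
   values in C^(1/2), so that the sine coefficients of D2 with large index are uniformly small.

   The n-th spectral gap has width of order n.  With th its centre, H^1 norms of solutions are
   controlled by L^2 norms of the forcing weighted by (1 + lam_j) / |lam_j - th| in the j-th
   mode.  This weight is at most of the order of the gap, and it stays bounded as n grows in
   any fixed finite set of modes; in the remaining modes only D1 and the small tail of D2
   matter.  Taking first K and then n large gives the spectral gap condition.

   Given the gap condition, the backward trajectories growing at most like exp(- th t) in
   reversed time are parametrised by their first n modes (fixed point of the mode-by-mode
   Duhamel formulas in an exponentially weighted space); their values at time 0 form the
   manifold.  The same fixed point theorem gives the forward semigroup, the exponential
   tracking, and the linearised trajectories, whose remainders decay with a slightly
   different weight: this yields a Hoelder continuous derivative. *)
From HB Require Import structures.
Require Import Defs.
From mathcomp Require Import all_boot all_order all_algebra.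
From mathcomp Require Import all_classical all_reals all_analysis.
From mathcomp Require Import measurable_realfun.
From mathcomp Require Import ring lra.
Import Order.TTheory GRing.Theory Num.Theory.
Import numFieldTopology.Exports numFieldNormedType.Exports.
Set Implicit Arguments.
Unset Strict Implicit.
Unset Printing Implicit Defensive.
Local Open Scope classical_set_scope.
Local Open Scope ring_scope.

(** * Scalar linear equations *)

(** The two smallness mechanisms must act in this order. A forcing that lies only in L^2 is
    amplified by as much as the gap grows, so no choice of n beats [F_1(v) v'] with a fixed
    coefficient: only K makes it small, and the bounds on [F_1] must be uniform in K. The other part
    has no small factor and is beaten by compactness; its constants may depend on K because n is
    chosen last. The gauge solves a nonlocal nonlinear problem. But U is given as a smooth map, so
    [f(P_K U(v))] is a known coefficient and [a(v)] is the fundamental matrix of a linear system,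
    which variation of constants differentiates. Nothing is known about U on the sphere where the
    truncation ends. There the cut-off, being smooth and zero beyond, vanishes to second order, and
    the truncated nonlinearity keeps a quadratic Taylor remainder on the whole space. Sine
    coefficients and finite sums reduce every evolution problem to scalar equations and energy
    estimates. Reversing time only changes the signs of the rates, so one fixed point theorem covers
    past, future and tracking. *)

Section RealCalculus.
Context {R : realType}.
Implicit Types (F f : R -> R) (a b t : R) (P : pred nat).

Lemma ltr_pow2_archi (x : R) : exists i : nat, x < 2 ^+ i.
Proof.
exists (Num.bound `|x|); apply: le_lt_trans (ler_norm x) _.
apply: lt_le_trans (archi_boundP (normr_ge0 x)) _.
by rewrite -natrX ler_nat ltnW// ltn_expl.
Qed.

Lemma le0_geometric (x B : R) : (forall i : nat, x <= B / 2 ^+ i) -> x <= 0.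
Proof.
move=> h; rewrite leNgt; apply/negP => x0.
have [i hi] := ltr_pow2_archi (B / x).
have := h i; rewrite ler_pdivlMr ?exprn_gt0// leNgt => /negP; apply.
by rewrite mulrC -ltr_pdivrMr.
Qed.

Lemma derive_ge0_le F f a b : a <= b ->
  (forall t, a < t -> t < b -> is_derive t 1 F (f t)) ->
  {within `[a, b], continuous F} ->
  (forall t, a < t -> t < b -> 0 <= f t) -> F a <= F b.
Proof.
move=> ab dF cF f0; have [c cab] : exists2 c, a <= c <= b &
    F b - F a = (if (a < c) && (c < b) then f c else 0) * (b - a).
  move: ab; rewrite le_eqVlt => /predU1P[<-|ab].
    by exists a; rewrite ?lexx// !subrr mulr0.
  have [|c /[!in_itv]/= cab ->] := @MVT R F f a b ab _ cF.
    by move=> x; rewrite in_itv/= => /andP[ax xb]; exact: dF.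
  by exists c; rewrite ?cab//; case/andP: cab => /ltW -> /ltW ->.
rewrite -subr_ge0 => ->; apply: mulr_ge0; last by rewrite subr_ge0.
by case: ifPn => // /andP[ac cb]; exact: f0.
Qed.

Lemma derive_le0_ge F f a b : a <= b ->
  (forall t, a < t -> t < b -> is_derive t 1 F (f t)) ->
  {within `[a, b], continuous F} ->
  (forall t, a < t -> t < b -> f t <= 0) -> F b <= F a.
Proof.
move=> ab dF cF f0.
rewrite -lerN2; apply: (@derive_ge0_le (\- F) (\- f) a b) => //.
- by move=> t at_ tb /=; have := dF t at_ tb => ?; exact: is_deriveN.
- by move=> x; apply: cvgN; exact: cF.
- by move=> t at_ tb /=; rewrite oppr_ge0 f0.
Qed.

Lemma is_derive_little_o F t (d : R) :
  (forall e, 0 < e -> exists2 dl, 0 < dl & forall s, `|s - t| < dl ->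
     `|F s - F t - (s - t) * d| <= e * `|s - t|) -> is_derive t 1 F d.
Proof.
move=> h.
have cF : (fun k => k^-1 *: (F (k *: 1 + t) - F t)) @ 0^' --> d.
  apply/cvgrPdist_le => /= e e0; have [dl dl0 hdl] := h e e0.
  near=> k.
  have k0 : k != 0 by near: k; exact: nbhs_dnbhs_neq.
  have kdl : `|k| < dl by near: k; apply: dnbhs0_lt.
  have := hdl (k + t); rewrite addrK => /(_ kdl).
  rewrite /GRing.scale/= mulr1 => hk.
  have -> : d - k^-1 * (F (k + t) - F t) = - (k^-1 * (F (k + t) - F t - k * d)).
    by field.
  by rewrite normrN normrM normfV ler_pdivrMl ?normr_gt0// [leRHS]mulrC.
have dF : derivable F t 1 by apply/cvg_ex; exists d.
by apply: (DeriveDef dF); exact: cvg_lim cF.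
Unshelve. all: by end_near. Qed.

Lemma is_derive_quadratic F t (d C : R) :
  (forall s, `|F s - F t - (s - t) * d| <= C * (s - t) ^+ 2) -> is_derive t 1 F d.
Proof.
move=> h; apply: is_derive_little_o => e e0.
have C0 : 0 < `|C| + 1 by rewrite ltr_wpDl.
exists (e / (`|C| + 1)); first by rewrite divr_gt0.
move=> s; rewrite ltr_pdivlMr// => /ltW hs; apply: le_trans (h s) _.
rewrite -[(s - t) ^+ 2]real_normK ?num_real// expr2 mulrA ler_wpM2r//.
apply: le_trans hs; rewrite mulrC ler_wpM2l//.
by apply: le_trans (ler_norm C) _; rewrite lerDl.
Qed.

Lemma is_derive_bigsum (F : nat -> R -> R) (d : nat -> R) t P J :
  (forall j, P j -> is_derive t 1 (F j) (d j)) ->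
  is_derive t 1 (fun s => \sum_(j < J | P j) F j s) (\sum_(j < J | P j) d j).
Proof.
move=> dF; elim: J => [|J IH].
  rewrite big_ord0 (_ : (fun s => _) = cst 0); first exact: is_derive_cst.
  by apply/funext => s; rewrite big_ord0.
rewrite big_mkcond big_ord_recr/= -big_mkcond/=.
rewrite (_ : (fun s => _) = (fun s => \sum_(j < J | P j) F j s) +
    (fun s => if P J then F J s else 0)).
  apply: is_deriveD; case: ifPn => PJ; first exact: dF.
  exact: is_derive_cst.
by apply/funext => s; rewrite [LHS]big_mkcond big_ord_recr/= -big_mkcond/=.
Qed.

Lemma continuous_bigsum (T : topologicalType) (F : nat -> T -> R) P J :
  (forall j, P j -> continuous (F j)) ->
  continuous (fun s => \sum_(j < J | P j) F j s).
Proof.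
move=> cF; elim: J => [|J IH] x.
  rewrite (_ : (fun s => _) = cst 0); first exact: cst_continuous.
  by apply/funext => s; rewrite big_ord0.
rewrite (_ : (fun s => _) = (fun s => \sum_(j < J | P j) F j s) \+
    (fun s => if P J then F J s else 0)).
  by apply: cvgD; [exact: IH|case: ifPn => PJ; [exact: cF|exact: cst_continuous]].
by apply/funext => s; rewrite [LHS]big_mkcond big_ord_recr/= -big_mkcond/=.
Qed.

Lemma is_derive_expRM (k t : R) : is_derive t 1 (fun s => expR (k * s)) (k * expR (k * t)).
Proof.
have -> : (fun s => expR (k * s)) = expR \o (fun s => k * s) by [].
have dk : is_derive t 1 (fun s : R => k * s) k.
  have := @is_deriveZ _ _ _ id k t 1 1 (is_derive_id _ _).
  by rewrite [_ *: 1]mulr1.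
by rewrite mulrC; apply: is_derive1_comp.
Qed.

Lemma continuous_expRM (k : R) : continuous (fun s : R => expR (k * s)).
Proof.
move=> x; apply: continuous_comp; last exact: continuous_expR.
by apply: cvgMr; exact: cvg_id.
Qed.

Variables (mu w nu : nat -> R) (th gam : R).
Hypotheses (w0 : forall j, 0 < w j) (nu0 : forall j, 0 < nu j) (gam0 : 0 < gam).

(* [2 w y n <= w^2 y^2 / nu + nu n^2] *)
Let young j (y n : R) : 2 * w j * y * n <= w j ^+ 2 * y ^+ 2 / nu j + nu j * n ^+ 2.
Proof.
rewrite -subr_ge0.
have -> : w j ^+ 2 * y ^+ 2 / nu j + nu j * n ^+ 2 - 2 * w j * y * n =
          (w j * y - nu j * n) ^+ 2 / nu j by field; rewrite gt_eqF.
by rewrite divr_ge0 ?sqr_ge0// ltW.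
Qed.

Let energy P J (y : nat -> R -> R) t := \sum_(j < J | P j) w j * y j t ^+ 2.

Let der_energy P J (y n : nat -> R -> R) t :
  (forall j, P j -> is_derive t 1 (y j) (- mu j * y j t + n j t)) ->
  is_derive t 1 (energy P J y)
    (\sum_(j < J | P j) w j * (2 * y j t * (- mu j * y j t + n j t))).
Proof.
move=> dy; apply: (@is_derive_bigsum (fun j s => w j * y j s ^+ 2)
   (fun j => w j * (2 * y j t * (- mu j * y j t + n j t)))) => j Pj.
have := dy j Pj => dyj.
have d2 : is_derive t 1 (y j ^+ 2) ((2 * y j t) *: (- mu j * y j t + n j t)).
  by apply: (is_derive_eq (is_deriveM dyj dyj)); rewrite /GRing.scale/=; ring.
exact: (@is_deriveZ _ _ _ (y j ^+ 2) (w j) t 1 _ d2).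
Qed.

Let continuous_energy P J (y : nat -> R -> R) :
  (forall j, P j -> continuous (y j)) -> continuous (energy P J y).
Proof.
move=> cy; apply: (@continuous_bigsum _ (fun j s => w j * y j s ^+ 2)) => j Pj x.
by apply: cvgMr; apply: (@continuous_comp _ _ _ (y j) (fun z => z ^+ 2));
  [exact: cy|exact: exprn_continuous].
Qed.

Let der_exp_energy k E dE t : is_derive t 1 E dE ->
  is_derive t 1 (fun s => expR (k * s) * E s) (expR (k * t) * (k * E t + dE)).
Proof.
move=> dE'; apply: (is_derive_eq (is_deriveM (is_derive_expRM k t) dE')).
by rewrite /GRing.scale/=; ring.
Qed.

(** With [k = 2 (th + gam)] the functional [G], the weighted energy times [exp (k t)] minus
    [b / (2 gam) exp (2 gam t)], is nonincreasing. In its derivative [young] splits the product of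
    solution and forcing; the part [w^2 y^2 / nu] is paid for by the term [w / (2 nu)] of the
    gap. *)
Lemma data_modes_estimate P J (y n : nat -> R -> R) b T : 0 <= b -> 0 <= T ->
  (forall j, P j -> th + gam + w j / (2 * nu j) <= mu j) ->
  (forall j, P j -> continuous (y j)) ->
  (forall j t, P j -> 0 < t -> t < T ->
     is_derive t 1 (y j) (- mu j * y j t + n j t)) ->
  (forall t, 0 < t -> t < T ->
     \sum_(j < J | P j) nu j * n j t ^+ 2 <= b * expR (- (2 * th) * t)) ->
  \sum_(j < J | P j) w j * y j T ^+ 2 <=
    expR (- (2 * th) * T) * (\sum_(j < J | P j) w j * y j 0 ^+ 2 + b / (2 * gam)).
Proof.
move=> b0 T0 muP cy dy nb.
pose k := 2 * (th + gam).
pose G t := expR (k * t) * energy P J y t - b / (2 * gam) * expR (2 * gam * t).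
have GT : G T <= G 0.
  pose dG t := expR (k * t) * (k * energy P J y t +
      \sum_(j < J | P j) w j * (2 * y j t * (- mu j * y j t + n j t))) -
      b / (2 * gam) * (2 * gam * expR (2 * gam * t)).
  refine (@derive_le0_ge G dG 0 T T0 _ _ _).
  - move=> t t0 tT; apply: is_deriveB.
      by apply: der_exp_energy; apply: der_energy => j Pj; exact: dy.
    by apply: is_deriveZ; exact: is_derive_expRM.
  - apply: continuous_subspaceT => x; apply: cvgB.
      by apply: cvgM; [exact: continuous_expRM|exact: continuous_energy].
    by apply: cvgMr; exact: continuous_expRM.
  - move=> t t0 tT; rewrite /dG subr_le0.
    have -> : b / (2 * gam) * (2 * gam * expR (2 * gam * t)) =
        expR (k * t) * (b * expR (- (2 * th) * t)).
      rewrite [RHS]mulrCA -expRD.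
      have -> : k * t + - (2 * th) * t = 2 * gam * t by rewrite /k; ring.
      by field; rewrite gt_eqF.
    rewrite ler_pM2l ?expR_gt0//; apply: le_trans (nb t t0 tT).
    rewrite /energy mulr_sumr -big_split/=; apply: ler_sum => j Pj.
    have := young j (y j t) (n j t); have := muP j Pj.
    set Y := y j t; set N := n j t => hmu hy.
    have h2 : 0 <= (mu j - th - gam - w j / (2 * nu j)) * (w j * Y ^+ 2).
      by apply: mulr_ge0; [lra|rewrite mulr_ge0 ?sqr_ge0 ?(ltW (w0 j))].
    have e1 : w j / (2 * nu j) * (w j * Y ^+ 2) = w j ^+ 2 * Y ^+ 2 / nu j / 2.
      by field; rewrite gt_eqF.
    rewrite /k; move: h2; rewrite !mulrBl e1 => h2.
    have -> : 2 * (th + gam) * (w j * Y ^+ 2) + w j * (2 * Y * (- mu j * Y + N)) =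
      - 2 * (mu j * (w j * Y ^+ 2) - th * (w j * Y ^+ 2) - gam * (w j * Y ^+ 2))
        + 2 * w j * Y * N by ring.
    by lra.
move: GT; rewrite /G !mulr0 !expR0 mul1r mulr1 => GT.
have e1 : expR (k * T) = expR (2 * gam * T) * expR (2 * th * T).
  by rewrite -expRD; congr expR; rewrite /k; ring.
have e2 : expR (2 * th * T) * expR (- (2 * th) * T) = 1.
  by rewrite -expRD mulNr subrr expR0.
have g1 : 1 <= expR (2 * gam * T).
  by rewrite -expR0 ler_expR mulr_ge0// mulr_ge0// ltW.
have E0 : 0 <= energy P J y 0.
  by apply: sumr_ge0 => j Pj; rewrite mulr_ge0 ?sqr_ge0// ltW.
rewrite -/(energy P J y T) -/(energy P J y 0).
rewrite -(ler_pM2l (expR_gt0 (k * T))) e1.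
have -> : expR (2 * gam * T) * expR (2 * th * T) *
    (expR (- (2 * th) * T) * (energy P J y 0 + b / (2 * gam))) =
    expR (2 * gam * T) * (energy P J y 0 + b / (2 * gam)) *
    (expR (2 * th * T) * expR (- (2 * th) * T)) by ring.
rewrite e2 mulr1 -e1 mulrDr.
have b1 : 0 <= b / (2 * gam) by rewrite divr_ge0// mulr_ge0// ltW.
have : energy P J y 0 <= expR (2 * gam * T) * energy P J y 0 by rewrite ler_peMl.
by lra.
Qed.

(** No data at time 0 enter. The functional [G] is now nondecreasing, and the growth hypothesis
    bounds it at late times by a multiple of [exp (- 2 gam t)]. Hence [G T <= 0], a bound from which
    the growth constant [C] has disappeared. *)
Lemma free_modes_estimate P J (y n : nat -> R -> R) b C T : 0 <= T ->
  (forall j, P j -> mu j <= th - gam - w j / (2 * nu j)) ->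
  (forall j, P j -> continuous (y j)) ->
  (forall j t, P j -> 0 < t ->
     is_derive t 1 (y j) (- mu j * y j t + n j t)) ->
  (forall t, 0 < t ->
     \sum_(j < J | P j) nu j * n j t ^+ 2 <= b * expR (- (2 * th) * t)) ->
  (forall t, 0 <= t ->
     \sum_(j < J | P j) w j * y j t ^+ 2 <= C * expR (- (2 * th) * t)) ->
  \sum_(j < J | P j) w j * y j T ^+ 2 <= expR (- (2 * th) * T) * (b / (2 * gam)).
Proof.
move=> T0 muP cy dy nb yC.
pose k := 2 * (th - gam).
pose G t := expR (k * t) * energy P J y t - b / (2 * gam) * expR (- (2 * gam) * t).
have ek t : expR (k * t) * expR (- (2 * th) * t) = expR (- (2 * gam) * t).
  by rewrite -expRD; congr expR; rewrite /k; ring.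
have GT S : T <= S -> G T <= G S.
  move=> TS.
  pose dG t := expR (k * t) * (k * energy P J y t +
      \sum_(j < J | P j) w j * (2 * y j t * (- mu j * y j t + n j t))) -
      b / (2 * gam) * (- (2 * gam) * expR (- (2 * gam) * t)).
  refine (@derive_ge0_le G dG T S TS _ _ _).
  - move=> t t0 tT; apply: is_deriveB.
      by apply: der_exp_energy; apply: der_energy => j Pj; apply: dy => //; lra.
    by apply: is_deriveZ; exact: is_derive_expRM.
  - apply: continuous_subspaceT => x; apply: cvgB.
      by apply: cvgM; [exact: continuous_expRM|exact: continuous_energy].
    by apply: cvgMr; exact: continuous_expRM.
  - move=> t t0 tT; rewrite /dG subr_ge0.
    have -> : b / (2 * gam) * (- (2 * gam) * expR (- (2 * gam) * t)) =
        expR (k * t) * (- (b * expR (- (2 * th) * t))).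
      by rewrite -ek; field; rewrite gt_eqF.
    rewrite ler_pM2l ?expR_gt0// lerNl; apply: le_trans (nb t _); last lra.
    rewrite -[leLHS]mulN1r mulrDr /energy 2!mulr_sumr mulr_sumr -big_split/=.
    apply: ler_sum => j Pj.
    have := young j (- y j t) (n j t); have := muP j Pj.
    set Y := y j t; set N := n j t => hmu; rewrite sqrrN => hy.
    have h2 : 0 <= (th - gam - w j / (2 * nu j) - mu j) * (w j * Y ^+ 2).
      by apply: mulr_ge0; [lra|rewrite mulr_ge0 ?sqr_ge0 ?(ltW (w0 j))].
    have e1 : w j / (2 * nu j) * (w j * Y ^+ 2) = w j ^+ 2 * Y ^+ 2 / nu j / 2.
      by field; rewrite gt_eqF.
    rewrite /k; move: h2; rewrite !mulrBl e1 => h2.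
    have -> : -1 * (2 * (th - gam) * (w j * Y ^+ 2)) +
        -1 * (w j * (2 * Y * (- mu j * Y + N))) =
      - 2 * (th * (w j * Y ^+ 2) - gam * (w j * Y ^+ 2) - mu j * (w j * Y ^+ 2))
        + 2 * w j * (- Y) * N by ring.
    by lra.
have GC S : T <= S -> G T <= (C + `|b / (2 * gam)|) * expR (- (2 * gam) * S).
  move=> TS; apply: le_trans (GT S TS) _; rewrite /G [leRHS]mulrDl lerD//.
    apply: (@le_trans _ _ (expR (k * S) * (C * expR (- (2 * th) * S)))).
      by rewrite ler_pM2l ?expR_gt0//; apply: yC; lra.
    by rewrite mulrCA ek.
  rewrite -mulNr ler_pM2r ?expR_gt0// -normrN; exact: ler_norm.
have G0 : G T <= 0.
  rewrite leNgt; apply/negP => GT0.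
  pose D := C + `|b / (2 * gam)|.
  have D0 : 0 < D.
    have := GC T (lexx _); rewrite -/D => h.
    by rewrite -(pmulr_lgt0 _ (expR_gt0 (- (2 * gam) * T))); apply: lt_le_trans h.
  (* [S] is so late that [exp (2 gam S) >= 1 + 2 gam S] exceeds [D / G T], which contradicts
     [GC S]. *)
  pose S := T + D / (2 * gam * G T).
  have g2 : 0 < D / (2 * gam * G T) by rewrite divr_gt0// !mulr_gt0.
  have TS : T <= S by rewrite /S; lra.
  have := GC S TS; rewrite -/D.
  have hS : D / G T <= 2 * gam * S.
    have -> : 2 * gam * S = 2 * gam * T + D / G T.
      by rewrite /S; field; rewrite !gt_eqF.
    by rewrite lerDr mulr_ge0// mulr_ge0// ltW.
  have hx : 1 + 2 * gam * S <= expR (2 * gam * S) by exact: expR_ge1Dx.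
  rewrite mulNr expRN -(ler_pM2r (expR_gt0 (2 * gam * S))) mulfVK; last first.
    by rewrite gt_eqF// expR_gt0.
  rewrite leNgt => /negP; apply.
  apply: (@lt_le_trans _ _ (G T * (1 + D / G T))).
    by rewrite mulrDr mulr1 mulrC mulfVK ?gt_eqF//; lra.
  by rewrite ler_pM2l//; lra.
move: G0; rewrite /G -ek => G0.
rewrite -/(energy P J y T) -(ler_pM2l (expR_gt0 (k * T))) -subr_le0.
by apply: le_trans G0; rewrite le_eqVlt; apply/orP; left; apply/eqP; ring.
Qed.

End RealCalculus.

Section ScalarODE.
Context {R : realType}.
Implicit Types (n y : R -> R) (t mu th C : R).
Local Notation leb := (@lebesgue_measure R).

Lemma continuous_has_primitive n : continuous n ->
  exists Y : R -> R, Y 0 = 0 /\ forall t, 0 <= t -> is_derive t 1 Y (n t).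
Proof.
(* Integrating from -1 makes 0 an interior point, so that the derivative at 0 is two-sided. *)
move=> cn; pose Y0 t := \int[leb]_(x in `[-1, t]) n x.
exists (fun t => Y0 t - Y0 0); split; first by rewrite subrr.
move=> t t0.
have [d1 d2] : derivable Y0 t 1 /\ derive1 Y0 t = n t.
  apply: (@continuous_FTC1_closed R n (-1) t (t + 1)).
  - by rewrite ltrDl.
  - apply: continuous_compact_integrable; first exact: segment_compact.
    exact: continuous_subspaceT.
  - by apply: lt_le_trans t0; rewrite ltrN10.
  - exact: cn.
rewrite -[n t]subr0; apply: is_deriveB.
have e : 'D_1 Y0 t = n t by rewrite -d2 derive1E.
exact: (DeriveDef d1 e).
Qed.

(** Trajectories on the half line are handled as functions on the whole line, frozen at their value
    at 0 for negative times. They become globally continuous, and two of them that agree for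
    nonnegative times are equal as functions. *)
Lemma extend_constant_left y (dy : R -> R) :
  (forall t, 0 <= t -> is_derive t 1 y (dy t)) ->
  let z t := y (Num.max t 0) in
  [/\ continuous z, forall t, 0 < t -> is_derive t 1 z (dy t) &
      forall t, 0 <= t -> z t = y t].
Proof.
move=> h z; have zE t : 0 <= t -> z t = y t by move=> t0; rewrite /z max_l.
split => //.
- move=> t; apply: (@continuous_comp _ _ _ (fun t => Num.max t 0) y).
    by apply: continuous_max; [exact: cvg_id|exact: cvg_cst].
  have m0 : 0 <= Num.max t 0 by rewrite le_max lexx orbT.
  apply: differentiable_continuous; apply/derivable1_diffP.
  by have := h _ m0 => -[].
- move=> t t0; have := h t (ltW t0) => yt.
  apply: (@near_eq_is_derive _ _ _ y) => //.
  by apply: filterS (lt_nbhsr t0) => s s0; rewrite zE// ltW.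
Unshelve. all: by end_near. Qed.

Lemma is_derive_integrating_factor mu (Y n : R -> R) (k t : R) :
  is_derive t 1 Y (expR (mu * t) * n t) ->
  is_derive t 1 (fun s => expR (- mu * s) * (k + Y s))
    (- mu * (expR (- mu * t) * (k + Y t)) + n t).
Proof.
move=> dY.
have dkY : is_derive t 1 (fun s => k + Y s) (expR (mu * t) * n t).
  by apply: (is_derive_eq (is_deriveD (is_derive_cst k t 1) dY)); rewrite add0r.
apply: (is_derive_eq (is_deriveM (is_derive_expRM (- mu) t) dkY)).
rewrite /GRing.scale/= mulrA -expRD mulNr addNr expR0 mul1r addrC.
by congr (_ + _); ring.
Qed.

Lemma linear_ode_data mu n (y0 : R) : continuous n ->
  exists y, [/\ continuous y, y 0 = y0, forall t, y t = y (Num.max t 0) &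
    forall t, 0 < t -> is_derive t 1 y (- mu * y t + n t)].
Proof.
move=> cn.
have [Y [Y0 dY]] : exists Y : R -> R, Y 0 = 0 /\
    forall t, 0 <= t -> is_derive t 1 Y (expR (mu * t) * n t).
  apply: continuous_has_primitive => x; apply: cvgM; last exact: cn.
  exact: continuous_expRM.
pose y s := expR (- mu * s) * (y0 + Y s).
have dy t : 0 <= t -> is_derive t 1 y (- mu * y t + n t).
  by move=> t0; apply: is_derive_integrating_factor; exact: dY.
have [cz dz zE] := extend_constant_left dy.
exists (fun t => y (Num.max t 0)); split; first exact: cz.
- by rewrite zE// /y mulr0 expR0 mul1r Y0 addr0.
- by move=> t; rewrite (max_l (_ : 0 <= Num.max t 0))// le_max lexx orbT.
- by move=> t t0; have := dz t t0; rewrite max_l// ltW.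
Qed.

(** The solution is [- exp (- mu t)] times the integral of [exp (mu s) n(s)] over [[t, oo[]. Let [Y]
    be the primitive from 0. Adding or subtracting [C / k exp (- k t)] gives functions that decrease
    and increase respectively; the limit of [Y] is the value [L] that separates them, found as a
    supremum. *)
Lemma linear_ode_free mu th n C : continuous n -> mu < th ->
  (forall t, 0 <= t -> `|n t| <= C * expR (- th * t)) ->
  exists y, [/\ continuous y, forall t, y t = y (Num.max t 0),
    forall t, 0 <= t -> `|y t| <= C / (th - mu) * expR (- th * t) &
    forall t, 0 < t -> is_derive t 1 y (- mu * y t + n t)].
Proof.
move=> cn muth nC.
have [Y [Y0 dY]] : exists Y : R -> R, Y 0 = 0 /\
    forall t, 0 <= t -> is_derive t 1 Y (expR (mu * t) * n t).
  apply: continuous_has_primitive => x; apply: cvgM; last exact: cn.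
  exact: continuous_expRM.
pose k := th - mu; have k0 : 0 < k by rewrite subr_gt0.
pose Z (s : R) t := Y t + s * (C / k) * expR (- k * t).
have dZ s t : 0 <= t -> is_derive t 1 (Z s) (expR (mu * t) * n t - s * C * expR (- k * t)).
  move=> t0; have := dY t t0 => dYt.
  apply: (is_derive_eq (is_deriveD dYt
    (is_deriveZ (s * (C / k)) (is_derive_expRM (- k) t)))).
  by rewrite /GRing.scale/=; congr (_ + _); field; rewrite gt_eqF.
have cZ s a b : 0 <= a -> {within `[a, b], continuous (Z s)}.
  move=> a0; apply: derivable_within_continuous => x; rewrite in_itv/= => /andP[ax _].
  by have := dZ s x (le_trans a0 ax) => -[].
have bnd t : 0 <= t -> `|expR (mu * t) * n t| <= C * expR (- k * t).
  move=> t0; rewrite normrM ger0_norm ?expR_ge0// mulrC.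
  apply: (@le_trans _ _ (C * expR (- th * t) * expR (mu * t))).
    by rewrite ler_pM2r ?expR_gt0// nC.
  by rewrite -mulrA -expRD le_eqVlt; apply/orP; left; apply/eqP; congr (_ * expR _);
    rewrite /k; ring.
have ZN a b : 0 <= a -> a <= b -> Z (-1) a <= Z (-1) b.
  move=> a0 ab; apply: (@derive_ge0_le _ _ _ a b ab _ (cZ (-1) a b a0)).
    by move=> t at_ _; apply: (dZ (-1)); lra.
  move=> t at_ tb /=; have t0 : 0 <= t by lra.
  by have := bnd t t0; rewrite ler_norml => /andP[h _]; lra.
have ZP a b : 0 <= a -> a <= b -> Z 1 b <= Z 1 a.
  move=> a0 ab; apply: (@derive_le0_ge _ _ _ a b ab _ (cZ 1 a b a0)).
    by move=> t at_ _; apply: (dZ 1); lra.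
  move=> t at_ tb /=; have t0 : 0 <= t by lra.
  by have := bnd t t0; rewrite ler_norml => /andP[_ h]; lra.
have C0 : 0 <= C.
  by have := nC 0 (lexx _); rewrite mulr0 expR0 mulr1; apply: le_trans.
have ZNP t : Z (-1) t <= Z 1 t.
  have : 0 <= C / k * expR (- k * t) by rewrite mulr_ge0 ?expR_ge0// divr_ge0// ltW.
  by rewrite /Z; lra.
pose A := [set Z (-1) t | t in [set t | 0 <= t]].
have Aub t : 0 <= t -> ubound A (Z 1 t).
  move=> t0 _ [s s0 <-]; have [st|/ltW ts] := leP s t.
    by apply: le_trans (ZN s t s0 st) (ZNP t).
  by apply: le_trans (ZNP s) (ZP t s t0 ts).
have A0 : A !=set0 by exists (Z (-1) 0); exists 0 => //=.
have hsA : has_sup A by split => //; exists (Z 1 0); exact: Aub.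
pose L := sup A.
have YL t : 0 <= t -> `|- L + Y t| <= C / k * expR (- k * t).
  move=> t0; have h1 : Z (-1) t <= L by apply: sup_upper_bound => //; exists t.
  have h2 : L <= Z 1 t by apply: ge_sup => //; exact: Aub.
  by move: h1 h2; rewrite /Z ler_norml; lra.
pose y s := expR (- mu * s) * (- L + Y s).
have dy t : 0 <= t -> is_derive t 1 y (- mu * y t + n t).
  by move=> t0; apply: is_derive_integrating_factor; exact: dY.
have [cz dz zE] := extend_constant_left dy.
exists (fun t => y (Num.max t 0)); split; first exact: cz.
- by move=> t; rewrite (max_l (_ : 0 <= Num.max t 0))// le_max lexx orbT.
- move=> t t0; rewrite zE// /y normrM ger0_norm ?expR_ge0//.
  apply: (@le_trans _ _ (expR (- mu * t) * (C / k * expR (- k * t)))).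
    by rewrite ler_pM2l ?expR_gt0// YL.
  rewrite mulrCA -expRD le_eqVlt; apply/orP; left; apply/eqP.
  by congr (_ * expR _); rewrite /k; ring.
- by move=> t t0; have := dz t t0; rewrite max_l// ltW.
Qed.

End ScalarODE.

(** * Exponential dichotomy for finitely many modes *)

Section Modes.
Context {R : realType}.
Variables (mu w nu : nat -> R) (th gam : R).
Hypotheses (w0 : forall j, 0 < w j) (nu0 : forall j, 0 < nu j) (gam0 : 0 < gam).
Implicit Types (P : pred nat) (y n : nat -> R -> R).

Lemma le_bigsum_cond P J (F : nat -> R) :
  (forall j, 0 <= F j) -> \sum_(j < J | P j) F j <= \sum_(j < J) F j.
Proof.
by move=> F0; rewrite big_mkcond/=; apply: ler_sum => j _; case: ifP.
Qed.

(** The modes are split at [th]. The bounds [C j] only keep the finitely many modes below [th] from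
    growing too fast and drop out of the result; each of the two groups contributes
    [b / (2 gam)]. *)
Lemma modes_estimate P J y n (C : nat -> R) (D b T : R) : 0 <= b -> 0 <= T ->
  (forall j, P j -> gam + w j / (2 * nu j) <= `|mu j - th|) ->
  (forall j, P j -> continuous (y j)) ->
  (forall j (t : R), P j -> 0 < t -> is_derive t 1 (y j) (- mu j * y j t + n j t)) ->
  (forall j (t : R), P j -> mu j <= th -> 0 <= t -> `|y j t| <= C j * expR (- th * t)) ->
  (forall t : R, 0 < t ->
     \sum_(j < J | P j) nu j * n j t ^+ 2 <= b * expR (- (2 * th) * t)) ->
  \sum_(j < J | P j && (th < mu j)) w j * y j 0 ^+ 2 <= D ->
  \sum_(j < J | P j) w j * y j T ^+ 2 <= expR (- (2 * th) * T) * (D + b / gam).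
Proof.
move=> b0 T0 muP cy dy yC nb yD.
have sub Q t : 0 < t -> \sum_(j < J | P j && Q j) nu j * n j t ^+ 2 <=
    b * expR (- (2 * th) * t).
  move=> t0; apply: le_trans (nb t t0).
  rewrite big_mkcondr/=; apply: ler_sum => j _.
  by case: ifP => // _; rewrite mulr_ge0 ?sqr_ge0// ltW.
rewrite (bigID (fun j : 'I_J => th < mu j))/=.
have h1 := @data_modes_estimate R mu w nu th gam w0 nu0 gam0
  (fun j => P j && (th < mu j)) J y n b T b0 T0.
have h2 := @free_modes_estimate R mu w nu th gam w0 nu0 gam0
  (fun j => P j && ~~ (th < mu j)) J y n b (\sum_(j < J) w j * C j ^+ 2) T T0.
have -> : expR (- (2 * th) * T) * (D + b / gam) =
  expR (- (2 * th) * T) * (D + b / (2 * gam)) + expR (- (2 * th) * T) * (b / (2 * gam)).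
  by field; rewrite gt_eqF.
apply: lerD.
  apply: (@le_trans _ _ (expR (- (2 * th) * T) *
     (\sum_(j < J | P j && (th < mu j)) w j * y j 0 ^+ 2 + b / (2 * gam)))).
    apply: h1.
    - by move=> j /andP[Pj thj]; have := muP j Pj; rewrite gtr0_norm ?subr_gt0//; lra.
    - by move=> j /andP[Pj thj]; exact: cy.
    - by move=> j t /andP[Pj thj] t0 _; exact: dy.
    - by move=> t t0 _; exact: sub.
  by rewrite ler_pM2l ?expR_gt0// lerD2r.
apply: h2.
- move=> j /andP[Pj]; rewrite -leNgt => thj; have := muP j Pj.
  by rewrite ler0_norm ?subr_le0//; lra.
- by move=> j /andP[Pj thj]; exact: cy.
- by move=> j t /andP[Pj thj] t0; exact: dy.
- by move=> t t0; exact: (sub (fun j => ~~ (th < mu j))).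
- move=> t t0; rewrite mulr_suml big_mkcond/=; apply: ler_sum => j _.
  case: ifP; last first.
    move=> _; apply: mulr_ge0; last exact: expR_ge0.
    by rewrite mulr_ge0 ?sqr_ge0// ltW.
  move=> /andP[Pj]; rewrite -leNgt => thj.
  rewrite -mulrA ler_pM2l//.
  have -> : - (2 * th) * t = - th * t + - th * t by ring.
  rewrite expRD -expr2 -exprMn -(real_normK (num_real (y j t))).
  by rewrite ler_pXn2r// ?nnegrE//; [exact: yC|apply: le_trans (yC j t Pj thj t0)].
Qed.

End Modes.

(** A Hilbert space seen through orthogonal coefficients: the squared norm is the sum of
    [w j * c j u ^+ 2]. Parseval's identity is split into [frame_bessel] and [frame_norm_le], both
    about finite sums, and Riesz-Fischer is [frame_synthesis]. Completeness is stated for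
    geometrically Cauchy sequences, the form in which a contraction of factor 1/2 produces them. *)
Record hilbert_frame (R : realType) (E : normedModType R) (c : nat -> E -> R)
    (w : nat -> R) : Prop := HilbertFrame {
  frame_linear : forall j a u v, c j (a *: u + v) = a * c j u + c j v;
  frame_gt0 : forall j, 0 < w j;
  frame_bessel : forall u J, \sum_(j < J) w j * c j u ^+ 2 <= `|u| ^+ 2;
  frame_norm_le : forall u b, 0 <= b ->
    (forall J, \sum_(j < J) w j * c j u ^+ 2 <= b) -> `|u| ^+ 2 <= b;
  frame_synthesis : forall (x : nat -> R) b,
    (forall J, \sum_(j < J) w j * x j ^+ 2 <= b) -> exists u, forall j, c j u = x j;
  frame_complete : forall (u_ : nat -> E) C,
    (forall i, `|u_ i.+1 - u_ i| <= C / 2 ^+ i) ->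
    exists u, forall i, `|u - u_ i| <= 2 * C / 2 ^+ i }.

(** * Coefficients, tails and continuity *)

Section Frame.
Context {R : realType} {E : normedModType R} {c : nat -> E -> R} {w : nat -> R}.
Hypothesis fr : hilbert_frame c w.
Implicit Types (u v : E) (P : pred nat).

Let w0 := frame_gt0 fr.

Lemma frameD j u v : c j (u + v) = c j u + c j v.
Proof. by have := frame_linear fr j 1 u v; rewrite scale1r mul1r. Qed.

Lemma frame0 j : c j 0 = 0.
Proof.
by have := frameD j 0 0; rewrite addr0 => /eqP; rewrite -subr_eq0 opprD addNKr oppr_eq0 => /eqP.
Qed.

Lemma frameZ j a u : c j (a *: u) = a * c j u.
Proof. by have := frame_linear fr j a u 0; rewrite frame0 !addr0. Qed.

Lemma frameN j u : c j (- u) = - c j u.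
Proof. by rewrite -scaleN1r frameZ mulN1r. Qed.

Lemma frameB j u v : c j (u - v) = c j u - c j v.
Proof. by rewrite frameD frameN. Qed.

Lemma frame_inj u v : (forall j, c j u = c j v) -> u = v.
Proof.
move=> uv; apply/eqP; rewrite -subr_eq0 -normr_eq0 -sqrf_eq0 eq_le sqr_ge0 andbT.
by apply: (frame_norm_le fr) => // J; rewrite big1// => j _; rewrite frameB uv subrr expr0n mulr0.
Qed.

Lemma frame_le1 j u : `|c j u| <= `|u| / Num.sqrt (w j).
Proof.
rewrite ler_pdivlMr ?sqrtr_gt0// -(@ler_pXn2r _ 2)// ?nnegrE ?mulr_ge0 ?sqrtr_ge0//.
rewrite exprMn sqr_sqrtr ?(ltW (w0 j))// real_normK ?num_real// mulrC.
apply: le_trans (frame_bessel fr u j.+1); rewrite big_ord_recr/= lerDr.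
by apply: sumr_ge0 => i _; rewrite mulr_ge0 ?sqr_ge0// ltW.
Qed.

Lemma frame_continuous j : continuous (c j).
Proof.
move=> u; apply/cvgrPdist_le => /= e e0.
have k0 : 0 < Num.sqrt (w j) by rewrite sqrtr_gt0.
near=> v; rewrite -frameB; apply: le_trans (frame_le1 j _) _.
rewrite ler_pdivrMr//; near: v.
have : \forall v \near u, ball u (e * Num.sqrt (w j)) v.
  by apply: nbhsx_ballx; rewrite mulr_gt0.
by apply: filterS => v; rewrite -ball_normE /= => /ltW.
Unshelve. all: by end_near. Qed.

Lemma continuous_frame_comp (T : topologicalType) (z : T -> E) j :
  continuous z -> continuous (c j \o z).
Proof. by move=> cz t; apply: continuous_comp; [exact: cz|exact: frame_continuous]. Qed.

Lemma bounded_sum_tail (F : nat -> R) b : (forall j, 0 <= F j) ->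
  (forall J, \sum_(j < J) F j <= b) -> forall e, 0 < e ->
  exists J0, forall J, \sum_(j < J | (J0 <= j)%N) F j <= e.
Proof.
move=> F0 Fb e e0.
pose A := range (fun J => \sum_(j < J) F j).
have hA : has_sup A.
  by split; [exists (\sum_(j < 0) F j); exists 0%N|exists b => _ [J _ <-]].
have [_ [J0 _ <-] hJ0] := sup_adherent e0 hA.
exists J0 => J.
have [JJ0|J0J] := leqP J J0.
  rewrite big1 ?ltW// => j; case: j => j jJ /= J0j.
  by move: (leq_trans jJ JJ0); rewrite ltnNge J0j.
have : \sum_(j < J) F j <= sup A by apply: sup_upper_bound => //; exists J.
rewrite (bigID (fun j : 'I_J => (J0 <= j)%N))/=.
suff -> : \sum_(j < J | ~~ (J0 <= j)%N) F j = \sum_(j < J0) F j by lra.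
rewrite (big_ord_widen _ F (ltnW J0J)); apply: eq_bigl => j.
by rewrite -ltnNge.
Qed.

Lemma sum_below_le (F : nat -> R) J J0 : (forall j, 0 <= F j) ->
  \sum_(j < J | ~~ (J0 <= j)%N) F j <= \sum_(j < J0) F j.
Proof.
move=> F0.
rewrite (big_ord_widen_cond (maxn J J0) (fun j => ~~ (J0 <= j)%N) F (leq_maxl _ _)).
rewrite [leRHS](big_ord_widen (maxn J J0) F (leq_maxr _ _)).
rewrite big_mkcond [leRHS]big_mkcond/=; apply: ler_sum => j _.
by rewrite -ltnNge; case: (j < J0)%N => //=; case: ifP.
Qed.

(** Finitely many coefficients vary continuously and the others are small uniformly in time,
    relative to a continuous weight [B]. Near [t0] the weight stays below [B t0 + 1]. *)
Lemma frame_tail_continuous (z : R -> E) (B : R -> R) :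
  (forall j, continuous (c j \o z)) -> continuous B -> (forall t, 0 <= B t) ->
  (forall e, 0 < e -> exists J0, forall J t,
     \sum_(j < J | (J0 <= j)%N) w j * c j (z t) ^+ 2 <= e * B t) ->
  continuous z.
Proof.
move=> cz cB B0 tail t0; apply/cvgrPdist_le => /= e e0.
have B1 : 0 < B t0 + 1 by rewrite ltr_wpDl.
(* With this [e'] the tails of the two values contribute at most [e ^+ 2 / 2]; the low modes are
   allowed [e ^+ 2 / 8]. *)
pose e' := e ^+ 2 / (8 * (B t0 + 1)).
have e'0 : 0 < e' by rewrite divr_gt0// ?exprn_gt0// mulr_gt0.
have [J0 hJ0] := tail e' e'0.
have low : (fun t => \sum_(j < J0) w j * (c j (z t0) - c j (z t)) ^+ 2) @ t0 --> (0 : R).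
  have s0 : \sum_(j < J0) w j * (c j (z t0) - c j (z t0)) ^+ 2 = 0.
    by rewrite big1// => j _; rewrite subrr expr0n mulr0.
  rewrite -[X in _ --> X]s0.
  apply: (@continuous_bigsum _ _ (fun j t => w j * (c j (z t0) - c j (z t)) ^+ 2) predT).
  move=> j _ t; apply: cvgMr; apply: (@continuous_comp _ _ _
      (fun t => c j (z t0) - c j (z t)) (fun x => x ^+ 2)).
    by apply: cvgB; [exact: cvg_cst|exact: cz].
  exact: exprn_continuous.
near=> t.
rewrite -(@ler_pXn2r _ 2)// ?nnegrE ?(ltW e0)//.
apply: (frame_norm_le fr); first exact: sqr_ge0.
move=> J; rewrite (bigID (fun j : 'I_J => (J0 <= j)%N))/=.
have h1 : \sum_(j < J | (J0 <= j)%N) w j * c j (z t0 - z t) ^+ 2 <=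
    2 * (e' * B t0) + 2 * (e' * B t).
  apply: (@le_trans _ _ (2 * \sum_(j < J | (J0 <= j)%N) w j * c j (z t0) ^+ 2 +
     2 * \sum_(j < J | (J0 <= j)%N) w j * c j (z t) ^+ 2)); last first.
    by apply: lerD; rewrite ler_pM2l.
  rewrite !mulr_sumr -big_split/=; apply: ler_sum => j _.
  rewrite frameB.
  have -> : 2 * (w j * c j (z t0) ^+ 2) + 2 * (w j * c j (z t) ^+ 2) =
     w j * (c j (z t0) - c j (z t)) ^+ 2 + w j * (c j (z t0) + c j (z t)) ^+ 2 by ring.
  by rewrite lerDl mulr_ge0 ?sqr_ge0// ltW.
have h2 : \sum_(j < J | ~~ (J0 <= j)%N) w j * c j (z t0 - z t) ^+ 2 <= e ^+ 2 / 8.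
  apply: (@le_trans _ _ (\sum_(j < J0) w j * (c j (z t0) - c j (z t)) ^+ 2)); last first.
    near: t; move/cvgrPdist_le : low => /(_ (e ^+ 2 / 8)).
    rewrite divr_gt0 ?exprn_gt0// => /(_ isT); apply: filterS => s.
    by rewrite sub0r normrN; apply: le_trans; exact: ler_norm.
  have F0 j : 0 <= w j * (c j (z t0) - c j (z t)) ^+ 2 by rewrite mulr_ge0 ?sqr_ge0// ltW.
  under eq_bigr do rewrite frameB.
  exact: sum_below_le F0.
have h3 : B t <= B t0 + 1.
  near: t; move/cvgrPdist_le : (cB t0) => /(_ 1 ltr01); apply: filterS => s.
  by rewrite ler_norml => /andP[]; lra.
have h4 : 2 * (e' * B t0) + 2 * (e' * B t) <= e ^+ 2 / 2.
  apply: (@le_trans _ _ (4 * (e' * (B t0 + 1)))).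
    have : e' * B t0 <= e' * (B t0 + 1) by rewrite ler_pM2l//; lra.
    have : e' * B t <= e' * (B t0 + 1) by rewrite ler_pM2l.
    by lra.
  by rewrite /e' mulrA le_eqVlt; apply/orP; left; apply/eqP; field; rewrite gt_eqF.
have := exprn_gt0 2 e0; lra.
Unshelve. all: by end_near. Qed.

End Frame.

(** * Modal equations in a Hilbert frame *)

Section LinearProblem.
Context {R : realType} {E : normedModType R} {c : nat -> E -> R} {w : nat -> R}.
Hypothesis fr : hilbert_frame c w.
Variables (mu nu : nat -> R) (th gam : R).
Hypotheses (nu0 : forall j, 0 < nu j) (gam0 : 0 < gam).
Hypothesis gap : forall j, gam + w j / (2 * nu j) <= `|mu j - th|.
Implicit Types (z : R -> E) (n : nat -> R -> R) (t : R).

Let w0 := frame_gt0 fr.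

(** The equations are required for positive times only, because frozen trajectories need not be
    differentiable at 0. *)
Definition modal_solution z n := forall j t, 0 < t ->
  is_derive t 1 (c j \o z) (- mu j * c j (z t) + n j t).

Lemma expR_sqr t : expR (- th * t) ^+ 2 = expR (- (2 * th) * t).
Proof. by rewrite expr2 -expRD; congr expR; ring. Qed.

Lemma weighted_sqr z C t : 0 <= C -> `|z t| ^+ 2 <= C ^+ 2 * expR (- (2 * th) * t) <->
  `|z t| <= C * expR (- th * t).
Proof.
move=> C0; have h : 0 <= C * expR (- th * t) by rewrite mulr_ge0 ?expR_ge0.
have -> : (`|z t| ^+ 2 <= C ^+ 2 * expR (- (2 * th) * t)) = (`|z t| <= C * expR (- th * t)).
  by rewrite -expR_sqr -exprMn ler_pXn2r ?nnegrE.
by [].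
Qed.

(** Data are counted only in the modes with [th < mu j]: in the others the growth bound alone
    controls the solution, whatever its value at 0, and its constant [C] does not survive. *)
Lemma dichotomy_estimate z n C D b : 0 <= b -> continuous z -> modal_solution z n ->
  (forall t, 0 <= t -> `|z t| <= C * expR (- th * t)) ->
  (forall J t, 0 < t -> \sum_(j < J) nu j * n j t ^+ 2 <= b * expR (- (2 * th) * t)) ->
  (forall J, \sum_(j < J | th < mu j) w j * c j (z 0) ^+ 2 <= D) ->
  forall t, 0 <= t -> `|z t| ^+ 2 <= expR (- (2 * th) * t) * (D + b / gam).
Proof.
move=> b0 cz dz zC nb zD t t0; apply: (frame_norm_le fr) => [|J].
  apply: mulr_ge0; first exact: expR_ge0.
  by rewrite addr_ge0 ?divr_ge0 ?(ltW gam0)//; have := zD 0; rewrite big_ord0.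
apply: (modes_estimate w0 nu0 gam0 (P := predT) (y := fun j => c j \o z) (n := n)
   (mu := mu) (C := fun j => C / Num.sqrt (w j))) => //.
- by move=> j _; exact: continuous_frame_comp fr _ _ _ cz.
- by move=> j s _; exact: dz.
- move=> j s _ _ s0; apply: le_trans (frame_le1 fr j _) _.
  by rewrite mulrAC ler_pM2r ?invr_gt0 ?sqrtr_gt0// zC.
- by move=> s s0; exact: nb.
Qed.

(** The supremum [s] of [exp (2 th t) |z t|^2] is finite by the growth hypothesis, so the share of
    [z] in its own forcing and data can be absorbed: [dichotomy_estimate] gives
    [s <= D + d2 s + (2 l2 s + 2 b) / gam], and [s] has a coefficient of at most 1/4 on the
    right. *)
Lemma stability_estimate z n C D b l2 d2 : 0 <= b -> 0 <= D -> 0 <= l2 -> 0 <= d2 ->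
  2 * l2 / gam + d2 <= 4^-1 -> continuous z -> modal_solution z n ->
  (forall t, 0 <= t -> `|z t| <= C * expR (- th * t)) ->
  (forall J t, 0 <= t -> \sum_(j < J) nu j * n j t ^+ 2 <=
     2 * l2 * `|z t| ^+ 2 + 2 * b * expR (- (2 * th) * t)) ->
  (forall J, \sum_(j < J | th < mu j) w j * c j (z 0) ^+ 2 <= D + d2 * `|z 0| ^+ 2) ->
  forall t, 0 <= t -> `|z t| ^+ 2 <= 2 * (D + 2 * b / gam) * expR (- (2 * th) * t).
Proof.
move=> b0 D0 l20 d20 small cz dz zC nb zD.
pose A := [set expR (2 * th * t) * `|z t| ^+ 2 | t in [set t | 0 <= t]].
have C0 : 0 <= C.
  by have := zC 0 (lexx _); rewrite mulr0 expR0 mulr1; apply: le_trans.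
have e1 t : expR (2 * th * t) * expR (- (2 * th) * t) = 1.
  by rewrite -expRD mulNr subrr expR0.
have AE s t : `|z t| ^+ 2 <= s * expR (- (2 * th) * t) <->
    expR (2 * th * t) * `|z t| ^+ 2 <= s.
  have -> : (`|z t| ^+ 2 <= s * expR (- (2 * th) * t)) = (expR (2 * th * t) * `|z t| ^+ 2 <= s).
    by rewrite -[LHS](ler_pM2l (expR_gt0 (2 * th * t))) [X in (_ <= X) = _]mulrCA e1 mulr1.
  by [].
have hA : has_sup A.
  split; first by exists (expR (2 * th * 0) * `|z 0| ^+ 2); exists 0 => //=.
  by exists (C ^+ 2) => _ [t t0 <-]; apply/AE/weighted_sqr => //; exact: zC.
pose s := sup A.
have zs t : 0 <= t -> `|z t| ^+ 2 <= s * expR (- (2 * th) * t).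
  by move=> t0; apply/AE/sup_upper_bound => //; exists t.
have s0 : 0 <= s.
  by have := zs 0 (lexx _); rewrite mulr0 expR0 mulr1; apply: le_trans; rewrite sqr_ge0.
have b1 : 0 <= 2 * l2 * s + 2 * b by rewrite addr_ge0// !mulr_ge0.
have h : s <= (D + d2 * s) + (2 * l2 * s + 2 * b) / gam.
  apply: ge_sup; first by case: hA.
  move=> _ [t /= t0 <-]; apply/AE; rewrite mulrC.
  apply: (@dichotomy_estimate z n C) => //.
    move=> J r r0; apply: le_trans (nb J r (ltW r0)) _.
    rewrite [leRHS]mulrDl lerD2r -[leRHS]mulrA; apply: ler_wpM2l; first exact: mulr_ge0.
    exact: zs (ltW r0).
  move=> J; apply: le_trans (zD J) _; rewrite lerD2l ler_wpM2l//.
  by have := zs 0 (lexx _); rewrite mulr0 expR0 mulr1.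
have h2 : s <= 2 * (D + 2 * b / gam).
  have : (2 * l2 / gam + d2) * s <= 4^-1 * s by rewrite ler_wpM2r.
  move: h; have -> : (2 * l2 * s + 2 * b) / gam = 2 * l2 / gam * s + 2 * b / gam.
    by field; rewrite gt_eqF.
  have : 0 <= 2 * b / gam by rewrite divr_ge0 ?(ltW gam0)// mulr_ge0.
  by rewrite mulrDl; lra.
move=> t t0; apply: le_trans (zs t t0) _.
by rewrite ler_pM2r ?expR_gt0.
Qed.

Hypothesis growth : forall b : R, exists J0, forall j, (J0 <= j)%N -> b <= `|mu j - th|.

(** Each mode is solved separately, by [linear_ode_data] above [th] and by [linear_ode_free] below.
    That the rates move away from [th] makes the tails of the solution small uniformly in time,
    whence continuity in norm. *)
Lemma linear_problem n (d : nat -> R) D b : 0 <= b ->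
  (forall j, continuous (n j)) ->
  (forall J t, 0 <= t -> \sum_(j < J) nu j * n j t ^+ 2 <= b * expR (- (2 * th) * t)) ->
  (forall J, \sum_(j < J | th < mu j) w j * d j ^+ 2 <= D) ->
  exists z, [/\ continuous z, modal_solution z n, forall t, z t = z (Num.max t 0),
    forall j, th < mu j -> c j (z 0) = d j &
    forall t, 0 <= t -> `|z t| ^+ 2 <= expR (- (2 * th) * t) * (D + b / gam)].
Proof.
move=> b0 cn nb dD.
have n1 j t : 0 <= t -> `|n j t| <= Num.sqrt (b / nu j) * expR (- th * t).
  move=> t0; rewrite -(@ler_pXn2r _ 2)// ?nnegrE ?mulr_ge0 ?sqrtr_ge0 ?expR_ge0//.
  rewrite exprMn sqr_sqrtr ?divr_ge0 ?(ltW (nu0 j))// expR_sqr real_normK ?num_real//.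
  rewrite mulrAC ler_pdivlMr// mulrC; apply: le_trans (nb j.+1 t t0).
  rewrite big_ord_recr/= lerDr; apply: sumr_ge0 => i _.
  by rewrite mulr_ge0 ?sqr_ge0// ltW.
pose K (j : nat) (y : R -> R) := [/\ continuous y,
  forall t, y t = y (Num.max t 0), th < mu j -> y 0 = d j,
  (mu j <= th -> forall t, 0 <= t ->
     `|y t| <= Num.sqrt (b / nu j) / (th - mu j) * expR (- th * t)) &
  forall t, 0 < t -> is_derive t 1 y (- mu j * y t + n j t)].
have /choice[y yK] : forall j, exists y, K j y.
  move=> j; have [thj|] := ltP th (mu j).
    have [y [cy y0 ym dy]] := linear_ode_data (mu j) (d j) (cn j).
    by exists y; split => //; rewrite leNgt thj.
  rewrite le_eqVlt => /predU1P[muj|muth].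
    by have := gap j; rewrite muj subrr normr0 leNgt addr_gt0 ?divr_gt0 ?mulr_gt0.
  have [y [cy ym yb dy]] := linear_ode_free (cn j) muth (n1 j).
  by exists y; split => //; rewrite ltNge (ltW muth).
have ym j s : y j s = y j (Num.max s 0) by case: (yK j).
(* The weights and the gap are left free here, since the tails are estimated below with a gap larger
   than [gam]. *)
have est (P : pred nat) J t (nu' : nat -> R) (gam' b' D' : R) : (forall j, 0 < nu' j) -> 0 < gam' ->
    (forall j, P j -> gam' + w j / (2 * nu' j) <= `|mu j - th|) -> 0 <= b' ->
    (forall t, 0 <= t -> \sum_(j < J | P j) nu' j * n j t ^+ 2 <= b' * expR (- (2 * th) * t)) ->
    \sum_(j < J | P j && (th < mu j)) w j * d j ^+ 2 <= D' -> 0 <= t ->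
    \sum_(j < J | P j) w j * y j t ^+ 2 <= expR (- (2 * th) * t) * (D' + b' / gam').
  move=> nu'0 gam'0 gap' b'0 nb' dD' t0.
  refine (@modes_estimate _ mu w nu' th gam' w0 nu'0 gam'0 P J y n
    (fun j => Num.sqrt (b / nu j) / (th - mu j)) D' b' t b'0 t0 gap' _ _ _ _ _).
  - by move=> j _; case: (yK j).
  - by move=> j s _; case: (yK j) => _ _ _ _; exact.
  - by move=> j s _ mj s0; case: (yK j) => _ _ _ /(_ mj s s0).
  - by move=> s s0; exact/nb'/ltW.
  - apply: le_trans dD'; rewrite le_eqVlt; apply/orP; left; apply/eqP.
    by apply: eq_bigr => j /andP[_ thj]; case: (yK j) => _ _ ->.
have est0 J t : 0 <= t ->
    \sum_(j < J) w j * y j t ^+ 2 <= expR (- (2 * th) * t) * (D + b / gam).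
  move=> t0; refine (est predT J t nu gam b D nu0 gam0 _ b0 _ (dD J) t0); first by move=> j _; exact: gap.
  by move=> s; exact: nb.
have /choice[z zE] : forall t, exists u, forall j, c j u = y j t.
  move=> t; apply: (frame_synthesis fr (b := expR (- (2 * th) * Num.max t 0) * (D + b / gam))) => J.
  under eq_bigr => j _ do rewrite ym.
  by apply: est0; rewrite le_max lexx orbT.
have yz j : c j \o z = y j by apply/funext => t /=; rewrite zE.
have D0 : 0 <= D by have := dD 0; rewrite big_ord0.
exists z; split.
- apply: (frame_tail_continuous fr (B := fun t => expR (- (2 * th) * Num.max t 0))).
  + by move=> j; rewrite yz; case: (yK j).
  + move=> t; apply: (@continuous_comp _ _ _ (fun t => Num.max t 0) (fun t => expR (- (2 * th) * t))).
      by apply: continuous_max; [exact: cvg_id|exact: cvg_cst].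
    exact: continuous_expRM.
  + by move=> t; exact: expR_ge0.
  + move=> e e0; have e2 : 0 < e / 2 by rewrite divr_gt0.
    pose F j := if th < mu j then w j * d j ^+ 2 else 0.
    have F0 j : 0 <= F j by rewrite /F; case: ifP => // _; rewrite mulr_ge0 ?sqr_ge0// ltW.
    have FD J : \sum_(j < J) F j <= D by rewrite -big_mkcond; exact: dD.
    have [J1 hJ1] := bounded_sum_tail F0 FD e2.
    (* [gam'] makes the forcing contribute at most [e / 2]. Doubling [nu] halves the part of the
       distance to [th] that the forcing consumes; from [J2] on the released half is at least
       [gam']. *)
    pose gam' := 4 * b / e + 1.
    have gam'0 : 0 < gam' by rewrite ltr_wpDl// divr_ge0 ?(ltW e0)// mulr_ge0.
    have [J2 hJ2] := growth (2 * gam').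
    exists (maxn J1 J2) => J t.
    under eq_bigr => j _ do rewrite zE ym.
    rewrite mulrC; apply: (@le_trans _ _
       (expR (- (2 * th) * Num.max t 0) * (e / 2 + (2 * b) / gam'))); last first.
      rewrite ler_pM2l ?expR_gt0//.
      suff : 2 * b / gam' <= e / 2 by lra.
      rewrite ler_pdivrMr// /gam' mulrDr mulr1.
      have -> : e / 2 * (4 * b / e) = 2 * b by field; rewrite gt_eqF.
      by lra.
    apply: (est (fun j => maxn J1 J2 <= j)%N J (Num.max t 0) (fun j => 2 * nu j) gam' (2 * b) (e / 2)) => //.
    * by move=> j; rewrite mulr_gt0.
    * move=> j; rewrite geq_max => /andP[_ j2].
      have := hJ2 j j2; have := gap j.
      have -> : w j / (2 * (2 * nu j)) = w j / (2 * nu j) / 2 by field; rewrite gt_eqF.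
      by move: gam0 gam'0; set q := w j / _; set q' := `|_|; lra.
    * by rewrite mulr_ge0.
    * move=> s s0; under eq_bigr do rewrite -mulrA.
      rewrite -mulr_sumr -mulrA ler_pM2l//; apply: le_trans (nb J s s0).
      apply: (@le_bigsum_cond _ (fun j => maxn J1 J2 <= j)%N J (fun j => nu j * n j s ^+ 2)).
      by move=> j; rewrite mulr_ge0 ?sqr_ge0// ltW.
    * apply: le_trans (hJ1 J); rewrite big_mkcond/= [leRHS]big_mkcond/=.
      apply: ler_sum => j _; rewrite geq_max; have := F0 j; rewrite /F.
      by case: (J1 <= j)%N; case: (J2 <= j)%N; case: (th < mu j).
    * by rewrite le_max lexx orbT.
- by move=> j t t0; rewrite yz zE; case: (yK j) => _ _ _ _; exact.
- by move=> t; apply: (frame_inj fr) => j; rewrite !zE; case: (yK j).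
- by move=> j thj; rewrite zE; case: (yK j) => _ _ ->.
- move=> t t0; apply: (frame_norm_le fr) => [|J].
    by rewrite mulr_ge0 ?expR_ge0// addr_ge0// divr_ge0// ltW.
  by under eq_bigr do rewrite zE; exact: est0.
Qed.

End LinearProblem.

Arguments modal_solution {R E} c mu z n.

(** * Fixed points in exponentially weighted spaces *)

Section SemilinearProblem.
Context {R : realType} {E : normedModType R} {c : nat -> E -> R} {w : nat -> R}.
Hypothesis fr : hilbert_frame c w.
Variables (mu nu : nat -> R) (th gam : R).
Hypotheses (nu0 : forall j, 0 < nu j) (gam0 : 0 < gam).
Hypothesis gap : forall j, gam + w j / (2 * nu j) <= `|mu j - th|.
Hypothesis growth : forall b : R, exists J0, forall j, (J0 <= j)%N -> b <= `|mu j - th|.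
Variables (N : R -> E -> nat -> R) (dat : E -> nat -> R) (l2 d2 b0 D0 : R).
Hypotheses (l20 : 0 <= l2) (d20 : 0 <= d2) (b00 : 0 <= b0).
Hypothesis small : 2 * l2 / gam + d2 <= 4^-1.
Hypothesis Ncont : forall y : R -> E, continuous y ->
  forall j, continuous (fun t => N t (y t) j).
Hypothesis Nlip : forall (t : R) u v J, 0 <= t ->
  \sum_(j < J) nu j * (N t u j - N t v j) ^+ 2 <= l2 * `|u - v| ^+ 2.
Hypothesis Nzero : forall (t : R) J, 0 <= t ->
  \sum_(j < J) nu j * N t 0 j ^+ 2 <= b0 * expR (- (2 * th) * t).
Hypothesis datlip : forall u v J,
  \sum_(j < J | th < mu j) w j * (dat u j - dat v j) ^+ 2 <= d2 * `|u - v| ^+ 2.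
Hypothesis datzero : forall J, \sum_(j < J | th < mu j) w j * dat 0 j ^+ 2 <= D0.

Let w0 := frame_gt0 fr.

Lemma sum_sqr_le (P : pred nat) (k F G : nat -> R) J : (forall j, 0 <= k j) ->
  \sum_(j < J | P j) k j * F j ^+ 2 <=
  2 * \sum_(j < J | P j) k j * (F j - G j) ^+ 2 + 2 * \sum_(j < J | P j) k j * G j ^+ 2.
Proof.
move=> k0; rewrite !mulr_sumr -big_split/=; apply: ler_sum => j _.
have -> : 2 * (k j * (F j - G j) ^+ 2) + 2 * (k j * G j ^+ 2) =
  k j * F j ^+ 2 + k j * (F j - 2 * G j) ^+ 2 by ring.
by rewrite lerDl mulr_ge0 ?sqr_ge0.
Qed.

Let weighted (C : R) (z : R -> E) :=
  forall t : R, 0 <= t -> `|z t| <= C * expR (- th * t).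

Let step (y z : R -> E) := [/\ continuous z,
  modal_solution c mu z (fun j t => N t (y t) j), forall t, z t = z (Num.max t 0) &
  forall j, th < mu j -> c j (z 0) = dat (y 0) j].

Let step_exists y C : 0 <= C -> continuous y -> weighted C y ->
  exists z, step y z /\ exists2 C', 0 <= C' & weighted C' z.
Proof.
move=> C0 cy yC.
have y2 (t : R) : 0 <= t -> `|y t| ^+ 2 <= C ^+ 2 * expR (- (2 * th) * t).
  by move=> t0; apply/weighted_sqr => //; exact: yC.
pose b := 2 * l2 * C ^+ 2 + 2 * b0.
have b1 : 0 <= b by rewrite addr_ge0// !mulr_ge0// sqr_ge0.
have [|J t t0|J|z [cz dz zm zD zb]] := @linear_problem R E c w fr mu nu th gam nu0 gam0 gap growth
  (fun j t => N t (y t) j) (dat (y 0)) (2 * d2 * C ^+ 2 + 2 * D0) b b1.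
- exact: Ncont.
- apply: le_trans (@sum_sqr_le predT nu _ (N t 0) J _) _.
    by move=> j; exact: ltW.
  rewrite /b [leRHS]mulrDl; apply: lerD; rewrite -[leRHS]mulrA ?ler_pM2l//; last exact: Nzero.
  rewrite -[leRHS]mulrA ler_pM2l//; apply: le_trans (Nlip _ _ _ t0) _.
  by rewrite subr0 ler_wpM2l// y2.
- apply: le_trans (@sum_sqr_le (fun j => th < mu j) w _ (dat 0) J _) _.
    by move=> j; exact: ltW.
  apply: lerD; rewrite -?mulrA ler_pM2l//; apply: le_trans (datlip _ _ _) _.
  rewrite subr0 ler_wpM2l//.
  by have := y2 0 (lexx _); rewrite mulr0 expR0 mulr1.
exists z; split; first by split.
set B := _ + _ in zb.
exists (Num.sqrt B); first exact: sqrtr_ge0.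
move=> t t0; apply/weighted_sqr; first exact: sqrtr_ge0.
rewrite sqr_sqrtr; first by rewrite mulrC; exact: zb.
have := zb 0 (lexx _); rewrite mulr0 expR0 mul1r; apply: le_trans.
exact: sqr_ge0.
Qed.

(** The squared distance is multiplied by at most [d2 + l2 / gam], which [small] bounds by 1/4. *)
Let step_contracts y z C y' z' C' q : 0 <= q -> step y z -> weighted C z ->
  step y' z' -> weighted C' z' -> weighted q (fun t => y t - y' t) ->
  weighted (q / 2) (fun t => z t - z' t).
Proof.
move=> q0 [cz dz zm zD] zC [cz' dz' zm' zD'] zC' yq.
have y2 (t : R) : 0 <= t -> `|y t - y' t| ^+ 2 <= q ^+ 2 * expR (- (2 * th) * t).
  by move=> t0; apply/(weighted_sqr th (fun t => y t - y' t)) => //; exact: yq.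
move=> t t0; apply/(weighted_sqr th (fun t => z t - z' t)); first by rewrite divr_ge0.
apply: (@le_trans _ _ (expR (- (2 * th) * t) * (d2 * q ^+ 2 + (l2 * q ^+ 2) / gam))); last first.
  rewrite mulrC ler_pM2r ?expR_gt0// expr_div_n.
  have -> : d2 * q ^+ 2 + l2 * q ^+ 2 / gam = (2 * l2 / gam + d2) * q ^+ 2 - l2 / gam * q ^+ 2.
    by field; rewrite gt_eqF.
  have := ler_wpM2r (sqr_ge0 q) small.
  have : 0 <= l2 / gam * q ^+ 2 by rewrite mulr_ge0 ?sqr_ge0// divr_ge0// ltW.
  have -> : (2 : R) ^+ 2 = 4 by ring.
  lra.
refine (@dichotomy_estimate R E c w fr mu nu th gam nu0 gam0 gap
  (fun t => z t - z' t) (fun j t => N t (y t) j - N t (y' t) j) (C + C') _ _ _ _ _ _ _ _ t t0).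
- by rewrite mulr_ge0// sqr_ge0.
- by move=> s; apply: cvgB; [exact: cz|exact: cz'].
- move=> j s s0.
  have -> : c j \o (fun t => z t - z' t) = (c j \o z) - (c j \o z').
    by apply/funext => r /=; rewrite (frameB fr).
  apply: (is_derive_eq (is_deriveB (dz j s s0) (dz' j s s0))).
  by rewrite (frameB fr); ring.
- move=> s s0; apply: le_trans (ler_normB _ _) _; rewrite mulrDl.
  by apply: lerD; [exact: zC|exact: zC'].
- move=> J s s0; apply: le_trans (Nlip _ _ _ (ltW s0)) _.
  by rewrite -mulrA ler_wpM2l// y2// ltW.
- move=> J; under eq_bigr => j thj do rewrite (frameB fr) zD// zD'//.
  apply: le_trans (datlip _ _ _) _; rewrite ler_wpM2l//.
  by have := y2 0 (lexx _); rewrite mulr0 expR0 mulr1.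
Qed.

(** Picard iteration. The data may depend on the unknown value at 0; exponential tracking relies on
    this, because there the initial value is only required to lie on a graph. *)
Lemma semilinear_problem : exists z, [/\ continuous z,
  modal_solution c mu z (fun j t => N t (z t) j), forall t, z t = z (Num.max t 0),
  forall j, th < mu j -> c j (z 0) = dat (z 0) j &
  exists2 C, 0 <= C & forall t : R, 0 <= t -> `|z t| <= C * expR (- th * t)].
Proof.
pose K (y : R -> E) := [/\ continuous y, forall t, y t = y (Num.max t 0) &
  exists2 C, 0 <= C & weighted C y].
have /choice[T TP] : forall y : {y | K y}, exists z : {z | K z}, step (sval y) (sval z).
  move=> [y [cy ym [C C0 yC]]] /=.
  have [z [[cz dz zm zD] Cz]] := step_exists C0 cy yC.
  have Kz : K z by split.
  by exists (exist _ z Kz).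
have K0 : K (cst 0).
  split => //; first exact: cst_continuous.
  by exists 0 => // t _; rewrite normr0 mul0r.
pose Y i := iter i T (exist _ _ K0); pose y_ i := sval (Y i).
have yS i : step (y_ i) (y_ i.+1) by exact: TP.
have yK i : K (y_ i) by exact: (svalP (Y i)).
have [C0 C00 yC0] : exists2 C, 0 <= C & weighted C (fun t => y_ 1 t - y_ 0 t).
  have [_ _ [C C0 yC]] := yK 1; exists C => // t t0.
  by rewrite /y_ /Y /= subr0; exact: yC.
have yC i : weighted (C0 / 2 ^+ i) (fun t => y_ i.+1 t - y_ i t).
  elim: i => [|i IH]; first by rewrite expr0 divr1.
  have [_ _ [C1 _ h1]] := yK i.+2; have [_ _ [C2 _ h2]] := yK i.+1.
  rewrite exprS invfM [2^-1 * _]mulrC mulrA.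
  by apply: step_contracts (yS i.+1) h1 (yS i) h2 IH; rewrite divr_ge0// exprn_ge0.
have m0 (t : R) : 0 <= Num.max t 0 by rewrite le_max lexx orbT.
have ym i t : y_ i t = y_ i (Num.max t 0) by case: (yK i).
(* The limit is taken at each time separately. The error bound has the exponential weight as a
   factor, so the limit inherits continuity and growth. *)
have /choice[y yP] : forall t, exists u, forall i,
    `|u - y_ i t| <= 2 * (C0 * expR (- th * Num.max t 0)) / 2 ^+ i.
  move=> t; apply: (frame_complete fr) => i.
  by rewrite ym (ym i) mulrAC; exact: yC.
have yy i : weighted (2 * C0 / 2 ^+ i) (fun t => y t - y_ i t).
  move=> t t0; have := yP t i; rewrite max_l//.
  by move/le_trans; apply; rewrite le_eqVlt; apply/orP; left; apply/eqP; field.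
have ymax t : y t = y (Num.max t 0).
  apply/eqP; rewrite -subr_eq0 -normr_le0.
  apply: (@le0_geometric _ _ (2 * (2 * (C0 * expR (- th * Num.max t 0))))) => i.
  have h1 := yP t i; have h2 := yP (Num.max t 0) i.
  rewrite (max_l (m0 t)) -(ym i) in h2.
  have -> : y t - y (Num.max t 0) = (y t - y_ i t) - (y (Num.max t 0) - y_ i t).
    by rewrite opprB addrA subrK.
  apply: le_trans (ler_normB _ _) _; apply: le_trans (lerD h1 h2) _.
  by rewrite le_eqVlt; apply/orP; left; apply/eqP; field.
have cy : continuous y.
  move=> t; apply/cvgrPdist_le => /= e e0.
  pose B := 2 * C0 * expR (`|th| * (`|t| + 1)).
  have [i hi] := ltr_pow2_archi (3 * B / e).
  have h3 : B / 2 ^+ i <= e / 3.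
    rewrite ler_pdivrMr ?exprn_gt0//; move: hi; rewrite ltr_pdivrMr// => /ltW.
    by rewrite mulrC; lra.
  have hB s : `|t - s| < 1 -> `|y s - y_ i s| <= e / 3.
    move=> ts; apply: le_trans (yP s i) _; apply: le_trans h3.
    rewrite ler_pM2r ?invr_gt0 ?exprn_gt0// /B mulrA ler_wpM2l ?mulr_ge0//.
    rewrite ler_expR; apply: le_trans (ler_norm _) _; rewrite normrM normrN.
    apply: ler_wpM2l => //.
    have hs : `|s| <= `|t| + 1.
      have -> : s = t - (t - s) by rewrite opprB addrCA subrr addr0.
      by apply: le_trans (ler_normB _ _) _; rewrite lerD2l ltW.
    by case: (leP s 0) => _ //; rewrite normr0 addr_ge0.
  have [ci _ _] := yK i.
  near=> s.
  have -> : y t - y s = (y t - y_ i t) + (y_ i t - y_ i s) - (y s - y_ i s).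
    by rewrite addrA subrK opprB addrA subrK.
  have e3 : e = e / 3 + e / 3 + e / 3 by field.
  rewrite e3; apply: le_trans (ler_normB _ _) _; apply: lerD; last first.
    apply: hB; near: s.
    by have := @nbhsx_ballx _ _ t 1 ltr01; rewrite -ball_normE.
  apply: le_trans (ler_normD _ _) _; apply: lerD.
    by apply: hB; rewrite subrr normr0.
  near: s; move: (ci t) => /cvgrPdist_le; apply.
  by rewrite divr_gt0.
have [C1 C10 yC1] : exists2 C, 0 <= C & weighted C y.
  have [_ _ [C C0' hC]] := yK 0%N; exists (2 * C0 / 2 ^+ 0 + C).
    by rewrite addr_ge0// expr0 divr1 mulr_ge0.
  move=> t t0; rewrite mulrDl.
  have -> : y t = (y t - y_ 0%N t) + y_ 0%N t by rewrite subrK.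
  by apply: le_trans (ler_normD _ _) _; apply: lerD; [exact: yy|exact: hC].
have Ky : K y by split => //; exists C1.
have [cz dz zm zD] : step y (sval (T (exist _ y Ky))) by exact: (TP (exist _ y Ky)).
have [_ _ [C2 C20 zC]] := svalP (T (exist _ y Ky)).
set z := sval _ in cz dz zm zD zC.
(* The image [z] of the limit and the limit [y] are both geometrically close to the same iterates,
   so [y] is a fixed point. *)
have zy t : 0 <= t -> z t = y t.
  move=> t0; apply/eqP; rewrite -subr_eq0 -normr_le0.
  apply: (@le0_geometric _ _ (2 * C0 * expR (- th * t))) => i.
  have [_ _ [C3 _ h3]] := yK i.+1.
  have q0 : 0 <= 2 * C0 / 2 ^+ i by rewrite divr_ge0 ?exprn_ge0// mulr_ge0.
  have sz : step y z by split.
  have h1 := step_contracts q0 sz zC (yS i) h3 (yy i) t0.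
  have h2 := yy i.+1 t t0.
  have -> : z t - y t = (z t - y_ i.+1 t) - (y t - y_ i.+1 t) by rewrite opprB addrA subrK.
  apply: le_trans (ler_normB _ _) _; apply: le_trans (lerD h1 h2) _.
  by rewrite le_eqVlt; apply/orP; left; apply/eqP; rewrite exprS invfM;
    set q := (2 ^+ i)^-1; field.
exists y; split => //.
- move=> j t t0; have -> : c j \o y = c j \o z.
    by apply/funext => s /=; rewrite ymax zm zy.
  by rewrite -(zy t (ltW t0)); have := dz j t t0; rewrite (zy t (ltW t0)).
- by move=> j thj; have := zD j thj; rewrite (zy 0).
- by exists C1.
Unshelve. all: by end_near. Qed.

End SemilinearProblem.

(** * The abstract inertial manifold *)

Section InertialManifold.
Context {R : realType} {E : normedModType R} {c : nat -> E -> R} {w lam : nat -> R}.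
Hypothesis fr : hilbert_frame c w.
Hypotheses (lam0 : forall j, 0 <= lam j) (wE : forall j, w j = 1 + lam j).
Hypothesis growth : forall b : R, exists J0, forall j, (J0 <= j)%N -> b <= lam j.
Variables (N : E -> nat -> R) (DN : E -> E -> nat -> R) (C2 Lp B0 : R).
Hypotheses (C20 : 0 <= C2) (Lp0 : 0 <= Lp) (B00 : 0 <= B0).
Hypothesis DN_lin : forall u a v v' j, DN u (a *: v + v') j = a * DN u v j + DN u v' j.
Hypothesis quad : forall u v J,
  \sum_(j < J) (N v j - N u j - DN u (v - u) j) ^+ 2 <= C2 * `|v - u| ^+ 4.
Hypothesis DN_le : forall u v J, \sum_(j < J) DN u v j ^+ 2 <= Lp * `|v| ^+ 2.
Hypothesis N0_le : forall J, \sum_(j < J) N 0 j ^+ 2 <= B0.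

Let w0 := frame_gt0 fr.

Let DND u v v' j : DN u (v + v') j = DN u v j + DN u v' j.
Proof. by have := DN_lin u 1 v v' j; rewrite scale1r mul1r. Qed.

Let DN0 u j : DN u 0 j = 0.
Proof.
by have := DND u 0 0 j; rewrite addr0 => /eqP; rewrite -subr_eq0 opprD addNKr oppr_eq0 => /eqP.
Qed.

Let DNZ u a v j : DN u (a *: v) j = a * DN u v j.
Proof. by have := DN_lin u a v 0 j; rewrite addr0 DN0 addr0. Qed.

Let DNB u v v' j : DN u (v - v') j = DN u v j - DN u v' j.
Proof. by rewrite DND -scaleN1r DNZ mulN1r. Qed.

Let is_derive_N u h j (s : R) :
  is_derive s 1 (fun s => N (u + s *: h) j) (DN (u + s *: h) h j).
Proof.
apply: (@is_derive_quadratic _ _ _ _ (Num.sqrt C2 * `|h| ^+ 2)) => r.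
have := quad (u + s *: h) (u + r *: h) j.+1.
have -> : u + r *: h - (u + s *: h) = (r - s) *: h.
  by rewrite opprD addrACA subrr add0r -scalerBl.
rewrite big_ord_recr/= DNZ normrZ => hq.
rewrite -(@ler_pXn2r _ 2)// ?nnegrE; last first.
  by apply: mulr_ge0; [apply: mulr_ge0; [exact: sqrtr_ge0|exact: sqr_ge0]|exact: sqr_ge0].
rewrite real_normK ?num_real// !exprMn sqr_sqrtr//.
apply: le_trans (le_trans _ hq) _; first by rewrite lerDr sumr_ge0// => i _; rewrite sqr_ge0.
have h2 : `|r - s| ^+ 2 = (r - s) ^+ 2 by rewrite real_normK ?num_real.
rewrite le_eqVlt; apply/orP; left; apply/eqP.
have -> : (`|r - s| * `|h|) ^+ 4 = (`|r - s| ^+ 2) ^+ 2 * `|h| ^+ 4 by ring.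
by rewrite h2; ring.
Qed.

(* The mean value theorem applied to [sum_j k_j (N u j - N v j) N (v + s (u - v)) j]. *)
Lemma lipschitz_of_derivative (k : nat -> R) (l : R) : (forall j, 0 <= k j) ->
  (forall u v J, \sum_(j < J) k j * DN u v j ^+ 2 <= l * `|v| ^+ 2) ->
  forall u v J, \sum_(j < J) k j * (N u j - N v j) ^+ 2 <= l * `|u - v| ^+ 2.
Proof.
move=> k0 hl u v J.
pose F s := \sum_(j < J) (k j * (N u j - N v j)) * N (v + s *: (u - v)) j.
pose dF s := \sum_(j < J) (k j * (N u j - N v j)) * DN (v + s *: (u - v)) (u - v) j.
have dFP (s : R) : is_derive s 1 F (dF s).
  refine (@is_derive_bigsum R (fun j s => (k j * (N u j - N v j)) * N (v + s *: (u - v)) j)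
    (fun j => (k j * (N u j - N v j)) * DN (v + s *: (u - v)) (u - v) j) s predT J _).
  by move=> j _; apply: is_deriveZ; exact: is_derive_N.
have [|s _] := @MVT_segment R F dF 0 1 ler01 (fun s _ => dFP s).
  by apply: derivable_within_continuous => s _; have := dFP s => -[].
rewrite subr0 mulr1 /F /dF -sumrB => hs.
have u1 : v + 1 *: (u - v) = u by rewrite scale1r addrC subrK.
have u0 : v + 0 *: (u - v) = v by rewrite scale0r addr0.
rewrite u1 u0 in hs.
apply: le_trans (hl (v + s *: (u - v)) (u - v) J).
have -> : \sum_(j < J) k j * (N u j - N v j) ^+ 2 =
    \sum_(j < J) k j * (N u j - N v j) * DN (v + s *: (u - v)) (u - v) j.
  rewrite -hs; apply: eq_bigr => j _.
  by ring.
set D := DN _ _.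
have : 0 <= \sum_(j < J) k j * (N u j - N v j - D j) ^+ 2.
  by apply: sumr_ge0 => j _; rewrite mulr_ge0// sqr_ge0.
have -> : \sum_(j < J) k j * (N u j - N v j - D j) ^+ 2 =
   \sum_(j < J) k j * (N u j - N v j) ^+ 2 + \sum_(j < J) k j * D j ^+ 2
   - 2 * \sum_(j < J) k j * (N u j - N v j) * D j.
  by rewrite mulr_sumr -sumrN -!big_split/=; apply: eq_bigr => j _; ring.
have -> : \sum_(j < J) k j * (N u j - N v j) ^+ 2 =
    \sum_(j < J) k j * (N u j - N v j) * D j.
  rewrite -hs; apply: eq_bigr => j _.
  by ring.
lra.
Qed.

Let N_lip u v J : \sum_(j < J) (N u j - N v j) ^+ 2 <= Lp * `|u - v| ^+ 2.
Proof.
under eq_bigr do rewrite -[_ ^+ 2]mul1r.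
apply: (@lipschitz_of_derivative (fun=> 1)) => // x y I.
by under eq_bigr do rewrite mul1r; exact: DN_le.
Qed.

Lemma nonlinearity_continuous (y : R -> E) j : continuous y ->
  continuous (fun t => N (y t) j).
Proof.
move=> cy t; apply/cvgrPdist_le => /= e e0.
have L1 : 0 < Num.sqrt Lp + 1 by rewrite ltr_wpDl// sqrtr_ge0.
near=> s; apply: (@le_trans _ _ ((Num.sqrt Lp + 1) * `|y t - y s|)).
  rewrite -(@ler_pXn2r _ 2)// ?nnegrE ?mulr_ge0 ?(ltW L1)//.
  rewrite real_normK ?num_real//.
  apply: (@le_trans _ _ (Lp * `|y t - y s| ^+ 2)).
    apply: le_trans (N_lip (y t) (y s) j.+1); rewrite big_ord_recr/= lerDr.
    by apply: sumr_ge0 => i _; rewrite sqr_ge0.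
  rewrite exprMn ler_wpM2r ?sqr_ge0// sqrrD1 sqr_sqrtr// -addrA lerDl.
  by rewrite addr_ge0// mulrn_wge0// sqrtr_ge0.
rewrite -ler_pdivlMl// mulrC; near: s; move: (cy t) => /cvgrPdist_le; apply.
by rewrite divr_gt0.
Unshelve. all: by end_near. Qed.

(* Polarisation of the quadratic remainder bound. *)
Lemma derivative_lipschitz u v h J :
  \sum_(j < J) (DN u h j - DN v h j) ^+ 2 <= 54 * C2 * `|u - v| ^+ 2 * `|h| ^+ 2.
Proof.
have [->|h0] := eqVneq h 0.
  by rewrite normr0 expr0n mulr0 big1// => j _; rewrite !DN0 subrr expr0n.
have [->|uv] := eqVneq u v.
  by rewrite subrr normr0 expr0n mulr0 mul0r big1// => j _; rewrite subrr expr0n.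
pose k := `|u - v| / `|h|; pose h' := k *: h.
have nh : 0 < `|h| by rewrite normr_gt0.
have nuv : 0 < `|u - v| by rewrite normr_gt0 subr_eq0.
have k0 : 0 < k by rewrite divr_gt0.
have nh' : `|h'| = `|u - v|.
  by rewrite normrZ gtr0_norm// divfK// gt_eqF.
have e1 := quad v (v + h') J; have e2 := quad u (v + h') J; have e3 := quad u v J.
have d1 : v + h' - v = h' by rewrite addrC addKr.
have n2 : `|v + h' - u| ^+ 4 <= 16 * `|u - v| ^+ 4.
  have : `|v + h' - u| <= 2 * `|u - v|.
    have -> : v + h' - u = h' + (v - u) by rewrite addrAC addrC.
    by apply: le_trans (ler_normD _ _) _; rewrite nh' distrC; lra.
  rewrite -(@ler_pXn2r _ 4)// ?nnegrE ?mulr_ge0// exprMn.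
  by move=> h4; apply: le_trans h4 _; rewrite le_eqVlt -natrX eqxx.
have hk : \sum_(j < J) (DN u h' j - DN v h' j) ^+ 2 <= 54 * C2 * `|u - v| ^+ 4.
  pose a j := N (v + h') j - N v j - DN v h' j.
  pose b j := N (v + h') j - N u j - DN u (v + h' - u) j.
  pose d j := N v j - N u j - DN u (v - u) j.
  apply: (@le_trans _ _ (\sum_(j < J) 3 * (a j ^+ 2 + b j ^+ 2 + d j ^+ 2))).
    apply: ler_sum => j _.
    have -> : DN u h' j - DN v h' j = a j - b j + d j.
      rewrite /a /b /d; have -> : v + h' - u = h' + (v - u) by rewrite addrAC addrC.
      by rewrite (DND u h' (v - u)); ring.
    rewrite -subr_ge0.
    have -> : 3 * (a j ^+ 2 + b j ^+ 2 + d j ^+ 2) - (a j - b j + d j) ^+ 2 =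
      (a j + b j) ^+ 2 + (a j - d j) ^+ 2 + (b j + d j) ^+ 2 by ring.
    by rewrite !addr_ge0// sqr_ge0.
  rewrite -mulr_sumr !big_split/= -/(a _).
  rewrite d1 nh' in e1; rewrite distrC in e3.
  have e2' := le_trans e2 (ler_wpM2l C20 n2).
  move: e1 e2' e3; rewrite -/(a _) => e1 e2' e3.
  apply: (@le_trans _ _ (3 * (C2 * `|u - v| ^+ 4 + C2 * (16 * `|u - v| ^+ 4) + C2 * `|u - v| ^+ 4))).
    by rewrite ler_pM2l//; apply: lerD => //; apply: lerD.
  by rewrite le_eqVlt; apply/orP; left; apply/eqP; ring.
move: hk; under eq_bigr do rewrite !DNZ -mulrBr exprMn.
rewrite -mulr_sumr -ler_pdivlMl ?exprn_gt0// => /le_trans; apply.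
rewrite le_eqVlt; apply/orP; left; apply/eqP.
by rewrite /k; field; rewrite !gt_eqF.
Qed.

Let fwd_gap (L : R) : 1 <= L -> forall j, L / 2 + w j / (2 * 1) <= `|lam j - - L|.
Proof.
move=> L1 j; rewrite opprK ger0_norm ?addr_ge0//; last lra.
by rewrite wE; have := lam0 j; lra.
Qed.

(** Let [G] be the squared distance times [exp (- 2 L t)] and let [t0] maximise it on [[0, T]]. The
    energy estimate with threshold [- L] gives [G <= Lp / L * G t0]; as [L = Lp + 1], the maximum is
    0. *)
Lemma forward_uniqueness (v1 v2 : R -> E) (T : R) : 0 <= T ->
  continuous v1 -> continuous v2 -> v1 0 = v2 0 ->
  (forall j t, 0 < t -> t < T ->
     is_derive t 1 (c j \o v1) (- lam j * c j (v1 t) + N (v1 t) j)) ->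
  (forall j t, 0 < t -> t < T ->
     is_derive t 1 (c j \o v2) (- lam j * c j (v2 t) + N (v2 t) j)) ->
  forall t, 0 <= t -> t <= T -> v1 t = v2 t.
Proof.
move=> T0 c1 c2 v0 d1 d2.
pose L := Lp + 1; have L1 : 1 <= L by rewrite lerDr.
have L0 : 0 < L / 2 by rewrite divr_gt0//; lra.
pose z t := v1 t - v2 t.
have cz : continuous z by move=> t; apply: cvgB; [exact: c1|exact: c2].
pose G (t : R) := expR (2 * - L * t) * `|z t| ^+ 2.
have cG : continuous G.
  move=> t; apply: cvgM; first exact: continuous_expRM.
  apply: (@continuous_comp _ _ _ (fun t => `|z t|) (fun x : R => x ^+ 2)).
    by apply: cvg_norm; exact: cz.
  exact: exprn_continuous.
have [t0 t0T Gmax] := EVT_max T0 (continuous_subspaceT cG).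
have zG (t : R) : `|z t| ^+ 2 = G t * expR (- (2 * - L) * t).
  by rewrite /G mulrAC -expRD mulNr subrr expR0 mul1r.
have G0 : 0 <= G t0 by rewrite mulr_ge0 ?expR_ge0// sqr_ge0.
have hG : forall t, 0 <= t -> t <= T -> G t <= Lp * G t0 / L.
  move=> t tt tT.
  have h : `|z t| ^+ 2 <= expR (- (2 * - L) * t) * (0 + Lp * G t0 / (2 * (L / 2))).
    apply: (frame_norm_le fr).
      rewrite mulr_ge0 ?expR_ge0// add0r divr_ge0 ?mulr_ge0//; lra.
    move=> J.
    have := @data_modes_estimate R lam w (fun=> 1) (- L) (L / 2) w0
      (fun=> ltr01) L0 predT J (fun j => c j \o z) (fun j t => N (v1 t) j - N (v2 t) j)
      (Lp * G t0) t _ tt.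
    have -> : \sum_(j < J | predT j) w j * (c j \o z) 0 ^+ 2 = 0.
      by rewrite big1// => j _; rewrite /= /z v0 subrr (frame0 fr) expr0n mulr0.
    apply; first by rewrite mulr_ge0.
    - by move=> j _; have := fwd_gap L1 j; rewrite opprK ger0_norm; have := lam0 j; lra.
    - by move=> j _; exact: (continuous_frame_comp fr).
    - move=> j s _ s0 st.
      have -> : c j \o z = (c j \o v1) - (c j \o v2).
        by apply/funext => r /=; rewrite /z (frameB fr).
      have sT := lt_le_trans st tT.
      apply: (is_derive_eq (is_deriveB (d1 j s s0 sT) (d2 j s s0 sT))).
      by rewrite !fctE/=; ring.
    - move=> s s0 st; under eq_bigr do rewrite mul1r.
      apply: le_trans (N_lip _ _ _) _; rewrite -/(z s) zG -mulrA ler_wpM2l//.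
      rewrite ler_pM2r ?expR_gt0//; apply: Gmax; rewrite in_itv/=; lra.
  rewrite -(ler_pM2r (expR_gt0 (- (2 * - L) * t))) -zG; apply: le_trans h _.
  rewrite add0r mulrC le_eqVlt; apply/orP; left; apply/eqP; field.
  by rewrite gt_eqF// (lt_le_trans ltr01 L1).
have G00 : G t0 = 0.
  have := hG t0; move: t0T; rewrite in_itv/= => /andP[h1 h2] /(_ h1 h2).
  rewrite ler_pdivlMr; last lra.
  rewrite /L mulrDr mulr1 [G t0 * Lp]mulrC => h.
  by apply/eqP; rewrite eq_le G0 andbT; lra.
move=> t tt tT; apply/eqP; rewrite -subr_eq0 -normr_eq0 -sqrf_eq0 -/(z t) zG.
have := Gmax t; rewrite in_itv/= tt tT G00 => /(_ isT) h.
rewrite mulf_eq0 eq_le h /= /G mulr_ge0 ?expR_ge0 ?sqr_ge0//.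
Qed.

(** The threshold [- L] lies below every rate, so all modes carry data and the semilinear problem is
    the initial value problem. The constant [16 * Lp + 1] makes [2 * Lp / (L / 2)] at most 1/4. *)
Lemma forward_semigroup : exists S : R -> E -> E, forall u0, S 0 u0 = u0 /\
  continuous (S^~ u0) /\ modal_solution c lam (S^~ u0) (fun j t => N (S t u0) j).
Proof.
pose L := 16 * Lp + 1; have L1 : 1 <= L by rewrite lerDr mulr_ge0.
have L0 : 0 < L / 2 by rewrite divr_gt0//; lra.
suff /choice[S SP] : forall u0, exists v : R -> E, v 0 = u0 /\ continuous v /\
    modal_solution c lam v (fun j t => N (v t) j).
  by exists (fun t u => S u t).
move=> u0.
have e1 (t : R) : 0 <= t -> 1 <= expR (- (2 * - L) * t).
  by move=> t0; rewrite -expR0 ler_expR mulrN opprK !mulr_ge0//; lra.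
have [|||||||v [cv dv _ v0 _]] := @semilinear_problem R E c w fr lam (fun=> 1) (- L) (L / 2)
  (fun=> ltr01) L0 (fwd_gap L1) _ (fun _ u j => N u j) (fun _ j => c j u0) Lp 0 B0
  (`|u0| ^+ 2) Lp0 (lexx _) B00.
- move=> b; have [J0 hJ0] := growth b; exists J0 => j jJ.
  have LL : 0 <= L by apply: le_trans L1.
  rewrite opprK ger0_norm; first by apply: le_trans (hJ0 j jJ) _; rewrite lerDl.
  by rewrite (addr_ge0 (lam0 j) LL).
- by rewrite addr0 ler_pdivrMr// /L; lra.
- by move=> y cy j; exact: nonlinearity_continuous.
- by move=> t u v J _; under eq_bigr do rewrite mul1r; exact: N_lip.
- move=> t J t0; under eq_bigr do rewrite mul1r.
  by apply: le_trans (N0_le J) _; rewrite ler_peMr// e1.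
- move=> u v J; rewrite mul0r big1// => j _.
  by rewrite subrr expr0n mulr0.
- move=> J; apply: le_trans (frame_bessel fr u0 J).
  by apply: (@le_bigsum_cond R (fun j => - L < lam j) J (fun j => w j * c j u0 ^+ 2)) => j;
    rewrite mulr_ge0 ?sqr_ge0// ltW.
exists v; split => //; apply: (frame_inj fr) => j; rewrite v0//.
by have := lam0 j; lra.
Qed.

Variables (n : nat) (P : E -> E) (th0 gam : R) (nu : nat -> R) (l2 K : R).
Hypothesis PE : forall u j, c j (P u) = if (j < n)%N then c j u else 0.
Hypotheses (gam0 : 0 < gam) (gamth : gam <= th0) (nu0 : forall j, 0 < nu j).
Hypotheses (nuK : forall j, nu j <= K) (l20 : 0 <= l2) (small : 64 * l2 <= gam).
Hypothesis lamn : forall j, (lam j < th0) = (j < n)%N.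
Hypothesis gap : forall j, 2 * gam + w j / (2 * nu j) <= `|lam j - th0|.
Hypothesis DN_nu : forall u v J, \sum_(j < J) nu j * DN u v j ^+ 2 <= l2 * `|v| ^+ 2.

Let N_nu u v J : \sum_(j < J) nu j * (N u j - N v j) ^+ 2 <= l2 * `|u - v| ^+ 2.
Proof. by apply: lipschitz_of_derivative => // j; exact: ltW. Qed.

Let wnu j : 0 < w j / (2 * nu j).
Proof. by rewrite divr_gt0// mulr_gt0. Qed.

(** The gap hypothesis offers [2 * gam] where the estimates ask for [gam]. The surplus lets the
    exponential weight move by [gam] around [th0]; the smoothness estimates need the weight
    [th0 + gam]. *)
Let window th := `|th - th0| <= gam.

Let window0 : window th0.
Proof. by rewrite /window subrr normr0 ltW. Qed.

Let rgap th : window th -> forall j, gam + w j / (2 * nu j) <= `|- lam j - - th|.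
Proof.
move=> hth j; have := gap j; move: hth; rewrite /window opprK => hth h.
have : `|lam j - th0| <= `|- lam j + th| + `|th - th0|.
  have -> : lam j - th0 = - (- lam j + th) + (th - th0) by ring.
  by apply: le_trans (ler_normD _ _) _; rewrite normrN.
by lra.
Qed.

(** In reversed time the rates are [- lam j], and the modes above the threshold, which carry the
    data, are the first [n]. *)
Let rdata th : window th -> forall j, (- th < - lam j) = (j < n)%N.
Proof.
move=> hth j; rewrite ltrN2 -lamn; have := gap j; have := wnu j.
move: hth gam0; rewrite /window ler_norml => /andP[h1 h2] g0 h3.
have [lt|ge] := ltP (lam j) th0.
  rewrite ler0_norm; last by rewrite subr_le0 ltW.
  by move=> h4; lra.
rewrite ger0_norm ?subr_ge0// => h4; apply/negbTE; rewrite -leNgt; lra.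
Qed.

Let rgrowth th (b : R) : exists J0, forall j, (J0 <= j)%N -> b <= `|- lam j - - th|.
Proof.
have [J0 hJ0] := growth (b + `|th|); exists J0 => j /hJ0 h.
have -> : - lam j - - th = - (lam j - th) by ring.
rewrite normrN; apply: le_trans (ler_norm _).
by have := ler_norm th; lra.
Qed.

Let low_le u J : \sum_(j < J | (j < n)%N) w j * c j u ^+ 2 <= `|u| ^+ 2.
Proof.
apply: le_trans (frame_bessel fr u J).
by apply: (@le_bigsum_cond R (fun j => j < n)%N J (fun j => w j * c j u ^+ 2)) => j;
  rewrite mulr_ge0 ?sqr_ge0// ltW.
Qed.

Let stab th z (h : nat -> R -> R) C D b : window th -> 0 <= b -> 0 <= D -> continuous z ->
  modal_solution c (fun j => - lam j) z h ->
  (forall t : R, 0 <= t -> `|z t| <= C * expR (th * t)) ->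
  (forall J (t : R), 0 <= t -> \sum_(j < J) nu j * h j t ^+ 2 <=
     2 * l2 * `|z t| ^+ 2 + 2 * b * expR (2 * th * t)) ->
  (forall J, \sum_(j < J | (j < n)%N) w j * c j (z 0) ^+ 2 <= D) ->
  forall t : R, 0 <= t -> `|z t| ^+ 2 <= 2 * (D + 2 * b / gam) * expR (2 * th * t).
Proof.
move=> hth b0 D0 cz dz zC hb zD t t0.
have e (s : R) : - (2 * - th) * s = 2 * th * s by ring.
rewrite -e.
refine (@stability_estimate R E c w fr (fun j => - lam j) nu (- th) gam nu0 gam0 (rgap hth)
  z h C D b l2 0 b0 D0 l20 (lexx _) _ cz dz _ _ _ t t0).
- rewrite addr0 ler_pdivrMr//; move: gam0 small; lra.
- by move=> s s0; rewrite opprK; exact: zC.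
- by move=> J s s0; rewrite e; exact: hb.
- move=> J; rewrite mul0r addr0; under eq_bigl do rewrite rdata//.
  exact: zD.
Qed.

Let reversed_problem (N' : R -> E -> nat -> R) p (b0 : R) : 0 <= b0 ->
  (forall y : R -> E, continuous y -> forall j, continuous (fun t => N' t (y t) j)) ->
  (forall (t : R) u v J, 0 <= t ->
     \sum_(j < J) nu j * (N' t u j - N' t v j) ^+ 2 <= l2 * `|u - v| ^+ 2) ->
  (forall (t : R) J, 0 <= t -> \sum_(j < J) nu j * N' t 0 j ^+ 2 <= b0 * expR (2 * th0 * t)) ->
  exists z, [/\ continuous z, modal_solution c (fun j => - lam j) z (fun j t => N' t (z t) j),
    forall t, z t = z (Num.max t 0), forall j, (j < n)%N -> c j (z 0) = c j p &
    exists2 C, 0 <= C & forall t : R, 0 <= t -> `|z t| <= C * expR (th0 * t)].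
Proof.
move=> b00 cN' lN' N'0.
have [||||z [cz dz zm zD [C C0 zC]]] := @semilinear_problem R E c w fr
  (fun j => - lam j) nu (- th0) gam nu0 gam0 (rgap window0) (rgrowth th0) N' (fun _ j => c j p)
  l2 0 b0 (`|p| ^+ 2) l20 (lexx _) b00 _ cN' lN'.
- by rewrite addr0 ler_pdivrMr//; move: gam0 small; lra.
- by move=> t J t0; have -> : - (2 * - th0) * t = 2 * th0 * t; [ring|exact: N'0].
- by move=> u v J; rewrite mul0r big1// => j _; rewrite subrr expr0n mulr0.
- by move=> J; under eq_bigl do rewrite (rdata window0); exact: low_le.
exists z; split => //.
- by move=> j jn; apply: zD; rewrite (rdata window0).
- by exists C => // t t0; have := zC t t0; rewrite opprK.
Qed.

(** Pasts read in reversed time: [y t] is the state at time [- t] of a trajectory arriving at [y 0],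
    whose low modes are those of [p]. The growth bound singles out one past for every [p]. *)
Let backward p y := [/\ continuous y,
  modal_solution c (fun j => - lam j) y (fun j t => - N (y t) j),
  forall t, y t = y (Num.max t 0), forall j, (j < n)%N -> c j (y 0) = c j p &
  exists2 C, 0 <= C & forall t : R, 0 <= t -> `|y t| <= C * expR (th0 * t)].

Let K0 : 0 <= K.
Proof. exact: le_trans (ltW (nu0 0)) (nuK 0). Qed.

Let nu_sum_le (F : nat -> R) J : \sum_(j < J) nu j * F j ^+ 2 <= K * \sum_(j < J) F j ^+ 2.
Proof. by rewrite mulr_sumr; apply: ler_sum => j _; rewrite ler_wpM2r// sqr_ge0. Qed.

Let th00 : 0 < th0.
Proof. exact: lt_le_trans gam0 gamth. Qed.

Let exp_ge1 (t : R) : 0 <= t -> 1 <= expR (2 * th0 * t).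
Proof. by move=> t0; rewrite -expR0 ler_expR !mulr_ge0// ltW. Qed.

Let backward_exists p : exists y, backward p y.
Proof.
apply: (@reversed_problem (fun _ u j => - N u j) p (K * B0)); first by rewrite mulr_ge0.
- by move=> y cy j t; apply: cvgN; exact: nonlinearity_continuous.
- move=> t u v J _; apply: le_trans (N_nu u v J); rewrite le_eqVlt; apply/orP; left; apply/eqP.
  by apply: eq_bigr => j _; ring.
- move=> t J t0; under eq_bigr do rewrite sqrrN.
  apply: le_trans (nu_sum_le _ _) _; rewrite -mulrA ler_wpM2l//.
  by apply: le_trans (N0_le J) _; rewrite ler_peMr// exp_ge1.
Qed.

Let sub_modal mu y1 y2 n1 n2 : modal_solution c mu y1 n1 -> modal_solution c mu y2 n2 ->
  modal_solution c mu (fun t => y1 t - y2 t) (fun j t => n1 j t - n2 j t).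
Proof.
move=> d1 d2 j t t0.
have -> : c j \o (fun t => y1 t - y2 t) = (c j \o y1) - (c j \o y2).
  by apply/funext => s /=; rewrite (frameB fr).
apply: (is_derive_eq (is_deriveB (d1 j t t0) (d2 j t t0))).
by rewrite (frameB fr); ring.
Qed.

Let sub_weighted (C1 C2' th : R) (y1 y2 : R -> E) :
  (forall t : R, 0 <= t -> `|y1 t| <= C1 * expR (th * t)) ->
  (forall t : R, 0 <= t -> `|y2 t| <= C2' * expR (th * t)) ->
  forall t : R, 0 <= t -> `|y1 t - y2 t| <= (C1 + C2') * expR (th * t).
Proof.
move=> h1 h2 t t0; apply: le_trans (ler_normB _ _) _.
by rewrite mulrDl lerD// ?h1// h2.
Qed.

Let backward_lip p q y y' : backward p y -> backward q y' ->
  forall t : R, 0 <= t -> `|y t - y' t| ^+ 2 <= 2 * `|p - q| ^+ 2 * expR (2 * th0 * t).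
Proof.
move=> [cy dy ym yD [C C0 yC]] [cy' dy' ym' yD' [C' C0' yC']] t t0.
have := @stab th0 (fun t => y t - y' t) _ (C + C') (`|p - q| ^+ 2) 0 window0 (lexx _)
  (sqr_ge0 _) _ (sub_modal dy dy').
rewrite mulr0 mul0r addr0; apply => //.
- by move=> s; apply: cvgB; [exact: cy|exact: cy'].
- exact: sub_weighted.
- move=> J s s0; rewrite mul0r addr0.
  apply: (@le_trans _ _ (l2 * `|y s - y' s| ^+ 2)).
    apply: le_trans (N_nu (y s) (y' s) J); rewrite le_eqVlt; apply/orP; left; apply/eqP.
    by apply: eq_bigr => j _; ring.
  by rewrite -mulrA ler_peMl ?mulr_ge0 ?sqr_ge0// ler1n.
- move=> J; under eq_bigr => j jn do rewrite (frameB fr) yD// yD'// -(frameB fr).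
  exact: low_le.
Qed.

Let backward_uniq p y y' : backward p y -> backward p y' -> y = y'.
Proof.
move=> hy hy'; apply/funext => t.
have -> : y t = y (Num.max t 0) by case: hy.
have -> : y' t = y' (Num.max t 0) by case: hy'.
have m0 : 0 <= Num.max t 0 by rewrite le_max lexx orbT.
have := backward_lip hy hy' m0.
rewrite subrr normr0 expr0n mulr0 mul0r => h.
by apply/eqP; rewrite -subr_eq0 -normr_eq0 -sqrf_eq0 eq_le h sqr_ge0.
Qed.

(** In reversed time the high modes lie below the threshold and carry no data: only the forcing
    moves them. This gives the factor [2 * l2 / gam <= 1/32], much better than the factor 2 of
    [backward_lip], and it makes the graph a strong contraction. *)
Lemma high_modes_small p q y y' : backward p y -> backward q y' ->
  forall J, \sum_(j < J | ~~ (j < n)%N) w j * c j (y 0 - y' 0) ^+ 2 <= 32^-1 * `|p - q| ^+ 2.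
Proof.
move=> hy hy' J; have hL := backward_lip hy hy'.
have [cy dy ym yD [C C0 yC]] := hy; have [cy' dy' ym' yD' [C' C0' yC']] := hy'.
have dz := sub_modal dy dy'.
have e : (- (2 * - th0)) = 2 * th0 by ring.
have sC := sub_weighted yC yC'.
have := @modes_estimate R (fun j => - lam j) w nu (- th0) gam w0 nu0 gam0
  (fun j => ~~ (j < n)%N) J (fun j => c j \o (fun t => y t - y' t))
  (fun j t => - N (y t) j - - N (y' t) j) (fun j => (C + C') / Num.sqrt (w j)) 0
  (l2 * (2 * `|p - q| ^+ 2)) 0.
rewrite mulr0 expR0 mul1r add0r => H.
apply: (@le_trans _ _ (l2 * (2 * `|p - q| ^+ 2) / gam)).
  apply: H => //.
  - by rewrite !mulr_ge0 ?sqr_ge0.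
  - by move=> j _; exact: rgap window0 j.
  - by move=> j _; apply: (continuous_frame_comp fr) => s; apply: cvgB; [exact: cy|exact: cy'].
  - by move=> j t _; exact: dz.
  - move=> j t _ _ t0; apply: le_trans (frame_le1 fr j _) _.
    by rewrite mulrAC ler_pM2r ?invr_gt0 ?sqrtr_gt0// opprK sC.
  - move=> t t0; rewrite e; apply: (@le_trans _ _ (l2 * `|y t - y' t| ^+ 2)).
      apply: le_trans (N_nu (y t) (y' t) J).
      rewrite big_mkcond/=; apply: ler_sum => j _; case: ifP => _.
        by rewrite -opprB opprK addrC sqrrN addrC.
      by rewrite mulr_ge0 ?sqr_ge0// ltW.
    by rewrite -mulrA ler_wpM2l// hL// ltW.
  - rewrite big1// => j; rewrite (rdata window0) => /andP[/negbTE h1].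
    by rewrite h1.
rewrite ler_pdivrMr//; have := ler_wpM2r (sqr_ge0 `|p - q|) small.
by set X := _ ^+ 2; lra.
Qed.

Let PP u : P (P u) = P u.
Proof. by apply: (frame_inj fr) => j; rewrite !PE; case: (j < n)%N. Qed.

Let P_le u : `|P u| <= `|u|.
Proof.
rewrite -(@ler_pXn2r _ 2)// ?nnegrE//; apply: (frame_norm_le fr) => [|J]; first exact: sqr_ge0.
apply: le_trans (low_le u J); rewrite [leRHS]big_mkcond/=; apply: ler_sum => j _.
by rewrite PE; case: ifP => //; rewrite expr0n mulr0.
Qed.

Let P_lin a u v : P (a *: u + v) = a *: P u + P v.
Proof.
apply: (frame_inj fr) => j; rewrite (frame_linear fr) !PE; case: ifP => _.
  by rewrite (frame_linear fr).
by rewrite mulr0 addr0.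
Qed.

(** An earlier state of a past is itself the end of a past. This is the half of invariance by which
    points of the manifold come from the manifold. *)
Let backward_shift p y (t0 : R) : 0 <= t0 -> backward p y ->
  backward (y t0) (fun t => y (t0 + Num.max t 0)).
Proof.
move=> t00 [cy dy ym yD [C C0 yC]]; split.
- have ct : continuous (fun t : R => t0 + Num.max t 0).
    move=> t; apply: cvgD; first exact: cvg_cst.
    by apply: continuous_max; [exact: cvg_id|exact: cvg_cst].
  by move=> t; exact: (continuous_comp (ct t) (cy _)).
- move=> j t tt; rewrite /= (max_l (ltW tt)).
  have dt : is_derive t 1 ((c j \o y) \o (fun s => t0 + s))
      (- - lam j * c j (y (t0 + t)) + - N (y (t0 + t)) j).
    have := @is_derive1_comp R (c j \o y) (fun s => t0 + s) t
      (- - lam j * c j (y (t0 + t)) + - N (y (t0 + t)) j) 1.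
    rewrite mulr1; apply; first by apply: dy; lra.
    by apply: (is_derive_eq (is_deriveD (is_derive_cst t0 t 1) (is_derive_id t 1))); rewrite add0r.
  apply: near_eq_is_derive dt.
  by apply: filterS (lt_nbhsr tt) => s s0; rewrite /= max_l// ltW.
- by move=> t; rewrite (max_l (_ : 0 <= Num.max t 0))// le_max lexx orbT.
- by rewrite maxxx addr0.
- exists (C * expR (th0 * t0)); first by rewrite mulr_ge0 ?expR_ge0.
  move=> t tt; rewrite max_l//; apply: le_trans (yC _ _) _; first by rewrite addr_ge0.
  by rewrite mulrDr expRD mulrA.
Qed.

Let forward (v : R -> E) := continuous v /\ modal_solution c lam v (fun j t => N (v t) j).

Let forward_uniq v v' : forward v -> forward v' -> v 0 = v' 0 ->
  forall t : R, 0 <= t -> v t = v' t.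
Proof.
move=> [cv dv] [cv' dv'] v0 t t0.
apply: (@forward_uniqueness v v' t) => //; first by move=> j s s0 _; exact: dv.
by move=> j s s0 _; exact: dv'.
Qed.

Let is_derive_reflect (F : R -> R) (a t d : R) : is_derive (a - t) 1 F d ->
  is_derive t 1 (F \o (fun s => a - s)) (- d).
Proof.
move=> dF; have := @is_derive1_comp R F (fun s => a - s) t d (-1) dF.
rewrite mulrN1; apply.
by apply: (is_derive_eq (is_deriveB (is_derive_cst a t 1) (is_derive_id t 1))); rewrite sub0r.
Qed.

Let backward_forward p y v (T : R) : 0 <= T -> backward p y -> forward v -> v 0 = y T ->
  forall t : R, 0 <= t -> t <= T -> v t = y (T - t).
Proof.
move=> T0 [cy dy ym yD _] [cv dv] v0.
apply: (@forward_uniqueness v (fun t => y (T - t)) T) => //.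
- by move=> t; apply: (@continuous_comp _ _ _ (fun t => T - t) y);
    [apply: cvgB; [exact: cvg_cst|exact: cvg_id]|exact: cy].
- by rewrite subr0.
- by move=> j s s0 _; exact: dv.
- move=> j s s0 sT; have Ts : 0 < T - s by lra.
  by apply: (is_derive_eq (is_derive_reflect (dy j _ Ts))); ring.
Qed.

Variable S : R -> E -> E.
Hypothesis SP : forall u0, S 0 u0 = u0 /\ continuous (S^~ u0) /\
  modal_solution c lam (S^~ u0) (fun j t => N (S t u0) j).

Let S_forward u : forward (S^~ u).
Proof. by have [_] := SP u. Qed.

Let S0 u : S 0 u = u.
Proof. by have [] := SP u. Qed.

Let S_add u (s t : R) : 0 <= s -> 0 <= t -> S (s + t) u = S s (S t u).
Proof.
move=> s0 t0; have [c1 d1] := S_forward u; have [c2 d2] := S_forward (S t u).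
apply: (@forward_uniqueness (fun s => S (s + t) u) (S^~ (S t u)) s) => //.
- by move=> r; apply: (@continuous_comp _ _ _ (fun s => s + t) (S^~ u));
    [apply: cvgD; [exact: cvg_id|exact: cvg_cst]|exact: c1].
- by rewrite add0r S0.
- move=> j r r0 _.
  have rt : 0 < r + t by lra.
  have := @is_derive1_comp R (c j \o S^~ u) (fun s => s + t) r _ 1 (d1 j _ rt).
  rewrite mulr1; apply.
  by apply: (is_derive_eq (is_deriveD (is_derive_id r 1) (is_derive_cst t r 1))); rewrite addr0.
- by move=> j r r0 _; exact: d2.
Qed.

Let S_backward p y (T t : R) : backward p y -> 0 <= t -> t <= T -> S t (y T) = y (T - t).
Proof.
move=> hy t0 tT; apply: (@backward_forward p y (S^~ (y T)) T) => //.
by apply: le_trans tT.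
Qed.

(* Glueing the backward trajectory of [p] with the forward one of its value at [0]. *)
Let backward_extend p y (t0 : R) : 0 <= t0 -> backward p y ->
  exists2 y', backward (S t0 (y 0)) y' & y' 0 = S t0 (y 0).
Proof.
move=> t00 hy; have [cy dy ym yD [C C0 yC]] := hy.
pose W (s : R) := if s <= t0 then S (t0 - s) (y 0) else y (s - t0).
(* Seen from an earlier state [y T], the glued function is a single forward trajectory read
   backwards. Continuity and the equations hold across the glueing point for this reason. *)
have WE (T s : R) : 0 <= T -> s <= T + t0 -> W s = S (T + t0 - s) (y T).
  move=> T0 sT; rewrite /W; case: ifPn => [st|]; last first.
    rewrite -ltNge => ts; rewrite (S_backward hy); [|lra|lra].
    by congr (y _); ring.
  have -> : T + t0 - s = (t0 - s) + T by ring.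
  have s0 : 0 <= t0 - s by rewrite subr_ge0.
  by rewrite (S_add (y T) s0 T0) (S_backward hy T0 (lexx T)) subrr.
have nearW (s : R) : \forall r \near s, W r = S (`|s| + 1 + t0 - r) (y (`|s| + 1)).
  have h : \forall r \near s, r < s + 1 by apply: lt_nbhsl; rewrite ltrDl.
  apply: filterS h => r rs; apply: WE; first by rewrite addr_ge0.
  by have := ler_norm s; lra.
have cW : continuous W.
  move=> s; have [cS _] := S_forward (y (`|s| + 1)).
  have h : {for s, continuous (fun r => S (`|s| + 1 + t0 - r) (y (`|s| + 1)))}.
    apply: (@continuous_comp _ _ _ (fun r => `|s| + 1 + t0 - r) (S^~ (y (`|s| + 1)))).
      by apply: cvgB; [exact: cvg_cst|exact: cvg_id].
    exact: cS.
  rewrite /continuous_at (nbhs_singleton (nearW s)).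
  apply: cvg_trans h; apply: near_eq_cvg.
  by apply: filterS (nearW s) => r ->.
have dW : modal_solution c (fun j => - lam j) W (fun j t => - N (W t) j).
  move=> j s s0; have [_ dS] := S_forward (y (`|s| + 1)).
  have pos : 0 < `|s| + 1 + t0 - s by have := ler_norm s; lra.
  have := is_derive_reflect (dS j _ pos).
  rewrite (nbhs_singleton (nearW s)) => d.
  have e : - (- lam j * c j (S (`|s| + 1 + t0 - s) (y (`|s| + 1))) +
        N (S (`|s| + 1 + t0 - s) (y (`|s| + 1))) j) =
     - - lam j * c j (S (`|s| + 1 + t0 - s) (y (`|s| + 1))) -
        N (S (`|s| + 1 + t0 - s) (y (`|s| + 1))) j by ring.
  rewrite -e; apply: near_eq_is_derive d.
  by apply: filterS (nearW s) => r /= ->.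
have [r0 _ Wmax] := EVT_max t00 (continuous_subspaceT (fun s => cvg_norm (cW s))).
exists (fun t => W (Num.max t 0)); last by rewrite maxxx /W t00 subr0.
split.
- have cm : continuous (fun t : R => Num.max t 0).
    by move=> t; apply: continuous_max; [exact: cvg_id|exact: cvg_cst].
  by move=> t; exact: (continuous_comp (cm t) (cW _)).
- move=> j t tt /=; rewrite (max_l (ltW tt)); apply: near_eq_is_derive (dW j t tt).
  by apply: filterS (lt_nbhsr tt) => s s0; rewrite /= max_l// ltW.
- by move=> t; rewrite (max_l (_ : 0 <= Num.max t 0))// le_max lexx orbT.
- by move=> j _; rewrite maxxx /W t00 subr0.
- exists (C + `|W r0|); first by rewrite addr_ge0.
  move=> t tt; rewrite max_l// mulrDl.
  have e1 : 1 <= expR (th0 * t) by rewrite -expR0 ler_expR mulr_ge0// ltW.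
  have [st|ts] := leP t t0.
    apply: (@le_trans _ _ `|W r0|); first by apply: Wmax; rewrite in_itv/= tt st.
    have : `|W r0| <= `|W r0| * expR (th0 * t) by rewrite ler_peMr.
    have : 0 <= C * expR (th0 * t) by rewrite mulr_ge0 ?expR_ge0.
    by lra.
  have -> : W t = y (t - t0) by rewrite /W leNgt ts.
  apply: (@le_trans _ _ (C * expR (th0 * (t - t0)))).
    by apply: yC; lra.
  apply: (@le_trans _ _ (C * expR (th0 * t))); last by rewrite lerDl mulr_ge0 ?expR_ge0.
  rewrite ler_wpM2l// ler_expR ler_wpM2l ?(ltW th00)//; lra.
Qed.

Let Y p := xget (cst 0) (backward p).

Let YP p : backward p (Y p).
Proof. exact: (xgetPex _ (backward_exists p)). Qed.

Let backwardP p y : backward p y <-> backward (P p) y.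
Proof.
by split=> -[cy dy ym yD yC]; split => // j jn; rewrite yD// PE jn.
Qed.

Let YPE p : Y (P p) = Y p.
Proof.
have h : backward p (Y (P p)) by apply/(backwardP p); exact: YP.
by apply: backward_uniq h (YP p).
Qed.

(** The graph map: what [Y p 0] has beyond its first [n] modes, which are those of [p]. *)
Definition slaving p := Y p 0 - P p.

Let slavingE p j : c j (slaving p) = if (j < n)%N then 0 else c j (Y p 0).
Proof.
rewrite /slaving (frameB fr) PE; case: ifPn => jn; last by rewrite subr0.
by have [_ _ _ -> // _] := YP p; rewrite subrr.
Qed.

Let slavingK p : P p + slaving p = Y p 0.
Proof. by rewrite /slaving addrC subrK. Qed.

Let Y_uniq p y : backward p y -> y = Y p.
Proof. by move=> hy; apply: backward_uniq hy (YP p). Qed.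

Lemma slaving_lip p q : `|slaving p - slaving q| <= `|p - q| / 4.
Proof.
rewrite -(@ler_pXn2r _ 2)// ?nnegrE ?divr_ge0//.
apply: (@le_trans _ _ (32^-1 * `|p - q| ^+ 2)); last first.
  by rewrite expr_div_n mulrC ler_wpM2l ?sqr_ge0// lef_pV2 ?posrE//; lra.
apply: (frame_norm_le fr) => [|J]; first by rewrite mulr_ge0 ?sqr_ge0// invr_ge0.
apply: le_trans (high_modes_small (YP p) (YP q) J); rewrite [leRHS]big_mkcond/=.
apply: ler_sum => j _; rewrite (frameB fr j (slaving p) (slaving q)) !slavingE.
rewrite (frameB fr j (Y p 0) (Y q 0)); case: ifP => //= _.
by rewrite subrr expr0n mulr0.
Qed.

Definition manifold : set E := range (fun p => P p + slaving p).

Lemma slaving_low p : P (slaving p) = 0.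
Proof.
apply: (frame_inj fr) => j; rewrite PE slavingE (frame0 fr).
by case: (j < n)%N.
Qed.

Lemma slaving_proj p : slaving (P p) = slaving p.
Proof. by rewrite /slaving YPE PP. Qed.

(** Forwards, [backward_extend] gives the image of a point a past of admissible growth. Backwards,
    [Y p t] lies on the manifold and reaches [Y p 0] after time [t]. *)
Lemma manifold_invariant (t : R) : 0 <= t -> S t @` manifold = manifold.
Proof.
move=> t0; apply/seteqP; split => [_ [_ [p _ <-] <-]|_ [p _ <-]].
  rewrite slavingK; have [y' hy' <-] := backward_extend t0 (YP p).
  by exists (S t (Y p 0)) => //; rewrite slavingK -(Y_uniq hy').
rewrite slavingK; exists (Y p t); last first.
  by rewrite (S_backward (YP p) t0 (lexx t)) subrr.
exists (Y p t) => //; rewrite slavingK -(Y_uniq (backward_shift t0 (YP p))).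
by rewrite maxxx addr0.
Qed.

(** The tracking trajectory is sought as [v + z] with [z] decaying like [exp (- th0 t)]. Decay
    leaves the high modes of [z 0] free, and they are used to put [v0 + z 0] on the graph. *)
Lemma manifold_tracking v0 : exists2 w0, manifold w0 & forall t : R, 0 <= t ->
  `|S t v0 - S t w0| <= 2 * `|v0 - w0| * expR (- th0 * t).
Proof.
pose v (t : R) := S (Num.max t 0) v0.
have [cS dS] := S_forward v0.
have cm : continuous (fun t : R => Num.max t 0).
  by move=> t; apply: continuous_max; [exact: cvg_id|exact: cvg_cst].
have cv : continuous v by move=> t; exact: (continuous_comp (cm t) (cS _)).
have g0 j : gam + w j / (2 * nu j) <= `|lam j - th0| by have := gap j; move: gam0; lra.
have gr (b : R) : exists J0, forall j, (J0 <= j)%N -> b <= `|lam j - th0|.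
  have [J0 hJ0] := growth (b + th0); exists J0 => j /hJ0 h.
  by apply: le_trans (ler_norm _); lra.
have hi j : (th0 < lam j) = ~~ (j < n)%N.
  rewrite -lamn -leNgt le_eqVlt; case: eqP => //= e.
  by have := gap j; rewrite -e subrr normr0 leNgt addr_gt0// mulr_gt0.
(* The data ask that the high modes of [v0 + z 0] be those of [slaving (v0 + z 0)]. Their squared
   Lipschitz constant 1/16 comes from [slaving_lip], and [2 * l2 / gam] is at most 1/32, so the sum
   stays below 1/4. *)
have [|||||||z [cz dz zm zD [C C0 zC]]] := @semilinear_problem R E c w fr lam nu th0 gam nu0 gam0 g0 gr
  (fun t a j => N (v t + a) j - N (v t) j) (fun a j => c j (slaving (v0 + a) - v0)) l2 16^-1 0
  (`|slaving v0 - v0| ^+ 2) l20 _ (lexx _) _.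
- by rewrite invr_ge0.
- have : 2 * l2 / gam <= 32^-1 by rewrite ler_pdivrMr//; move: small; lra.
  by lra.
- move=> y cy j t; apply: cvgB.
    apply: (@nonlinearity_continuous (fun t => v t + y t)).
    by move=> s; apply: cvgD; [exact: cv|exact: cy].
  exact: nonlinearity_continuous.
- move=> t a a' J _.
  have -> : a - a' = (v t + a) - (v t + a') by rewrite opprD addrACA subrr add0r.
  apply: le_trans (N_nu _ _ J); rewrite le_eqVlt; apply/orP; left; apply/eqP.
  by apply: eq_bigr => j _; ring.
- move=> t J _; rewrite mul0r big1// => j _.
  by rewrite addr0 subrr expr0n mulr0.
- move=> a a' J.
  apply: (@le_trans _ _ (`|slaving (v0 + a) - slaving (v0 + a')| ^+ 2)).
    apply: le_trans (frame_bessel fr _ J); rewrite big_mkcond/=; apply: ler_sum => j _.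
    case: ifP => _; last by rewrite mulr_ge0 ?sqr_ge0// ltW.
    rewrite -(frameB fr); have -> : slaving (v0 + a) - v0 - (slaving (v0 + a') - v0) =
      slaving (v0 + a) - slaving (v0 + a') by rewrite opprB addrA subrK.
    by [].
  have := slaving_lip (v0 + a) (v0 + a').
  have -> : (v0 + a) - (v0 + a') = a - a' by rewrite opprD addrACA subrr add0r.
  rewrite -(@ler_pXn2r _ 2)// ?nnegrE ?divr_ge0// expr_div_n => h; apply: le_trans h _.
  by rewrite mulrC ler_wpM2r ?sqr_ge0// lef_pV2 ?posrE//; lra.
- move=> J; rewrite addr0; apply: le_trans (frame_bessel fr _ J).
  by apply: (@le_bigsum_cond R (fun j => th0 < lam j) J
    (fun j => w j * c j (slaving v0 - v0) ^+ 2)) => j; rewrite mulr_ge0 ?sqr_ge0// ltW.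
pose W t := v t + z t.
have v00 : v 0 = v0 by rewrite /v maxxx S0.
have fW : forward W.
  split; first by move=> t; apply: cvgD; [exact: cv|exact: cz].
  move=> j t t0.
  have dv : is_derive t 1 (c j \o v) (- lam j * c j (v t) + N (v t) j).
    rewrite /v (max_l (ltW t0)); apply: near_eq_is_derive (dS j t t0).
    by apply: filterS (lt_nbhsr t0) => s s0; rewrite /= /v max_l// ltW.
  have -> : c j \o W = (c j \o v) + (c j \o z).
    by apply/funext => s /=; rewrite /W (frameD fr).
  apply: (is_derive_eq (is_deriveD dv (dz j t t0))).
  by rewrite /W (frameD fr); ring.
have SW t : 0 <= t -> S t (W 0) = W t.
  by move=> t0; apply: (forward_uniq (S_forward _) fW) => //; rewrite S0.
have W0 : P (W 0) + slaving (W 0) = W 0.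
  apply: (frame_inj fr) => j; rewrite (frameD fr) PE.
  case: ifPn => jn; first by rewrite slavingE jn addr0.
  have := zD j; rewrite hi jn => /(_ isT).
  rewrite add0r /W v00 (frameD fr j v0) (frameB fr j (slaving _) v0) => ->; ring.
exists (W 0); first by exists (W 0).
move=> t t0; rewrite SW//.
have -> : S t v0 - W t = - z t by rewrite /W /v max_l// opprD addrA subrr add0r.
have -> : v0 - W 0 = - z 0 by rewrite /W v00 opprD addrA subrr add0r.
rewrite !normrN.
apply/(weighted_sqr th0 z); first by rewrite mulr_ge0.
have := @stability_estimate R E c w fr lam nu th0 gam nu0 gam0 g0 z
  (fun j t => N (v t + z t) j - N (v t) j) C (`|z 0| ^+ 2) 0 l2 0 (lexx _) (sqr_ge0 _) l20 (lexx _)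
  _ cz dz zC _ _ t t0.
rewrite mulr0 mul0r addr0 => h; apply: le_trans (h _ _ _) _.
- by rewrite ler_pdivrMr//; move: gam0 small; lra.
- move=> J s s0; rewrite mul0r addr0; apply: (@le_trans _ _ (l2 * `|z s| ^+ 2)).
    apply: le_trans (N_nu _ _ J) _.
    by rewrite addrC addKr.
  by rewrite -mulrA ler_peMl ?mulr_ge0 ?sqr_ge0// ler1n.
- move=> J; rewrite mul0r addr0; apply: le_trans (frame_bessel fr _ J).
  by apply: (@le_bigsum_cond R (fun j => th0 < lam j) J
    (fun j => w j * c j (z 0) ^+ 2)) => j; rewrite mulr_ge0 ?sqr_ge0// ltW.
rewrite exprMn; have : 0 <= `|z 0| ^+ 2 * expR (- (2 * th0) * t).
  by rewrite mulr_ge0 ?sqr_ge0 ?expR_ge0.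
by lra.
Qed.

Let DN_continuous (u y : R -> E) j : continuous u -> continuous y ->
  continuous (fun t => DN (u t) (y t) j).
Proof.
move=> cu cy t; apply/cvgrPdist_le => /= e e0.
pose A := Num.sqrt (54 * C2) * `|y t| + 1; pose B := Num.sqrt Lp + 1.
have A0 : 0 < A by rewrite ltr_wpDl// mulr_ge0// sqrtr_ge0.
have B1 : 0 < B by rewrite ltr_wpDl// sqrtr_ge0.
have one (F : nat -> R) (x : R) : 0 <= x -> \sum_(i < j.+1) F i ^+ 2 <= x ^+ 2 -> `|F j| <= x.
  move=> x0; rewrite big_ord_recr/= => h.
  rewrite -(@ler_pXn2r _ 2)// ?nnegrE// real_normK ?num_real//.
  by apply: le_trans h; rewrite lerDr sumr_ge0// => i _; rewrite sqr_ge0.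
near=> s.
have -> : DN (u t) (y t) j - DN (u s) (y s) j =
  (DN (u t) (y t) j - DN (u s) (y t) j) + DN (u s) (y t - y s) j by rewrite DNB; ring.
have e2 : e = e / 2 + e / 2 by field.
rewrite e2; apply: le_trans (ler_normD _ _) _; apply: lerD.
  apply: (@le_trans _ _ (A * `|u t - u s|)).
    apply: (@le_trans _ _ (Num.sqrt (54 * C2) * `|y t| * `|u t - u s|)); last first.
      by rewrite ler_wpM2r// lerDl.
    apply: (one (fun j => DN (u t) (y t) j - DN (u s) (y t) j)).
      by rewrite !mulr_ge0 ?sqrtr_ge0.
    apply: le_trans (derivative_lipschitz _ _ _ _) _.
    rewrite !exprMn sqr_sqrtr; last by rewrite mulr_ge0.
    by rewrite le_eqVlt; apply/orP; left; apply/eqP; ring.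
  rewrite -ler_pdivlMl// mulrC; near: s; move: (cu t) => /cvgrPdist_le; apply.
  by rewrite !divr_gt0.
apply: (@le_trans _ _ (B * `|y t - y s|)).
  apply: (@le_trans _ _ (Num.sqrt Lp * `|y t - y s|)); last by rewrite ler_wpM2r// lerDl.
  apply: (one (fun j => DN (u s) (y t - y s) j)); first by rewrite mulr_ge0 ?sqrtr_ge0.
  by rewrite exprMn sqr_sqrtr//; exact: DN_le.
rewrite -ler_pdivlMl// mulrC; near: s; move: (cy t) => /cvgrPdist_le; apply.
by rewrite !divr_gt0.
Unshelve. all: by end_near. Qed.

Let linearized p h z := [/\ continuous z,
  modal_solution c (fun j => - lam j) z (fun j t => - DN (Y p t) (z t) j),
  forall t, z t = z (Num.max t 0), forall j, (j < n)%N -> c j (z 0) = c j h &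
  exists2 C, 0 <= C & forall t : R, 0 <= t -> `|z t| <= C * expR (th0 * t)].

Let linearized_exists p h : exists z, linearized p h z.
Proof.
have [cY _ _ _ _] := YP p.
apply: (@reversed_problem (fun t a j => - DN (Y p t) a j) h 0) => //.
- by move=> y cy j t; apply: cvgN; exact: DN_continuous.
- move=> t u v J _; apply: le_trans (DN_nu (Y p t) (u - v) J).
  by apply: ler_sum => j _; rewrite -opprD sqrrN -DNB.
- by move=> t J _; rewrite mul0r big1// => j _; rewrite DN0 oppr0 expr0n mulr0.
Qed.

Let linearized_le p h z : linearized p h z ->
  forall t : R, 0 <= t -> `|z t| ^+ 2 <= 2 * `|h| ^+ 2 * expR (2 * th0 * t).
Proof.
move=> [cz dz zm zD [C C0 zC]] t t0.
have := @stab th0 z _ C (`|h| ^+ 2) 0 window0 (lexx _) (sqr_ge0 _) cz dz zC.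
rewrite mulr0 mul0r addr0; apply => //.
- move=> J s s0; rewrite mul0r addr0.
  apply: (@le_trans _ _ (l2 * `|z s| ^+ 2)).
    by under eq_bigr do rewrite sqrrN; exact: DN_nu.
  by rewrite -mulrA ler_peMl ?mulr_ge0 ?sqr_ge0// ler1n.
- by move=> J; under eq_bigr => j jn do rewrite zD//; exact: low_le.
Qed.

Let linearized_lin p a h h' z z' : linearized p h z -> linearized p h' z' ->
  linearized p (a *: h + h') (fun t => a *: z t + z' t).
Proof.
move=> [cz dz zm zD [C C0 zC]] [cz' dz' zm' zD' [C' C0' zC']]; split.
- by move=> t; apply: cvgD; [apply: cvgZr; exact: cz|exact: cz'].
- move=> j t t0.
  have -> : c j \o (fun t => a *: z t + z' t) = a *: (c j \o z) + (c j \o z').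
    by apply/funext => s /=; rewrite (frame_linear fr).
  apply: (is_derive_eq (is_deriveD (is_deriveZ a (dz j t t0)) (dz' j t t0))).
  by rewrite (frame_linear fr) DN_lin /GRing.scale/=; ring.
- by move=> t; rewrite zm zm'.
- by move=> j jn; rewrite !(frame_linear fr) zD// zD'.
- exists (`|a| * C + C'); first by rewrite addr_ge0// mulr_ge0.
  move=> t t0; apply: le_trans (ler_normD _ _) _; rewrite normrZ mulrDl.
  by apply: lerD; [rewrite -mulrA ler_wpM2l// zC|exact: zC'].
Qed.

Let linearized_uniq p h z z' : linearized p h z -> linearized p h z' -> z = z'.
Proof.
move=> hz hz'; apply/funext => t.
have -> : z t = z (Num.max t 0) by case: hz.
have -> : z' t = z' (Num.max t 0) by case: hz'.
have m0 : 0 <= Num.max t 0 by rewrite le_max lexx orbT.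
have := linearized_le (linearized_lin (-1) hz hz') m0.
rewrite !scaleN1r addNr normr0 expr0n mulr0 mul0r => h0.
apply/eqP; rewrite eq_sym -subr_eq0 addrC -normr_eq0 -sqrf_eq0.
by rewrite eq_le h0 sqr_ge0.
Qed.

Let Z p h := xget (cst 0) (linearized p h).

Let ZP p h : linearized p h (Z p h).
Proof. exact: (xgetPex _ (linearized_exists p h)). Qed.

(** The candidate for the derivative of [slaving] at [p] in the direction [h], read off at time 0
    from the past linearised along [Y p]. *)
Definition dslaving p h := Z p h 0 - P h.

Lemma dslaving_lin p a h h' : dslaving p (a *: h + h') = a *: dslaving p h + dslaving p h'.
Proof.
rewrite /dslaving (linearized_uniq (ZP _ _) (linearized_lin a (ZP p h) (ZP p h'))) P_lin.
by rewrite scalerBr opprD addrACA.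
Qed.

Lemma dslaving_le p h : `|dslaving p h| <= 3 * `|h|.
Proof.
have := linearized_le (ZP p h) (lexx 0).
rewrite mulr0 expR0 mulr1 => h1.
have h2 : `|Z p h 0| <= 2 * `|h|.
  rewrite -(@ler_pXn2r _ 2)// ?nnegrE ?mulr_ge0//; apply: le_trans h1 _.
  by rewrite exprMn; have := sqr_ge0 `|h|; lra.
by apply: le_trans (ler_normB _ _) _; have := P_le h; lra.
Qed.

(** The squared distance of two pasts grows like [exp (2 th0 t)]. Its power [eps] grows like
    [exp (2 gam t)], exactly what raising the weight from [th0] to the end [th0 + gam] of the window
    can absorb. *)
Definition smoothness_exponent : R := gam / th0.

Local Notation eps := smoothness_exponent.

Lemma smoothness_exponent_gt0 : 0 < eps.
Proof. by rewrite divr_gt0. Qed.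

Let window1 : window (th0 + gam).
Proof. by rewrite /window addrAC subrr add0r ger0_norm// ltW. Qed.

(* Interpolation between the bounds [x <= A X Q] and [x <= B Q]. *)
Let interpolate (A B X Q x : R) : 0 <= A -> 0 <= B -> 0 <= X -> 0 <= Q ->
  x <= A * X * Q -> x <= B * Q -> x <= (A + B) * X `^ eps * Q.
Proof.
move=> A0 B1 X0 Q0 h1 h2; have e0 := smoothness_exponent_gt0.
have e1 : eps <= 1 by rewrite /eps ler_pdivrMr ?mul1r.
have [X1|X1] := leP 1 X.
  apply: le_trans h2 _; rewrite ler_wpM2r// mulrDl.
  have p1 : 1 <= X `^ eps by rewrite -(powRr0 X) ler_powR// ltW.
  apply: (@le_trans _ _ (B * X `^ eps)); first by rewrite ler_peMr.
  by rewrite lerDr mulr_ge0// powR_ge0.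
move: X0; rewrite le_eqVlt => /predU1P[X0|X0].
  apply: le_trans h1 _; rewrite -X0 mulr0 mul0r; apply: mulr_ge0 => //.
  by apply: mulr_ge0; [exact: addr_ge0|exact: powR_ge0].
apply: le_trans h1 _; rewrite ler_wpM2r// mulrDl.
have p1 : X <= X `^ eps by rewrite -{1}(powRr1 (ltW X0)) ger_powR// X0 ltW.
apply: (@le_trans _ _ (A * X `^ eps)); first by rewrite ler_wpM2l.
by rewrite lerDl mulr_ge0// powR_ge0.
Qed.

Let powR_exp (d t : R) : 0 <= d ->
  (2 * d ^+ 2 * expR (2 * th0 * t)) `^ eps = 2 `^ eps * (d `^ eps) ^+ 2 * expR (2 * gam * t).
Proof.
move=> d0; rewrite powRM ?mulr_ge0 ?expR_ge0 ?sqr_ge0// powRM// ?sqr_ge0//.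
congr (_ * _ * _); last first.
  by rewrite -expRM; congr expR; rewrite /eps; field; rewrite gt_eqF.
by rewrite -(powR_mulrn 2 d0) -powRrM mulrC powRrM powR_mulrn ?powR_ge0.
Qed.

Let sqr_le (x y : R) : 0 <= x -> 0 <= y -> x ^+ 2 <= y ^+ 2 -> x <= y.
Proof. by move=> x0 y0; rewrite ler_pXn2r. Qed.

(** The square of [2 * Csm] has to dominate [4 * b / gam], the outcome of [stab] for the
    interpolated forcing bound [b] of [smooth_stab]. The numerical factors are generous. *)
Let Csm := Num.sqrt (8 / gam * (54 * C2 * K * 2 + 4 * l2) * 2 `^ eps).

Let Csm_sqr : Csm ^+ 2 = 8 / gam * (54 * C2 * K * 2 + 4 * l2) * 2 `^ eps.
Proof.
rewrite sqr_sqrtr// mulr_ge0 ?powR_ge0// mulr_ge0 ?divr_ge0 ?(ltW gam0)//.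
by rewrite addr_ge0 ?mulr_ge0.
Qed.

(* Both smoothness estimates: the inhomogeneity lies in the weight [th0 + gam]. *)
Let smooth_stab z (e : nat -> R -> R) u C (d Q : R) : 0 <= d -> 0 <= Q -> continuous z ->
  modal_solution c (fun j => - lam j) z (fun j t => - (DN (u t) (z t) j + e j t)) ->
  (forall t : R, 0 <= t -> `|z t| <= C * expR (th0 * t)) ->
  (forall j, (j < n)%N -> c j (z 0) = 0) ->
  (forall J (t : R), 0 <= t -> \sum_(j < J) nu j * e j t ^+ 2 <=
    (54 * C2 * K * 2) * (2 * d ^+ 2 * expR (2 * th0 * t)) * (Q ^+ 2 * expR (2 * th0 * t))) ->
  (forall J (t : R), 0 <= t -> \sum_(j < J) nu j * e j t ^+ 2 <=
    (4 * l2) * 2 * (Q ^+ 2 * expR (2 * th0 * t))) ->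
  `|z 0| <= 2 * Csm * d `^ eps * Q.
Proof.
move=> d0 Q0 cz dz zC zD e1 e2.
pose A := 54 * C2 * K * 2; pose B := 4 * l2 * 2.
have A0 : 0 <= A by rewrite !mulr_ge0.
have B1 : 0 <= B by rewrite !mulr_ge0.
pose b := (A + B) * (2 `^ eps * (d `^ eps) ^+ 2) * Q ^+ 2.
have b0 : 0 <= b.
  by rewrite mulr_ge0 ?sqr_ge0// mulr_ge0 ?addr_ge0// mulr_ge0 ?powR_ge0 ?sqr_ge0.
have C0 : 0 <= C.
  by have := zC 0 (lexx _); rewrite mulr0 expR0 mulr1; apply: le_trans.
have := @stab (th0 + gam) z _ C 0 b window1 b0 (lexx _) cz dz.
rewrite add0r => H.
have {H} : `|z 0| ^+ 2 <= 2 * (2 * b / gam) * expR (2 * (th0 + gam) * 0).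
  apply: H => //.
  - move=> t t0; apply: le_trans (zC t t0) _; rewrite ler_wpM2l// ler_expR.
    by rewrite ler_wpM2r// lerDl ltW.
  - move=> J t t0.
    apply: (@le_trans _ _ (2 * \sum_(j < J) nu j * DN (u t) (z t) j ^+ 2 +
        2 * \sum_(j < J) nu j * e j t ^+ 2)).
      rewrite !mulr_sumr -big_split/=; apply: ler_sum => j _.
      rewrite -subr_ge0; set X := DN _ _ _; set Y' := e j t.
      have -> : 2 * (nu j * X ^+ 2) + 2 * (nu j * Y' ^+ 2) - nu j * (- (X + Y')) ^+ 2 =
        nu j * (X - Y') ^+ 2 by ring.
      by rewrite mulr_ge0 ?sqr_ge0// ltW.
    apply: lerD.
      by rewrite -[leRHS]mulrA ler_pM2l//; exact: DN_nu.
    rewrite -[leRHS]mulrA ler_pM2l//.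
    have X0 : 0 <= 2 * d ^+ 2 * expR (2 * th0 * t).
      by rewrite !mulr_ge0 ?sqr_ge0 ?expR_ge0.
    have Q1 : 0 <= Q ^+ 2 * expR (2 * th0 * t) by rewrite mulr_ge0 ?sqr_ge0 ?expR_ge0.
    have := interpolate A0 B1 X0 Q1 (e1 J t t0) (e2 J t t0).
    rewrite powR_exp// => h; apply: le_trans h _.
    have -> : expR (2 * (th0 + gam) * t) = expR (2 * th0 * t) * expR (2 * gam * t).
      by rewrite -expRD; congr expR; ring.
    by rewrite /b le_eqVlt; apply/orP; left; apply/eqP; ring.
  - by move=> J; rewrite big1// => j jn; rewrite zD// expr0n mulr0.
rewrite mulr0 expR0 mulr1 => h.
have c0 : 0 <= Csm by exact: sqrtr_ge0.
apply: sqr_le => //; first by rewrite !mulr_ge0 ?powR_ge0.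
rewrite !exprMn Csm_sqr; apply: le_trans h _.
rewrite -subr_ge0.
have -> : 2 ^+ 2 * (8 / gam * (54 * C2 * K * 2 + 4 * l2) * 2 `^ eps) * (d `^ eps) ^+ 2 * Q ^+ 2
    - 2 * (2 * b / gam) =
  (28 * A + 96 * l2) / gam * (2 `^ eps * (d `^ eps) ^+ 2 * Q ^+ 2).
  by rewrite /b /A /B; field; rewrite gt_eqF.
apply: mulr_ge0; first by rewrite divr_ge0 ?(ltW gam0)// addr_ge0// mulr_ge0.
apply: mulr_ge0; last exact: sqr_ge0.
by apply: mulr_ge0; [exact: powR_ge0|exact: sqr_ge0].
Qed.

(** [Y q - Y p - Z p (q - p)] solves the equation linearised along [Y p], has no low modes at 0, and
    is forced by the Taylor remainder [e] of [N]. By [quad] this [e] is quadratic in [Y q - Y p]; by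
    the weighted Lipschitz bounds it is also at most linear. [smooth_stab] interpolates between the
    two. *)
Lemma slaving_differentiable p q :
  `|slaving q - slaving p - dslaving p (q - p)| <=
    2 * Csm * `|q - p| `^ eps * `|q - p|.
Proof.
have [cp dp pm pD [Cp Cp0 pC]] := YP p; have [cq dq qm qD [Cq Cq0 qC]] := YP q.
have [cz dz zm zD [Cz Cz0 zC]] := ZP p (q - p).
pose z t := Y q t - Y p t - Z p (q - p) t.
pose e j t := N (Y q t) j - N (Y p t) j - DN (Y p t) (Y q t - Y p t) j.
have -> : slaving q - slaving p - dslaving p (q - p) = z 0.
  rewrite /slaving /dslaving /z.
  have -> : P (q - p) = P q - P p by rewrite -scaleN1r addrC P_lin scaleN1r addrC.
  by apply: (frame_inj fr) => j; rewrite !(frameB fr); ring.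
have dist t (t0 : 0 <= t) := backward_lip (YP q) (YP p) t0.
apply: (@smooth_stab z e (Y p) (Cq + Cp + Cz) `|q - p| `|q - p|) => //.
- by move=> t; apply: cvgB; [apply: cvgB; [exact: cq|exact: cp]|exact: cz].
- move=> j t t0; have H := sub_modal (sub_modal dq dp) dz j t0.
  by apply: (is_derive_eq H); rewrite /z /e !DNB; ring.
- by apply: sub_weighted => //; exact: sub_weighted.
- by move=> j jn; rewrite /z !(frameB fr) qD// pD// zD// (frameB fr) subrr.
- move=> J t t0; apply: le_trans (nu_sum_le (e^~ t) J) _.
  apply: (@le_trans _ _ (K * (C2 * (`|Y q t - Y p t| ^+ 2) ^+ 2))).
    by rewrite ler_wpM2l// -exprM; exact: quad.
  set X := `|q - p| ^+ 2; set ex := expR (2 * th0 * t).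
  have := dist t t0; rewrite -/X -/ex => h.
  have h2 : (`|Y q t - Y p t| ^+ 2) ^+ 2 <= (2 * X * ex) ^+ 2.
    by rewrite ler_pXn2r// ?nnegrE ?mulr_ge0 ?sqr_ge0 ?expR_ge0.
  apply: (@le_trans _ _ (K * (C2 * (2 * X * ex) ^+ 2))).
    by rewrite ler_wpM2l// ler_wpM2l.
  have p0 : 0 <= K * C2 * (X * ex) ^+ 2.
    by apply: mulr_ge0; [exact: mulr_ge0|exact: sqr_ge0].
  rewrite -subr_ge0.
  have -> : 54 * C2 * K * 2 * (2 * X * ex) * (X * ex) - K * (C2 * (2 * X * ex) ^+ 2) =
    212 * (K * C2 * (X * ex) ^+ 2) by ring.
  by rewrite mulr_ge0.
- move=> J t t0; apply: (@le_trans _ _ (4 * l2 * `|Y q t - Y p t| ^+ 2)); last first.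
    by rewrite -[leRHS]mulrA ler_wpM2l ?mulr_ge0// mulrA dist.
  apply: (@le_trans _ _ (2 * \sum_(j < J) nu j * (N (Y q t) j - N (Y p t) j) ^+ 2 +
        2 * \sum_(j < J) nu j * DN (Y p t) (Y q t - Y p t) j ^+ 2)).
    rewrite !mulr_sumr -big_split/=; apply: ler_sum => j _.
    rewrite -subr_ge0 /e; set A := N _ _; set A' := N _ _; set B := DN _ _ _.
    have -> : 2 * (nu j * (A - A') ^+ 2) + 2 * (nu j * B ^+ 2) - nu j * (A - A' - B) ^+ 2 =
        nu j * (A - A' + B) ^+ 2 by ring.
    by rewrite mulr_ge0 ?sqr_ge0// ltW.
  by have := N_nu (Y q t) (Y p t) J; have := DN_nu (Y p t) (Y q t - Y p t) J; lra.
Qed.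

(** The difference of the linearised pasts is forced by [DN (Y p) - DN (Y q)] applied to [Z q h].
    This is small by [derivative_lipschitz] and bounded by [DN_nu], and [smooth_stab] interpolates
    again. *)
Lemma dslaving_holder p q h :
  `|dslaving p h - dslaving q h| <= 2 * Csm * `|p - q| `^ eps * `|h|.
Proof.
have [cp dp pm pD [Cp Cp0 pC]] := ZP p h; have [cq dq qm qD [Cq Cq0 qC]] := ZP q h.
pose z t := Z p h t - Z q h t.
pose e j t := DN (Y p t) (Z q h t) j - DN (Y q t) (Z q h t) j.
have -> : dslaving p h - dslaving q h = z 0.
  by apply: (frame_inj fr) => j; rewrite /dslaving /z !(frameB fr); ring.
have dist t (t0 : 0 <= t) := backward_lip (YP p) (YP q) t0.
have Zle t (t0 : 0 <= t) := linearized_le (ZP q h) t0.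
apply: (@smooth_stab z e (Y p) (Cp + Cq) `|p - q| `|h|) => //.
- by move=> t; apply: cvgB; [exact: cp|exact: cq].
- move=> j t t0; have H := sub_modal dp dq j t0.
  by apply: (is_derive_eq H); rewrite /z /e !DNB; ring.
- exact: sub_weighted.
- by move=> j jn; rewrite /z !(frameB fr) pD// qD// subrr.
- move=> J t t0; apply: le_trans (nu_sum_le (e^~ t) J) _.
  apply: (@le_trans _ _ (K * (54 * C2 * `|Y p t - Y q t| ^+ 2 * `|Z q h t| ^+ 2))).
    by rewrite ler_wpM2l//; exact: derivative_lipschitz.
  have -> : 54 * C2 * K * 2 * (2 * `|p - q| ^+ 2 * expR (2 * th0 * t)) *
     (`|h| ^+ 2 * expR (2 * th0 * t)) =
    K * (54 * C2 * (2 * `|p - q| ^+ 2 * expR (2 * th0 * t)) *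
     (2 * `|h| ^+ 2 * expR (2 * th0 * t))) by ring.
  rewrite ler_wpM2l//; apply: ler_pM; rewrite ?mulr_ge0 ?sqr_ge0//.
    by rewrite ler_wpM2l ?mulr_ge0// dist.
  exact: Zle.
- move=> J t t0; apply: (@le_trans _ _ (4 * l2 * `|Z q h t| ^+ 2)); last first.
    by rewrite -[leRHS]mulrA ler_wpM2l ?mulr_ge0// mulrA Zle.
  apply: (@le_trans _ _ (2 * \sum_(j < J) nu j * DN (Y p t) (Z q h t) j ^+ 2 +
        2 * \sum_(j < J) nu j * DN (Y q t) (Z q h t) j ^+ 2)).
    rewrite !mulr_sumr -big_split/=; apply: ler_sum => j _.
    rewrite -subr_ge0 /e; set A := DN _ _ _; set B := DN _ _ _.
    have -> : 2 * (nu j * A ^+ 2) + 2 * (nu j * B ^+ 2) - nu j * (A - B) ^+ 2 =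
        nu j * (A + B) ^+ 2 by ring.
    by rewrite mulr_ge0 ?sqr_ge0// ltW.
  by have := DN_nu (Y p t) (Z q h t) J; have := DN_nu (Y q t) (Z q h t) J; lra.
Qed.

Theorem abstract_inertial_manifold : exists (M : E -> E) (DM : E -> E -> E) (eps C : R),
  [/\ 0 < eps, forall p, P (M p) = 0, forall p, M (P p) = M p &
      forall p q, `|M p - M q| <= `|p - q|] /\
  [/\ forall p a h h', DM p (a *: h + h') = a *: DM p h + DM p h',
      forall p h, `|DM p h| <= 3 * `|h|,
      forall p q, `|M q - M p - DM p (q - p)| <= C * `|q - p| `^ eps * `|q - p| &
      forall p q h, `|DM p h - DM q h| <= C * `|p - q| `^ eps * `|h|] /\
  (forall t, 0 <= t -> S t @` range (fun p => P p + M p) = range (fun p => P p + M p)) /\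
  (forall v0, exists2 w0, range (fun p => P p + M p) w0 & forall t, 0 <= t ->
      `|S t v0 - S t w0| <= 2 * `|v0 - w0| * expR (- th0 * t)).
Proof.
exists slaving, dslaving, smoothness_exponent, (2 * Csm); repeat split.
- exact: smoothness_exponent_gt0.
- exact: slaving_low.
- exact: slaving_proj.
- by move=> p q; apply: le_trans (slaving_lip p q) _; have := normr_ge0 (p - q); lra.
- exact: dslaving_lin.
- exact: dslaving_le.
- exact: slaving_differentiable.
- exact: dslaving_holder.
- exact: manifold_invariant.
- exact: manifold_tracking.
Qed.

End InertialManifold.

(** * Sine series in L^2 and H^1_0 *)

Section ScalarL2.
Context {R : realType} {L : R}.
Local Notation mu := (@lebesgue_measure R).
Local Notation "`I" := (`[0, L]%classic : set R).
Implicit Types (h : R -> R).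

Definition ip h (k : R -> R) : R := \int[mu]_(x in `[0, L]) (h x * k x).

Let mI : measurable (`I : set (measurableTypeR R)).
Proof. by []. Qed.

Lemma L2_of_integrable_sqr h : measurable_fun `I h ->
  mu.-integrable `I (EFin \o (fun x => h x * h x)) -> L2 L h.
Proof.
move=> mh ih; rewrite /L2 inE; apply/andP; split.
  by rewrite inE/=; exact/(measurable_restrictT _ _).1.
rewrite inE/= /finite_norm unlock; apply: poweR_lty.
have /integrableP[_] : mu.-integrable setT (EFin \o ((fun x => h x * h x) \_ `I)).
  move: ih; rewrite integrable_mkcond//; congr (mu.-integrable _ _).
  by apply/funext => x /=; rewrite !patchE; case: ifP.
apply: le_lt_trans; rewrite le_eqVlt; apply/orP; left; apply/eqP; apply: eq_integral => x _ /=.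
rewrite powR_mulrn// !patchE; case: ifP => _.
  by rewrite normrM expr2.
by rewrite normr0 expr0n.
Qed.

Lemma L2_dominated h k : measurable_fun `I h -> L2 L k ->
  (forall x, `I x -> `|h x| <= k x) -> L2 L h.
Proof.
move=> mh Lk hk; apply: L2_of_integrable_sqr => //.
apply: le_integrable (L2_integrableM Lk Lk) => //.
  by apply/measurable_EFinP; exact: measurable_funM.
move=> x Ix /=; rewrite lee_fin !normrM ler_pM//; by apply: le_trans (hk x Ix) (ler_norm _).
Qed.

Lemma continuous_L2 h : {within `I, continuous h} -> L2 L h.
Proof.
move=> ch; apply: L2_of_integrable_sqr.
  exact: subspace_continuous_measurable_fun.
apply: continuous_compact_integrable; first exact: segment_compact.
by move=> x; apply: cvgM; exact: ch.
Qed.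

Lemma L2_cst (C : R) : L2 L (fun=> C).
Proof. by apply: continuous_L2; apply: continuous_subspaceT => x; exact: cvg_cst. Qed.

Lemma L2D h k : L2 L h -> L2 L k -> L2 L (fun x => h x + k x).
Proof.
move=> Lh Lk; have := L2_lin 1 Lh Lk; congr (L2 L _).
by apply/funext => x; rewrite mul1r.
Qed.

Lemma L2Z (a : R) h : L2 L h -> L2 L (fun x => a * h x).
Proof.
move=> Lh; have := L2_lin a Lh (L2_0 L); congr (L2 L _).
by apply/funext => x; rewrite addr0.
Qed.

Lemma L2N h : L2 L h -> L2 L (fun x => - h x).
Proof.
move=> Lh; have := L2Z (-1) Lh; congr (L2 L _).
by apply/funext => x; rewrite mulN1r.
Qed.

Lemma L2B h k : L2 L h -> L2 L k -> L2 L (fun x => h x - k x).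
Proof. by move=> Lh Lk; apply: L2D => //; exact: L2N. Qed.

Lemma L2_norm h : L2 L h -> L2 L (fun x => `|h x|).
Proof.
move=> Lh; apply: L2_of_integrable_sqr.
  by apply: measurableT_comp => //; exact: L2_measurable.
have := L2_integrableM Lh Lh; congr (mu.-integrable _ _).
by apply/funext => x /=; rewrite -normrM ger0_norm// -expr2 sqr_ge0.
Qed.

Lemma L2M_bounded h k (C : R) : measurable_fun `I h -> (forall x, `I x -> `|h x| <= C) ->
  L2 L k -> L2 L (fun x => h x * k x).
Proof.
move=> mh hC Lk; apply: (@L2_dominated _ (fun x => C * `|k x|)).
- by apply: measurable_funM => //; exact: L2_measurable.
- by apply: L2Z; exact: L2_norm.
- by move=> x Ix; rewrite normrM ler_wpM2r// hC.
Qed.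

Lemma ipC h k : ip h k = ip k h.
Proof. by apply: eq_Rintegral => x _; rewrite mulrC. Qed.

Lemma ip_lin (a : R) h1 h2 k : L2 L h1 -> L2 L h2 -> L2 L k ->
  ip (fun x => a * h1 x + h2 x) k = a * ip h1 k + ip h2 k.
Proof.
move=> L1 L2' Lk; rewrite /ip.
have i1 := L2_integrableM L1 Lk; have i2 := L2_integrableM L2' Lk.
under eq_Rintegral do rewrite mulrDl -mulrA.
rewrite RintegralD//; first by rewrite RintegralZl.
by have := integrableZl mI a i1.
Qed.

Lemma ip0l k : ip (fun=> 0) k = 0.
Proof.
rewrite /ip; under eq_Rintegral do rewrite mul0r.
by rewrite Rintegral_cst// mul0r.
Qed.

Lemma ipD h1 h2 k : L2 L h1 -> L2 L h2 -> L2 L k ->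
  ip (fun x => h1 x + h2 x) k = ip h1 k + ip h2 k.
Proof.
move=> L1 L2' Lk; rewrite -[ip h1 k]mul1r -ip_lin//.
by apply: eq_Rintegral => x _; rewrite mul1r.
Qed.

Lemma ipZ (a : R) h k : L2 L h -> L2 L k -> ip (fun x => a * h x) k = a * ip h k.
Proof.
move=> L1 Lk; rewrite -[RHS]addr0 -(ip0l k) -ip_lin//; last exact: L2_0.
by apply: eq_Rintegral => x _; rewrite addr0.
Qed.

Lemma ipB h1 h2 k : L2 L h1 -> L2 L h2 -> L2 L k ->
  ip (fun x => h1 x - h2 x) k = ip h1 k - ip h2 k.
Proof.
move=> L1 L2' Lk; have Ln := L2N L2'; rewrite ipD//; congr (_ + _).
rewrite -mulN1r -ipZ//; by apply: eq_Rintegral => x _; rewrite mulN1r.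
Qed.

Lemma ip_ge0 h : 0 <= ip h h.
Proof. by apply: Rintegral_ge0 => x _; rewrite -expr2 sqr_ge0. Qed.

Lemma ip_sqrD (a : R) h k : L2 L h -> L2 L k ->
  ip (fun x => a * h x + k x) (fun x => a * h x + k x) =
    a ^+ 2 * ip h h + 2 * a * ip h k + ip k k.
Proof.
move=> Lh Lk; have Ls := L2_lin a Lh Lk.
rewrite ip_lin// ![ip _ (fun x => a * h x + k x)]ipC !ip_lin//.
by rewrite [ip k h]ipC; ring.
Qed.

Lemma ip_CS h k : L2 L h -> L2 L k -> ip h k ^+ 2 <= ip h h * ip k k.
Proof.
move=> Lh Lk.
have pos a : 0 <= a ^+ 2 * ip h h + 2 * a * ip h k + ip k k.
  by rewrite -ip_sqrD// ip_ge0.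
have := ip_ge0 h; rewrite le_eqVlt => /predU1P[h0|h0].
  rewrite -h0 mul0r; have := pos (- (ip k k + 1) / (2 * ip h k)).
  have [->|hk] := eqVneq (ip h k) 0; first by rewrite expr0n.
  rewrite -h0 mulr0 add0r.
  have -> : 2 * (- (ip k k + 1) / (2 * ip h k)) * ip h k = - (ip k k + 1) by field.
  by lra.
have := pos (- ip h k / ip h h).
have -> : (- ip h k / ip h h) ^+ 2 * ip h h + 2 * (- ip h k / ip h h) * ip h k + ip k k =
   (ip h h * ip k k - ip h k ^+ 2) / ip h h by field; rewrite gt_eqF.
by rewrite pmulr_lge0 ?invr_gt0// subr_ge0.
Qed.

Lemma ip_le h k : L2 L h -> L2 L k -> (forall x, `I x -> `|h x| <= `|k x|) -> ip h h <= ip k k.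
Proof.
move=> Lh Lk hk; apply: le_Rintegral => //; [exact: L2_integrableM..|].
move=> x Ix; rewrite -[leLHS]ger0_norm; last by rewrite -expr2 sqr_ge0.
rewrite -[leRHS]ger0_norm; last by rewrite -expr2 sqr_ge0.
by rewrite !normrM ler_pM// hk.
Qed.

Lemma ip_ae h1 h2 k : L2 L h1 -> L2 L h2 -> L2 L k ->
  {ae mu, forall x, x \in `[0, L] -> h1 x = h2 x} -> ip h1 k = ip h2 k.
Proof.
move=> L1 L2' Lk h12; congr fine; apply: ae_eq_integral => //=.
- by have /integrableP[] := L2_integrableM L1 Lk.
- by have /integrableP[] := L2_integrableM L2' Lk.
apply: filterS h12; first exact: (ae_filter_ringOfSetsType mu).
by move=> x + xI => /(_ xI) ->.
Qed.

Lemma sub_itv0 x : x \in `[0, L] -> [set` `[0, x]] `<=` `I.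
Proof.
move=> xI; apply: subset_itvl; rewrite bnd_simp.
by move: xI; rewrite in_itv/= => /andP[].
Qed.

Lemma integral_increment h x y : L2 L h -> 0 <= x -> x <= y -> y <= L ->
  \int[mu]_(z in `[0, y]) h z - \int[mu]_(z in `[0, x]) h z = \int[mu]_(z in `[x, y]) h z.
Proof.
move=> Lh x0 xy yL.
have yI : y \in `[0, L] by rewrite in_itv/= yL (le_trans x0 xy).
have ih : mu.-integrable `[0, y] (EFin \o h).
  by apply: integrableS (L2_integrable Lh) => //; exact: sub_itv0.
rewrite Rintegral_itvB//; try by rewrite bnd_simp.
rewrite Rintegral_itv_obnd_cbnd//.
by apply: integrableS ih => //; apply: subset_itvr; rewrite bnd_simp.
Qed.

Lemma L2_indicator (i : interval R) : L2 L ((cst 1 : R -> R) \_ [set` i]).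
Proof.
apply: (@L2_dominated _ (fun=> 1)); [|exact: L2_cst|].
  by apply: measurable_funTS; apply/(measurable_restrictT _ _).1.
by move=> z _; rewrite patchE; case: ifP; rewrite ?normr1 ?normr0.
Qed.

Lemma integral_sqr_le h x y : L2 L h -> 0 <= x -> x <= y -> y <= L ->
  (\int[mu]_(z in `[x, y]) h z) ^+ 2 <= (y - x) * ip h h.
Proof.
move=> Lh x0 xy yL.
have sub : `[x, y]%classic `<=` `I.
  by apply: subset_itvScc; rewrite bnd_simp.
pose k := (cst 1 : R -> R) \_ `[x, y]%classic.
have Lk : L2 L k by exact: L2_indicator.
have e f : \int[mu]_(z in `[x, y]) f z = \int[mu]_(z in `I) (k z * f z).
  rewrite -(setIidr sub) Rintegral_mkcondr; apply: eq_Rintegral => z _.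
  by rewrite /k !patchE; case: ifP => _; rewrite ?mul1r ?mul0r.
rewrite e -/(ip k h); apply: le_trans (ip_CS Lk Lh) _.
rewrite ler_wpM2r ?ip_ge0//.
have -> : ip k k = \int[mu]_(z in `[x, y]) 1.
  rewrite e; apply: eq_Rintegral => z _; rewrite /k !patchE.
  by case: ifP => _; rewrite ?mulr1 ?mulr0.
rewrite Rintegral_cst// mul1r /= lebesgue_measure_itv/= lte_fin.
by case: ifP => _ //=; rewrite subr_ge0.
Qed.

(** Split off the first increment and use [(a + b)^2 <= 2 a^2 + 2 b^2]; the weights [2 ^+ i] match
    the repeated doubling. The factor [2 / 2 ^+ n] is the gain for sums that start at [n]. *)
Lemma dyadic_increment_sqr (a : nat -> R) (n k : nat) :
  (a (n + k)%N - a n) ^+ 2 <=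
    2 / 2 ^+ n * \sum_(i < k) 2 ^+ (n + i) * (a (n + i).+1 - a (n + i)%N) ^+ 2.
Proof.
elim: k n => [n|k IH n]; first by rewrite addn0 subrr expr0n big_ord0 mulr0.
rewrite big_ord_recl /= addn0 addnS -addSn.
have := IH n.+1; under [X in _ <= _ * X -> _]eq_bigr do rewrite addSnnS.
set S := \sum_(i < k) _; set x := a (n.+1 + k)%N; set y := a n.+1; set z := a n.
have -> : 2 / 2 ^+ n.+1 * S = S / 2 ^+ n.
  by rewrite exprS invfM mulrA divff ?mul1r ?pnatr_eq0// mulrC.
move=> xy.
have -> : 2 / 2 ^+ n * (2 ^+ n * (y - z) ^+ 2 + S) = 2 * (y - z) ^+ 2 + 2 * (S / 2 ^+ n).
  by field; rewrite expf_neq0.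
have : (x - z) ^+ 2 <= 2 * (y - z) ^+ 2 + 2 * (x - y) ^+ 2.
  rewrite -subr_ge0.
  have -> : 2 * (y - z) ^+ 2 + 2 * (x - y) ^+ 2 - (x - z) ^+ 2 = (2 * y - x - z) ^+ 2 by ring.
  exact: sqr_ge0.
by lra.
Qed.

(** By [2 |d i| <= 2^(-i) + 2^i (d i)^2] the series of increments converges absolutely. *)
Lemma dyadic_cvg (a : nat -> R) (M : R) :
  (forall k, \sum_(i < k) 2 ^+ i * (a i.+1 - a i) ^+ 2 <= M) -> cvgn a.
Proof.
move=> aM; pose d i := a i.+1 - a i.
have : cvgn (series d).
  apply: normed_cvg; apply: nondecreasing_is_cvgn.
    suff : nondecreasing_seq (series (fun i => `|d i|)) by [].
    by apply/nondecreasing_seqP => i; rewrite seriesSr lerDl normr_ge0.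
  exists (1 + M) => _ [k _ <-]; suff : series (fun i => `|d i|) k <= 1 + M by [].
  rewrite /series/= big_mkord.
  have -> : 1 + M = (2 * 1 + 2 * M) / 2 by field.
  apply: (@le_trans _ _ ((\sum_(i < k) 2 ^- i + \sum_(i < k) 2 ^+ i * d i ^+ 2) / 2)).
    rewrite -big_split/= mulr_suml; apply: ler_sum => i _.
    have p0 : 0 < 2 ^+ i :> R by rewrite exprn_gt0.
    have := sqr_ge0 (1 - 2 ^+ i * `|d i|).
    have -> : (1 - 2 ^+ i * `|d i|) ^+ 2 =
      2 ^+ i * (2 ^- i + 2 ^+ i * d i ^+ 2 - 2 * `|d i|).
      by rewrite -(real_normK (num_real (d i))); field; rewrite gt_eqF.
    by rewrite pmulr_rge0//; lra.
  rewrite ler_pM2r ?invr_gt0//; apply: lerD.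
    rewrite mulr1; elim: k => [|k]; first by rewrite big_ord0.
    have -> : \sum_(i < k.+1) 2 ^- i = 2 - 2 * 2 ^- k.+1 :> R.
      elim: k => [|k IH]; first by rewrite big_ord_recr big_ord0 /= expr1; field.
      by rewrite big_ord_recr /= IH [2 ^+ k.+2]exprS; field; rewrite expf_neq0.
    have : 0 <= 2 ^- k.+1 :> R by rewrite invr_ge0 exprn_ge0.
    by lra.
  by apply: (@le_trans _ _ M); [exact: aM|have := aM 0%N; rewrite big_ord0; lra].
have -> : series d = (fun n => a n - a 0%N).
  by apply/funext => n; rewrite /series/= telescope_sumr.
move=> /(is_cvgD (is_cvg_cst (a 0%N))); rewrite (_ : _ + _ = a)//.
by apply/funext => n; rewrite fctE addrC subrK.
Qed.

Lemma integral_nneseries_geometric (s : nat -> R -> R) (b : R) n :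
  (forall i x, 0 <= s i x) -> (forall i, mu.-integrable `I (EFin \o s i)) ->
  (forall i, \int[mu]_(x in `I) s i x <= b / 2 ^+ i) ->
  (\int[mu]_(x in `I) (\sum_(i <oo) (s (n + i)%N x)%:E) <= (2 * b / 2 ^+ n)%:E)%E.
Proof.
move=> s0 is_ sb.
rewrite integral_nneseries//; last 2 first.
- by move=> i; have /integrableP[] := is_ (n + i)%N.
- by move=> i x _; rewrite lee_fin.
apply: lime_le.
  by apply: is_cvg_nneseries => i _ _; apply: integral_ge0 => x _; rewrite lee_fin.
apply: nearW => k.
have b0 : 0 <= b.
  by have := sb 0%N; rewrite expr0 divr1; apply: le_trans; apply: Rintegral_ge0 => x _.
apply: (@le_trans _ _ (\sum_(0 <= i < k) (b / 2 ^+ (n + i))%:E)%E).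
  apply: lee_sum => i _; rewrite -(fineK (integrable_fin_num _ (is_ (n + i)%N)))//.
  by rewrite lee_fin; exact: sb.
rewrite sumEFin lee_fin.
have -> : \sum_(0 <= i < k) b / 2 ^+ (n + i) = b / 2 ^+ n * (2 - 2 / 2 ^+ k).
  elim: k => [|k IH]; first by rewrite big_nil expr0; field; rewrite expf_neq0.
  rewrite big_nat_recr//= IH exprD exprS; field.
  by rewrite !expf_neq0.
rewrite -[2 * b]mulrC -[leRHS]mulrAC ler_wpM2l//.
  by rewrite divr_ge0// exprn_ge0.
by rewrite gerBl divr_ge0// exprn_ge0.
Qed.

(* Riesz-Fischer: [sum_i 2^i (h_(i+1) - h_i)^2] is integrable, hence finite a.e. *)
Lemma L2_complete (h_ : nat -> R -> R) (C : R) : (forall i, L2 L (h_ i)) ->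
  (forall i, ip (fun x => h_ i.+1 x - h_ i x) (fun x => h_ i.+1 x - h_ i x) <= (C / 2 ^+ i) ^+ 2) ->
  exists h, L2 L h /\ forall i,
    ip (fun x => h x - h_ i x) (fun x => h x - h_ i x) <= (2 * C / 2 ^+ i) ^+ 2.
Proof.
move=> Lh hC.
pose d i x := h_ i.+1 x - h_ i x.
have Ld i : L2 L (d i) by exact: L2B.
pose s i x := 2 ^+ i * d i x ^+ 2.
have s0 i x : 0 <= s i x by apply: mulr_ge0; [rewrite exprn_ge0|exact: sqr_ge0].
have is_ i : mu.-integrable `I (EFin \o s i).
  have := integrableZl mI (2 ^+ i) (L2_integrableM (Ld i) (Ld i)).
  by congr (mu.-integrable _ _); apply/funext => x /=; rewrite /s expr2.
have sb i : \int[mu]_(x in `I) s i x <= C ^+ 2 / 2 ^+ i.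
  have -> : \int[mu]_(x in `I) s i x = 2 ^+ i * ip (d i) (d i).
    rewrite -RintegralZl//; last exact: L2_integrableM.
  have -> : C ^+ 2 / 2 ^+ i = 2 ^+ i * (C / 2 ^+ i) ^+ 2 by field; rewrite expf_neq0.
  by rewrite ler_wpM2l ?exprn_ge0//; exact: hC.
pose G n x := (\sum_(i <oo) (s (n + i)%N x)%:E)%E.
have G0 n x : (0 <= G n x)%E by apply: nneseries_ge0 => i _ _; rewrite lee_fin.
have mG n : measurable_fun `I (G n).
  apply: ge0_emeasurable_sum => [k x _ _|k _]; first by rewrite lee_fin.
  by have /integrableP[] := is_ (n + k)%N.
have GS n k x : ((\sum_(i < k) s (n + i)%N x)%:E <= G n x)%E.
  rewrite /G; apply: le_trans (nneseries_lim_ge k _); last by move=> i _ _; rewrite lee_fin.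
  by rewrite sumEFin big_mkord.
have IG n := integral_nneseries_geometric n s0 is_ sb.
have cv x : (G 0%N x < +oo)%E -> cvgn (h_ ^~ x).
  move=> Gx; apply: (@dyadic_cvg _ (fine (G 0%N x))) => k.
  rewrite -lee_fin fineK; last by rewrite ge0_fin_numE.
  exact: (GS 0%N k x).
pose A := `I `&` [set x | (G 0%N x < +oo)%E].
have mA : measurable A by exact: emeasurable_fun_infty_o.
(* Outside [A], where the majorant is infinite, the value 0 is substituted; inside [[0, L]] this
   happens on a null set only, and it makes [h] a pointwise limit of measurable functions there. *)
pose h x := if x \in A then limn (h_ ^~ x) else 0.
have mh : measurable_fun `I h.
  apply: (@measurable_fun_cvg _ _ _ _ (fun n => h_ n \_ A)).
    move=> n; apply: measurable_funTS; apply/(measurable_restrictT _ _).1 => //.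
    by apply: measurable_funS (L2_measurable (Lh n)) => //; exact: subIsetl.
  move=> x Ix; rewrite /h; case: ifPn => xA; last first.
    rewrite (_ : (fun n => _) = fun=> 0); first exact: cvg_cst.
    by apply/funext => n; rewrite patchE (negbTE xA).
  rewrite (_ : (fun n => _) = h_ ^~ x).
    by apply: cv; move: xA; rewrite inE => -[].
  by apply/funext => n; rewrite patchE xA.
have fG : {ae mu, forall x, `I x -> (G 0%N x < +oo)%E}.
  have : mu.-integrable `I (G 0%N).
    apply/integrableP; split; first exact: mG.
    under eq_integral do rewrite gee0_abs//.
    by apply: le_lt_trans (IG 0%N) _; rewrite ltry.
  move=> /(integrable_ae mI); apply: filterS => x + Ix.
  by move=> /(_ Ix); rewrite ge0_fin_numE.
(* Let the upper index tend to infinity in [dyadic_increment_sqr], at the points where the sequence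
   converges. *)
have key n : {ae mu, forall x, `I x -> (((h x - h_ n x) * (h x - h_ n x))%:E <= (2 / 2 ^+ n)%:E * G n x)%E}.
  apply: filterS fG; first exact: (ae_filter_ringOfSetsType mu).
  move=> x + Ix => /(_ Ix) Gx.
  have hx : h_ ^~ x @ \oo --> h x.
    by rewrite /h mem_set//; exact: cv.
  have hn : (fun k => ((h_ (k + n)%N x - h_ n x) ^+ 2)%:E) @ \oo --> ((h x - h_ n x) ^+ 2)%:E.
    apply: cvg_EFin; first by apply: nearW.
    have c1 : (fun k => h_ (k + n)%N x - h_ n x) @ \oo --> h x - h_ n x.
      by apply: cvgB; [move: hx; rewrite -(cvg_shiftn n)|exact: cvg_cst].
    rewrite expr2; under eq_fun do rewrite expr2.
    exact: cvgM.
  rewrite -expr2 -(cvg_lim _ hn)//; apply: lime_le; first by apply/cvg_ex; eexists; exact: hn.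
  apply: nearW => k; rewrite addnC.
  apply: le_trans (_ : (((2 / 2 ^+ n) * \sum_(i < k) s (n + i)%N x)%:E <= _)%E).
    by rewrite lee_fin; exact: (@dyadic_increment_sqr (h_ ^~ x)).
  by rewrite EFinM; apply: lee_pmul => //; rewrite ?lee_fin ?divr_ge0 ?exprn_ge0 ?sumr_ge0.
have bound n : (\int[mu]_(x in `I) ((h x - h_ n x) * (h x - h_ n x))%:E <= ((2 * C / 2 ^+ n) ^+ 2)%:E)%E.
  apply: (@le_trans _ _ (\int[mu]_(x in `I) ((2 / 2 ^+ n)%:E * G n x))%E).
    apply: ae_ge0_le_integral => //.
    - by move=> x _; rewrite lee_fin -expr2 sqr_ge0.
    - apply/measurable_EFinP; apply: measurable_funM; apply: measurable_funB => //;
        exact: L2_measurable.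
    - by move=> x _; rewrite mule_ge0// lee_fin divr_ge0// exprn_ge0.
    - by apply: emeasurable_funM; [exact: measurable_cst|exact: mG].
  rewrite ge0_integralZl//; last exact: mG.
  apply: (@le_trans _ _ ((2 / 2 ^+ n)%:E * (2 * C ^+ 2 / 2 ^+ n)%:E)%E).
    by apply: lee_wpmul2l; [rewrite lee_fin divr_ge0// exprn_ge0|exact: IG].
  rewrite -EFinM lee_fin le_eqVlt; apply/orP; left; apply/eqP; field.
  by rewrite expf_neq0.
have Lhn n : L2 L (fun x => h x - h_ n x).
  have mhn : measurable_fun `I (fun x => h x - h_ n x).
    by apply: measurable_funB => //; exact: L2_measurable.
  apply: L2_of_integrable_sqr => //; apply/integrableP; split.
    by apply/measurable_EFinP; exact: measurable_funM.
  apply: le_lt_trans (_ : (((2 * C / 2 ^+ n) ^+ 2)%:E < +oo)%E); last by rewrite ltry.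
  apply: le_trans (bound n); rewrite le_eqVlt; apply/orP; left; apply/eqP.
  by apply: eq_integral => x _ /=; rewrite ger0_norm// -expr2 sqr_ge0.
exists h; split.
  have := L2D (Lhn 0%N) (Lh 0%N); congr (L2 L _).
  by apply/funext => x; rewrite subrK.
move=> n; rewrite -lee_fin; apply: le_trans (bound n).
by rewrite /ip /Rintegral fineK//; apply: integrable_fin_num => //; exact: L2_integrableM.
Qed.

End ScalarL2.

Arguments ip {R} L h k.

(** * Primitives vanishing at both ends, integration by parts *)

Section PrimitiveVanishing.
Context {R : realType} (L : R) (L0 : 0 < L).
Local Notation mu := (@lebesgue_measure R).
Local Notation "`I" := (`[0, L]%classic : set R).
Implicit Types (h u g : R -> R).

(** Membership of [u] in H^1_0(0, L) with weak derivative [g]. The integral formula contains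
    [u 0 = 0], and the values outside the interval are left free, so that sine sums qualify as they
    stand. *)
Definition vanishing_primitive u g : Prop :=
  [/\ L2 L g, forall x, x \in `[0, L] -> u x = \int[mu]_(y in `[0, x]) g y & u L = 0].

Lemma integral_norm_le h x y : L2 L h -> 0 <= x -> x <= y -> y <= L ->
  \int[mu]_(z in `[x, y]) `|h z| <= Num.sqrt (y - x) * Num.sqrt (ip L h h).
Proof.
move=> Lh x0 xy yL.
have -> : ip L h h = ip L (fun z => `|h z|) (fun z => `|h z|).
  by apply: eq_Rintegral => z _; rewrite -normrM ger0_norm// -expr2 sqr_ge0.
rewrite -sqrtrM ?subr_ge0// -[leLHS]ger0_norm; last by apply: Rintegral_ge0.
rewrite -sqrtr_sqr ler_wsqrtr//; exact: (integral_sqr_le (L2_norm Lh)).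
Qed.

Lemma sub_itv_L x y : 0 <= x -> y <= L -> `[x, y]%classic `<=` `I.
Proof. by move=> x0 yL; apply: subset_itvScc; rewrite bnd_simp. Qed.

Lemma integrable_sub h x y : L2 L h -> 0 <= x -> y <= L ->
  mu.-integrable `[x, y] (EFin \o h).
Proof. by move=> Lh x0 yL; apply: integrableS (L2_integrable Lh) => //; exact: sub_itv_L. Qed.

Lemma integral_product_le h k x y (c : R) : L2 L h -> L2 L k ->
  0 <= x -> x <= y -> y <= L -> (forall z, z \in `[x, y] -> `|k z| <= c) ->
  `|\int[mu]_(z in `[x, y]) (h z * k z)| <= c * (Num.sqrt (y - x) * Num.sqrt (ip L h h)).
Proof.
move=> Lh Lk x0 xy yL kc.
have sub := sub_itv_L x0 yL.
have ihk : mu.-integrable `[x, y] (EFin \o (fun z => h z * k z)).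
  by apply: integrableS (L2_integrableM Lh Lk).
apply: le_trans (le_normr_Rintegral _ ihk) _ => //.
have c0 : 0 <= c by apply: le_trans (kc x _) => //; rewrite in_itv/= lexx.
apply: (@le_trans _ _ (\int[mu]_(z in `[x, y]) (c * `|h z|))).
  apply: le_Rintegral => //.
  - by have := integrable_abse ihk; congr (mu.-integrable _ _); apply/funext.
  - have := integrable_sub (L2Z c (L2_norm Lh)) x0 yL.
    by [].
  - by move=> z zxy; rewrite normrM mulrC ler_wpM2r//; exact: kc.
rewrite RintegralZl//; last exact: (integrable_sub (L2_norm Lh)).
by rewrite ler_wpM2l//; exact: integral_norm_le.
Qed.

Lemma integral_bounded_le k x y (c : R) : L2 L k -> 0 <= x -> x <= y -> y <= L ->
  (forall z, z \in `[x, y] -> `|k z| <= c) -> `|\int[mu]_(z in `[x, y]) k z| <= c * (y - x).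
Proof.
move=> Lk x0 xy yL kc.
have ik := integrable_sub Lk x0 yL.
apply: le_trans (le_normr_Rintegral _ ik) _ => //.
apply: (@le_trans _ _ (\int[mu]_(s in `[x, y]) c)).
  apply: le_Rintegral => //.
  - by have := integrable_abse ik; congr (mu.-integrable _ _); apply/funext.
  - by apply: integrable_sub => //; exact: L2_cst.
rewrite Rintegral_cst//= lebesgue_measure_itv/= lte_fin.
move: xy; rewrite le_eqVlt => /predU1P[->|->]; last by [].
by rewrite ltxx subrr mulr0.
Qed.

Lemma continuous_bounded h : {within `I, continuous h} ->
  exists B, 0 <= B /\ forall x, x \in `[0, L] -> `|h x| <= B.
Proof.
move=> ch; have [B [_ BP]] := compact_bounded (continuous_compact ch (@segment_compact _ 0 L)).
have hB x : x \in `[0, L] -> `|h x| <= `|B| + 1.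
  by move=> xI; apply: (BP (`|B| + 1)); [rewrite (le_lt_trans (ler_norm B))// ltrDl|exists x].
by exists (`|B| + 1); split => //; rewrite addr_ge0.
Qed.

Lemma primitive_holder u g x y : vanishing_primitive u g ->
  0 <= x -> x <= y -> y <= L -> `|u y - u x| <= Num.sqrt (y - x) * Num.sqrt (ip L g g).
Proof.
move=> [Lg ug _] x0 xy yL.
rewrite !ug ?in_itv/= ?x0 ?yL ?(le_trans x0 xy) ?(le_trans xy yL)//.
rewrite (integral_increment Lg)//.
apply: le_trans (le_normr_Rintegral _ _) _ => //; first exact: integrable_sub.
exact: integral_norm_le.
Qed.

Lemma primitive_at0 u g : vanishing_primitive u g -> u 0 = 0.
Proof. by move=> [_ ug _]; rewrite ug ?in_itv/= ?lexx ?ltW// set_itv1 Rintegral_set1. Qed.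

Lemma primitive_le u g x : vanishing_primitive u g -> x \in `[0, L] ->
  u x ^+ 2 <= L * ip L g g.
Proof.
move=> h /[!in_itv]/= /andP[x0 xL]; have := primitive_holder h (lexx 0) x0 xL.
rewrite (primitive_at0 h) !subr0 => ux.
have : `|u x| ^+ 2 <= (Num.sqrt x * Num.sqrt (ip L g g)) ^+ 2 by rewrite lerXn2r ?nnegrE ?mulr_ge0 ?sqrtr_ge0.
rewrite exprMn !sqr_sqrtr// ?ip_ge0// real_normK ?num_real// => /le_trans; apply.
by rewrite ler_wpM2r// ip_ge0.
Qed.

Lemma primitive_continuous u g : vanishing_primitive u g -> {within `I, continuous u}.
Proof.
move=> [Lg ug _]; have := parameterized_integral_continuous (ltW L0) (L2_integrable Lg).
by apply: subspace_eq_continuous => x /set_mem xL; exact/esym/ug.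
Qed.

Lemma primitive_L2 u g : vanishing_primitive u g -> L2 L u.
Proof. by move=> /primitive_continuous/continuous_L2. Qed.

Definition C1 (p p' : R -> R) := (forall x : R, is_derive x (1 : R) p (p' x)) /\ continuous p'.

Lemma C1_continuous p p' : C1 p p' -> continuous p.
Proof. by move=> [dp _] x; apply: differentiable_continuous; apply/derivable1_diffP; case: (dp x). Qed.

Lemma continuous_within h (A : set R) : continuous h -> {within A, continuous h}.
Proof. exact: continuous_subspaceT. Qed.

Lemma C1_integral p p' x y : C1 p p' -> x <= y ->
  \int[mu]_(z in `[x, y]) p' z = p y - p x.
Proof.
move=> pp; rewrite le_eqVlt => /predU1P[->|xy]; first by rewrite set_itv1 Rintegral_set1 subrr.
have [dp cp'] := pp.
rewrite /Rintegral (@continuous_FTC2 _ p' p)//.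
- exact: continuous_within.
- split; first by move=> z _; case: (dp z).
  + exact/cvg_at_right_filter/(C1_continuous pp).
  + exact/cvg_at_left_filter/(C1_continuous pp).
- by move=> z _; rewrite derive1E; case: (dp z).
Qed.

Lemma C1_vanishing_primitive p p' : C1 p p' -> p 0 = 0 -> p L = 0 -> vanishing_primitive p p'.
Proof.
move=> pp p0 pL; split => //; first by apply/continuous_L2/continuous_within; case: pp.
by move=> x /[!in_itv]/= /andP[x0 _]; rewrite (C1_integral pp)// p0 subr0.
Qed.

(** Over [n] equal pieces the increments add up to at most [n] times a multiple of [n^(-3/2)]. *)
Lemma superlinear_increment_eq0 (Z : R -> R) (B : R) :
  (forall x y, 0 <= x -> x <= y -> y <= L -> `|Z y - Z x| <= B * ((y - x) * Num.sqrt (y - x))) ->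
  Z L = Z 0.
Proof.
move=> ZB; apply/eqP; rewrite -subr_eq0 -normr_le0; apply/ler_addgt0Pr => e e0; rewrite add0r.
have B0 : 0 <= B.
  have := ZB 0 L (lexx 0) (ltW L0) (lexx L); rewrite subr0.
  move=> /(le_trans (normr_ge0 _)); rewrite pmulr_lge0// mulr_gt0// sqrtr_gt0//.
have key n : `|Z L - Z 0| <= B * (L * Num.sqrt (L / n.+1%:R)).
  pose t i : R := L * (i%:R / n.+1%:R).
  have -> : Z L - Z 0 = \sum_(0 <= i < n.+1) (Z (t i.+1) - Z (t i)).
    rewrite telescope_sumr//; congr (Z _ - Z _); rewrite /t ?mul0r ?mulr0//.
    by rewrite divff ?mulr1 ?pnatr_eq0.
  rewrite big_mkord; apply: le_trans (ler_norm_sum _ _ _) _.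
  apply: (@le_trans _ _ (\sum_(i < n.+1) B * (L / n.+1%:R * Num.sqrt (L / n.+1%:R)))).
    apply: ler_sum => i _.
    have -> : L / n.+1%:R = t i.+1 - t i by rewrite /t -mulrBr -mulrBl -[i.+1%:R]natr1 addrAC subrr add0r mul1r.
    apply: ZB.
    - by rewrite mulr_ge0 ?divr_ge0// ltW.
    - by rewrite ler_wpM2l ?ltW// ltr_pM2r ?invr_gt0// ltr_nat.
    - rewrite /t ler_piMr ?(ltW L0)//.
      by rewrite ler_pdivrMr ?ltr0n// mul1r ler_nat.
  rewrite sumr_const card_ord -mulr_natl le_eqVlt; apply/orP; left; apply/eqP.
  set q := Num.sqrt _; have n0 : n.+1%:R != 0 :> R by rewrite pnatr_eq0.
  by move: n0; set k := n.+1%:R => n0; field.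
pose c := B * L / e; have c0 : 0 <= c by apply: divr_ge0; [apply: mulr_ge0 => //; exact: ltW|exact: ltW].
have Lc : 0 <= L * c ^+ 2 by apply: mulr_ge0; [exact: ltW|exact: sqr_ge0].
pose N := Num.bound (L * c ^+ 2).
have NL : L * c ^+ 2 <= N.+1%:R.
  by apply/ltW; apply: lt_le_trans (archi_boundP Lc) _; rewrite ler_nat.
apply: le_trans (key N) _.
have : c * Num.sqrt (L / N.+1%:R) <= 1.
  have z0 : 0 <= c * Num.sqrt (L / N.+1%:R) by apply: mulr_ge0 => //; exact: sqrtr_ge0.
  rewrite -(ger0_norm z0) -sqrtr_sqr -[leRHS]sqrtr1 ler_wsqrtr//.
  rewrite exprMn sqr_sqrtr ?divr_ge0 ?(ltW L0)// mulrA ler_pdivrMr ?ltr0n// mul1r.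
  by rewrite mulrC.
by rewrite /c mulrAC ler_pdivrMr// mul1r -mulrA.
Qed.

(* Integration by parts for a weak derivative: the defect over [x, y] is O((y-x)^(3/2)). *)
Lemma primitive_by_parts u g p p' : vanishing_primitive u g -> C1 p p' ->
  ip L g p = - ip L u p'.
Proof.
move=> ug pp; have [Lg _ uL] := ug; have u0 := primitive_at0 ug.
have Lu := primitive_L2 ug.
have Lp : L2 L p by apply/continuous_L2/continuous_within/(C1_continuous pp).
have Lp' : L2 L p' by apply/continuous_L2/continuous_within; case: pp.
have [B0 [B00 B0P]] := continuous_bounded (continuous_within (A := `I) pp.2).
pose G := Num.sqrt (ip L g g).
have ii x y : 0 <= x -> y <= L -> mu.-integrable `[x, y] (EFin \o (fun z => g z * p z)).
  by move=> x0 yL; apply: integrableS (L2_integrableM Lg Lp) => //; exact: sub_itv_L.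
have ij x y : 0 <= x -> y <= L -> mu.-integrable `[x, y] (EFin \o (fun z => u z * p' z)).
  by move=> x0 yL; apply: integrableS (L2_integrableM Lu Lp') => //; exact: sub_itv_L.
have inc h x y : 0 <= x -> x <= y -> y <= L -> mu.-integrable `[0, y] (EFin \o h) ->
  \int[mu]_(z in `[0, y]) h z - \int[mu]_(z in `[0, x]) h z = \int[mu]_(z in `[x, y]) h z.
  move=> x0 xy yL ih; rewrite Rintegral_itvB//; try by rewrite bnd_simp.
  rewrite Rintegral_itv_obnd_cbnd//.
  by apply: integrableS ih => //; apply: subset_itvr; rewrite bnd_simp.
(* The defect of the product rule on [[0, x]]. As [u] vanishes at both ends, the claim is
   [Z L = Z 0]. *)
pose Z x := u x * p x - \int[mu]_(z in `[0, x]) (g z * p z) - \int[mu]_(z in `[0, x]) (u z * p' z).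
suff : Z L = Z 0.
  rewrite /Z uL u0 !mul0r !sub0r set_itv1 !Rintegral_set1.
  by rewrite -/(ip L g p) -/(ip L u p'); lra.
apply: (@superlinear_increment_eq0 _ (2 * B0 * G)) => x y x0 xy yL.
have yx0 : 0 <= y - x by rewrite subr_ge0.
have xI : x \in `[0, L] by rewrite in_itv/= x0 (le_trans xy).
have yI : y \in `[0, L] by rewrite in_itv/= yL (le_trans x0).
have uB z : z \in `[x, y] -> `|u x - u z| <= Num.sqrt (y - x) * G.
  rewrite in_itv/= => /andP[xz zy]; rewrite distrC.
  apply: le_trans (primitive_holder ug x0 xz (le_trans zy yL)) _.
  by rewrite ler_wpM2r ?sqrtr_ge0// ler_wsqrtr// lerB.
have pB z : z \in `[x, y] -> `|p y - p z| <= B0 * (y - x).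
  rewrite in_itv/= => /andP[xz zy]; rewrite -(C1_integral pp zy).
  apply: le_trans (_ : B0 * (y - z) <= _); last by rewrite ler_wpM2l// lerB.
  apply: integral_bounded_le => //; first exact: le_trans xz.
  move=> s; rewrite in_itv/= => /andP[zs sy]; apply: B0P.
  by rewrite in_itv/= (le_trans _ zs) ?(le_trans x0)// (le_trans sy).
(* The defect on [[x, y]] is the error of freezing [p] at [y] and [u] at [x]. The first error is of
   order [y - x] against [g] in L^2, the second of order [(y - x)^(1/2)] against the bounded
   [p']. *)
have -> : Z y - Z x = \int[mu]_(z in `[x, y]) (g z * (p y - p z)) +
                      \int[mu]_(z in `[x, y]) (p' z * (u x - u z)).
  have e1 := inc _ _ _ x0 xy yL (ii _ _ (lexx 0) yL).
  have e2 := inc _ _ _ x0 xy yL (ij _ _ (lexx 0) yL).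
  have -> : Z y - Z x = (u y * p y - u x * p x) - \int[mu]_(z in `[x, y]) (g z * p z) -
     \int[mu]_(z in `[x, y]) (u z * p' z) by rewrite -e1 -e2 /Z; ring.
  have g1 : \int[mu]_(z in `[x, y]) (p y * g z) = p y * (u y - u x).
    have [_ uE _] := ug; rewrite RintegralZl//; last exact: integrable_sub.
    by rewrite !uE// (integral_increment Lg).
  have g2 : \int[mu]_(z in `[x, y]) (u x * p' z) = u x * (p y - p x).
    by rewrite RintegralZl//; [rewrite (C1_integral pp)|exact: integrable_sub].
  have -> : \int[mu]_(z in `[x, y]) (g z * (p y - p z)) =
      \int[mu]_(z in `[x, y]) (p y * g z) - \int[mu]_(z in `[x, y]) (g z * p z).
    rewrite -RintegralB//; [|by apply: integrable_sub => //; exact: L2Z|exact: ii].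
    by apply: eq_Rintegral => z _; ring.
  have -> : \int[mu]_(z in `[x, y]) (p' z * (u x - u z)) =
      \int[mu]_(z in `[x, y]) (u x * p' z) - \int[mu]_(z in `[x, y]) (u z * p' z).
    rewrite -RintegralB//; [|by apply: integrable_sub => //; exact: L2Z|exact: ij].
    by apply: eq_Rintegral => z _; ring.
  by rewrite g1 g2; ring.
apply: le_trans (ler_normD _ _) _.
have -> : 2 * B0 * G * ((y - x) * Num.sqrt (y - x)) =
  B0 * (y - x) * (Num.sqrt (y - x) * G) + B0 * (y - x) * (Num.sqrt (y - x) * G) by ring.
apply: lerD; first by apply: integral_product_le => //; apply: L2B => //; exact: L2_cst.
have -> : B0 * (y - x) * (Num.sqrt (y - x) * G) = B0 * (Num.sqrt (y - x) * G) * (y - x) by ring.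
apply: integral_bounded_le => //.
  by apply: (L2M_bounded _ B0P) => //; [exact: L2_measurable|apply: L2B => //; exact: L2_cst].
move=> z zI; rewrite normrM ler_pM//; last exact: uB.
apply: B0P; move: zI; rewrite !in_itv/= => /andP[xz zy].
by rewrite (le_trans x0)//= (le_trans zy).
Qed.

End PrimitiveVanishing.

(** * Orthonormal systems and Bessel's inequality *)

Section Bessel.
Context {R : realType} {L : R}.
Local Notation mu := (@lebesgue_measure R).
Implicit Types (h : R -> R) (p : nat -> R -> R).

Lemma L2_bigsum p (c : nat -> R) n : (forall k, L2 L (p k)) ->
  L2 L (fun x => \sum_(k < n) c k * p k x).
Proof.
move=> Lp; elim: n => [|n IH].
  by have := L2_0 L; congr (L2 L _); apply/funext => x; rewrite big_ord0.
have := L2D IH (L2Z (c n) (Lp n)); congr (L2 L _).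
by apply/funext => x; rewrite big_ord_recr.
Qed.

Lemma ip_bigsum p (c : nat -> R) n h : (forall k, L2 L (p k)) -> L2 L h ->
  ip L (fun x => \sum_(k < n) c k * p k x) h = \sum_(k < n) c k * ip L (p k) h.
Proof.
move=> Lp Lh; elim: n => [|n IH].
  by rewrite big_ord0 -[RHS](ip0l (L := L) h); apply: eq_Rintegral => x _; rewrite big_ord0.
rewrite big_ord_recr/= -IH -ipZ// -ipD//; [|exact: L2_bigsum|exact: L2Z].
by apply: eq_Rintegral => x _; rewrite big_ord_recr.
Qed.

Definition orthonormal p := forall j k, ip L (p j) (p k) = (j == k)%:R.

Lemma ip_orthonormal_sum p (c : nat -> R) n k : (forall k, L2 L (p k)) -> orthonormal p ->
  ip L (fun x => \sum_(j < n) c j * p j x) (p k) = if (k < n)%N then c k else 0.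
Proof.
move=> Lp op; rewrite ip_bigsum//; under eq_bigr do rewrite op.
case: ifPn => kn.
  rewrite (bigD1 (Ordinal kn))//= eqxx mulr1 big1 ?addr0// => j jk.
  suff -> : (val j == k) = false by rewrite mulr0.
  by apply: contraNF jk => /eqP jk; apply/eqP/val_inj.
rewrite big1// => j _; suff -> : (val j == k) = false by rewrite mulr0.
by apply/negbTE; apply: contra kn => /eqP <-; exact: ltn_ord.
Qed.

Lemma ip_orthonormal_sqr p (c : nat -> R) n : (forall k, L2 L (p k)) -> orthonormal p ->
  ip L (fun x => \sum_(j < n) c j * p j x) (fun x => \sum_(j < n) c j * p j x) =
  \sum_(j < n) c j ^+ 2.
Proof.
move=> Lp op; rewrite ip_bigsum//; last exact: L2_bigsum.
by apply: eq_bigr => k _; rewrite ipC ip_orthonormal_sum// ltn_ord expr2.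
Qed.

Lemma bessel p h n : (forall k, L2 L (p k)) -> orthonormal p -> L2 L h ->
  \sum_(k < n) ip L h (p k) ^+ 2 <= ip L h h.
Proof.
move=> Lp op Lh; pose c k := ip L h (p k).
have Ls := L2_bigsum c n Lp.
have := ip_ge0 (L := L) (fun x => -1 * (\sum_(k < n) c k * p k x) + h x).
rewrite ip_sqrD// ip_orthonormal_sqr// ip_bigsum//.
have -> : \sum_(k < n) c k * ip L (p k) h = \sum_(k < n) c k ^+ 2.
  by apply: eq_bigr => k _; rewrite ipC expr2.
by rewrite sqrrN expr1n -/c; lra.
Qed.

End Bessel.

(** * Dirichlet eigenfunctions and their completeness *)

Section Eigenfunctions.
Context {R : realType} (L : R) (L0 : 0 < L).
Local Notation mu := (@lebesgue_measure R).
Implicit Types (h u g : R -> R).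

(** Indices start at 0 from here on: [eigv k] and [efun k] belong to the eigenvalue with number
    [k + 1]. *)
Definition eigv (k : nat) : R := (k.+1%:R * pi / L) ^+ 2.
Definition efun k : R -> R := eigf L k.+1.
Definition defun k (x : R) : R :=
  Num.sqrt (2 / L) * (k.+1%:R * pi / L) * cos (k.+1%:R * pi * x / L).

Lemma eigv_gt0 k : 0 < eigv k.
Proof. by rewrite exprn_gt0// divr_gt0// mulr_gt0 ?pi_gt0. Qed.

Lemma is_derive_phase k (x : R) :
  is_derive x (1 : R) (fun x : R => k.+1%:R * pi * x / L) (k.+1%:R * pi / L).
Proof.
have -> : (fun x : R => k.+1%:R * pi * x / L) = (k.+1%:R * pi / L) \*: (@id R).
  by apply/funext => y /=; rewrite /GRing.scale/=; ring.
by apply: is_derive_eq; rewrite /GRing.scale/= mulr1.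
Qed.

Lemma is_derive_efun k (x : R) : is_derive x (1 : R) (efun k) (defun k x).
Proof.
have d := is_derive1_comp (is_derive_sin _) (is_derive_phase k x).
have -> : efun k = Num.sqrt (2 / L) \*: (sin \o (fun x : R => k.+1%:R * pi * x / L)).
  by apply/funext.
by apply: is_derive_eq; rewrite /defun /GRing.scale/=; ring.
Qed.

Lemma is_derive_defun k (x : R) : is_derive x (1 : R) (defun k) (- eigv k * efun k x).
Proof.
have d := is_derive1_comp (is_derive_cos _) (is_derive_phase k x).
have -> : defun k = (Num.sqrt (2 / L) * (k.+1%:R * pi / L)) \*:
   (cos \o (fun x : R => k.+1%:R * pi * x / L)) by apply/funext.
by apply: is_derive_eq; rewrite /eigv /efun /eigf /GRing.scale/=; ring.
Qed.

Lemma efun_continuous k : continuous (efun k).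
Proof. by move=> x; apply: differentiable_continuous; apply/derivable1_diffP; case: (is_derive_efun k x). Qed.

Lemma defun_continuous k : continuous (defun k).
Proof. by move=> x; apply: differentiable_continuous; apply/derivable1_diffP; case: (is_derive_defun k x). Qed.

Lemma efun_C1 k : C1 (efun k) (defun k).
Proof. by split; [exact: is_derive_efun|exact: defun_continuous]. Qed.

Lemma defun_C1 k : C1 (defun k) (fun x => - eigv k * efun k x).
Proof.
split; first exact: is_derive_defun.
by move=> x; apply: cvgM; [exact: cvg_cst|exact: efun_continuous].
Qed.

Lemma sin_natpi k : sin (k%:R * pi) = 0 :> R.
Proof.
elim: k => [|k IH]; first by rewrite mul0r sin0.
by rewrite -natr1 mulrDl mul1r sinDpi IH oppr0.
Qed.

Lemma efun_vanishing_primitive k : vanishing_primitive L (efun k) (defun k).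
Proof.
apply: C1_vanishing_primitive => //; first exact: efun_C1.
  by rewrite /efun /eigf mulr0 mul0r sin0 mulr0.
by rewrite /efun /eigf mulfK ?gt_eqF// sin_natpi mulr0.
Qed.

Lemma efun_L2 k : L2 L (efun k).
Proof. by apply/continuous_L2/continuous_within/efun_continuous. Qed.

Lemma defun_L2 k : L2 L (defun k).
Proof. by apply/continuous_L2/continuous_within/defun_continuous. Qed.

Lemma ip_primitive_defun u g k : vanishing_primitive L u g ->
  ip L g (defun k) = eigv k * ip L u (efun k).
Proof.
move=> ug; rewrite (primitive_by_parts L0 ug (defun_C1 k)) ipC ipZ ?mulNr ?opprK ?[ip L (efun k) u]ipC//.
- exact: efun_L2.
- exact: (primitive_L2 L0 ug).
Qed.

(** The function [defun^2 + eigv efun^2] is the constant [2 eigv / L], with integral [2 eigv].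
    Integration by parts shows that its two summands have the same integral. *)
Lemma efun_norm k : ip L (efun k) (efun k) = 1.
Proof.
have := ip_primitive_defun k (efun_vanishing_primitive k).
have e : ip L (defun k) (defun k) + eigv k * ip L (efun k) (efun k) = 2 * eigv k.
  rewrite -ipZ; [|exact: efun_L2..].
  have i1 := L2_integrableM (defun_L2 k) (defun_L2 k).
  have i2 := L2_integrableM (L2Z (eigv k) (efun_L2 k)) (efun_L2 k).
  rewrite /ip -RintegralD//.
  have -> : \int[mu]_(x in `[0, L]) (defun k x * defun k x + eigv k * efun k x * efun k x) =
     \int[mu]_(x in `[0, L]) (2 / L * eigv k).
    apply: eq_Rintegral => x _; rewrite /defun /efun /eigf /eigv.
    set t := k.+1%:R * pi * x / L; set s := Num.sqrt _; set q := _ * pi / L.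
    have -> : s * q * cos t * (s * q * cos t) + q ^+ 2 * (s * sin t) * (s * sin t) =
      s ^+ 2 * q ^+ 2 * (cos t ^+ 2 + sin t ^+ 2) by ring.
    by rewrite cos2Dsin2 mulr1 sqr_sqrtr// divr_ge0// ltW.
  rewrite Rintegral_cst//= lebesgue_measure_itv/= lte_fin L0/= subr0.
  by field; rewrite gt_eqF.
move=> e'; rewrite e' in e; apply: (@mulfI _ (eigv k)); first by rewrite gt_eqF ?eigv_gt0.
by rewrite mulr1; lra.
Qed.

Lemma eigv_inj : injective eigv.
Proof.
move=> j k /eqP; rewrite /eigv eqrXn2// ?divr_ge0 ?mulr_ge0 ?pi_ge0 ?ltW// => /eqP.
move=> /(mulIf (_ : L^-1 != 0)) h; apply/succn_inj/eqP.
rewrite -(eqr_nat R); apply/eqP/(mulIf (_ : pi != 0)); first by rewrite gt_eqF// pi_gt0.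
by apply: h; rewrite gt_eqF ?invr_gt0.
Qed.

(** Integrating by parts both ways multiplies the same inner product by two different
    eigenvalues. *)
Lemma efun_orthonormal : orthonormal (L := L) efun.
Proof.
move=> j k; have [->|jk] := eqVneq j k; first exact: efun_norm.
have e1 := ip_primitive_defun k (efun_vanishing_primitive j).
have := ip_primitive_defun j (efun_vanishing_primitive k).
rewrite ipC e1 [ip L (efun k) _]ipC => /eqP; rewrite -subr_eq0 -mulrBl mulf_eq0 => /orP[|/eqP//].
by rewrite subr_eq0 => /eqP/eigv_inj kj; rewrite kj eqxx in jk.
Qed.

(** The orthonormal cosines. Bessel's inequality for them controls the derivative part of the H^1
    norm. *)
Definition defun_normed k (x : R) := (Num.sqrt (eigv k))^-1 * defun k x.

Lemma defun_normed_L2 k : L2 L (defun_normed k).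
Proof. by apply: L2Z; exact: defun_L2. Qed.

Lemma ip_defun_normed u g k : vanishing_primitive L u g ->
  ip L g (defun_normed k) = Num.sqrt (eigv k) * ip L u (efun k).
Proof.
move=> ug; rewrite ipC ipZ; [|exact: defun_L2|by case: ug].
rewrite ipC (ip_primitive_defun k ug) mulrA; congr (_ * _).
have s0 : 0 < Num.sqrt (eigv k) by rewrite sqrtr_gt0 eigv_gt0.
by rewrite -{2}(sqr_sqrtr (ltW (eigv_gt0 k))) expr2 mulKf ?gt_eqF.
Qed.

Lemma defun_normed_orthonormal : orthonormal (L := L) defun_normed.
Proof.
move=> j k; rewrite ipZ; [|exact: defun_L2|exact: defun_normed_L2].
rewrite (ip_defun_normed k (efun_vanishing_primitive j)) efun_orthonormal.
have [->|_] := eqVneq j k; last by rewrite !mulr0.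
by rewrite mulr1 mulVf// gt_eqF// sqrtr_gt0 eigv_gt0.
Qed.

Lemma bessel_primitive u g n : vanishing_primitive L u g ->
  \sum_(k < n) eigv k * ip L u (efun k) ^+ 2 <= ip L g g.
Proof.
move=> ug; have [Lg _ _] := ug.
have := bessel n defun_normed_L2 defun_normed_orthonormal Lg.
under eq_bigr => k _ do rewrite (ip_defun_normed _ ug) exprMn sqr_sqrtr ?(ltW (eigv_gt0 _))//.
by [].
Qed.

Lemma efun_le k x : `|efun k x| <= Num.sqrt (2 / L).
Proof.
rewrite /efun /eigf normrM ger0_norm ?sqrtr_ge0// ler_piMr ?sqrtr_ge0//.
by rewrite ler_norml sin_geN1 sin_le1.
Qed.

(** The continuous [p] for which [u p] is orthogonal to all sines. They form a space closed under
    multiplication by [cos (pi x / L)]; so if 1 belongs to it, all polynomials in this cosine do. *)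
Let annihilated u (p : R -> R) := continuous p /\ forall k, ip L u (fun x => p x * eigf L k x) = 0.

Lemma eigf_continuous k : continuous (eigf L k).
Proof.
case: k => [|k]; last exact: efun_continuous.
rewrite (_ : eigf L 0 = fun=> 0); first by move=> x; exact: cvg_cst.
by apply/funext => x; rewrite /eigf !mul0r sin0 mulr0.
Qed.

Let phase_cos (x : R) := cos (pi * x / L).

Let phase_cos_continuous : continuous phase_cos.
Proof.
have d (x : R) : is_derive x (1 : R) (pi / L \*: @id R) (pi / L).
  by apply: is_derive_eq; rewrite /GRing.scale/= mulr1.
move=> x; have -> : phase_cos = cos \o (pi / L \*: @id R).
  by apply/funext => y; rewrite /phase_cos /= /GRing.scale/= mulrAC.
apply: continuous_comp; last exact: continuous_cos.
by apply: differentiable_continuous; apply/derivable1_diffP; case: (d x).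
Qed.

(** The unshifted index is convenient here: [eigf L 0] vanishes, so the first sine is no
    exception. *)
Lemma eigf_cos k x : phase_cos x * eigf L k.+1 x = 2^-1 * (eigf L k.+2 x + eigf L k x).
Proof.
rewrite /eigf /phase_cos; set t := pi * x / L; set b := k.+1%:R * pi * x / L.
have -> : k.+2%:R * pi * x / L = b + t by rewrite /b /t -[k.+2%:R]natr1; ring.
have -> : k%:R * pi * x / L = b - t by rewrite /b /t -[k.+1%:R]natr1; ring.
by rewrite sinD sinB; field.
Qed.

Let annihilated_lin u (a : R) p p' : {within `[0, L], continuous u} ->
  annihilated u p -> annihilated u p' -> annihilated u (fun x => a * p x + p' x).
Proof.
move=> cu [cp Ap] [cp' Ap']; split.
  by move=> x; apply: cvgD; [apply: cvgM; [exact: cvg_cst|exact: cp]|exact: cp'].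
move=> k.
have Lq (q : R -> R) : continuous q -> L2 L (fun x => q x * eigf L k x).
  by move=> cq; apply/continuous_L2/continuous_within => x; apply: cvgM; [exact: cq|exact: eigf_continuous].
have -> : (fun x => (a * p x + p' x) * eigf L k x) =
    (fun x => a * (p x * eigf L k x) + p' x * eigf L k x).
  by apply/funext => x; rewrite mulrDl mulrA.
rewrite ipC ip_lin; [|exact: Lq|exact: Lq|exact: continuous_L2].
by rewrite ![ip L _ u]ipC Ap Ap' mulr0 addr0.
Qed.

Let annihilated_cos u p : {within `[0, L], continuous u} ->
  annihilated u p -> annihilated u (fun x => p x * phase_cos x).
Proof.
move=> cu [cp Ap]; split.
  by move=> x; apply: cvgM; [exact: cp|exact: phase_cos_continuous].
have Lq k : L2 L (fun x => p x * eigf L k x).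
  by apply/continuous_L2/continuous_within => x; apply: cvgM; [exact: cp|exact: eigf_continuous].
case=> [|k].
  rewrite -[RHS](Ap 0%N); apply: eq_Rintegral => x _.
  by rewrite /eigf !mul0r sin0 !mulr0.
have -> : (fun x => p x * phase_cos x * eigf L k.+1 x) =
    (fun x => 2^-1 * (p x * eigf L k.+2 x) + 2^-1 * (p x * eigf L k x)).
  by apply/funext => x; rewrite -mulrA eigf_cos; ring.
rewrite ipC ip_lin; [|exact: Lq|exact/L2Z/Lq|exact: continuous_L2].
rewrite ipZ; [|exact: Lq|exact: continuous_L2].
by rewrite ![ip L _ u]ipC !Ap mulr0 addr0.
Qed.

(* Peak functions: [1 - (cos t - cos t0)^2 / 4] has its strict maximum over [0, pi] at [t0]. *)
Let peak (c x : R) : R := 1 - (phase_cos x - c) ^+ 2 / 4.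

Let annihilated_peak u c n : {within `[0, L], continuous u} ->
  (forall k, ip L u (eigf L k) = 0) -> annihilated u (fun x => peak c x ^+ n).
Proof.
move=> cu u0; elim: n => [|n IH].
  split; first by move=> x; exact: cvg_cst.
  by move=> k; rewrite -[RHS](u0 k); apply: eq_Rintegral => x _; rewrite expr0 mul1r.
have h1 := annihilated_cos cu IH; have h2 := annihilated_cos cu h1.
have -> : (fun x => peak c x ^+ n.+1) = (fun x => - c ^+ 2 / 4 * (peak c x ^+ n) +
   (c / 2 * (peak c x ^+ n * phase_cos x) +
    (- 4^-1 * (peak c x ^+ n * phase_cos x * phase_cos x) + peak c x ^+ n))).
  by apply/funext => x; rewrite exprS {1}/peak; field.
by do 3 (apply: annihilated_lin => //).
Qed.

(** Multiply [u] by the first sine, which is positive inside, and by high powers of the peak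
    function at [x0]. The integral is 0 by orthogonality. But the powers stay above [r2 ^+ n] near
    [x0] and below [r1 ^+ n] away from it, with [r1 < r2], so the positive contribution near [x0]
    eventually wins. *)
Let peak_positive u x0 : {within `[0, L], continuous u} -> x0 \in `]0, L[ ->
  (forall k, ip L u (eigf L k) = 0) -> 0 < u x0 -> False.
Proof.
move=> cu x0I u0 ux0.
have [x00 x0L] : 0 < x0 /\ x0 < L by move: x0I; rewrite in_itv/= => /andP.
pose v x := u x * eigf L 1 x; pose c0 := phase_cos x0.
have phase x : 0 <= x -> x <= L -> pi * x / L \in `[0, pi].
  move=> h0 hL; rewrite in_itv/= divr_ge0 ?mulr_ge0 ?pi_ge0 ?(ltW L0)//=.
  by rewrite ler_pdivrMr// ler_wpM2l ?pi_ge0.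
have dec x y : 0 <= x -> x < y -> y <= L -> phase_cos y < phase_cos x.
  move=> h0 xy yL; have h0y := ltW (le_lt_trans h0 xy); have hxL := ltW (lt_le_trans xy yL).
  rewrite /phase_cos ltr_cos ?phase//.
  by rewrite ltr_pM2r ?invr_gt0// ltr_pM2l ?pi_gt0.
have cv : {within `[0, L], continuous v}.
  by move=> x; apply: cvgM; [exact: cu|exact: (continuous_within (@eigf_continuous 1))].
have vx0 : 0 < v x0.
  rewrite mulr_gt0// /eigf mul1r mulr_gt0 ?sqrtr_gt0 ?divr_gt0// sin_gt0_pi//.
  by rewrite divr_gt0 ?mulr_gt0 ?pi_gt0//= ltr_pdivrMr// ltr_pM2l ?pi_gt0.
have [M [M0 vM]] := continuous_bounded cv.
pose a := v x0 / 2.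
have a0 : 0 < a by rewrite divr_gt0.
have /nbhs_ballP[d d0 dP] : \forall x \near x0, a < v x /\ x \in `]0, L[.
  have [cv' _ _] := (continuous_within_itvP _ L0).1 cv.
  near=> x; split; last by near: x; exact: near_in_itvoo.
  near: x; apply: (cvgr_gt (v x0) (cv' _ x0I)).
  by rewrite /a; lra.
have d20 : 0 < d / 2 by rewrite divr_gt0.
have inball e : `|e| <= d / 2 -> ball x0 d (x0 + e).
  by move=> he; rewrite /ball/= opprD addNKr normrN; apply: le_lt_trans he _; move: d0 => /=; lra.
have xm : x0 - d / 2 \in `]0, L[.
  by case: (dP (x0 - d / 2)) => //; apply: inball; rewrite normrN ger0_norm// ltW.
have xp : x0 + d / 2 \in `]0, L[.
  by case: (dP (x0 + d / 2)) => //; apply: inball; rewrite ger0_norm// ltW.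
move: xm xp; rewrite !in_itv/= => /andP[xm0 xmL] /andP[xp0 xpL].
pose e1 := c0 - phase_cos (x0 + d / 2); pose e2 := phase_cos (x0 - d / 2) - c0.
have e10 : 0 < e1 by rewrite subr_gt0; apply: dec; [exact: ltW|rewrite ltrDl|exact: ltW].
have e20 : 0 < e2 by rewrite subr_gt0; apply: dec; [exact: ltW|rewrite gtrDl oppr_lt0|exact: ltW].
have [e [e0 [ee1 ee2]]] : exists e, 0 < e /\ (e <= e1 /\ e <= e2).
  by exists (Num.min e1 e2); rewrite lt_min e10 e20 !ge_min !lexx orbT.
have pc1 x : -1 <= phase_cos x /\ phase_cos x <= 1 by rewrite cos_geN1 cos_le1.
have e4 : e <= 2.
  apply: le_trans ee1 _; rewrite /e1; have [+ _] := pc1 (x0 + d / 2); have [_ +] := pc1 x0.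
  by rewrite -/c0; lra.
have q0 x : 0 <= peak c0 x.
  rewrite /peak; have [? ?] := pc1 x; have [] := pc1 x0; rewrite -/c0 => ? ?.
  have : 0 <= (2 - (phase_cos x - c0)) * (2 + (phase_cos x - c0)) by apply: mulr_ge0; lra.
  by lra.
have q1 x : peak c0 x <= 1 by rewrite /peak gerBl divr_ge0// sqr_ge0.
have far x : 0 <= x -> x <= L -> ~~ (x0 - d / 2 <= x <= x0 + d / 2) -> peak c0 x <= 1 - e ^+ 2 / 4.
  move=> h0 hL /nandP hx; rewrite /peak lerD2l lerN2 ler_pM2r ?invr_gt0//.
  rewrite -[leRHS]real_normK ?num_real// lerXn2r ?nnegrE ?(ltW e0)//.
  case: hx; rewrite -ltNge => hx; rewrite ltW// ltr_normr.
    by apply/orP; left; apply: le_lt_trans ee2 _; rewrite /e2 ltrD2r; apply: dec => //; exact: ltW.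
  by apply/orP; right; rewrite opprB; apply: le_lt_trans ee1 _; rewrite /e1 ltrD2l ltrN2; apply: dec => //; exact: ltW.
(* Farther than [d / 2] from [x0] the cosine differs from [c0] by at least [e], whence [r1]. The
   bound [r2] lies strictly between [r1] and the peak value 1, so it holds on a smaller
   neighbourhood. *)
pose r1 := 1 - e ^+ 2 / 4; pose r2 := 1 - e ^+ 2 / 8.
have ee : 0 < e ^+ 2 by rewrite exprn_gt0.
have e44 : e ^+ 2 <= 4 by rewrite -[4]/(2 * 2)%:R natrM -expr2 lerXn2r ?nnegrE ?(ltW e0).
have r10 : 0 <= r1 by rewrite /r1; lra.
have r20 : 0 < r2 by rewrite /r2; lra.
have r12 : r1 < r2 by rewrite /r1 /r2; lra.
have /nbhs_ballP[d' d'0 d'P] : \forall x \near x0, r2 < peak c0 x.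
  have cq : peak c0 x @[x --> x0] --> peak c0 x0.
    apply: cvgB; first exact: cvg_cst.
    apply: cvgM; last exact: cvg_cst.
    rewrite expr2; under eq_fun do rewrite expr2.
    by apply: cvgM; (apply: cvgB; [exact: phase_cos_continuous|exact: cvg_cst]).
  apply: (cvgr_gt _ cq); rewrite /peak -/c0 subrr expr0n mul0r subr0 /r2; lra.
have [s [s0 [sd sd']]] : exists s, 0 < s /\ (s <= d / 2 /\ s < d').
  exists (Num.min (d / 2) (d' / 2)); rewrite lt_min d20 divr_gt0//= ge_min lexx; split => //; split => //.
  by rewrite gt_min; apply/orP; right; move: d'0 => /=; lra.
pose J := `[x0 - s, x0 + s]%classic.
pose kap := (cst (1 : R) : R -> R) \_ J.
have lower n x : x \in `[0, L] -> a * r2 ^+ n * kap x - M * r1 ^+ n <= v x * peak c0 x ^+ n.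
  move=> xI; have := vM x xI; move: xI; rewrite in_itv/= => /andP[h0 hL] vxM.
  have Mr : 0 <= M * r1 ^+ n by rewrite mulr_ge0// exprn_ge0.
  have [near|fr] := boolP (x0 - d / 2 <= x <= x0 + d / 2); last first.
    have -> : kap x = 0.
      rewrite /kap patchE memNset// /J/= in_itv/= => /andP[h1 h2].
      by move: fr; rewrite (le_trans _ h1) ?(le_trans h2) ?lerD2l// lerN2.
    rewrite mulr0 sub0r lerNl; apply: le_trans (ler_norm _) _.
    rewrite normrN normrM ler_pM//.
    rewrite ger0_norm ?exprn_ge0// lerXn2r ?nnegrE//; exact: far.
  have vx : a < v x.
    case: (dP x) => //; rewrite -(subrKC x0 x); apply: inball.
    by rewrite ler_distl.
  have [xJ|xJ] := boolP (x \in J); last first.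
    rewrite /kap patchE (negbTE xJ) mulr0 sub0r.
    apply: (@le_trans _ _ 0); first by rewrite oppr_le0.
    by apply: mulr_ge0; [exact: ltW (lt_trans a0 vx)|exact: exprn_ge0].
  rewrite /kap patchE xJ mulr1; apply: (@le_trans _ _ (a * r2 ^+ n)); first by rewrite gerBl.
  apply: ler_pM; [exact: ltW|by rewrite exprn_ge0// ltW|exact: ltW|].
  rewrite lerXn2r ?nnegrE ?(ltW r20)//; apply/ltW/d'P; rewrite /ball/= distrC; apply: le_lt_trans sd'.
  by move: xJ; rewrite inE /J/= in_itv/= ler_distl.
have key n : 2 * s * a * r2 ^+ n <= M * L * r1 ^+ n.
  have [cp Ap] := annihilated_peak c0 n cu u0.
  have Lv : mu.-integrable `[0, L] (EFin \o (fun x => v x * peak c0 x ^+ n)).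
    apply: L2_integrable; apply: continuous_L2 => x.
    by apply: cvgM; [exact: cv|exact: (continuous_within cp)].
  have sub : J `<=` `[0, L] by apply: sub_itv_L; apply: ltW; lra.
  have Lk : L2 L kap by exact: L2_indicator.
  have Lw : L2 L (fun x => a * r2 ^+ n * kap x - M * r1 ^+ n).
    by apply: L2B; [exact: L2Z|exact: L2_cst].
  have := le_Rintegral _ (L2_integrable Lw) Lv (lower n).
  have -> : \int[mu]_(x in `[0, L]) (v x * peak c0 x ^+ n) = 0.
    rewrite -[RHS](Ap 1%N); apply: eq_Rintegral => x _; rewrite /v; ring.
  rewrite RintegralB//; [|exact: L2_integrable (L2Z _ Lk)|exact: L2_integrable (L2_cst _)].
  rewrite RintegralZl//; last exact: L2_integrable Lk.
  have -> : \int[mu]_(x in `[0, L]) kap x = 2 * s.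
    rewrite /kap -Rintegral_mkcondr (setIidr sub) /J.
    rewrite Rintegral_cst//= lebesgue_measure_itv/= lte_fin ifT; first by rewrite /=; ring.
    by lra.
  rewrite Rintegral_cst//= lebesgue_measure_itv/= lte_fin L0/= subr0 => h;
   have {h} : a * r2 ^+ n * (2 * s) - M * r1 ^+ n * L <= 0 by apply: h.
  by rewrite subr_le0; congr (_ <= _); ring.
have ML : 0 <= M * L by rewrite mulr_ge0// ltW.
pose b := 2 * s * a / (M * L + 1).
have b0 : 0 < b by apply: divr_gt0; [apply: mulr_gt0; [exact: mulr_gt0|exact: a0]|exact: ltr_wpDl].
have rb : `|r1 / r2| < 1.
  by rewrite ger0_norm ?divr_ge0// ?(ltW r20)// ltr_pdivrMr// mul1r.
have /cvgrPdist_lt/(_ _ b0)[N _ /(_ N)] := cvg_expr rb.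
rewrite /= leqnn sub0r normrN => /(_ isT).
rewrite ger0_norm; last by rewrite exprn_ge0// divr_ge0// ltW.
rewrite expr_div_n ltr_pdivrMr ?exprn_gt0// => h.
have h1 := key N.
have : M * L * r1 ^+ N <= (M * L + 1) * r1 ^+ N by rewrite ler_wpM2r ?exprn_ge0//; lra.
move: h; rewrite /b mulrAC ltr_pdivlMr; last by lra.
by rewrite [r1 ^+ N * _]mulrC; lra.
Unshelve. all: by end_near. Qed.

Lemma efun_coefficients_eq0 u : {within `[0, L], continuous u} -> u 0 = 0 -> u L = 0 ->
  (forall k, ip L u (efun k) = 0) -> forall x, x \in `[0, L] -> u x = 0.
Proof.
move=> cu u0 uL uk x xI.
have ue k : ip L u (eigf L k) = 0.
  case: k => [|k]; last exact: uk.
  rewrite -[RHS](ip0l (L := L) u) ipC; apply: eq_Rintegral => y _.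
  by rewrite /eigf !mul0r sin0 mulr0 !mul0r.
have [->//|x0] := eqVneq x 0; have [->//|xL] := eqVneq x L.
have xI' : x \in `]0, L[.
  by move: xI; rewrite !in_itv/= => /andP[h0 hL]; rewrite !lt_neqAle h0 hL eq_sym x0 xL.
apply/eqP; rewrite eq_le !leNgt; apply/andP; split; apply/negP => ux.
  exact: (peak_positive cu xI' ue ux).
have cN : {within `[0, L], continuous (fun x => - u x)} by move=> y; apply: cvgN; exact: cu.
apply: (peak_positive cN xI'); last by rewrite oppr_gt0.
move=> k; have Lu := continuous_L2 cu.
have -> : (fun x => - u x) = (fun x => -1 * u x) by apply/funext => y; rewrite mulN1r.
by rewrite ipZ ?ue ?mulr0//; apply/continuous_L2/continuous_within/eigf_continuous.
Qed.

End Eigenfunctions.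

Lemma sum_mul_split (R : realType) (F : nat -> R) (n m : nat) :
  \sum_(j < n * m) F j = \sum_(k < n) \sum_(i < m) F (k * m + i)%N.
Proof.
elim: n => [|n IH]; first by rewrite mul0n !big_ord0.
by rewrite mulSnr big_split_ord/= IH big_ord_recr.
Qed.

Lemma cvg_bigsum (R : realType) (F : nat -> nat -> R) (l : nat -> R) J :
  (forall j, F j k @[k --> \oo] --> l j) ->
  \sum_(j < J) F j k @[k --> \oo] --> \sum_(j < J) l j.
Proof.
move=> Fl; elim: J => [|J IH].
  by rewrite big_ord0; under eq_fun do rewrite big_ord0; exact: cvg_cst.
by rewrite big_ord_recr/=; under eq_fun do rewrite big_ord_recr/=; exact: cvgD.
Qed.

(** * Completeness from synthesis *)

Section FrameCompleteness.
Context {R : realType} {E : normedModType R} (c : nat -> E -> R) (w : nat -> R).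
Hypothesis lin : forall j a u v, c j (a *: u + v) = a * c j u + c j v.
Hypothesis w0 : forall j, 0 < w j.
Hypothesis bes : forall u J, \sum_(j < J) w j * c j u ^+ 2 <= `|u| ^+ 2.
Hypothesis norm_le : forall u b, 0 <= b ->
    (forall J, \sum_(j < J) w j * c j u ^+ 2 <= b) -> `|u| ^+ 2 <= b.
Hypothesis syn : forall (x : nat -> R) b,
    (forall J, \sum_(j < J) w j * x j ^+ 2 <= b) -> exists u, forall j, c j u = x j.

(** The coefficients of a geometrically Cauchy sequence converge one by one, synthesis realises the
    limits by a vector, and finite sums pass the distance estimates to the limit. *)
Lemma hilbert_frame_of_synthesis : hilbert_frame c w.
Proof.
split => // u_ C uC.
have C0 : 0 <= C by have := uC 0%N; rewrite expr0 divr1; apply: le_trans.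
have cB j u v : c j (u - v) = c j u - c j v.
  by rewrite addrC -scaleN1r lin mulN1r addrC.
have far i k : `|u_ (i + k)%N - u_ i| <= 2 * C / 2 ^+ i.
  suff : `|u_ (i + k)%N - u_ i| <= (2 - 2 / 2 ^+ k) * C / 2 ^+ i.
    move=> /le_trans; apply; rewrite ler_pM2r ?invr_gt0 ?exprn_gt0// ler_wpM2r//.
    by rewrite gerBl divr_ge0// exprn_ge0.
  elim: k => [|k IH]; first by rewrite addn0 subrr normr0 expr0 divr1 subrr !mul0r.
  rewrite -(subrKA (u_ (i + k)%N)); apply: le_trans (ler_normD _ _) _.
  have := uC (i + k)%N; rewrite -addnS => h; apply: le_trans (lerD h IH) _.
  rewrite le_eqVlt; apply/orP; left; apply/eqP; rewrite exprD exprS; field.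
  by rewrite !expf_neq0.
have cv j : cvgn (fun i => c j (u_ i)).
  apply: (@dyadic_cvg _ _ (2 * C ^+ 2 / w j)) => k.
  rewrite ler_pdivlMr// mulr_suml.
  apply: (@le_trans _ _ (\sum_(i < k) C ^+ 2 / 2 ^+ i)).
    apply: ler_sum => i _.
    have h : w j * (c j (u_ i.+1) - c j (u_ i)) ^+ 2 <= (C / 2 ^+ i) ^+ 2.
      apply: (@le_trans _ _ (`|u_ i.+1 - u_ i| ^+ 2)); last by rewrite lerXn2r ?nnegrE ?divr_ge0 ?exprn_ge0.
      rewrite -cB; apply: le_trans (bes _ j.+1); rewrite big_ord_recr/= lerDr.
      by apply: sumr_ge0 => l _; apply: mulr_ge0; [exact: ltW|exact: sqr_ge0].
    have -> : C ^+ 2 / 2 ^+ i = 2 ^+ i * (C / 2 ^+ i) ^+ 2 by field; rewrite expf_neq0.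
    by rewrite -mulrA ler_wpM2l ?exprn_ge0// mulrC.
  have -> : \sum_(i < k) C ^+ 2 / 2 ^+ i = C ^+ 2 * (2 - 2 / 2 ^+ k).
    elim: k => [|k IH]; first by rewrite big_ord0 expr0 divr1 subrr mulr0.
    by rewrite big_ord_recr/= IH [2 ^+ k.+1]exprS; field; rewrite expf_neq0.
  by rewrite [leRHS]mulrC ler_wpM2l ?sqr_ge0// gerBl divr_ge0// exprn_ge0.
pose x j := limn (fun i => c j (u_ i)).
have close J i : \sum_(j < J) w j * (x j - c j (u_ i)) ^+ 2 <= (2 * C / 2 ^+ i) ^+ 2.
  have h : (fun k => \sum_(j < J) w j * (c j (u_ (k + i)%N) - c j (u_ i)) ^+ 2) @ \oo -->
      \sum_(j < J) w j * (x j - c j (u_ i)) ^+ 2.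
    apply: (@cvg_bigsum _ (fun j k => w j * (c j (u_ (k + i)%N) - c j (u_ i)) ^+ 2)
      (fun j => w j * (x j - c j (u_ i)) ^+ 2)) => j; apply: cvgM; first exact: cvg_cst.
    rewrite expr2; under eq_fun do rewrite expr2.
    have d : (fun k => c j (u_ (k + i)%N) - c j (u_ i)) @ \oo --> x j - c j (u_ i).
      by apply: cvgB; [rewrite (cvg_shiftn i (fun k => c j (u_ k)))|exact: cvg_cst].
    exact: cvgM.
  rewrite -(cvg_lim _ h)//; apply: limr_le; first by apply/cvg_ex; eexists; exact: h.
  apply: nearW => k; under eq_bigr do rewrite -cB.
  apply: le_trans (bes _ _) _; rewrite addnC lerXn2r ?nnegrE//.
  by rewrite divr_ge0 ?exprn_ge0// mulr_ge0.
have [u cu] : exists u, forall j, c j u = x j.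
  apply: (@syn x (2 * (2 * C) ^+ 2 + 2 * `|u_ 0%N| ^+ 2)) => J.
  apply: (@le_trans _ _ (\sum_(j < J) (2 * (w j * (x j - c j (u_ 0%N)) ^+ 2) + 2 * (w j * c j (u_ 0%N) ^+ 2)))).
    apply: ler_sum => j _.
    have -> : 2 * (w j * (x j - c j (u_ 0%N)) ^+ 2) + 2 * (w j * c j (u_ 0%N) ^+ 2) =
      w j * x j ^+ 2 + w j * (x j - 2 * c j (u_ 0%N)) ^+ 2 by ring.
    by rewrite lerDl; apply: mulr_ge0; [exact: ltW|exact: sqr_ge0].
  rewrite big_split/= -!mulr_sumr; apply: lerD; rewrite ler_pM2l//.
    by have := close J 0%N; rewrite expr0 divr1.
  exact: bes.
exists u => i; have r0 : 0 <= 2 * C / 2 ^+ i by rewrite divr_ge0 ?exprn_ge0// mulr_ge0.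
rewrite -(@ler_pXn2r _ 2)// ?nnegrE//; apply: norm_le; first exact: sqr_ge0.
by move=> J; apply: le_trans (close J i); apply: ler_sum => j _; rewrite cB cu.
Qed.

End FrameCompleteness.

(** * Functions from sine coefficients, Parseval's identity *)

Section Synthesis.
Context {R : realType} (L : R) (L0 : 0 < L).
Local Notation mu := (@lebesgue_measure R).
Implicit Types (h u g : R -> R).

Let eigv0 k := ltW (eigv_gt0 L0 k).

Lemma vanishing_primitive_lin (a : R) u g u' g' : vanishing_primitive L u g ->
  vanishing_primitive L u' g' ->
  vanishing_primitive L (fun x => a * u x + u' x) (fun x => a * g x + g' x).
Proof.
move=> [Lg ug uL] [Lg' ug' uL']; split; first exact: L2_lin.
- move=> x xI; rewrite ug// ug'//.
  have xL : x <= L by move: xI; rewrite in_itv/= => /andP[].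
  have i1 := integrable_sub (L2Z a Lg) (lexx 0) xL.
  have i2 := integrable_sub Lg' (lexx 0) xL; have i3 := integrable_sub Lg (lexx 0) xL.
  by rewrite RintegralD// RintegralZl.
- by rewrite uL uL' mulr0 addr0.
Qed.

Lemma vanishing_primitive_sum (x : nat -> R) n :
  vanishing_primitive L (fun y => \sum_(k < n) x k * efun L k y)
                        (fun y => \sum_(k < n) x k * defun L k y).
Proof.
elim: n => [|n IH].
  rewrite (_ : (fun y => \sum_(k < 0) _ * efun _ _ _) = fun=> 0); last by apply/funext => y; rewrite big_ord0.
  rewrite (_ : (fun y => \sum_(k < 0) _) = fun=> 0); last by apply/funext => y; rewrite big_ord0.
  split => //; first exact: L2_0.
  by move=> y _; rewrite Rintegral_cst// mul0r.
have := vanishing_primitive_lin (x n) (efun_vanishing_primitive L0 n) IH.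
congr (vanishing_primitive L _ _); by apply/funext => y; rewrite big_ord_recr/= addrC.
Qed.

Lemma vanishing_primitive_sub u g u' g' : vanishing_primitive L u g ->
  vanishing_primitive L u' g' ->
  vanishing_primitive L (fun x => u x - u' x) (fun x => g x - g' x).
Proof.
move=> ug ug'; have := vanishing_primitive_lin (-1) ug' ug.
by congr (vanishing_primitive L _ _); apply/funext => x; rewrite mulN1r addrC.
Qed.

Lemma ip_derivative_unique u g u' g' : vanishing_primitive L u g ->
  vanishing_primitive L u' g' -> (forall x, x \in `[0, L] -> u x = u' x) ->
  ip L g g = ip L g' g'.
Proof.
move=> ug ug' uu'; have [Ld dP _] := vanishing_primitive_sub ug ug'.
have [Lg _ _] := ug; have [Lg' _ _] := ug'.
have ae : {ae mu, forall x, x \in `[0, L] -> g x = g' x}.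
  have : {ae mu, forall x, x \in `[0, L] -> g x - g' x = 0}.
    by apply: ae_eq0_primitive => // x xI; rewrite -dP// uu'// subrr.
  apply: filterS; first exact: (ae_filter_ringOfSetsType mu).
  by move=> x + xI => /(_ xI)/eqP; rewrite subr_eq0 => /eqP.
by rewrite (ip_ae Lg Lg' Lg)// [LHS]ipC (ip_ae Lg Lg' Lg').
Qed.

Lemma ip_primitive_le u g : vanishing_primitive L u g -> ip L u u <= L ^+ 2 * ip L g g.
Proof.
move=> ug; have Lu := primitive_L2 L0 ug.
apply: (@le_trans _ _ (\int[mu]_(x in `[0, L]) (L * ip L g g))).
  apply: le_Rintegral => //; first exact: L2_integrableM.
    exact: (L2_integrable (L2_cst _)).
  by move=> x xI; rewrite -expr2; exact: (primitive_le L0 ug xI).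
rewrite Rintegral_cst//= lebesgue_measure_itv/= lte_fin L0/= subr0.
by rewrite expr2 mulrAC.
Qed.

Lemma ip_sub_sum p h n : (forall k, L2 L (p k)) -> orthonormal (L := L) p -> L2 L h ->
  ip L (fun x => h x - \sum_(k < n) ip L h (p k) * p k x)
       (fun x => h x - \sum_(k < n) ip L h (p k) * p k x) =
  ip L h h - \sum_(k < n) ip L h (p k) ^+ 2.
Proof.
move=> Lp op Lh; pose c k := ip L h (p k); have Ls := L2_bigsum c n Lp.
have -> : (fun x => h x - \sum_(k < n) ip L h (p k) * p k x) =
   (fun x => -1 * (\sum_(k < n) c k * p k x) + h x).
  by apply/funext => x; rewrite mulN1r addrC.
rewrite ip_sqrD// ip_orthonormal_sqr// ip_bigsum//.
have -> : \sum_(k < n) c k * ip L (p k) h = \sum_(k < n) c k ^+ 2.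
  by apply: eq_bigr => k _; rewrite ipC expr2.
by rewrite sqrrN expr1n -/c; lra.
Qed.

Lemma ip_derivative_remainder u g n : vanishing_primitive L u g ->
  ip L (fun y => g y - \sum_(k < n) ip L u (efun L k) * defun L k y)
       (fun y => g y - \sum_(k < n) ip L u (efun L k) * defun L k y) =
  ip L g g - \sum_(k < n) eigv L k * ip L u (efun L k) ^+ 2.
Proof.
move=> ug; have [Lg _ _] := ug.
under [in RHS]eq_bigr do rewrite -[X in X * _]sqr_sqrtr ?eigv0// -exprMn -(ip_defun_normed L0 _ ug).
rewrite -(ip_sub_sum _ (defun_normed_L2 L) (defun_normed_orthonormal L0))//.
suff -> : (fun y => g y - \sum_(k < n) ip L u (efun L k) * defun L k y) =
  (fun y => g y - \sum_(k < n) ip L g (defun_normed L k) * defun_normed L k y) by [].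
apply/funext => y; congr (_ - _); apply: eq_bigr => k _.
rewrite (ip_defun_normed L0 _ ug) /defun_normed.
have : Num.sqrt (eigv L k) != 0 by rewrite gt_eqF// sqrtr_gt0 eigv_gt0.
by set s := Num.sqrt _ => s0; field.
Qed.

Lemma ip_defun_sum_sqr (x : nat -> R) n :
  ip L (fun y => \sum_(k < n) x k * defun L k y) (fun y => \sum_(k < n) x k * defun L k y) =
  \sum_(k < n) eigv L k * x k ^+ 2.
Proof.
have -> : (fun y => \sum_(k < n) x k * defun L k y) =
    (fun y => \sum_(k < n) (x k * Num.sqrt (eigv L k)) * defun_normed L k y).
  apply/funext => y; apply: eq_bigr => k _; rewrite /defun_normed.
  have : Num.sqrt (eigv L k) != 0 by rewrite gt_eqF// sqrtr_gt0 eigv_gt0.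
  by set s := Num.sqrt _ => s0; field.
rewrite (ip_orthonormal_sqr (fun k => x k * Num.sqrt (eigv L k)) _ (defun_normed_L2 L) (defun_normed_orthonormal L0)).
by apply: eq_bigr => k _; rewrite exprMn sqr_sqrtr// mulrC.
Qed.

Lemma sub_partial_sums (F : nat -> R) n n' : (n <= n')%N ->
  \sum_(k < n') F k - \sum_(k < n) F k = \sum_(k < n') (if (n <= k)%N then F k else 0).
Proof.
move=> nn'; rewrite (big_ord_widen n' F nn') (bigID (fun k : 'I_n' => (k < n)%N))/=.
by rewrite addrAC subrr add0r big_mkcond/=; apply: eq_bigr => k _; rewrite -leqNgt.
Qed.

(** The derivatives of the partial sums converge in L^2 to some [g], geometrically along a
    subsequence, and [u] is the primitive of [g]. The last clause is the hard half of Parseval's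
    identity; it is accessible here because [u] is built as a limit of partial sums. *)
Lemma sine_synthesis (x : nat -> R) b :
  (forall n, \sum_(k < n) (1 + eigv L k) * x k ^+ 2 <= b) ->
  exists u g, [/\ vanishing_primitive L u g, forall k, ip L u (efun L k) = x k &
   forall e, 0 < e -> exists n, ip L u u + ip L g g <= \sum_(k < n) (1 + eigv L k) * x k ^+ 2 + e].
Proof.
move=> xb.
have F0 k : 0 <= (1 + eigv L k) * x k ^+ 2.
  by apply: mulr_ge0; [rewrite addr_ge0|exact: sqr_ge0].
have tail i : exists N, forall n, \sum_(k < n | (N <= k)%N) (1 + eigv L k) * x k ^+ 2 <= (1 / 2 ^+ i) ^+ 2.
  by apply: (bounded_sum_tail F0 xb); rewrite exprn_gt0// divr_gt0// exprn_gt0.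
have [N NP] := choice tail.
(* Nondecreasing in [i], at least [N i] for the geometric rate, and at least [i] so that every
   coefficient is eventually included. *)
pose N' i := (i + \sum_(j < i.+1) N j)%N.
have NN' i : (N i <= N' i)%N by rewrite /N' big_ord_recr/= addnA leq_addl.
have N'i i : (i <= N' i)%N by rewrite leq_addr.
have N'S i : (N' i <= N' i.+1)%N by rewrite /N' leq_add// [in leqRHS]big_ord_recr/= leq_addr.
pose p n := (fun y => \sum_(k < n) x k * defun L k y).
have qp n := vanishing_primitive_sum x n.
have Lp n : L2 L (p n) by case: (qp n).
have [|g [Lg gP]] := @L2_complete _ L (fun i => p (N' i)) 1 (fun i => Lp _).
  move=> i; apply: le_trans (NP i (N' i.+1)).
  have -> : (fun y => p (N' i.+1) y - p (N' i) y) =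
      (fun y => \sum_(k < N' i.+1) (if (N' i <= k)%N then x k else 0) * defun L k y).
    apply/funext => y; rewrite /p (@sub_partial_sums (fun k => x k * defun L k y) _ _ (N'S i)).
    by apply: eq_bigr => k _; case: ifP => // _; rewrite mul0r.
  rewrite (ip_defun_sum_sqr (fun k => if (N' i <= k)%N then x k else 0)) [leRHS]big_mkcond/=.
  apply: ler_sum => k _; case: ifP => [Nk|_].
    rewrite (leq_trans (NN' i) Nk) ler_wpM2r ?sqr_ge0// lerDr//.
  rewrite expr0n mulr0; case: ifP => // _; exact: F0.
pose u y := \int[mu]_(z in `[0, y]) g z.
have small i : ip L (fun y => g y - p (N' i) y) (fun y => g y - p (N' i) y) <= 4 / 2 ^+ i.
  apply: le_trans (gP i) _; rewrite mulr1 expr_div_n expr2 -natrM ler_pM2l// lef_pV2 ?posrE ?exprn_gt0//.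
  by rewrite -exprM muln2 ler_weXn2l ?ler1n// -addnn leq_addr.
have Ld i : L2 L (fun y => g y - p (N' i) y) by exact: L2B.
have ug : vanishing_primitive L u g.
  split => //; apply/eqP; rewrite -sqrf_eq0 eq_le sqr_ge0 andbT.
  apply: (@le0_geometric _ _ (L * 4)) => i.
  have -> : u L = \int[mu]_(z in `[0, L]) (g z - p (N' i) z).
    rewrite RintegralB//; [|exact: L2_integrable..].
    have [_ pE pL] := qp (N' i); rewrite -(pE L) ?pL ?subr0//.
    by rewrite in_itv/= lexx ltW.
  apply: le_trans (integral_sqr_le (Ld i) (lexx 0) (ltW L0) (lexx L)) _.
  by rewrite subr0 -mulrA ler_pM2l.
have ux k : ip L u (efun L k) = x k.
  have l0 := eigv_gt0 L0 k.
  apply/eqP; rewrite -subr_eq0; apply/eqP/(@mulfI _ (eigv L k)); first by rewrite gt_eqF.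
  rewrite mulr0; apply/eqP; rewrite -sqrf_eq0 eq_le sqr_ge0 andbT.
  apply: (@le0_geometric _ _ (ip L (defun L k) (defun L k) * 4)) => i.
  have kN : (k < N' (k.+1 + i))%N by apply: leq_trans (N'i _); rewrite leq_addr.
  have -> : eigv L k * (ip L u (efun L k) - x k) = ip L (fun y => g y - p (N' (k.+1 + i)%N) y) (defun L k).
    rewrite ipB//; last exact: defun_L2.
    rewrite (ip_primitive_defun L0 k ug) (ip_primitive_defun L0 k (qp _)) mulrBr; congr (_ - _ * _).
    by rewrite (ip_orthonormal_sum _ _ _ (efun_L2 L) (efun_orthonormal L0)) kN.
  apply: le_trans (ip_CS (Ld _) (defun_L2 L k)) _.
  rewrite mulrC -mulrA ler_wpM2l ?ip_ge0//; apply: le_trans (small _) _.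
  by rewrite ler_pM2l// lef_pV2 ?posrE ?exprn_gt0// ler_weXn2l ?ler1n// leq_addl.
exists u, g; split => // e e0.
have [i ie] := ltr_pow2_archi ((1 + L ^+ 2) * 4 / e).
exists (N' i).
have Eg := ip_derivative_remainder (N' i) ug.
have Eu := ip_sub_sum (N' i) (efun_L2 L) (efun_orthonormal L0) (primitive_L2 L0 ug).
have := ip_primitive_le (vanishing_primitive_sub ug (qp (N' i))).
move: Eg Eu; under eq_fun do under eq_bigr do rewrite ux.
under [X in _ = _ - X -> _]eq_bigr do rewrite ux.
move=> Eg; under eq_fun do under eq_bigr do rewrite ux.
under [X in _ = _ - X -> _]eq_bigr do rewrite ux.
move=> Eu; rewrite Eu => h.
under eq_bigr do rewrite mulrDl mul1r.
rewrite big_split/=.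
have s1 := small i; rewrite Eg in s1.
have s2 : (1 + L ^+ 2) * (4 / 2 ^+ i) <= e.
  rewrite mulrA ler_pdivrMr ?exprn_gt0//; move: ie; rewrite ltr_pdivrMr// => /ltW.
  by rewrite [e * _]mulrC.
have s3 : L ^+ 2 * ip L (fun y => g y - p (N' i) y) (fun y => g y - p (N' i) y) <= L ^+ 2 * (4 / 2 ^+ i).
  by rewrite ler_wpM2l ?sqr_ge0.
have s4 := le_trans h s3.
by move: s1 s2 s4; rewrite mulrDl mul1r; lra.
Qed.

(** Resynthesise a function from the coefficients of [u]. By completeness of the sines it is [u]
    itself, so the norm estimate of the synthesised function applies to [u]. *)
Lemma primitive_norm_approx u g : vanishing_primitive L u g ->
  forall e, 0 < e -> exists n,
    ip L u u + ip L g g <= \sum_(k < n) (1 + eigv L k) * ip L u (efun L k) ^+ 2 + e.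
Proof.
move=> ug e e0; have [Lg _ uL] := ug; have Lu := primitive_L2 L0 ug.
have [|u' [g' [ug' c' /(_ e e0)[n nP]]]] := @sine_synthesis (fun k => ip L u (efun L k)) (ip L u u + ip L g g).
  move=> n; under eq_bigr do rewrite mulrDl mul1r.
  rewrite big_split/= lerD//; first exact: bessel (efun_L2 L) (efun_orthonormal L0) Lu.
  exact: bessel_primitive.
exists n; have uu' y : y \in `[0, L] -> u y = u' y.
  move=> yI; apply/eqP; rewrite -subr_eq0; apply/eqP.
  have d := vanishing_primitive_sub ug ug'.
  apply: (efun_coefficients_eq0 L0 (primitive_continuous L0 d)) => //.
  - exact: (primitive_at0 L0 d).
  - by case: d.
  - move=> k; rewrite ipB ?c' ?subrr//; [exact: primitive_L2 ug'|exact: efun_L2].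
rewrite (ip_derivative_unique ug ug' uu').
have -> : ip L u u = ip L u' u' by apply: eq_Rintegral => y /set_mem yI; rewrite uu'.
exact: nP.
Qed.

End Synthesis.

Lemma sum_cauchy_schwarz (R : realType) (P : pred nat) (a b : nat -> R) n :
  (\sum_(k < n | P k) a k * b k) ^+ 2 <=
  (\sum_(k < n | P k) a k ^+ 2) * \sum_(k < n | P k) b k ^+ 2.
Proof.
set A := \sum_(k < n | P k) a k ^+ 2; set B := \sum_(k < n | P k) b k ^+ 2.
set S := \sum_(k < n | P k) a k * b k.
have sq t s : 0 <= t ^+ 2 * A + 2 * t * s * S + s ^+ 2 * B.
  have -> : t ^+ 2 * A + 2 * t * s * S + s ^+ 2 * B = \sum_(k < n | P k) (t * a k + s * b k) ^+ 2.
    rewrite /A /B /S !mulr_sumr -!big_split/=; apply: eq_bigr => k _; ring.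
  by apply: sumr_ge0 => k _; exact: sqr_ge0.
have A0 : 0 <= A by apply: sumr_ge0 => k _; exact: sqr_ge0.
have B0 : 0 <= B by apply: sumr_ge0 => k _; exact: sqr_ge0.
have := sq S (- A); have -> : S ^+ 2 * A + 2 * S * - A * S + (- A) ^+ 2 * B = A * (A * B - S ^+ 2) by ring.
move: A0; rewrite le_eqVlt => /predU1P[A0|A0]; last by rewrite pmulr_rge0// subr_ge0.
move=> _; have := sq (B + 1) (- S).
rewrite -A0 mulr0 add0r mul0r => h.
have : 0 <= - (S ^+ 2 * (B + 2)) by apply: le_trans h _; rewrite le_eqVlt; apply/orP; left; apply/eqP; ring.
by rewrite oppr_ge0 pmulr_lle0//; lra.
Qed.

(** Comparison with the telescoping differences [1 / q - 1 / (q + 1)]. *)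
Lemma sum_inv_sqr_le (R : realType) (K n : nat) : (0 < K)%N ->
  \sum_(k < n | (K <= k)%N) (k.+1%:R ^+ 2)^-1 <= K%:R^-1 :> R.
Proof.
move=> K0; elim: n => [|n IH]; first by rewrite big_ord0 invr_ge0.
have [nK|Kn] := ltnP n K.
  rewrite big1 ?invr_ge0// => k Kk; exfalso.
  by have := leq_trans nK (leq_trans Kk (leq_ord k)); rewrite ltnn.
suff : \sum_(k < n.+1 | (K <= k)%N) (k.+1%:R ^+ 2)^-1 <= K%:R^-1 - n.+1%:R^-1 :> R.
  by move=> /le_trans; apply; rewrite gerBl invr_ge0.
move: Kn {IH}; elim: n => [|n IH]; first by rewrite leqn0 => /eqP E; rewrite E in K0.
have step q : (0 < q)%N -> (q.+1%:R ^+ 2)^-1 <= q%:R^-1 - q.+1%:R^-1 :> R.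
  move=> q0; have q1 : 0 < q%:R :> R by rewrite ltr0n.
  rewrite -[q.+1%:R]natr1; set t := q%:R in q1 *.
  have -> : t^-1 - (t + 1)^-1 = (t * (t + 1))^-1 by field; rewrite !gt_eqF//; lra.
  rewrite lef_pV2 ?posrE ?exprn_gt0 ?mulr_gt0//; [|lra..].
  by rewrite expr2 ler_pM2r; lra.
rewrite leq_eqVlt => /predU1P[<-|Kn].
  rewrite big_mkcond big_ord_recr/= leqnn big1 ?add0r; first exact: step.
  by move=> k _; rewrite leqNgt ltn_ord.
rewrite big_mkcond big_ord_recr/= (ltnW Kn) -big_mkcond/=.
move: (IH Kn) (step n.+1 isT); set s := \sum_(_ < _ | _) _; set d := n.+2%:R ^- 2.
by set a := K%:R^-1; set b := n.+1%:R^-1; set c := n.+2%:R^-1; lra.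
Qed.

(** * Rates of approximation and uniform tails *)

Section ScalarEstimates.
Context {R : realType} (L : R) (L0 : 0 < L).
Local Notation mu := (@lebesgue_measure R).
Implicit Types (h u g : R -> R).

(** Cauchy-Schwarz bounds the modes from [K] to [n] by the derivative norm times the sum of
    [efun^2 / eigv], which is at most [L / K]. Beyond [n] the derivative has almost no mass left by
    [primitive_norm_approx], and [primitive_le] turns this into a pointwise bound. *)
Lemma partial_sum_remainder u g (K : nat) x : vanishing_primitive L u g -> (0 < K)%N ->
  x \in `[0, L] -> (u x - \sum_(k < K) ip L u (efun L k) * efun L k x) ^+ 2 <=
    2 * L / K%:R * ip L g g.
Proof.
move=> ug K0 xI; pose c k := ip L u (efun L k).
pose S n := \sum_(k < n) c k * efun L k x.
have K0' : 0 < K%:R :> R by rewrite ltr0n.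
apply/ler_addgt0Pr => e e0.
have [n0 n0P] := primitive_norm_approx L0 ug (divr_gt0 e0 (mulr_gt0 (ltr0n R 2) L0)).
pose n := maxn n0 K.
have Lu := primitive_L2 L0 ug.
have h1 : (u x - S n) ^+ 2 <= e / 2.
  apply: le_trans (primitive_le L0 (vanishing_primitive_sub ug (vanishing_primitive_sum L0 c n)) xI) _.
  rewrite (ip_derivative_remainder L0 n ug).
  have := bessel n0 (efun_L2 L) (efun_orthonormal L0) Lu => bu.
  have : \sum_(k < n0) eigv L k * c k ^+ 2 <= \sum_(k < n) eigv L k * c k ^+ 2.
    rewrite -subr_ge0 (@sub_partial_sums _ (fun k => eigv L k * c k ^+ 2) n0 n (leq_maxl _ _)).
    apply: sumr_ge0 => k _; case: ifP => // _; apply: mulr_ge0; [exact/ltW/eigv_gt0|exact: sqr_ge0].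
  move: n0P; under eq_bigr do rewrite mulrDl mul1r.
  rewrite big_split/= -/c; move=> h2 h3.
  have {h2 h3} : ip L g g - \sum_(k < n) eigv L k * c k ^+ 2 <= e / (2 * L) by move: bu; rewrite -/c; lra.
  by rewrite -(ler_pM2l L0); congr (_ <= _); field; rewrite gt_eqF.
have h2 : (S n - S K) ^+ 2 <= L / K%:R * ip L g g.
  rewrite /S (@sub_partial_sums _ (fun k => c k * efun L k x) K n (leq_maxr _ _)) -big_mkcond/=.
  have l0 k := eigv_gt0 L0 k.
  have -> : \sum_(k < n | (K <= k)%N) c k * efun L k x =
     \sum_(k < n | (K <= k)%N) (Num.sqrt (eigv L k) * c k) * (efun L k x / Num.sqrt (eigv L k)).
    apply: eq_bigr => k _; have : Num.sqrt (eigv L k) != 0 by rewrite gt_eqF// sqrtr_gt0.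
    by set s := Num.sqrt _ => s0; field.
  apply: le_trans (sum_cauchy_schwarz (fun k => K <= k)%N (fun k => Num.sqrt (eigv L k) * c k)
    (fun k => efun L k x / Num.sqrt (eigv L k)) n) _.
  rewrite mulrC; apply: ler_pM; try by apply: sumr_ge0 => k _; exact: sqr_ge0.
    apply: (@le_trans _ _ (\sum_(k < n | (K <= k)%N) L * (k.+1%:R ^+ 2)^-1)).
      apply: ler_sum => k _; rewrite expr_div_n sqr_sqrtr ?(ltW (l0 _))//.
      rewrite ler_pdivrMr// /eigv.
      have p0 : 0 < pi ^+ 2 :> R by rewrite exprn_gt0// pi_gt0.
      have -> : L * (k.+1%:R ^+ 2)^-1 * (k.+1%:R * pi / L) ^+ 2 = pi ^+ 2 / L.
        by field; rewrite gt_eqF//= pnatr_eq0.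
      apply: (@le_trans _ _ (2 / L)).
        have := efun_le L k x; rewrite -(@ler_pXn2r _ 2)// ?nnegrE ?sqrtr_ge0//.
        by rewrite sqr_sqrtr ?divr_ge0 ?(ltW L0)// real_normK ?num_real.
      rewrite ler_pM2r ?invr_gt0//; have := pi_ge2 R => pi2.
      apply: (@le_trans _ _ (2 ^+ 2)); first by rewrite expr2; lra.
      by rewrite lerXn2r ?nnegrE ?pi_ge0.
    by rewrite -mulr_sumr ler_wpM2l ?(ltW L0)//; exact: sum_inv_sqr_le.
  apply: le_trans (bessel_primitive L0 n ug); rewrite big_mkcond/=; apply: ler_sum => k _.
  rewrite exprMn sqr_sqrtr ?(ltW (l0 _))//; case: ifP => // _.
  by apply: mulr_ge0; [exact: ltW|exact: sqr_ge0].
have -> : u x - S K = (u x - S n) + (S n - S K) by ring.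
have : (u x - S n + (S n - S K)) ^+ 2 <= 2 * (u x - S n) ^+ 2 + 2 * (S n - S K) ^+ 2.
  rewrite -subr_ge0.
  have -> : 2 * (u x - S n) ^+ 2 + 2 * (S n - S K) ^+ 2 - (u x - S n + (S n - S K)) ^+ 2 =
    ((u x - S n) - (S n - S K)) ^+ 2 by ring.
  exact: sqr_ge0.
have -> : 2 * L / K%:R * ip L g g = 2 * (L / K%:R * ip L g g) by rewrite !mulrA.
by lra.
Qed.

Lemma tail_le_bessel (h : R -> R) (J n : nat) : L2 L h ->
  \sum_(k < n | (J <= k)%N) ip L h (efun L k) ^+ 2 <= ip L h h.
Proof.
move=> Lh; apply: le_trans (bessel n (efun_L2 L) (efun_orthonormal L0) Lh).
by rewrite big_mkcond/=; apply: ler_sum => k _; case: ifP => // _; exact: sqr_ge0.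
Qed.

Lemma coefficient_tail (h : R -> R) e : L2 L h -> 0 < e ->
  exists J, forall n, \sum_(k < n | (J <= k)%N) ip L h (efun L k) ^+ 2 <= e.
Proof.
move=> Lh; apply: (@bounded_sum_tail _ (fun k => ip L h (efun L k) ^+ 2) (ip L h h)).
  by move=> k; exact: sqr_ge0.
by move=> n; exact: bessel (efun_L2 L) (efun_orthonormal L0) Lh.
Qed.

Definition holder_half (A : R) h := (forall x, x \in `[0, L] -> `|h x| <= A) /\
  forall x y, x \in `[0, L] -> y \in `[0, L] -> `|h y - h x| <= A * Num.sqrt `|y - x|.

Lemma holder_half_continuous A h : holder_half A h -> {within `[0, L], continuous h}.
Proof.
move=> [hA hH]; apply/subspace_continuousP => x xI; apply/cvgrPdist_le => e e0.
have A0 : 0 <= A by apply: le_trans (hA x xI).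
have A1 : 0 < A + 1 by rewrite ltr_wpDl.
have d0 : 0 < (e / (A + 1)) ^+ 2 by rewrite exprn_gt0// divr_gt0.
rewrite /= near_withinE; near=> y => yI.
rewrite distrC; apply: le_trans (hH x y xI yI) _.
have h1 : Num.sqrt `|y - x| <= e / (A + 1).
  have -> : e / (A + 1) = Num.sqrt ((e / (A + 1)) ^+ 2).
    by rewrite sqrtr_sqr ger0_norm// divr_ge0// ltW.
  apply: ler_wsqrtr; near: y; apply: filterS (nbhsx_ballx x _ d0) => z.
  by rewrite /ball/= distrC => /ltW.
apply: (@le_trans _ _ (A * (e / (A + 1)))); first by rewrite ler_wpM2l.
by rewrite mulrA ler_pdivrMr// mulrC ler_pM2l// lerDl.
Unshelve. all: by end_near. Qed.

(* Equi-Hoelder functions are uniformly close to step functions on a common finite grid, so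
   their sine coefficients have uniformly small tails. *)
Lemma holder_half_tail (e : R) : 0 < e -> exists J, forall A h, holder_half A h ->
  forall n, \sum_(k < n | (J <= k)%N) ip L h (efun L k) ^+ 2 <= e * A ^+ 2.
Proof.
move=> e0.
have [N [N0 NP]] : exists N : nat, (0 < N)%N /\ L ^+ 2 / N%:R <= e / 4.
  have z0 : 0 <= L ^+ 2 / (e / 4) by rewrite divr_ge0 ?sqr_ge0// divr_ge0// ltW.
  exists (Num.bound (L ^+ 2 / (e / 4))).+1; split => //.
  rewrite ler_pdivrMr ?ltr0n// mulrC -ler_pdivrMr ?divr_gt0//.
  by apply/ltW; apply: lt_le_trans (archi_boundP z0) _; rewrite ler_nat.
have N0' : 0 < N%:R :> R by rewrite ltr0n.
pose X p : R := L * (p%:R / N%:R).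
(* There are [N + 1] half-open cells, the last one starting at [L], so that the right end point is
   covered too. *)
pose chi p : R -> R := (cst 1 : R -> R) \_ [set` `[X p, X p.+1[].
have Lchi p : L2 L (chi p) by exact: L2_indicator.
(* Cauchy-Schwarz over the cells and the summation over them each cost a factor [N + 1]. *)
pose d := e / 4 / N.+1%:R ^+ 2.
have d0 : 0 < d by rewrite !divr_gt0// exprn_gt0.
have [J JP] := choice (fun p => coefficient_tail (Lchi p) d0).
exists (\sum_(p < N.+1) J p)%N => A h hh n.
have [hA hH] := hh; have Lh := continuous_L2 (holder_half_continuous hh).
have I0 : 0 \in `[0, L] by rewrite in_itv/= lexx ltW.
have A0 : 0 <= A by apply: le_trans (hA 0 I0).
pose s x := \sum_(p < N.+1) h (X p) * chi p x.
have Ls : L2 L s := L2_bigsum (fun p => h (X p)) N.+1 Lchi.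
have XI p : (p < N.+1)%N -> X p \in `[0, L].
  move=> pN; rewrite in_itv/= mulr_ge0 ?(ltW L0) ?divr_ge0//= ler_piMr ?(ltW L0)//.
  by rewrite ler_pdivrMr// mul1r ler_nat.
have close x : x \in `[0, L] -> `|h x - s x| <= A * Num.sqrt (L / N%:R).
  move=> xI; have /andP[x0 xL] : 0 <= x <= L by move: xI; rewrite in_itv.
  pose p := Num.truncn (x / L * N%:R).
  have t0 : 0 <= x / L * N%:R by rewrite mulr_ge0// divr_ge0// ltW.
  have /andP[p1 p2] := truncn_itv t0.
  have pN : (p < N.+1)%N.
    rewrite ltnS -(ler_nat R); apply: le_trans p1 _.
    by rewrite ler_piMl// ler_pdivrMr// mul1r.
  have Xp : X p <= x.
    by move: p1; rewrite -(ler_pM2l (divr_gt0 L0 N0')); congr (_ <= _); rewrite /X; field; rewrite !gt_eqF.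
  have Xp1 : x < X p.+1.
    by move: p2; rewrite -(ltr_pM2l (divr_gt0 L0 N0')); congr (_ < _); rewrite /X; field; rewrite !gt_eqF.
  have chiE q : chi q x = (q == p)%:R.
    rewrite /chi patchE; have [->|qp] := eqVneq q p.
      by rewrite mem_set//= in_itv/= Xp.
    rewrite memNset//= in_itv/= => /andP[q1 q2]; move/negP : qp; apply; rewrite eqn_leq; apply/andP; split.
      rewrite -ltnS -(ltr_nat R); have := le_lt_trans q1 Xp1.
      by rewrite /X ltr_pM2l// ltr_pM2r ?invr_gt0.
    rewrite -ltnS -(ltr_nat R); have := le_lt_trans Xp q2.
    by rewrite /X ltr_pM2l// ltr_pM2r ?invr_gt0.
  have -> : s x = h (X p).
    rewrite /s (bigD1 (Ordinal pN))//= chiE eqxx mulr1 big1 ?addr0// => q qp.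
    by rewrite chiE (negbTE (_ : val q != p)) ?mulr0//.
  apply: le_trans (hH _ _ (XI p pN) xI) _; rewrite ler_wpM2l// ler_wsqrtr//.
  rewrite ger0_norm ?subr_ge0//; apply: (@le_trans _ _ (X p.+1 - X p)); first by rewrite lerD2r ltW.
  by rewrite /X -mulrBr -mulrBl -[p.+1%:R]natr1 addrAC subrr add0r mul1r.
have Lhs : L2 L (fun x => h x - s x) by exact: L2B.
have err : ip L (fun x => h x - s x) (fun x => h x - s x) <= e / 4 * A ^+ 2.
  apply: (@le_trans _ _ (ip L (fun=> A * Num.sqrt (L / N%:R)) (fun=> A * Num.sqrt (L / N%:R)))).
    apply: ip_le => //; first exact: L2_cst.
    move=> x xI; rewrite [leRHS]ger0_norm; first exact: close.
    by rewrite mulr_ge0// sqrtr_ge0.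
  rewrite /ip Rintegral_cst//= lebesgue_measure_itv/= lte_fin L0/= subr0 -expr2 exprMn.
  rewrite sqr_sqrtr ?divr_ge0 ?(ltW L0)//.
  have -> : A ^+ 2 * (L / N%:R) * L = L ^+ 2 / N%:R * A ^+ 2 by ring.
  by rewrite ler_wpM2r ?sqr_ge0.
have step : \sum_(k < n | (\sum_(p < N.+1) J p <= k)%N) ip L s (efun L k) ^+ 2 <= e / 4 * A ^+ 2.
  apply: (@le_trans _ _ (\sum_(k < n | (\sum_(p < N.+1) J p <= k)%N)
     (N.+1%:R * A ^+ 2 * \sum_(p < N.+1) ip L (chi p) (efun L k) ^+ 2))).
    apply: ler_sum => k _; rewrite (ip_bigsum (fun p => h (X p)) N.+1 Lchi (efun_L2 L k)).
    apply: le_trans (sum_cauchy_schwarz predT (fun p => h (X p)) (fun p => ip L (chi p) (efun L k)) N.+1) _.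
    rewrite ler_wpM2r//; first by apply: sumr_ge0 => p _; exact: sqr_ge0.
    apply: (@le_trans _ _ (\sum_(p < N.+1) A ^+ 2)).
      apply: ler_sum => p _; rewrite -(real_normK (num_real _)) lerXn2r ?nnegrE//.
      by apply: hA; exact: XI.
    by rewrite sumr_const card_ord -[leLHS]mulr_natl.
  rewrite -mulr_sumr exchange_big/=.
  apply: (@le_trans _ _ (N.+1%:R * A ^+ 2 * \sum_(p < N.+1) d)).
    rewrite ler_wpM2l ?mulr_ge0 ?sqr_ge0//; apply: ler_sum => p _.
    apply: le_trans (JP p n); rewrite big_mkcond [leRHS]big_mkcond/=; apply: ler_sum => k _.
    case: ifP => [hk|_]; last by case: ifP => // _; exact: sqr_ge0.
    by rewrite (leq_trans _ hk)// (bigD1 p)//= leq_addr.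
  rewrite sumr_const card_ord -mulr_natl /d le_eqVlt; apply/orP; left; apply/eqP.
  have n0 : N.+1%:R != 0 :> R by rewrite pnatr_eq0.
  by move: n0; set q := N.+1%:R => n0; field.
apply: (@le_trans _ _ (\sum_(k < n | (\sum_(p < N.+1) J p <= k)%N)
   (2 * ip L (fun x => h x - s x) (efun L k) ^+ 2 + 2 * ip L s (efun L k) ^+ 2))).
  apply: ler_sum => k _; rewrite ipB//; last exact: efun_L2.
  rewrite -subr_ge0; set a := ip L h _; set b := ip L s _.
  have -> : 2 * (a - b) ^+ 2 + 2 * b ^+ 2 - a ^+ 2 = (a - 2 * b) ^+ 2 by ring.
  exact: sqr_ge0.
rewrite big_split/= -!mulr_sumr.
have := tail_le_bessel (\sum_(p < N.+1) J p)%N n Lhs.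
move: err step; set a := ip L _ _; set b := \sum_(_ < _ | _) _; set c := \sum_(_ < _ | _) _.
by move=> h1 h2 h3; lra.
Qed.

End ScalarEstimates.

Lemma cV_point (R : realType) (m : nat) : point = 0 :> 'cV[R]_m.
Proof. by apply/colP => i; rewrite !mxE. Qed.

(** * Vector valued H^1_0 as a Hilbert frame *)

Section H10Frame.
Context {R : realType} (L : R) (L0 : 0 < L) (m : nat) (m0 : (0 < m)%N).
Local Notation mu := (@lebesgue_measure R).
Implicit Types (u v : H10 L m).

Lemma H10_vanishing u : forall x, x \notin `]0, L[ -> u x = 0.
Proof. by have := valP u; rewrite inE => -[]. Qed.

Lemma H10_primitive u (i : 'I_m) : vanishing_primitive L (fun x => u x i 0) (fun x => dx L u x i 0).
Proof.
have [Lg ug] := dxP u; split => //.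
  by move=> x xI; rewrite ug// H10_vanishing ?in_itv/= ?ltxx// mxE add0r.
by rewrite H10_vanishing ?in_itv/= ?ltxx ?andbF// mxE.
Qed.

Lemma is_H10_primitives (w g : R -> 'cV[R]_m) :
  (forall i, vanishing_primitive L (fun x => w x i 0) (fun x => g x i 0)) ->
  is_H10 L (w \_ `[0, L]).
Proof.
move=> wg; have w0 x : x \notin `]0, L[ -> (w \_ `[0, L]) x = 0.
  move=> xI; have [xJ|/negP xJ] := boolP (x \in `[0, L]); last first.
    by rewrite patchE memNset//=; exact: cV_point.
  rewrite patchE mem_set//; move: xJ; rewrite in_itv/= => /andP[x0 xL].
  move: xI; rewrite in_itv/= negb_and -!leNgt => /orP[x0'|xL'].
    have -> : x = 0 by apply/eqP; rewrite eq_le x0 x0'.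
    by apply/colP => i; rewrite mxE; exact: (primitive_at0 L0 (wg i)).
  have -> : x = L by apply/eqP; rewrite eq_le xL xL'.
  by apply/colP => i; rewrite mxE; case: (wg i).
have wE x : x \in `[0, L] -> (w \_ `[0, L]) x = w x by move=> xI; rewrite patchE mem_set.
split => //.
  move=> i; rewrite /L2.
  have -> : (fun x => (w \_ `[0, L]) x i 0) \_ `[0, L] = (fun x => w x i 0) \_ `[0, L].
    apply/funext => x; rewrite patchE [RHS]patchE.
    by case: ifPn => // xI; rewrite patchE xI.
  exact: (primitive_L2 L0 (wg i)).
exists g; split; first by move=> i; case: (wg i).
have w00 : (w \_ `[0, L]) 0 = 0 by apply: w0; rewrite in_itv/= ltxx.
move=> i x xI; rewrite w00 mxE add0r wE//.
by have [_ wi _] := wg i; exact: wi.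
Qed.

Lemma embed_val (w g : R -> 'cV[R]_m) :
  (forall i, vanishing_primitive L (fun x => w x i 0) (fun x => g x i 0)) ->
  forall x, x \in `[0, L] -> embed L w x = w x.
Proof.
move=> wg x xI; rewrite /embed insubdK; first by rewrite patchE mem_set.
by rewrite inE; exact: (is_H10_primitives wg).
Qed.

Lemma H10_ext u v : (forall x, x \in `[0, L] -> u x = v x) -> u = v.
Proof.
move=> uv; apply/val_inj/funext => x /=; have [xI|xI] := boolP (x \in `]0, L[).
  by apply: uv; move: xI; rewrite !in_itv/= => /andP[/ltW -> /ltW ->].
by rewrite (H10_vanishing u)// (H10_vanishing v).
Qed.

Lemma H10_norm_sqr u : `|u| ^+ 2 =
  \sum_(i < m) (ip L (fun x => u x i 0) (fun x => u x i 0) +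
                ip L (fun x => dx L u x i 0) (fun x => dx L u x i 0)).
Proof.
rewrite H10_normE sqr_sqrtr; last by rewrite addr_ge0// l2_ge0.
by rewrite big_split.
Qed.

(* The basis of [H^1_0(0, L)^m] is indexed by [k * m + i]: the (k+1)-st eigenfunction in the
   i-th component. *)
Definition lcoef (j : nat) (h : R -> 'cV[R]_m) : R :=
  \sum_(i < m | val i == (j %% m)%N) ip L (fun x => h x i 0) (efun L (j %/ m)).
Definition hcoef (j : nat) u : R := lcoef j u.
Definition hlam (j : nat) : R := eigv L (j %/ m).
Definition hweight (j : nat) : R := 1 + hlam j.

Lemma lcoefE k (i : 'I_m) h : lcoef (k * m + i) h = ip L (fun x => h x i 0) (efun L k).
Proof.
rewrite /lcoef modnMDl modn_small// divnMDl// divn_small// addn0.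
by rewrite (bigD1 i)//= big1 ?addr0// => l /andP[/eqP/val_inj ->]; rewrite eqxx.
Qed.

Lemma hcoefE k (i : 'I_m) u : hcoef (k * m + i) u = ip L (fun x => u x i 0) (efun L k).
Proof. exact: lcoefE. Qed.

Lemma hlamE k (i : 'I_m) : hlam (k * m + i) = eigv L k.
Proof. by rewrite /hlam divnMDl// divn_small// addn0. Qed.

Lemma hindex (j : nat) : exists (k : nat) (i : 'I_m), j = (k * m + i)%N.
Proof. by exists (j %/ m)%N, (Ordinal (ltn_pmod j m0)); rewrite /= -divn_eq. Qed.

Lemma H10_component_lin a u v (i : 'I_m) :
  (fun x => (a *: u + v) x i 0) = (fun x => a * u x i 0 + v x i 0).
Proof.
apply/funext => x; change ((a *: (u : R -> 'cV[R]_m) + (v : R -> 'cV[R]_m)) x i 0 = a * u x i 0 + v x i 0).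
by rewrite !fctE !mxE.
Qed.

Lemma H10_component_L2 u (i : 'I_m) : L2 L (fun x => u x i 0).
Proof. exact: (primitive_L2 L0 (H10_primitive u i)). Qed.

Lemma hweight_gt0 j : 0 < hweight j.
Proof. by rewrite ltr_wpDr// ltW// eigv_gt0. Qed.

Lemma sum_hindex (F : nat -> R) J : (forall j, 0 <= F j) ->
  \sum_(j < J) F j <= \sum_(i < m) \sum_(k < J) F (k * m + i)%N.
Proof.
move=> F0; rewrite exchange_big/= -sum_mul_split -subr_ge0.
rewrite sub_partial_sums ?leq_pmulr//.
by apply: sumr_ge0 => k _; case: ifP.
Qed.

(** The weight [1 + eigv] adds the L^2 norms of the function and of its derivative, so the frame
    norm is the H^1 norm itself and not merely an equivalent one. *)
Lemma H10_hilbert_frame : hilbert_frame hcoef hweight.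
Proof.
have F0 (x : nat -> R) j : 0 <= hweight j * x j ^+ 2.
  by apply: mulr_ge0; [exact/ltW/hweight_gt0|exact: sqr_ge0].
have wE k (i : 'I_m) : hweight (k * m + i) = 1 + eigv L k by rewrite /hweight hlamE.
apply: hilbert_frame_of_synthesis.
- move=> j a u v; have [k [i ->]] := hindex j; rewrite !hcoefE H10_component_lin.
  by rewrite ip_lin//; [exact: H10_component_L2..|exact: efun_L2].
- exact: hweight_gt0.
- move=> u J; apply: le_trans (sum_hindex J (F0 (hcoef^~ u))) _.
  rewrite H10_norm_sqr; apply: ler_sum => i _.
  under eq_bigr do rewrite hcoefE wE mulrDl mul1r.
  rewrite big_split/= lerD//.
    exact: (bessel J (efun_L2 L) (efun_orthonormal L0) (H10_component_L2 u i)).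
  exact: (bessel_primitive L0 J (H10_primitive u i)).
- move=> u b b0 ub; rewrite H10_norm_sqr; apply/ler_addgt0Pr => e e0.
  have e1 : 0 < e / m%:R by rewrite divr_gt0// ltr0n.
  have [n nP] := choice (fun i => primitive_norm_approx L0 (H10_primitive u i) e1).
  pose N := (\sum_(i < m) n i)%N.
  apply: (@le_trans _ _ (\sum_(i < m) (\sum_(k < N) hweight (k * m + i) * hcoef (k * m + i) u ^+ 2 + e / m%:R))).
    apply: ler_sum => i _; apply: le_trans (nP i) _; rewrite lerD2r.
    under [leRHS]eq_bigr do rewrite hcoefE wE.
    rewrite -subr_ge0 (@sub_partial_sums _ (fun k => (1 + eigv L k) * ip L (fun x => u x i 0) (efun L k) ^+ 2)).
      apply: sumr_ge0 => k _; case: ifP => // _; apply: mulr_ge0; last exact: sqr_ge0.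
      by rewrite addr_ge0//; exact/ltW/eigv_gt0.
    by rewrite /N (bigD1 i)//= leq_addr.
  have em : \sum_(i < m) e / m%:R = e.
    by rewrite sumr_const card_ord -[LHS]mulr_natr divfK// pnatr_eq0 -lt0n.
  rewrite big_split/= em lerD2r.
  by rewrite exchange_big/= -(sum_mul_split (fun j => hweight j * hcoef j u ^+ 2)); exact: ub.
- move=> x b xb.
  have xi (i : 'I_m) n : \sum_(k < n) (1 + eigv L k) * x (k * m + i)%N ^+ 2 <= b.
    apply: le_trans (xb (n * m)%N); rewrite (sum_mul_split (fun j => hweight j * x j ^+ 2)).
    apply: ler_sum => k _; rewrite (bigD1 i)//= wE lerDl; apply: sumr_ge0 => l _; exact: F0.
  have [U UP] := choice (fun i : 'I_m => @sine_synthesis _ L L0 (fun k => x (k * m + i)%N) b (xi i)).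
  have [G GP] := choice UP.
  pose w x := \col_i U i x : 'cV[R]_m; pose g x := \col_i G i x : 'cV[R]_m.
  have wg i : vanishing_primitive L (fun x => w x i 0) (fun x => g x i 0).
    have [h _ _] := GP i.
    by move: h; congr (vanishing_primitive L _ _); apply/funext => y; rewrite mxE.
  exists (embed L w) => j; have [k [i ->]] := hindex j; rewrite hcoefE.
  have [_ <- _] := GP i; apply: eq_Rintegral => y /set_mem yI.
  by rewrite (embed_val wg)// mxE.
Qed.

End H10Frame.

(** * Pointwise bounds, spectral projectors and test functions *)

Section H10Estimates.
Context {R : realType} (L : R) (L0 : 0 < L) (m : nat) (m0 : (0 < m)%N).
Local Notation mu := (@lebesgue_measure R).
Implicit Types (u v : H10 L m) (h : R -> 'cV[R]_m).

Lemma H10_component_derivative_le u (i : 'I_m) :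
  ip L (fun x => dx L u x i 0) (fun x => dx L u x i 0) <= `|u| ^+ 2.
Proof.
rewrite H10_norm_sqr (bigD1 i)//= addrAC [leRHS]addrC lerDl.
by rewrite addr_ge0// ?ip_ge0//; apply: sumr_ge0 => j _; rewrite addr_ge0// ip_ge0.
Qed.

Lemma H10_value_le u x (i : 'I_m) : `|u x i 0| <= Num.sqrt L * `|u|.
Proof.
have [xI|xI] := boolP (x \in `[0, L]); last first.
  rewrite (H10_vanishing u) ?mxE ?normr0 ?mulr_ge0 ?sqrtr_ge0//.
  by apply: contra xI; rewrite !in_itv/= => /andP[/ltW -> /ltW ->].
have s0 : 0 <= Num.sqrt L * `|u| by rewrite mulr_ge0// sqrtr_ge0.
rewrite -(@ler_pXn2r _ 2)// ?nnegrE// exprMn sqr_sqrtr ?(ltW L0)// real_normK ?num_real//.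
apply: le_trans (primitive_le L0 (H10_primitive u i) xI) _.
by rewrite ler_pM2l// H10_component_derivative_le.
Qed.

Lemma H10_holder u (i : 'I_m) x y : x \in `[0, L] -> y \in `[0, L] ->
  `|u y i 0 - u x i 0| <= Num.sqrt `|y - x| * `|u|.
Proof.
wlog xy : x y / x <= y.
  move=> h xI yI; have [/h|/ltW/h] := leP x y; first exact.
  by rewrite distrC [`|y - x|]distrC; apply.
rewrite !in_itv/= => /andP[x0 xL] /andP[y0 yL].
apply: le_trans (primitive_holder (H10_primitive u i) x0 xy yL) _.
rewrite ger0_norm ?subr_ge0// ler_wpM2l ?sqrtr_ge0//.
rewrite -[leRHS]ger0_norm// -sqrtr_sqr ler_wsqrtr//; exact: H10_component_derivative_le.
Qed.

Lemma proj_entry h K x (i : 'I_m) : Defs.proj L K h x i 0 =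
  \sum_(k < K) ip L (fun y => h y i 0) (efun L k) * efun L k x.
Proof.
rewrite /proj summxE big_add1/= big_mkord; apply: eq_bigr => k _.
by rewrite !mxE mulrC.
Qed.

Lemma proj_primitive h K (i : 'I_m) : vanishing_primitive L (fun x => Defs.proj L K h x i 0)
  (fun x => \sum_(k < K) ip L (fun y => h y i 0) (efun L k) * defun L k x).
Proof.
have := vanishing_primitive_sum L0 (fun k => ip L (fun y => h y i 0) (efun L k)) K.
by congr (vanishing_primitive L _ _); apply/funext => x; rewrite proj_entry.
Qed.

Lemma projH_val n u x : x \in `[0, L] -> projH n u x = Defs.proj L n u x.
Proof.
pose g x : 'cV[R]_m := \col_i \sum_(k < n) ip L (fun y => u y i 0) (efun L k) * defun L k x.
apply: (@embed_val _ L L0 m _ g) => i.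
have -> : (fun x => g x i 0) =
    (fun x => \sum_(k < n) ip L (fun y => u y i 0) (efun L k) * defun L k x).
  by apply/funext => y; rewrite mxE.
exact: proj_primitive.
Qed.

Lemma hcoef_projH n u j : hcoef j (projH n u) = if (j < n * m)%N then hcoef j u else 0.
Proof.
have [k [i ->]] := hindex m0 j; rewrite !(hcoefE m0).
have -> : (k * m + i < n * m)%N = (k < n)%N.
  apply/idP/idP => [h|kn].
    rewrite ltnNge; apply/negP => nk; move: h; rewrite ltnNge => /negP; apply.
    by rewrite (leq_trans (_ : n * m <= k * m)%N) ?leq_addr// leq_mul2r nk orbT.
  by apply: leq_trans (leq_mul kn (leqnn m)); rewrite mulSn addnC ltn_add2r.
rewrite -(ip_orthonormal_sum (fun k => ip L (fun y => u y i 0) (efun L k)) n k (efun_L2 L) (efun_orthonormal L0)).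
by apply: eq_Rintegral => x /set_mem xI; rewrite projH_val// proj_entry.
Qed.

Lemma projH_tail u K x (i : 'I_m) : (0 < K)%N -> x \in `[0, L] ->
  `|u x i 0 - Defs.proj L K u x i 0| <= Num.sqrt (2 * L) / Num.sqrt K%:R * `|u|.
Proof.
move=> K0 xI; have K0' : 0 < K%:R :> R by rewrite ltr0n.
have s0 : 0 <= Num.sqrt (2 * L) / Num.sqrt K%:R * `|u|.
  by rewrite mulr_ge0// divr_ge0// sqrtr_ge0.
rewrite -(@ler_pXn2r _ 2)// ?nnegrE// real_normK ?num_real// proj_entry.
apply: le_trans (partial_sum_remainder L0 (H10_primitive u i) K0 xI) _.
rewrite exprMn expr_div_n [Num.sqrt (2 * L) ^+ 2]sqr_sqrtr ?mulr_ge0 ?(ltW L0)// [Num.sqrt K%:R ^+ 2]sqr_sqrtr//.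
apply: ler_wpM2l; last exact: H10_component_derivative_le.
by rewrite divr_ge0// mulr_ge0// ltW.
Qed.

Lemma lcoef_bessel h J : L2v L h -> \sum_(j < J) lcoef L j h ^+ 2 <= l2 L h h.
Proof.
move=> Lh; apply: le_trans (sum_hindex m0 J (F := fun j => lcoef L j h ^+ 2) _) _.
  by move=> j; exact: sqr_ge0.
apply: ler_sum => i _; under eq_bigr do rewrite (lcoefE _ m0).
exact: (bessel J (efun_L2 L) (efun_orthonormal L0) (Lh i)).
Qed.

Lemma lcoef_holder_tail (e : R) : 0 < e -> exists J0, forall A h,
  (forall i, holder_half L A (fun x => h x i 0)) ->
  forall n, \sum_(j < n | (J0 <= j)%N) lcoef L j h ^+ 2 <= e * A ^+ 2.
Proof.
move=> e0; have e1 : 0 < e / m%:R by rewrite divr_gt0// ltr0n.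
have [J JP] := holder_half_tail L0 e1.
exists (J * m)%N => A h hh n; rewrite big_mkcond/=.
apply: le_trans (sum_hindex m0 n (F := fun j => if (J * m <= j)%N then lcoef L j h ^+ 2 else 0) _) _.
  by move=> j; case: ifP => // _; exact: sqr_ge0.
apply: (@le_trans _ _ (\sum_(i < m) e / m%:R * A ^+ 2)).
  apply: ler_sum => i _; apply: le_trans (JP A _ (hh i) n); rewrite [leRHS]big_mkcond/=.
  apply: ler_sum => k _; rewrite (lcoefE _ m0); case: ifP => [h1|_]; last by case: ifP => // _; exact: sqr_ge0.
  suff -> : (J <= k)%N by [].
  rewrite leqNgt; apply/negP => kJ; move: h1; rewrite leqNgt => /negP; apply.
  by apply: leq_trans (leq_mul kJ (leqnn m)); rewrite mulSn addnC ltn_add2r.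
rewrite sumr_const card_ord -mulrnAl -[e / m%:R *+ m]mulr_natr divfK// pnatr_eq0 -lt0n//.
Qed.

Definition hbasis (j : nat) : H10 L m := embed L (fun x => \col_i
  (if val i == (j %% m)%N then efun L (j %/ m) x else 0)).

Lemma hbasis_val j x : x \in `[0, L] ->
  hbasis j x = \col_i (if val i == (j %% m)%N then efun L (j %/ m) x else 0).
Proof.
move=> xI.
pose w y : 'cV[R]_m := \col_i (if val i == (j %% m)%N then efun L (j %/ m) y else 0).
pose g y : 'cV[R]_m := \col_i (if val i == (j %% m)%N then defun L (j %/ m) y else 0).
apply: (@embed_val _ L L0 m w g) => // i.
have -> : (fun x => w x i 0) = (fun x => if val i == (j %% m)%N then efun L (j %/ m) x else 0).
  by apply/funext => y; rewrite mxE.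
have -> : (fun x => g x i 0) = (fun x => if val i == (j %% m)%N then defun L (j %/ m) x else 0).
  by apply/funext => y; rewrite mxE.
case: (val i == _); first exact: efun_vanishing_primitive.
by split => //; [exact: L2_0|move=> y _; rewrite Rintegral_cst// mul0r].
Qed.

Lemma l2_hbasis h j : l2 L h (hbasis j) = lcoef L j h.
Proof.
rewrite /l2 /lcoef [RHS]big_mkcond/=; apply: eq_bigr => i _.
case: ifP => ij.
  by apply: eq_Rintegral => x /set_mem xI; rewrite hbasis_val// mxE ij.
rewrite -[RHS](ip0l (L := L) (fun x => h x i 0)) ipC; apply: eq_Rintegral => x /set_mem xI.
by rewrite hbasis_val// mxE ij.
Qed.

Lemma l2_dx_hbasis u j : l2 L (dx L u) (dx L (hbasis j)) = hlam L m j * hcoef j u.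
Proof.
have [k [i ->]] := hindex m0 j; rewrite (hcoefE m0) (hlamE _ m0).
rewrite /l2 (bigD1 i)//= big1 ?addr0; last first.
  move=> l li.
  have z : vanishing_primitive L (fun x => hbasis (k * m + i) x l 0) (fun=> 0).
    split => //; first exact: L2_0.
    - move=> x xI; rewrite hbasis_val// mxE Rintegral_cst// mul0r.
      by rewrite modnMDl modn_small// (negbTE (_ : val l != val i)).
    - by rewrite (H10_vanishing (hbasis _)) ?mxE// in_itv/= ltxx andbF.
  have [Lu _ _] := H10_primitive u l; have [Lb _ _] := H10_primitive (hbasis (k * m + i)) l.
  have := ip_derivative_unique (H10_primitive (hbasis (k * m + i)) l) z (fun x _ => erefl).
  rewrite ip0l => E; apply/eqP; rewrite -sqrf_eq0 eq_le sqr_ge0 andbT.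
  by apply: le_trans (ip_CS Lu Lb) _; rewrite E mulr0.
have e : vanishing_primitive L (fun x => hbasis (k * m + i) x i 0) (defun L k).
  have [Ld dE _] := efun_vanishing_primitive L0 k; split => //.
  - move=> x xI; rewrite hbasis_val// mxE modnMDl modn_small// eqxx.
    by rewrite divnMDl// divn_small// addn0; exact: dE.
  - by rewrite (H10_vanishing (hbasis _)) ?mxE// in_itv/= ltxx andbF.
have b := H10_primitive (hbasis (k * m + i)) i.
have ub := H10_primitive u i.
rewrite -[LHS]/(ip L (fun x => dx L u x i 0) (fun x => dx L (hbasis (k * m + i)) x i 0)).
rewrite -(ip_primitive_defun L0 k ub) [LHS]ipC [RHS]ipC.
have [Lb _ _] := b; have [Le _ _] := e; have [Lu _ _] := ub.
apply: ip_ae => //.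
have [Ld dP _] := vanishing_primitive_sub b e.
have : {ae mu, forall x, x \in `[0, L] -> dx L (hbasis (k * m + i)) x i 0 - defun L k x = 0}.
  by apply: ae_eq0_primitive => // x xI; rewrite -dP// subrr.
apply: filterS; first exact: (ae_filter_ringOfSetsType mu).
by move=> x + xI => /(_ xI)/eqP; rewrite subr_eq0 => /eqP.
Qed.

Lemma L2v_H10 u : L2v L u.
Proof. by move=> i; exact: H10_component_L2. Qed.

Lemma L2v_dx u : L2v L (dx L u).
Proof. by move=> i; case: (H10_primitive u i). Qed.

Lemma l2_CS h k : L2v L h -> L2v L k -> `|l2 L h k| <= Num.sqrt (l2 L h h) * Num.sqrt (l2 L k k).
Proof.
move=> Lh Lk; rewrite -sqrtrM ?l2_ge0// -sqrtr_sqr ler_wsqrtr//.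
have sq t s : 0 <= t ^+ 2 * l2 L h h + 2 * t * s * l2 L h k + s ^+ 2 * l2 L k k.
  have Lsk i : L2 L (fun x => s * k x i 0) by exact: L2Z.
  have -> : t ^+ 2 * l2 L h h + 2 * t * s * l2 L h k + s ^+ 2 * l2 L k k = \sum_(i < m)
    ip L (fun x => t * h x i 0 + s * k x i 0) (fun x => t * h x i 0 + s * k x i 0).
    rewrite /l2 !mulr_sumr -!big_split/=; apply: eq_bigr => i _.
    rewrite ip_sqrD// [ip L _ (fun x => s * k x i 0)]ipC ipZ// ipZ// [ip L _ (fun x => s * k x i 0)]ipC ipZ//.
    by rewrite [ip L (fun x => k x i 0) (fun x => h x i 0)]ipC /ip; ring.
  by apply: sumr_ge0 => i _; exact: ip_ge0.
have := l2_ge0 L h; rewrite le_eqVlt => /predU1P[h0|h0].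
  have := sq (l2 L k k + 1) (- l2 L h k); rewrite -h0 mulr0 add0r mul0r => p.
  have : 0 <= - (l2 L h k ^+ 2 * (l2 L k k + 2)).
    by apply: le_trans p _; rewrite le_eqVlt; apply/orP; left; apply/eqP; ring.
  by rewrite oppr_ge0 pmulr_lle0//; have := l2_ge0 L k; lra.
have := sq (l2 L h k) (- l2 L h h).
have -> : l2 L h k ^+ 2 * l2 L h h + 2 * l2 L h k * - l2 L h h * l2 L h k + (- l2 L h h) ^+ 2 * l2 L k k =
  l2 L h h * (l2 L h h * l2 L k k - l2 L h k ^+ 2) by ring.
by rewrite pmulr_rge0// subr_ge0.
Qed.

End H10Estimates.

(** * Weak and modal solutions *)

Lemma mean_value_interval (R : realType) (F dF : R -> R) (a b D C : R) : a <= b ->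
  (forall z : R, z \in `[a, b] -> is_derive z (1 : R) F (dF z)) ->
  (forall z, z \in `[a, b] -> `|dF z - D| <= C) ->
  `|F b - F a - (b - a) * D| <= C * (b - a).
Proof.
move=> ab dFz bd.
have dF' (z : R) : z \in `]a, b[ -> is_derive z (1 : R) F (dF z).
  by move=> zI; apply/dFz; move: zI; rewrite !in_itv/= => /andP[/ltW -> /ltW ->].
have cF : {within `[a, b], continuous F}.
  by apply: derivable_within_continuous => z zI; case: (dFz z zI).
have [c cI E] := @MVT_segment R F dF a b ab dF' cF.
by rewrite E [_ * D]mulrC -mulrBl normrM [`|b - a|]ger0_norm ?subr_ge0// ler_wpM2r ?subr_ge0//; exact/bd.
Qed.

Lemma mean_value_increment (R : realType) (F dF : R -> R) (t s D C : R) :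
  (forall z : R, `|z - t| <= `|s - t| -> is_derive z (1 : R) F (dF z)) ->
  (forall z, `|z - t| <= `|s - t| -> `|dF z - D| <= C) ->
  `|F s - F t - (s - t) * D| <= C * `|s - t|.
Proof.
move=> dFz bd; have [ts|/ltW st] := leP t s.
  have sub z : z \in `[t, s] -> `|z - t| <= `|s - t|.
    by rewrite in_itv/= => /andP[tz zs]; rewrite !ger0_norm ?subr_ge0// lerD2r.
  rewrite [`|s - t|]ger0_norm ?subr_ge0//.
  by apply: (mean_value_interval ts) => z /sub; [exact: dFz|exact: bd].
have sub z : z \in `[s, t] -> `|z - t| <= `|s - t|.
  by rewrite in_itv/= => /andP[sz zt]; rewrite !ler0_norm ?subr_le0// lerN2 lerD2r.
rewrite [`|s - t|]ler0_norm ?subr_le0// opprB -normrN.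
have -> : - (F s - F t - (s - t) * D) = F t - F s - (t - s) * D by ring.
by apply: (mean_value_interval st) => z /sub; [exact: dFz|exact: bd].
Qed.

Lemma small_factor (R : realFieldType) (a b e : R) : 0 <= a -> 0 <= b -> 0 < e ->
  exists dl, 0 < dl /\ dl <= 1 /\ a * dl * b <= e.
Proof.
move=> a0 b0 e0; have ab1 : 0 < a * b + 1 by rewrite ltr_wpDl// mulr_ge0.
exists (Num.min 1 (e / (a * b + 1))).
rewrite lt_min ltr01 (divr_gt0 e0 ab1) ge_min lexx; split => //; split => //.
set dl := Num.min _ _; have : dl <= e / (a * b + 1) by rewrite ge_min lexx orbT.
rewrite ler_pdivlMr// => h; apply: le_trans h.
have dl0 : 0 <= dl by rewrite le_min ler01 ltW// divr_gt0.
by rewrite mulrAC mulrC mulrDr mulr1 lerDl.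
Qed.

Section ModalSolutions.
Context {R : realType} (L : R) (L0 : 0 < L) (m : nat) (m0 : (0 < m)%N).
Local Notation mu := (@lebesgue_measure R).
Local Notation Phi := (H10 L m).
Implicit Types (u v psi : Phi) (h : R -> 'cV[R]_m) (N : Phi -> R -> 'cV[R]_m).

Let fr := H10_hilbert_frame L0 m0.

Lemma solution_modal N (v : R -> Phi) : solution N v ->
  modal_solution (hcoef (m := m)) (hlam L m) v (fun j t => lcoef L j (N (v t))).
Proof.
move=> [_ dv] j t t0; have := dv (hbasis L m j) t t0.
rewrite (l2_hbasis L0) (l2_dx_hbasis L0 m0).
have -> : (fun s => l2 L (v s) (hbasis L m j)) = hcoef j \o v.
  by apply/funext => s; rewrite (l2_hbasis L0).
by move=> d; apply: is_derive_eq; rewrite addrC mulNr.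
Qed.

Lemma hcoef_hbasis i j : hcoef i (hbasis L m j) = (i == j)%:R.
Proof.
have [k [l ->]] := hindex m0 i; have [k' [l' ->]] := hindex m0 j.
rewrite (hcoefE m0).
have -> : ip L (fun x => hbasis L m (k' * m + l') x l 0) (efun L k) =
    ip L (fun x => if val l == val l' then efun L k' x else 0) (efun L k).
  apply: eq_Rintegral => x /set_mem xI; rewrite (hbasis_val L0)// mxE.
  by rewrite modnMDl modn_small// divnMDl// divn_small// addn0.
have [ll|ll] := eqVneq (val l) (val l').
  rewrite (efun_orthonormal L0) ll; congr (_%:R); rewrite eqn_add2r eqn_pmul2r//.
  by rewrite eq_sym.
rewrite ip0l; suff -> : (k * m + l == k' * m + l')%N = false by [].
apply/negbTE; apply: contra ll => /eqP/(congr1 (fun q => q %% m)%N).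
by rewrite !modnMDl !modn_small// => /eqP.
Qed.

Definition htrunc psi n : Phi := \sum_(j < n) hcoef j psi *: hbasis L m j.

Lemma hcoef_htrunc psi n i : hcoef i (htrunc psi n) = if (i < n)%N then hcoef i psi else 0.
Proof.
rewrite /htrunc; elim: n => [|n IH]; first by rewrite big_ord0 (frame0 fr).
rewrite big_ord_recr/= (frameD fr) (frameZ fr) IH hcoef_hbasis ltnS.
have [->|ni] := eqVneq i n; first by rewrite ltnn leqnn mulr1 add0r.
by rewrite mulr0 addr0 [in RHS]leq_eqVlt (negbTE ni).
Qed.

Lemma htrunc_cvg psi e : 0 < e -> exists n, `|psi - htrunc psi n| <= e.
Proof.
move=> e0.
have F0 j : 0 <= hweight L m j * hcoef j psi ^+ 2.
  by apply: mulr_ge0; [exact/ltW/(frame_gt0 fr)|exact: sqr_ge0].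
have [n nP] := bounded_sum_tail F0 (frame_bessel fr psi) (exprn_gt0 2 e0).
exists n; rewrite -(@ler_pXn2r _ 2)// ?nnegrE ?(ltW e0)//.
apply: (frame_norm_le fr); first exact: sqr_ge0.
move=> J; apply: le_trans (nP J); rewrite [leRHS]big_mkcond/=; apply: ler_sum => j _.
rewrite (frameB fr) hcoef_htrunc; case: ltnP => _; last by rewrite subr0.
by rewrite subrr expr0n mulr0.
Qed.

Lemma H10_linP a u v : (a *: u + v : Phi) = a *: (u : R -> 'cV[R]_m) + (v : R -> 'cV[R]_m) :> (R -> 'cV[R]_m).
Proof. by []. Qed.

Lemma l2_psi_lin a h u v : L2v L h -> l2 L h (a *: u + v : Phi) = a * l2 L h u + l2 L h v.
Proof.
move=> Lh; rewrite l2C H10_linP l2_lin; [|exact: L2v_H10|exact: L2v_H10|by []].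
by rewrite ![l2 L _ h]l2C.
Qed.

Lemma l2_dx_lin a (w : Phi) u v :
  l2 L (dx L w) (dx L (a *: u + v : Phi)) = a * l2 L (dx L w) (dx L u) + l2 L (dx L w) (dx L v).
Proof.
have E (x y : Phi) : l2 L (dx L x) (dx L y) = H1dot x y - l2 L x y by rewrite /H1dot addrAC subrr add0r.
rewrite !E (l2_psi_lin _ _ _ (L2v_H10 L0 w)) H1dotC H1dot_lin ![H1dot _ w]H1dotC.
by ring.
Qed.

Lemma l2_htrunc h psi n : L2v L h ->
  l2 L h (htrunc psi n) = \sum_(j < n) hcoef j psi * lcoef L j h.
Proof.
move=> Lh; rewrite /htrunc; elim: n => [|n IH].
  rewrite !big_ord0; have := l2_psi_lin 1 0 0 Lh; rewrite scale1r addr0 mul1r.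
  by move=> /eqP; rewrite -subr_eq0 opprD addNKr oppr_eq0 => /eqP.
by rewrite !big_ord_recr/= [_ + _ *: _]addrC l2_psi_lin// IH (l2_hbasis L0) addrC.
Qed.

Lemma l2_dx_htrunc u psi n :
  l2 L (dx L u) (dx L (htrunc psi n)) = \sum_(j < n) hcoef j psi * (hlam L m j * hcoef j u).
Proof.
rewrite /htrunc; elim: n => [|n IH].
  rewrite !big_ord0; have := l2_dx_lin 1 u 0 0; rewrite scale1r addr0 mul1r.
  by move=> /eqP; rewrite -subr_eq0 opprD addNKr oppr_eq0 => /eqP.
by rewrite !big_ord_recr/= [_ + _ *: _]addrC l2_dx_lin IH (l2_dx_hbasis L0 m0) addrC.
Qed.

Lemma l2_H10_le u : Num.sqrt (l2 L u u) <= `|u|.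
Proof. by rewrite H10_normE ler_wsqrtr// lerDl l2_ge0. Qed.

Lemma l2_dx_le u : Num.sqrt (l2 L (dx L u) (dx L u)) <= `|u|.
Proof. by rewrite H10_normE ler_wsqrtr// lerDr l2_ge0. Qed.

Section Converse.
Variables (N : Phi -> R -> 'cV[R]_m) (B Q : R).
Hypotheses (B0 : 0 <= B) (Q0 : 0 <= Q).
Hypothesis NL2 : forall u, L2v L (N u).
Hypothesis Nbd : forall u, l2 L (N u) (N u) <= B ^+ 2.
Hypothesis Nlip : forall u v, `|v - u| <= 1 ->
  l2 L (-1 *: N u + N v) (-1 *: N u + N v) <= Q ^+ 2 * `|v - u| ^+ 2.

Let G psi u := l2 L (N u) psi - l2 L (dx L u) (dx L psi).

Let G_B psi psi' u : G psi u - G psi' u = G (psi - psi') u.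
Proof.
rewrite /G; have -> : psi - psi' = -1 *: psi' + psi by rewrite scaleN1r addrC.
by rewrite l2_psi_lin// l2_dx_lin; ring.
Qed.

Let G_le psi u : `|G psi u| <= (B + `|u|) * `|psi|.
Proof.
apply: le_trans (ler_normB _ _) _; rewrite mulrDl; apply: lerD.
  apply: le_trans (l2_CS (NL2 u) (L2v_H10 L0 psi)) _.
  apply: ler_pM; rewrite ?sqrtr_ge0//; last exact: l2_H10_le.
  by rewrite -[leRHS]ger0_norm// -sqrtr_sqr ler_wsqrtr.
apply: le_trans (l2_CS (L2v_dx u) (L2v_dx psi)) _.
by apply: ler_pM; rewrite ?sqrtr_ge0//; exact: l2_dx_le.
Qed.

Let G_lip psi u v : `|v - u| <= 1 -> `|G psi v - G psi u| <= (Q + 1) * `|v - u| * `|psi|.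
Proof.
move=> uv; have -> : G psi v - G psi u = l2 L (-1 *: N u + N v) psi -
    l2 L (dx L (v - u)) (dx L psi).
  rewrite (l2_lin _ (NL2 u) (NL2 v) (L2v_H10 L0 psi)).
  have -> : v - u = -1 *: u + v by rewrite scaleN1r addrC.
  by rewrite [l2 L (dx L (_ + _)) _]l2C l2_dx_lin ![l2 L (dx L psi) _]l2C /G; ring.
have LN : L2v L (-1 *: N u + N v).
  by move=> i; have := L2_lin (-1) (NL2 u i) (NL2 v i); congr (L2 L _); apply/funext => x; rewrite !fctE !mxE.
apply: le_trans (ler_normB _ _) _; rewrite !mulrDl mul1r; apply: lerD.
  apply: le_trans (l2_CS LN (L2v_H10 L0 psi)) _.
  apply: ler_pM; rewrite ?sqrtr_ge0//; last exact: l2_H10_le.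
  rewrite -[leRHS]ger0_norm ?mulr_ge0// -sqrtr_sqr ler_wsqrtr// exprMn.
  exact: Nlip.
apply: le_trans (l2_CS (L2v_dx _) (L2v_dx psi)) _.
by apply: ler_pM; rewrite ?sqrtr_ge0//; exact: l2_dx_le.
Qed.

(** For a finite combination of basis functions the weak equation is a finite sum of modal ones. A
    general [psi] is approximated by [htrunc]. As derivatives do not pass to limits by themselves,
    increments over a short interval are compared by the mean value inequality, with errors
    controlled by the bounds on [N]. *)
Lemma modal_is_solution (v : R -> Phi) : continuous v ->
  modal_solution (hcoef (m := m)) (hlam L m) v (fun j t => lcoef L j (N (v t))) ->
  solution N v.
Proof.
move=> cv mv; split; first exact: continuous_subspaceT.
move=> psi t t0; rewrite -/(G psi (v t)).
apply: is_derive_little_o => e e0.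
pose V := `|v t| + 1.
have V0 : 0 <= V by rewrite addr_ge0.
have [dl [dl0 [dl1 dlG]]] : exists dl, 0 < dl /\ dl <= 1 /\ (Q + 1) * dl * `|psi| <= e.
  by apply: small_factor => //; rewrite addr_ge0.
have : \forall s \near t, `|v s - v t| <= dl /\ 0 < s.
  near=> s; split; last by near: s; exact: lt_nbhsr.
  by near: s; move/cvgrPdist_le : (cv t) => /(_ _ dl0); apply: filterS => s; rewrite distrC.
move=> /nbhs_ballP[d d0 dP]; exists d => // s sd.
have seg z : `|z - t| <= `|s - t| -> `|v z - v t| <= dl /\ 0 < z.
  by move=> zs; apply: dP; rewrite /ball/= distrC; exact: le_lt_trans zs sd.
have segV z : `|z - t| <= `|s - t| -> `|v z| <= V.
  move=> /seg[h _].
  rewrite /V -(subrK (v t) (v z)) addrC; apply: le_trans (ler_normD _ _) _; rewrite lerD2l.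
  exact: le_trans h dl1.
have segG z : `|z - t| <= `|s - t| -> `|G psi (v z) - G psi (v t)| <= e.
  move=> /seg[h _]; apply: le_trans (G_lip psi (le_trans h dl1)) _; apply: le_trans dlG.
  by rewrite ler_wpM2r// ler_wpM2l// addr_ge0.
apply/ler_addgt0Pr => e' e'0.
(* The points [s] and [t] are already fixed, so the accuracy of the truncation may depend on them;
   the denominator collects the factors of [eta] in the final sum. *)
pose eta := e' / ((2 * (B + V) + 1) * `|s - t| + 2 * V + `|s - t| * (B + V) + 1).
have den0 : 0 < (2 * (B + V) + 1) * `|s - t| + 2 * V + `|s - t| * (B + V) + 1.
  have BV : 0 <= B + V by rewrite addr_ge0.
  apply: ltr_wpDl => //; apply: addr_ge0; last exact: mulr_ge0.
  apply: addr_ge0; last exact: mulr_ge0.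
  by apply: mulr_ge0 => //; rewrite addr_ge0// mulr_ge0.
have eta0 : 0 < eta by rewrite divr_gt0.
have [n nP] := htrunc_cvg psi eta0; pose p := htrunc psi n.
pose F (q : Phi) z := l2 L (v z) q.
have FF z : `|z - t| <= `|s - t| -> `|F psi z - F p z| <= V * eta.
  move=> zs; have -> : F psi z - F p z = l2 L (v z) (psi - p).
    have -> : psi - p = -1 *: p + psi by rewrite scaleN1r addrC.
    by rewrite l2_psi_lin; [rewrite /F; ring|exact: L2v_H10].
  apply: le_trans (l2_CS (L2v_H10 L0 _) (L2v_H10 L0 _)) _.
  apply: ler_pM; rewrite ?sqrtr_ge0//; first exact: le_trans (l2_H10_le _) (segV _ zs).
  exact: le_trans (l2_H10_le _) nP.
have GG z : `|z - t| <= `|s - t| -> `|G psi (v z) - G p (v z)| <= (B + V) * eta.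
  move=> zs; rewrite G_B; apply: le_trans (G_le _ _) _.
  by apply: ler_pM => //; [rewrite addr_ge0|rewrite lerD2l; exact: segV].
have dF (z : R) : 0 < z -> is_derive z (1 : R) (F p) (G p (v z)).
  move=> z0; have -> : F p = (fun z => \sum_(j < n) hcoef j psi * hcoef j (v z)).
    by apply/funext => y; rewrite /F (l2_htrunc _ _ (L2v_H10 L0 _)).
  have dj j : is_derive z (1 : R) (fun y => hcoef j psi * hcoef j (v y))
      (hcoef j psi * (- hlam L m j * hcoef j (v z) + lcoef L j (N (v z)))).
    have h := mv j z z0; have -> : (fun y => hcoef j psi * hcoef j (v y)) = hcoef j psi \*: (hcoef j \o v) by [].
    exact: is_deriveZ.
  have := @is_derive_bigsum R (fun j y => hcoef j psi * hcoef j (v y)) _ z predT n (fun j _ => dj j).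
  move=> h; apply: (is_derive_eq h).
  rewrite /G (l2_htrunc _ _ (NL2 _)) l2_dx_htrunc -sumrB; apply: eq_bigr => j _; ring.
have main : `|F p s - F p t - (s - t) * G p (v t)| <= (e + 2 * ((B + V) * eta)) * `|s - t|.
  apply: (mean_value_increment (dF := fun z => G p (v z))) => z zs.
    by apply: dF; have [] := seg z zs.
  have alg (a b c d' : R) : a - b = (c - d') - (c - a) + (d' - b) by ring.
  rewrite (alg _ _ (G psi (v z)) (G psi (v t))).
  apply: le_trans (ler_normD _ _) _; apply: le_trans (lerD (ler_normB _ _) (lexx _)) _.
  have h1 := segG z zs; have h2 := GG z zs; have h3 := GG t (_ : `|t - t| <= _).
  have -> : e + 2 * ((B + V) * eta) = e + (B + V) * eta + (B + V) * eta by ring.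
  apply: lerD; first exact: lerD.
  by apply: h3; rewrite subrr normr0.
have z0 : `|t - t| <= `|s - t| by rewrite subrr normr0.
have alg (A A' A1 A1' k g g1 : R) : A1 - A1' - k * g1 =
  (A - A' - k * g) + (A1 - A) - (A1' - A') - k * (g1 - g) by ring.
rewrite -/(F psi s) -/(F psi t) (alg (F p s) (F p t) _ _ _ (G p (v t))).
apply: le_trans (ler_normB _ _) _; apply: le_trans (lerD (ler_normB _ _) (lexx _)) _.
apply: le_trans (lerD (lerD (ler_normD _ _) (lexx _)) (lexx _)) _.
rewrite normrM; have h1 := FF s (lexx _); have h2 := FF t z0.
have h3 : `|s - t| * `|G psi (v t) - G p (v t)| <= `|s - t| * ((B + V) * eta).
  by apply: ler_wpM2l => //; exact: GG.
have h4 : (2 * (B + V) * `|s - t| + 2 * V + `|s - t| * (B + V)) * eta <= e'.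
  rewrite /eta mulrA ler_pdivrMr// mulrC ler_pM2l//.
  by apply: ler_wpDr => //; rewrite !lerD2r ler_wpM2r// lerDl.
apply: le_trans (lerD (lerD (lerD main h1) h2) h3) _; apply: le_trans (lerD (lexx _) h4).
by rewrite le_eqVlt; apply/orP; left; apply/eqP; ring.
Unshelve. all: by end_near. Qed.

End Converse.

End ModalSolutions.

(** * Differentiable families of functions *)

Section MatrixNorm.
Context {R : realType}.

Lemma mx_entry_le (p q : nat) (M : 'M[R]_(p, q)) i j : `|M i j| <= `|M|.
Proof.
rewrite /Num.norm/= mx_normrE; exact: (le_bigmax _ (fun ij => `|M ij.1 ij.2|) (i, j)).
Qed.

Lemma mx_norm_le (p q : nat) (M : 'M[R]_(p, q)) (e : R) : 0 <= e ->
  (forall i j, `|M i j| <= e) -> `|M| <= e.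
Proof.
move=> e0 h; rewrite /Num.norm/= mx_normrE; apply: bigmax_le => // -[i j] _; exact: h.
Qed.

Lemma cV_delta_sum (m : nat) (h : 'cV[R]_m) : h = \sum_l h l 0 *: delta_mx l 0.
Proof.
apply/colP => i; rewrite summxE (bigD1 i)//= !mxE !eqxx mulr1 big1 ?addr0// => l li.
by rewrite !mxE eq_sym (negbTE li) mulr0.
Qed.

End MatrixNorm.

Section Taylor.
Context {R : realType} {V W : normedModType R}.
Implicit Types (x y d v : V) (h : V -> W).

Lemma is_derive_line h (l : {linear W -> R}) x d (t : R) : continuous l ->
  differentiable h (x + t *: d) ->
  is_derive t (1 : R) (fun s : R => l (h (x + s *: d))) (l ('D_d h (x + t *: d))).
Proof.
move=> cl dh.
have i1 := is_diffD (is_diff_cst x t) (is_diff_scalel t d).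
have i2 : is_diff ((cst x + *:%R^~ d) t) h ('d h (x + t *: d)) by apply: DiffDef.
have i3 := is_diff_comp i1 i2.
have i4 z : is_diff z l l by apply: DiffDef; [exact: linear_differentiable|exact: diff_lin].
have i5 := is_diff_comp i3 (i4 _).
have -> : (fun s : R => l (h (x + s *: d))) = l \o (h \o (cst x + *:%R^~ d)) by [].
have [df E] := i5.
apply: DeriveDef; first exact: diff_derivable.
by rewrite deriveE// E deriveE//= !fctE add0r scale1r.
Qed.

(** Composing with a scalar functional reduces the estimate to the real mean value inequality,
    applied first to the derivative and then to the function; the factor 1/2 of Taylor's formula is
    given away. *)
Lemma taylor_functional h (l : {linear W -> R}) x y (C : R) : continuous l ->
  (forall t : R, 0 <= t <= 1 -> differentiable h (x + t *: (y - x)) /\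
      differentiable ('D_(y - x) h) (x + t *: (y - x))) ->
  (forall t : R, 0 <= t <= 1 -> `|l ('D_(y - x) ('D_(y - x) h) (x + t *: (y - x)))| <= C) ->
  `|l (h y - h x - 'D_(y - x) h x)| <= C.
Proof.
move=> cl dh bd; pose d := y - x.
have C0 : 0 <= C by apply: le_trans (bd 0 _); rewrite // lexx ler01.
pose G (t : R) := l ('D_d h (x + t *: d)).
have step (t : R) : t \in `[0, 1] -> `|G t - G 0| <= C.
  rewrite in_itv/= => /andP[t0 t1].
  have := @mean_value_interval R G (fun t => l ('D_d ('D_d h) (x + t *: d))) 0 t 0 C t0.
  rewrite mulr0 !subr0 => /(_ _ _)/le_trans; apply; last by rewrite ler_piMr.
  - move=> z; rewrite in_itv/= => /andP[z0 zt]; apply: is_derive_line => //.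
    by have [] := dh z; rewrite ?z0 ?(le_trans zt).
  - move=> z; rewrite in_itv/= => /andP[z0 zt]; rewrite subr0; apply: bd.
    by rewrite z0 (le_trans zt).
have := @mean_value_interval R (fun t => l (h (x + t *: d))) G 0 1 (G 0) C ler01.
rewrite subr0 mul1r mulr1 scale1r scale0r addr0 => H.
have -> : l (h y - h x - 'D_d h x) = l (h (x + d)) - l (h x) - G 0.
  by rewrite /G scale0r addr0 !raddfB/= /d [x + _]addrC subrK.
apply: H; last exact: step.
move=> z; rewrite in_itv/= => zI; apply: is_derive_line => //; by have [] := dh z.
Qed.

End Taylor.

Section SmoothCompactlySupported.
Context {R : realType} {m p q : nat}.
Implicit Types (f : 'cV[R]_m -> 'M[R]_(p, q)) (x y h : 'cV[R]_m).

Definition C2_bounded f := exists2 C : R, 0 <= C & forall x y h i j,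
  [/\ `|f x i j| <= C, `|'d f x h i j| <= C * `|h|,
      `|(f y - f x - 'd f x (y - x)) i j| <= C * `|y - x| ^+ 2 &
      `|('d f y h - 'd f x h) i j| <= C * `|y - x| * `|h|].

Lemma smooth_derive f e : smooth f -> smooth ('D_e f).
Proof. by move=> sf vs x _; have := sf (rcons vs e) x I; rewrite /iter_derive -cats1 foldr_cat. Qed.

Lemma smooth_continuous f : smooth f -> continuous f.
Proof. by move=> sf x; apply: differentiable_continuous; exact: (sf [::] x I). Qed.

Lemma compactly_supported_derive f e : compactly_supported f -> compactly_supported ('D_e f).
Proof.
move=> cf; apply: (subclosed_compact _ cf); first exact: closed_closure.
have sub : [set x | 'D_e f x != 0] `<=` closure [set x | f x != 0].
  move=> x /= dx; apply: contrapT => nx; move/eqP: dx; apply.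
  have : \forall y \near x, f y = 0.
    have op : open (~` closure [set x | f x != 0]) by exact/closed_openC/closed_closure.
    have := open_nbhs_nbhs (conj op nx : open_nbhs x (~` closure [set x | f x != 0])).
    by apply: filterS => y ny; apply: contrapT => fy; apply: ny; apply: subset_closure; exact/eqP.
  move=> near0; rewrite -[RHS](@derive_cst R _ _ 0 e x).
  exact: near_eq_derive.
rewrite [X in _ `<=` X](closure_id _).1; last exact: closed_closure.
exact: closureS.
Qed.

Lemma smooth_bounded f : smooth f -> compactly_supported f ->
  exists C : R, 0 <= C /\ forall x, `|f x| <= C.
Proof.
move=> sf cf; have cimg := continuous_compact (continuous_subspaceT (smooth_continuous sf)) cf.
have [B [_ BP]] := compact_bounded cimg.
exists (`|B| + 1); split; first by rewrite addr_ge0.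
move=> x; have [fx|fx] := eqVneq (f x) 0; first by rewrite fx normr0 addr_ge0.
apply: (BP (`|B| + 1)); first by rewrite (le_lt_trans (ler_norm B))// ltrDl.
by exists x => //; exact: subset_closure.
Qed.

Lemma derive_delta_sum f x h : differentiable f x ->
  'D_h f x = \sum_l h l 0 *: 'D_(delta_mx l 0) f x.
Proof.
move=> df; rewrite deriveE// {1}(cV_delta_sum h) linear_sum; apply: eq_bigr => l _.
by rewrite linearZ/= deriveE.
Qed.

Lemma smooth_derive_bounded f : smooth f -> compactly_supported f ->
  exists C : R, 0 <= C /\ forall x h, `|'D_h f x| <= C * `|h|.
Proof.
move=> sf cf.
have [C CP] := choice (fun l : 'I_m => smooth_bounded (@smooth_derive f (delta_mx l 0) sf)
  (@compactly_supported_derive f (delta_mx l 0) cf)).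
exists (\sum_l C l); split; first by apply: sumr_ge0 => l _; case: (CP l).
move=> x h; rewrite derive_delta_sum; last exact: (sf [::] x I).
apply: le_trans (ler_norm_sum _ _ _) _; rewrite mulr_suml; apply: ler_sum => l _.
rewrite normrZ mulrC; have [C0 Cl] := CP l.
by apply: ler_pM => //; exact: mx_entry_le.
Qed.

Lemma derive_derive_sum f x d h : smooth f ->
  'D_d ('D_h f) x = \sum_l h l 0 *: 'D_d ('D_(delta_mx l 0) f) x.
Proof.
move=> sf.
have -> : 'D_h f = \sum_l h l 0 \*: 'D_(delta_mx l 0) f.
  apply/funext => y; rewrite derive_delta_sum; last exact: (sf [::] y I).
  by rewrite fct_sumE.
have dl (l : 'I_m) : derivable ('D_(delta_mx l 0) f) x d.
  exact/diff_derivable/(sf [:: delta_mx l 0] x I).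
rewrite derive_sum; last by move=> l; exact: derivableZ.
by apply: eq_bigr => l _; rewrite deriveZ.
Qed.

Lemma smooth_derive2_bounded f : smooth f -> compactly_supported f ->
  exists C : R, 0 <= C /\ forall x d h, `|'D_d ('D_h f) x| <= C * `|d| * `|h|.
Proof.
move=> sf cf.
have [C CP] := choice (fun l : 'I_m => smooth_derive_bounded (@smooth_derive f (delta_mx l 0) sf)
  (@compactly_supported_derive f (delta_mx l 0) cf)).
exists (\sum_l C l); split; first by apply: sumr_ge0 => l _; case: (CP l).
move=> x d h; rewrite derive_derive_sum//.
apply: le_trans (ler_norm_sum _ _ _) _; rewrite -mulrA mulr_suml; apply: ler_sum => l _.
rewrite normrZ mulrC mulrA; have [C0 Cl] := CP l.
by apply: ler_pM => //; exact: mx_entry_le.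
Qed.

Definition mx_entry (i : 'I_p) (j : 'I_q) (M : 'M[R]_(p, q)) : R := M i j.

Lemma mx_entry_is_linear i j : linear (mx_entry i j).
Proof. by move=> a u v; rewrite /mx_entry !mxE. Qed.

HB.instance Definition _ i j :=
  GRing.isLinear.Build R 'M[R]_(p, q) R *:%R (mx_entry i j) (mx_entry_is_linear i j).

Lemma mx_entry_continuous i j : continuous (mx_entry i j).
Proof. exact: coord_continuous. Qed.

Lemma C2_bounded_smooth f : smooth f -> compactly_supported f -> C2_bounded f.
Proof.
move=> sf cf.
have [C0 [C00 h0]] := smooth_bounded sf cf.
have [C1 [C10 h1]] := smooth_derive_bounded sf cf.
have [C2 [C20 h2]] := smooth_derive2_bounded sf cf.
have df x : differentiable f x := sf [::] x I.
have ddf h x : differentiable ('D_h f) x := sf [:: h] x I.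
have C012 : 0 <= C0 + C1 + C2 by rewrite !addr_ge0.
have c0 : C0 <= C0 + C1 + C2 by rewrite -addrA lerDl addr_ge0.
have c1 : C1 <= C0 + C1 + C2 by rewrite addrAC lerDr addr_ge0.
have c2 : C2 <= C0 + C1 + C2 by rewrite lerDr addr_ge0.
exists (C0 + C1 + C2) => // x y h i j; split.
- by apply: le_trans (mx_entry_le _ _ _) (le_trans (h0 x) c0).
- rewrite -deriveE//; apply: le_trans (mx_entry_le _ _ _) (le_trans (h1 x h) _).
  by rewrite ler_wpM2r.
- rewrite -deriveE//.
  apply: (@taylor_functional R _ _ f (mx_entry i j) x y _ (@mx_entry_continuous i j)).
    by move=> t _; split; [exact: df|exact: ddf].
  move=> t _; apply: le_trans (mx_entry_le _ _ _) (le_trans (h2 _ _ _) _).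
  by rewrite -mulrA -expr2 ler_wpM2r// exprn_ge0.
- pose d := y - x.
  have E z : 'd f z h i j = mx_entry i j ('D_h f z) by rewrite /mx_entry deriveE.
  have := @mean_value_interval R (fun t => mx_entry i j ('D_h f (x + t *: d)))
    (fun t => mx_entry i j ('D_d ('D_h f) (x + t *: d))) 0 1 0 (C2 * `|d| * `|h|) ler01.
  rewrite scale0r scale1r addr0 mulr0 !subr0 mulr1 => H.
  have -> : ('d f y h - 'd f x h) i j = mx_entry i j ('D_h f (x + d)) - mx_entry i j ('D_h f x).
    by rewrite -!E /d [x + _]addrC subrK !mxE.
  apply: le_trans (H _ _) _; last by rewrite -!mulrA ler_wpM2r// mulr_ge0.
    by move=> t _; apply: is_derive_line; [exact: mx_entry_continuous|exact: ddf].
  by move=> t _; rewrite subr0; apply: le_trans (mx_entry_le _ _ _) (h2 _ _ _).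
Qed.

End SmoothCompactlySupported.

(** * Families that are Hoelder in space and C^(1,1) in the state *)

Section RegularFamilies.
Context {R : realType} (L : R) (L0 : 0 < L) (m : nat) (r : R).
Local Notation Phi := (H10 L m).
Local Notation mu := (@lebesgue_measure R).
Implicit Types (v w : Phi) (x y A B : R) (G H : Phi -> R -> R) (DG DH : Phi -> Phi -> R -> R).

(** One constant bounds [G v] and its linear derivative [DG v w] in C^(1/2) of the space variable,
    together with a quadratic Taylor remainder in the state. The exponent 1/2 is the one that H^1
    functions have, and the class is stable under sums, products, primitives and smooth
    composition. *)
Record regular_at A G DG : Prop := RegularAt {
  reg_bound : forall v x, `|v| < r -> x \in `[0, L] -> `|G v x| <= A;
  reg_holder : forall v x y, `|v| < r -> x \in `[0, L] -> y \in `[0, L] ->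
    `|G v y - G v x| <= A * Num.sqrt `|y - x|;
  reg_lin : forall v a w w' x, `|v| < r -> x \in `[0, L] ->
    DG v (a *: w + w') x = a * DG v w x + DG v w' x;
  reg_Dbound : forall v w x, `|v| < r -> x \in `[0, L] -> `|DG v w x| <= A * `|w|;
  reg_Dholder : forall v w x y, `|v| < r -> x \in `[0, L] -> y \in `[0, L] ->
    `|DG v w y - DG v w x| <= A * `|w| * Num.sqrt `|y - x|;
  reg_taylor : forall v v' x, `|v| < r -> `|v'| < r -> x \in `[0, L] ->
    `|G v' x - G v x - DG v (v' - v) x| <= A * `|v' - v| ^+ 2 }.

Lemma regular_at_le A B G DG : A <= B -> regular_at A G DG -> regular_at B G DG.
Proof.
move=> AB [h1 h2 h3 h4 h5 h6]; split.
- by move=> v x vr xI; exact: le_trans (h1 v x vr xI) AB.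
- by move=> v x y vr xI yI; apply: le_trans (h2 v x y vr xI yI) _; rewrite ler_wpM2r// sqrtr_ge0.
- exact: h3.
- by move=> v w x vr xI; apply: le_trans (h4 v w x vr xI) _; rewrite ler_wpM2r.
- move=> v w x y vr xI yI; apply: le_trans (h5 v w x y vr xI yI) _.
  by rewrite -!mulrA ler_wpM2r// mulr_ge0// sqrtr_ge0.
- by move=> v v' x vr v'r xI; apply: le_trans (h6 v v' x vr v'r xI) _; rewrite ler_wpM2r// exprn_ge0.
Qed.

Lemma regular_at_eq A G DG G' DG' :
  (forall v x, `|v| < r -> x \in `[0, L] -> G v x = G' v x) ->
  (forall v w x, `|v| < r -> x \in `[0, L] -> DG v w x = DG' v w x) ->
  regular_at A G DG -> regular_at A G' DG'.
Proof.
move=> GE DE [h1 h2 h3 h4 h5 h6]; split.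
- by move=> v x vr xI; rewrite -GE//; exact: h1.
- by move=> v x y vr xI yI; rewrite -!GE//; exact: h2.
- by move=> v a w w' x vr xI; rewrite -!DE//; exact: h3.
- by move=> v w x vr xI; rewrite -DE//; exact: h4.
- by move=> v w x y vr xI yI; rewrite -!DE//; exact: h5.
- by move=> v v' x vr v'r xI; rewrite -!GE// -DE//; exact: h6.
Qed.

(** One plus the diameter bound of the ball: it turns the quadratic Taylor remainder into a
    Lipschitz bound. *)
Let rr := 1 + 2 * `|r|.

Let rr1 : 1 <= rr. Proof. by rewrite lerDl mulr_ge0. Qed.

Let rr0 : 0 <= rr. Proof. exact: le_trans ler01 rr1. Qed.

Let diam v v' : `|v| < r -> `|v'| < r -> `|v' - v| <= 2 * `|r|.
Proof.
move=> h h'; apply: le_trans (ler_normB _ _) _; rewrite mulr2n mulrDl mul1r.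
by apply: lerD; [exact: (ltW (lt_le_trans h' (ler_norm r)))|exact: (ltW (lt_le_trans h (ler_norm r)))].
Qed.

Lemma reg_lipschitz A G DG v v' x : 0 <= A -> regular_at A G DG -> `|v| < r -> `|v'| < r ->
  x \in `[0, L] -> `|G v' x - G v x| <= A * rr * `|v' - v|.
Proof.
move=> A0 h vr v'r xI; rewrite -(subrK (DG v (v' - v) x) (G v' x - G v x)).
apply: le_trans (ler_normD _ _) _.
apply: le_trans (lerD (reg_taylor h vr v'r xI) (reg_Dbound h (v' - v) vr xI)) _.
rewrite expr2 mulrA -mulrDl ler_wpM2r// /rr mulrDr mulr1 addrC lerD2l ler_wpM2l//.
exact: diam.
Qed.

Lemma regular_at_fixed A h : holder_half L A h -> 0 <= A ->
  regular_at A (fun=> h) (fun _ _ _ => 0).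
Proof.
move=> [h1 h2] A0; split => //.
- by move=> v x _; exact: h1.
- by move=> v x y _; exact: h2.
- by move=> *; rewrite mulr0 addr0.
- by move=> *; rewrite normr0 mulr_ge0.
- by move=> *; rewrite subrr normr0 !mulr_ge0// sqrtr_ge0.
- by move=> *; rewrite subrr subr0 normr0 mulr_ge0// exprn_ge0.
Qed.

Lemma regular_atD A B G DG H DH : regular_at A G DG -> regular_at B H DH ->
  regular_at (A + B) (fun v x => G v x + H v x) (fun v w x => DG v w x + DH v w x).
Proof.
move=> [h1 h2 h3 h4 h5 h6] [k1 k2 k3 k4 k5 k6]; split.
- by move=> v x vr xI; apply: le_trans (ler_normD _ _) (lerD (h1 _ _ vr xI) (k1 _ _ vr xI)).
- move=> v x y vr xI yI; rewrite opprD addrACA mulrDl.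
  by apply: le_trans (ler_normD _ _) (lerD (h2 _ _ _ vr xI yI) (k2 _ _ _ vr xI yI)).
- by move=> v a w w' x vr xI; rewrite h3// k3//; ring.
- by move=> v w x vr xI; rewrite mulrDl; apply: le_trans (ler_normD _ _) (lerD (h4 _ _ _ vr xI) (k4 _ _ _ vr xI)).
- move=> v w x y vr xI yI; rewrite opprD addrACA !mulrDl.
  by apply: le_trans (ler_normD _ _) (lerD (h5 _ _ _ _ vr xI yI) (k5 _ _ _ _ vr xI yI)).
- move=> v v' x vr v'r xI; rewrite mulrDl.
  have -> : G v' x + H v' x - (G v x + H v x) - (DG v (v' - v) x + DH v (v' - v) x) =
    (G v' x - G v x - DG v (v' - v) x) + (H v' x - H v x - DH v (v' - v) x) by ring.
  by apply: le_trans (ler_normD _ _) (lerD (h6 _ _ _ vr v'r xI) (k6 _ _ _ vr v'r xI)).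
Qed.

Lemma regular_atM A G DG H DH : 0 <= A -> regular_at A G DG -> regular_at A H DH ->
  regular_at (A ^+ 2 * (4 * rr)) (fun v x => G v x * H v x)
    (fun v w x => DG v w x * H v x + G v x * DH v w x).
Proof.
move=> A0 hG hH.
have [h1 h2 h3 h4 h5 h6] := hG; have [k1 k2 k3 k4 k5 k6] := hH.
have AA : 0 <= A ^+ 2 by exact: sqr_ge0.
have c1 : A ^+ 2 * 1 <= A ^+ 2 * (4 * rr) by rewrite ler_wpM2l//; move: rr1; lra.
have c2 : A ^+ 2 * 2 <= A ^+ 2 * (4 * rr) by rewrite ler_wpM2l//; move: rr1; lra.
have c4 : A ^+ 2 * 4 <= A ^+ 2 * (4 * rr) by rewrite ler_wpM2l//; move: rr1; lra.
have c3 : A ^+ 2 * (2 + rr) <= A ^+ 2 * (4 * rr) by rewrite ler_wpM2l//; move: rr1; lra.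
split.
- move=> v x vr xI; rewrite normrM; apply: le_trans c1; rewrite mulr1 expr2.
  by apply: ler_pM => //; [exact: h1|exact: k1].
- move=> v x y vr xI yI; have s0 := sqrtr_ge0 `|y - x|; set s := Num.sqrt _ in s0 *.
  have -> : G v y * H v y - G v x * H v x = (G v y - G v x) * H v y + G v x * (H v y - H v x) by ring.
  apply: (@le_trans _ _ (A ^+ 2 * 2 * s)); last by rewrite ler_wpM2r.
  apply: le_trans (ler_normD _ _) _; rewrite !normrM.
  have -> : A ^+ 2 * 2 * s = (A * s) * A + A * (A * s) by ring.
  by apply: lerD; apply: ler_pM => //; [exact: h2|exact: k1|exact: h1|exact: k2].
- by move=> v a w w' x vr xI; rewrite h3// k3//; ring.
- move=> v w x vr xI; apply: (@le_trans _ _ (A ^+ 2 * 2 * `|w|)); last by rewrite ler_wpM2r.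
  apply: le_trans (ler_normD _ _) _; rewrite !normrM.
  have -> : A ^+ 2 * 2 * `|w| = (A * `|w|) * A + A * (A * `|w|) by ring.
  by apply: lerD; apply: ler_pM => //; [exact: h4|exact: k1|exact: h1|exact: k4].
- move=> v w x y vr xI yI; have s0 := sqrtr_ge0 `|y - x|; set s := Num.sqrt _ in s0 *.
  apply: (@le_trans _ _ (A ^+ 2 * 4 * `|w| * s)); last first.
    by rewrite -[leLHS]mulrA -[leRHS]mulrA ler_wpM2r// mulr_ge0.
  have -> : DG v w y * H v y + G v y * DH v w y - (DG v w x * H v x + G v x * DH v w x) =
    (DG v w y - DG v w x) * H v y + DG v w x * (H v y - H v x) +
    ((G v y - G v x) * DH v w y + G v x * (DH v w y - DH v w x)) by ring.
  have -> : A ^+ 2 * 4 * `|w| * s = (A * `|w| * s) * A + (A * `|w|) * (A * s) +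
    ((A * s) * (A * `|w|) + A * (A * `|w| * s)) by ring.
  apply: le_trans (ler_normD _ _) _; apply: lerD; apply: le_trans (ler_normD _ _) _; rewrite !normrM; apply: lerD; apply: ler_pM => //.
  + exact: h5.
  + exact: k1.
  + exact: h4.
  + exact: k2.
  + exact: h2.
  + exact: k4.
  + exact: h1.
  + exact: k5.
- move=> v v' x vr v'r xI; set d := v' - v.
  apply: (@le_trans _ _ (A ^+ 2 * (2 + rr) * `|d| ^+ 2)); last by rewrite ler_wpM2r// exprn_ge0.
  have -> : G v' x * H v' x - G v x * H v x - (DG v d x * H v x + G v x * DH v d x) =
    (G v' x - G v x - DG v d x) * H v' x + DG v d x * (H v' x - H v x) +
    G v x * (H v' x - H v x - DH v d x) by ring.
  have -> : A ^+ 2 * (2 + rr) * `|d| ^+ 2 = (A * `|d| ^+ 2) * A + (A * `|d|) * (A * rr * `|d|) +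
    A * (A * `|d| ^+ 2) by ring.
  apply: le_trans (ler_normD _ _) _; apply: lerD; last first.
    by rewrite normrM; apply: ler_pM => //; [exact: h1|exact: k6].
  apply: le_trans (ler_normD _ _) _; rewrite !normrM; apply: lerD; apply: ler_pM => //.
  + exact: h6.
  + exact: k1.
  + exact: h4.
  + exact: (reg_lipschitz A0 hH).
Qed.

Lemma reg_holder_half A G DG v : regular_at A G DG -> `|v| < r -> holder_half L A (G v).
Proof. by move=> h vr; split => [x|x y]; [exact: (reg_bound h)|exact: (reg_holder h)]. Qed.

Lemma reg_D_holder_half A G DG v w : regular_at A G DG -> `|v| < r ->
  holder_half L (A * `|w|) (DG v w).
Proof. by move=> h vr; split => [x|x y]; [exact: (reg_Dbound h)|exact: (reg_Dholder h)]. Qed.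

Lemma holder_half_L2 A h : holder_half L A h -> L2 L h.
Proof. by move=> hh; apply/continuous_L2/holder_half_continuous/hh. Qed.

Lemma integral_le_bound (h : R -> R) A x y : L2 L h -> (forall z, z \in `[0, L] -> `|h z| <= A) ->
  x \in `[0, L] -> y \in `[0, L] -> x <= y -> `|\int[mu]_(z in `[0, y]) h z - \int[mu]_(z in `[0, x]) h z| <= A * (y - x).
Proof.
move=> Lh hA; rewrite !in_itv/= => /andP[x0 xL] /andP[y0 yL] xy.
rewrite (integral_increment Lh)//; apply: (@integral_bounded_le _ L h x y A) => // z.
by rewrite in_itv/= => /andP[xz zy]; apply: hA; rewrite in_itv/= (le_trans x0)//= (le_trans zy).
Qed.

Lemma integral0_le_bound (h : R -> R) A x : L2 L h -> (forall z, z \in `[0, L] -> `|h z| <= A) ->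
  x \in `[0, L] -> `|\int[mu]_(z in `[0, x]) h z| <= A * L.
Proof.
move=> Lh hA xI; have I0 : 0 \in `[0, L] by rewrite in_itv/= lexx ltW.
have x0L : 0 <= x <= L by move: xI; rewrite in_itv.
have := integral_le_bound Lh hA I0 xI (andP x0L).1; rewrite set_itv1 Rintegral_set1 !subr0.
move=> /le_trans; apply; apply: ler_wpM2l; last by case/andP: x0L.
exact: le_trans (normr_ge0 _) (hA _ I0).
Qed.

Lemma integral_holder (h : R -> R) A x y : L2 L h -> (forall z, z \in `[0, L] -> `|h z| <= A) ->
  x \in `[0, L] -> y \in `[0, L] ->
  `|\int[mu]_(z in `[0, y]) h z - \int[mu]_(z in `[0, x]) h z| <= A * Num.sqrt L * Num.sqrt `|y - x|.
Proof.
move=> Lh hA; wlog xy : x y / x <= y.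
  move=> H xI yI; have [xy|/ltW yx] := leP x y; first exact: H.
  by rewrite distrC [`|y - x|]distrC; exact: H.
move=> xI yI; apply: le_trans (integral_le_bound Lh hA xI yI xy) _.
have A0 : 0 <= A by exact: le_trans (normr_ge0 _) (hA _ xI).
have yx0 : 0 <= y - x by rewrite subr_ge0.
rewrite -mulrA ler_wpM2l// ger0_norm// -{1}(sqr_sqrtr yx0) expr2 ler_wpM2r ?sqrtr_ge0//.
rewrite ler_wsqrtr//; move: xI yI; rewrite !in_itv/= => /andP[x0 _] /andP[_ yL].
by rewrite lerBlDr (le_trans yL)// lerDl.
Qed.

Lemma regular_at_integral A G DG : 0 <= A -> regular_at A G DG ->
  regular_at (A * (1 + L + Num.sqrt L)) (fun v x => \int[mu]_(y in `[0, x]) G v y)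
    (fun v w x => \int[mu]_(y in `[0, x]) DG v w y).
Proof.
move=> A0 h.
have s0 := sqrtr_ge0 L; have L0' := ltW L0.
have cL : A * L <= A * (1 + L + Num.sqrt L) by rewrite ler_wpM2l//; lra.
have cs : A * Num.sqrt L <= A * (1 + L + Num.sqrt L) by rewrite ler_wpM2l//; lra.
have LG v : `|v| < r -> L2 L (G v) by move=> vr; exact: holder_half_L2 (reg_holder_half h vr).
have LDG v w : `|v| < r -> L2 L (DG v w) by move=> vr; exact: holder_half_L2 (reg_D_holder_half w h vr).
have ix k x : L2 L k -> x \in `[0, L] -> mu.-integrable `[0, x] (EFin \o k).
  by move=> Lk; rewrite in_itv/= => /andP[_ xL]; exact: (integrable_sub Lk (lexx 0) xL).
split.
- move=> v x vr xI; apply: le_trans cL; apply: integral0_le_bound => //; first exact: LG.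
  by move=> z; exact: (reg_bound h).
- move=> v x y vr xI yI; apply: (@le_trans _ _ (A * Num.sqrt L * Num.sqrt `|y - x|)); last by rewrite ler_wpM2r// sqrtr_ge0.
  by apply: integral_holder => //; [exact: LG|move=> z; exact: (reg_bound h)].
- move=> v a w w' x vr xI.
  have e : \int[mu]_(y in `[0, x]) DG v (a *: w + w') y = \int[mu]_(y in `[0, x]) (a * DG v w y + DG v w' y).
    apply: eq_Rintegral => y /set_mem/=; rewrite in_itv/= => /andP[y0 yx]; apply: (reg_lin h) => //.
    by move: xI; rewrite !in_itv/= y0/= => /andP[_]; exact: le_trans.
  rewrite e RintegralD//; [|by apply: ix => //; apply: L2Z; exact: LDG|by apply: ix => //; exact: LDG].
  by rewrite RintegralZl//; apply: ix => //; exact: LDG.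
- move=> v w x vr xI; apply: (@le_trans _ _ (A * `|w| * L)); last by rewrite mulrAC ler_wpM2r.
  by apply: integral0_le_bound => //; [exact: LDG|move=> z; exact: (reg_Dbound h)].
- move=> v w x y vr xI yI.
  apply: (@le_trans _ _ (A * `|w| * Num.sqrt L * Num.sqrt `|y - x|)).
    by apply: integral_holder => //; [exact: LDG|move=> z; exact: (reg_Dbound h)].
  by rewrite ler_wpM2r ?sqrtr_ge0// mulrAC ler_wpM2r.
- move=> v v' x vr v'r xI; set d := v' - v.
  have Ls : L2 L (fun y => G v' y - G v y - DG v d y).
    by apply: L2B; [apply: L2B; exact: LG|exact: LDG].
  have -> : \int[mu]_(y in `[0, x]) G v' y - \int[mu]_(y in `[0, x]) G v y - \int[mu]_(y in `[0, x]) DG v d y =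
    \int[mu]_(y in `[0, x]) (G v' y - G v y - DG v d y).
    by rewrite !RintegralB//; apply: ix => //; [exact: LG|exact: LG|apply: L2B; exact: LG|exact: LDG].
  apply: (@le_trans _ _ (A * `|d| ^+ 2 * L)); last by rewrite mulrAC ler_wpM2r// exprn_ge0.
  by apply: integral0_le_bound => // z zI; exact: (reg_taylor h).
Qed.

Lemma regular_at_comp (p q : nat) (f : 'cV[R]_m -> 'M[R]_(p, q)) (C A : R)
    (g : Phi -> R -> 'cV[R]_m) (Dg : Phi -> Phi -> R -> 'cV[R]_m) (i : 'I_p) (j : 'I_q) : 0 <= C -> 0 <= A ->
  (forall (x y h : 'cV[R]_m) (i : 'I_p) (j : 'I_q), [/\ `|f x i j| <= C, `|'d f x h i j| <= C * `|h|,
      `|(f y - f x - 'd f x (y - x)) i j| <= C * `|y - x| ^+ 2 &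
      `|('d f y h - 'd f x h) i j| <= C * `|y - x| * `|h|]) ->
  (forall l, regular_at A (fun v x => g v x l 0) (fun v w x => Dg v w x l 0)) ->
  regular_at (C * (1 + A + A ^+ 2 * rr ^+ 2 * 2)) (fun v x => f (g v x) i j)
    (fun v w x => 'd f (g v x) (Dg v w x) i j).
Proof.
move=> C0 A0 fC hg.
have AA : 0 <= A ^+ 2 by exact: sqr_ge0.
have rr2 : 1 <= rr ^+ 2 by rewrite expr_ge1.
have AAr : A ^+ 2 <= A ^+ 2 * rr ^+ 2 by rewrite ler_peMr.
have [M1 M2 M3 M4 M5] : let M := 1 + A + A ^+ 2 * rr ^+ 2 * 2 in
    [/\ 1 <= M, A <= M, A + A ^+ 2 * 2 <= M, A + A ^+ 2 <= M & A + A ^+ 2 * rr ^+ 2 <= M].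
  by split; lra.
have B0 : 0 <= C * (1 + A + A ^+ 2 * rr ^+ 2 * 2) by rewrite mulr_ge0// !addr_ge0// !mulr_ge0// exprn_ge0.
have vbound (h : 'cV[R]_m) (e : R) : 0 <= e -> (forall l, `|h l 0| <= e) -> `|h| <= e.
  by move=> e0 he; apply: mx_norm_le => // l k; rewrite ord1; exact: he.
have gy v x y : `|v| < r -> x \in `[0, L] -> y \in `[0, L] -> `|g v y - g v x| <= A * Num.sqrt `|y - x|.
  move=> vr xI yI; apply: vbound; first by rewrite mulr_ge0// sqrtr_ge0.
  by move=> l; rewrite !mxE; exact: (reg_holder (hg l)).
have gD v w x : `|v| < r -> x \in `[0, L] -> `|Dg v w x| <= A * `|w|.
  by move=> vr xI; apply: vbound; [rewrite mulr_ge0|move=> l; exact: (reg_Dbound (hg l))].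
have gDy v w x y : `|v| < r -> x \in `[0, L] -> y \in `[0, L] -> `|Dg v w y - Dg v w x| <= A * `|w| * Num.sqrt `|y - x|.
  move=> vr xI yI; apply: vbound; first by rewrite !mulr_ge0// sqrtr_ge0.
  by move=> l; rewrite !mxE; exact: (reg_Dholder (hg l)).
have glip v v' x : `|v| < r -> `|v'| < r -> x \in `[0, L] -> `|g v' x - g v x| <= A * rr * `|v' - v|.
  move=> vr v'r xI; apply: vbound; first by rewrite !mulr_ge0.
  by move=> l; rewrite !mxE; exact: (reg_lipschitz A0 (hg l)).
have gT v v' x : `|v| < r -> `|v'| < r -> x \in `[0, L] ->
    `|g v' x - g v x - Dg v (v' - v) x| <= A * `|v' - v| ^+ 2.
  move=> vr v'r xI; apply: vbound; first by rewrite mulr_ge0// exprn_ge0.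
  by move=> l; rewrite !mxE; exact: (reg_taylor (hg l)).
have mB (a b : 'M[R]_(p, q)) : (a - b) i j = a i j - b i j by rewrite !mxE.
have dB (z a b : 'cV[R]_m) : 'd f z (a - b) i j = 'd f z a i j - 'd f z b i j.
  by rewrite -mB; congr ((_ : 'M[R]_(p, q)) i j); exact: linearB.
have telescope (a b c : R) : a - c = a - b + (b - c) by rewrite subrKA.
have telescope' (a b c d e : R) : a - b - e = a - b - (c - d) + (c - d - e) by rewrite subrKA.
split.
- move=> v x vr xI; have [h _ _ _] := fC (g v x) 0 0 i j; apply: le_trans h _.
  by rewrite ler_peMr.
- move=> v x y vr xI yI; have s0 := sqrtr_ge0 `|y - x|.
  have h := gy v x y vr xI yI; set s := Num.sqrt _ in s0 h *.
  have [h0 h1 h2 _] := fC (g v x) (g v y) (g v y - g v x) i j.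
  have g2 : `|g v y - g v x| <= 2 * A.
    apply: vbound; first by rewrite mulr_ge0.
    move=> l; rewrite !mxE; apply: le_trans (ler_normB _ _) _; rewrite mulr2n mulrDl mul1r.
    by apply: lerD; exact: (reg_bound (hg l)).
  have -> : f (g v y) i j - f (g v x) i j = (f (g v y) - f (g v x) - 'd f (g v x) (g v y - g v x)) i j +
    'd f (g v x) (g v y - g v x) i j by rewrite !mxE subrK.
  apply: le_trans (ler_normD _ _) _; apply: le_trans (lerD h2 h1) _.
  rewrite expr2 mulrA -mulrDl.
  apply: (@le_trans _ _ ((C * (2 * A) + C) * (A * s))).
    apply: ler_pM => //; first by rewrite addr_ge0// mulr_ge0.
    by rewrite lerD2r ler_wpM2l.
  rewrite mulrA ler_wpM2r//.
  have -> : (C * (2 * A) + C) * A = C * (A + A ^+ 2 * 2) by ring.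
  by rewrite ler_wpM2l.
- move=> v a w w' x vr xI.
  have -> : Dg v (a *: w + w') x = a *: Dg v w x + Dg v w' x.
    by apply/colP => l; rewrite !mxE; exact: (reg_lin (hg l)).
  by rewrite linearP !mxE.
- move=> v w x vr xI; have [_ h _ _] := fC (g v x) 0 (Dg v w x) i j; apply: le_trans h _.
  apply: (@le_trans _ _ (C * (A * `|w|))); first by rewrite ler_wpM2l// gD.
  by rewrite mulrA ler_wpM2r// ler_wpM2l.
- move=> v w x y vr xI yI; have s0 := sqrtr_ge0 `|y - x|.
  have h := gy v x y vr xI yI; have h' := gDy v w x y vr xI yI; set s := Num.sqrt _ in s0 h h' *.
  have [_ _ _ k1] := fC (g v x) (g v y) (Dg v w y) i j.
  have [_ k2 _ _] := fC (g v x) (g v y) (Dg v w y - Dg v w x) i j.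
  have -> : 'd f (g v y) (Dg v w y) i j - 'd f (g v x) (Dg v w x) i j =
    ('d f (g v y) (Dg v w y) - 'd f (g v x) (Dg v w y)) i j + 'd f (g v x) (Dg v w y - Dg v w x) i j.
    by rewrite dB mB; exact: telescope.
  apply: le_trans (ler_normD _ _) _; apply: le_trans (lerD k1 k2) _.
  apply: (@le_trans _ _ (C * (A * s) * (A * `|w|) + C * (A * `|w| * s))).
    apply: lerD; last by rewrite ler_wpM2l.
    by apply: ler_pM => //; rewrite ?mulr_ge0//; [rewrite ler_wpM2l|exact: gD].
  have -> : C * (A * s) * (A * `|w|) + C * (A * `|w| * s) = C * (A + A ^+ 2) * (`|w| * s) by ring.
  by rewrite -[leRHS]mulrA ler_wpM2r ?mulr_ge0// ler_wpM2l.
- move=> v v' x vr v'r xI; set d := v' - v.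
  have [_ _ k1 _] := fC (g v x) (g v' x) 0 i j.
  have [_ k2 _ _] := fC (g v x) 0 (g v' x - g v x - Dg v d x) i j.
  have -> : f (g v' x) i j - f (g v x) i j - 'd f (g v x) (Dg v d x) i j =
    (f (g v' x) - f (g v x) - 'd f (g v x) (g v' x - g v x)) i j +
    'd f (g v x) (g v' x - g v x - Dg v d x) i j
    by rewrite !dB !mB dB; exact: telescope'.
  apply: le_trans (ler_normD _ _) _; apply: le_trans (lerD k1 k2) _.
  apply: (@le_trans _ _ (C * (A * rr * `|d|) ^+ 2 + C * (A * `|d| ^+ 2))).
    apply: lerD; rewrite ler_wpM2l//; last exact: gT.
    by rewrite lerXn2r ?nnegrE ?mulr_ge0//; exact: glip.
  have -> : C * (A * rr * `|d|) ^+ 2 + C * (A * `|d| ^+ 2) = C * (A + A ^+ 2 * rr ^+ 2) * `|d| ^+ 2 by ring.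
  by rewrite ler_wpM2r ?exprn_ge0// ler_wpM2l.
Qed.

End RegularFamilies.

(** * The gauge as a fundamental matrix *)

Section MatrixOde.
Context {R : realType} (L : R) (L0 : 0 < L) (m : nat).
Local Notation mu := (@lebesgue_measure R).
Implicit Types (a c h y z : R -> 'M[R]_m).

Lemma is_derive_sum_seq (I : Type) (s : seq I) (F : I -> R -> R) (d : I -> R) (t : R) :
  (forall i, is_derive t (1 : R) (F i) (d i)) ->
  is_derive t (1 : R) (fun x : R => \sum_(i <- s) F i x) (\sum_(i <- s) d i).
Proof.
move=> dF; elim: s => [|i s IH].
  rewrite big_nil (_ : (fun x => _) = cst 0); first exact: is_derive_cst.
  by apply/funext => x; rewrite big_nil.
rewrite big_cons (_ : (fun x => _) = F i + (fun x => \sum_(j <- s) F j x)).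
  exact: (is_deriveD (dF i) IH).
by apply/funext => x; rewrite big_cons.
Qed.

Lemma within_continuous_sum (I : Type) (s : seq I) (F : I -> R -> R) (A : set R) :
  (forall i, {within A, continuous (F i)}) ->
  {within A, continuous (fun x => \sum_(i <- s) F i x)}.
Proof.
move=> cF; elim: s => [|i s IH].
  rewrite (_ : (fun x => _) = cst 0); last by apply/funext => x; rewrite big_nil.
  by move=> x; exact: cvg_cst.
rewrite (_ : (fun x => _) = F i \+ (fun x => \sum_(j <- s) F j x)).
  by move=> x; apply: cvgD; [exact: cF|exact: IH].
by apply/funext => x; rewrite big_cons.
Qed.

Definition mx_continuous y := forall i j, {within `[0, L], continuous (fun x => y x i j)}.

Definition mx_derive y (d : R -> 'M[R]_m) := forall x i j, x \in `]0, L[ ->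
  is_derive x (1 : R) (fun t : R => y t i j) (d x i j).

Lemma within_continuous_mx y : {within `[0, L], continuous y} <-> mx_continuous y.
Proof.
split=> [cy i j x|cy x].
  exact: (@continuous_comp _ _ _ (y : subspace _ -> _) (mx_entry i j) x (cy x) (@mx_entry_continuous _ _ _ i j _)).
apply/cvgrPdist_le => e e0; near=> t.
apply: mx_norm_le; first exact: ltW.
move=> i j; rewrite !mxE.
have : forall ij : 'I_m * 'I_m, `|y x ij.1 ij.2 - y t ij.1 ij.2| <= e.
  near: t; apply: filter_forall => ij.
  exact: ((cvgrPdist_le _ _).1 (cy ij.1 ij.2 x) e e0).
by move=> /(_ (i, j)).
Unshelve. all: by end_near. Qed.

Lemma is_derive_mx (p q : nat) (y : R -> 'M[R]_(p, q)) (d : 'M[R]_(p, q)) (t : R) :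
  is_derive t (1 : R) y d <->
  forall i j, is_derive t (1 : R) (fun x : R => y x i j) (d i j).
Proof.
split=> [[yt <-] i j|dy].
  by split; [exact: (derivable_mxP _ _ _).1|rewrite (derive_mx yt) mxE].
have yt : derivable y t (1 : R) by apply/derivable_mxP => i j; case: (dy i j).
by split => //; apply/matrixP => i j; rewrite (derive_mx yt) mxE; case: (dy i j).
Qed.

Lemma ivp_mx F (b : 'M[R]_m) y : ivp L F b y <->
  [/\ y 0 = b, mx_continuous y & mx_derive y (fun x => F x (y x))].
Proof.
split=> -[y00 cy dy]; split => //.
- exact/within_continuous_mx.
- by move=> x i j xI; move: (dy x xI) => /is_derive_mx.
- exact/within_continuous_mx.
- by move=> x xI; apply/is_derive_mx => i j; exact: dy.
Qed.

Lemma mulmx_entry (a b : 'M[R]_m) i j : (a *m b) i j = \sum_k a i k * b k j.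
Proof. by rewrite mxE. Qed.

Lemma mx_continuousM y z : mx_continuous y -> mx_continuous z -> mx_continuous (fun x => y x *m z x).
Proof.
move=> cy cz i j; rewrite (_ : (fun x => _) = fun x => \sum_k y x i k * z x k j).
  by apply: within_continuous_sum => k x; apply: cvgM; [exact: cy|exact: cz].
by apply/funext => x; rewrite mulmx_entry.
Qed.

Lemma mx_continuous_cst (a : 'M[R]_m) : mx_continuous (fun=> a).
Proof. by move=> i j x; exact: cvg_cst. Qed.

Lemma mx_continuousB y z : mx_continuous y -> mx_continuous z -> mx_continuous (fun x => y x - z x).
Proof.
move=> cy cz i j; rewrite (_ : (fun x => _) = fun x => y x i j - z x i j).
  by move=> x; apply: cvgB; [exact: cy|exact: cz].
by apply/funext => x; rewrite !mxE.
Qed.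

Lemma mx_deriveM y z dy dz : mx_derive y dy -> mx_derive z dz ->
  mx_derive (fun x => y x *m z x) (fun x => dy x *m z x + y x *m dz x).
Proof.
move=> hy hz x i j xI; rewrite mxE !mulmx_entry -big_split/=.
rewrite (_ : (fun x => _) = fun x => \sum_k y x i k * z x k j); last first.
  by apply/funext => t; rewrite mulmx_entry.
apply: is_derive_sum_seq => k.
apply: (is_derive_eq (is_deriveM (hy x i k xI) (hz x k j xI))).
by rewrite /GRing.scale/= [LHS]addrC [X in X + _ = _]mulrC.
Qed.

Lemma mx_deriveB y z dy dz : mx_derive y dy -> mx_derive z dz ->
  mx_derive (fun x => y x - z x) (fun x => dy x - dz x).
Proof.
move=> hy hz x i j xI; rewrite !mxE (_ : (fun x => _) = (fun x => y x i j) - (fun x => z x i j)).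
  exact: (is_deriveB (hy x i j xI) (hz x i j xI)).
by apply/funext => t; rewrite !fctE !mxE.
Qed.

Lemma mx_derive_eq y d d' : (forall x, x \in `]0, L[ -> d x = d' x) -> mx_derive y d -> mx_derive y d'.
Proof. by move=> dd h x i j xI; rewrite -dd//; exact: h. Qed.

(** The squared Frobenius norm, which unlike the norm by maximal entries can be differentiated along
    a solution. *)
Definition energy (a : 'M[R]_m) : R := \sum_i \sum_j a i j ^+ 2.

Lemma energy_ge0 a x : 0 <= energy (a x).
Proof. by do 2!apply: sumr_ge0 => ? _; exact: sqr_ge0. Qed.

Lemma entry_energy (a : 'M[R]_m) i j : a i j ^+ 2 <= energy a.
Proof.
rewrite /energy (bigD1 i)//= (bigD1 j)//= -addrA lerDl addr_ge0//.
  by apply: sumr_ge0 => ? _; exact: sqr_ge0.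
by do 2!apply: sumr_ge0 => ? _; exact: sqr_ge0.
Qed.

Lemma energy_mulmx_le (c z : 'M[R]_m) C : 0 <= C -> (forall i j, `|c i j| <= C) ->
  `|\sum_i \sum_j 2 * (z i j * (c *m z) i j)| <= 2 * C * m%:R * energy z.
Proof.
move=> C0 cC; apply: le_trans (ler_norm_sum _ _ _) _.
have b i j : `|2 * (z i j * (c *m z) i j)| <= C * (m%:R * z i j ^+ 2 + \sum_k z k j ^+ 2).
  rewrite mulmx_entry !mulr_sumr; apply: le_trans (ler_norm_sum _ _ _) _.
  have -> : m%:R * z i j ^+ 2 + \sum_k z k j ^+ 2 = \sum_(k < m) (z i j ^+ 2 + z k j ^+ 2).
    by rewrite big_split/= sumr_const card_ord mulr_natl.
  rewrite mulr_sumr; apply: ler_sum => k _; rewrite !normrM ger0_norm//.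
  rewrite -[z i j ^+ 2]real_normK ?num_real// -[z k j ^+ 2]real_normK ?num_real//.
  have h := sqr_ge0 (`|z i j| - `|z k j|); set p := `|z i j| in h *; set q := `|z k j| in h *.
  have -> : 2 * (p * (`|c i k| * q)) = `|c i k| * (2 * p * q) by ring.
  have pq : 0 <= 2 * p * q by rewrite !mulr_ge0 /p /q.
  have pq2 : 2 * p * q <= p ^+ 2 + q ^+ 2 by move: h; rewrite sqrrB; lra.
  exact: (ler_pM (normr_ge0 _) pq (cC i k) pq2).
apply: le_trans (_ : \sum_i \sum_j C * (m%:R * z i j ^+ 2 + \sum_k z k j ^+ 2) <= _).
  by apply: ler_sum => i _; apply: le_trans (ler_norm_sum _ _ _) _; apply: ler_sum => j _; exact: b.
rewrite le_eqVlt; apply/orP; left; apply/eqP.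
have -> : \sum_i \sum_j C * (m%:R * z i j ^+ 2 + \sum_k z k j ^+ 2) =
    C * (\sum_i \sum_j m%:R * z i j ^+ 2 + \sum_(i < m) \sum_j \sum_k z k j ^+ 2).
  rewrite -big_split/= mulr_sumr; apply: eq_bigr => i _.
  by rewrite -big_split/= mulr_sumr.
have -> : \sum_i \sum_j m%:R * z i j ^+ 2 = m%:R * energy z.
  by rewrite /energy mulr_sumr; apply: eq_bigr => i _; rewrite mulr_sumr.
have -> : \sum_(i < m) \sum_j \sum_k z k j ^+ 2 = \sum_(i < m) energy z.
  by apply: eq_bigr => i _; rewrite exchange_big.
by rewrite sumr_const card_ord -mulr_natl; ring.
Qed.

Lemma is_derive_energy z dz x : mx_derive z dz -> x \in `]0, L[ ->
  is_derive x (1 : R) (fun t : R => energy (z t)) (\sum_i \sum_j 2 * (z x i j * dz x i j)).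
Proof.
move=> hz xI; do 2!apply: is_derive_sum_seq => ?.
apply: (is_derive_eq (is_deriveM (hz x _ _ xI) (hz x _ _ xI))).
by rewrite /GRing.scale/=; ring.
Qed.

Lemma within_continuous_energy z : mx_continuous z -> {within `[0, L], continuous (fun t => energy (z t))}.
Proof. by move=> cz; do 2!apply: within_continuous_sum => ?; move=> x; apply: cvgM; exact: cz. Qed.

(** Gronwall's inequality in both directions: values at any two points are comparable. Going
    backwards is what bounds the inverse matrix. *)
Lemma energy_growth c z C : 0 <= C -> (forall (x : R) i j, x \in `[0, L] -> `|c x i j| <= C) ->
  mx_continuous z -> mx_derive z (fun x => c x *m z x) ->
  forall (x y : R), x \in `[0, L] -> y \in `[0, L] ->
  energy (z y) <= expR (2 * C * m%:R * L) * energy (z x).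
Proof.
move=> C0 cC cz dz x y xI yI; set k := 2 * C * m%:R.
have k0 : 0 <= k by rewrite !mulr_ge0.
have cE := within_continuous_energy cz.
have dE s (t : R) : t \in `]0, L[ -> is_derive t (1 : R) (fun u : R => expR (s * u) * energy (z u))
    (expR (s * t) * (s * energy (z t) + \sum_i \sum_j 2 * (z t i j * (c t *m z t) i j))).
  move=> tI; have dE := is_derive_energy dz tI; have de := is_derive_expRM s t.
  by apply: (is_derive_eq (is_deriveM de dE)); rewrite /GRing.scale/=; ring.
have bE t : t \in `]0, L[ -> `|\sum_i \sum_j 2 * (z t i j * (c t *m z t) i j)| <= k * energy (z t).
  move=> tI; apply: energy_mulmx_le => // i j; apply: cC.
  by move: tI; rewrite !in_itv/= => /andP[/ltW -> /ltW ->].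
have ce s u v : 0 <= u -> v <= L -> {within `[u, v], continuous (fun u => expR (s * u) * energy (z u))}.
  move=> u0 vL; apply: continuous_subspaceW (sub_itv_L u0 vL) _ => t.
  by apply: cvgM; [apply: (continuous_subspaceT (@continuous_expRM _ s))|exact: cE].
have sub u v t : 0 <= u -> v <= L -> u < t -> t < v -> t \in `]0, L[.
  by move=> u0 vL ut tv; rewrite in_itv/= (le_lt_trans u0)// (lt_le_trans tv).
have up u v : 0 <= u -> u <= v -> v <= L -> energy (z v) <= expR (k * (v - u)) * energy (z u).
  move=> u0 uv vL; have := @derive_le0_ge _ _ _ _ _ uv
    (fun t ut tv => dE (- k) t (sub u v t u0 vL ut tv)) (ce (- k) u v u0 vL) _.
  have neg t : u < t -> t < v -> expR (- k * t) * (- k * energy (z t) +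
      \sum_i \sum_j 2 * (z t i j * (c t *m z t) i j)) <= 0.
    move=> ut tv; rewrite mulr_ge0_le0 ?expR_ge0//.
    by have := bE t (sub u v t u0 vL ut tv); rewrite ler_norml => /andP[_]; lra.
  move=> /(_ neg); rewrite mulrBr expRD !mulNr !expRN => h.
  by rewrite -mulrA mulrC -ler_pdivrMr ?expR_gt0// mulrC.
have dn u v : 0 <= u -> u <= v -> v <= L -> energy (z u) <= expR (k * (v - u)) * energy (z v).
  move=> u0 uv vL; have := @derive_ge0_le _ _ _ _ _ uv
    (fun t ut tv => dE k t (sub u v t u0 vL ut tv)) (ce k u v u0 vL) _.
  have pos t : u < t -> t < v -> 0 <= expR (k * t) * (k * energy (z t) +
      \sum_i \sum_j 2 * (z t i j * (c t *m z t) i j)).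
    move=> ut tv; rewrite mulr_ge0 ?expR_ge0//.
    by have := bE t (sub u v t u0 vL ut tv); rewrite ler_norml => /andP[+ _]; lra.
  move=> /(_ pos); rewrite mulrBr expRD expRN => h.
  by rewrite mulrAC ler_pdivlMr ?expR_gt0// mulrC.
have le u v w w' : 0 <= w -> u <= w -> w <= v * expR (k * w') -> w' <= L -> 0 <= v -> u <= expR (k * L) * v.
  move=> w0 uw wv w'L v0; apply: le_trans uw _; apply: le_trans wv _.
  by rewrite mulrC ler_wpM2r// ler_expR ler_wpM2l.
move: xI yI; rewrite !in_itv/= => /andP[x0 xL] /andP[y0 yL].
have [xy|/ltW yx] := leP x y.
  apply: le_trans (up x y x0 xy yL) _; rewrite ler_wpM2r ?energy_ge0// ler_expR ler_wpM2l//; lra.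
apply: le_trans (dn y x y0 yx xL) _; rewrite ler_wpM2r ?energy_ge0// ler_expR ler_wpM2l//; lra.
Qed.

Lemma energy0 : energy 0 = 0.
Proof. by rewrite /energy big1// => i _; rewrite big1// => j _; rewrite mxE expr0n. Qed.

Lemma energy_le_eq0 (a : 'M[R]_m) : energy a <= 0 -> a = 0.
Proof.
move=> h; apply/matrixP => i j; have := le_trans (entry_energy a i j) h.
by rewrite mxE exprn_even_le0//= => /eqP.
Qed.

Lemma energy1_le : energy 1%:M <= m%:R ^+ 2.
Proof.
rewrite /energy; apply: (@le_trans _ _ (\sum_(i < m) \sum_(j < m) 1)).
  by apply: ler_sum => i _; apply: ler_sum => j _; rewrite mxE; case: eqP; rewrite ?expr1n ?expr0n.
by rewrite !sumr_const !card_ord -mulrnA -natrX mulnn.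
Qed.

Section Fundamental.
Variables (c a : R -> 'M[R]_m) (C : R).
Hypothesis C0 : 0 <= C.
Hypothesis cC : forall x i j, x \in `[0, L] -> `|c x i j| <= C.
Hypothesis ca : mx_continuous a.
Hypothesis da : mx_derive a (fun x => c x *m a x).
Hypothesis a0 : a 0 = 1%:M.
Hypothesis ua : forall x, x \in `[0, L] -> a x \in unitmx.

Let I0 : 0 \in `[0, L]. Proof. by rewrite in_itv/= lexx ltW. Qed.

Definition ode_growth : R := Num.sqrt (expR (2 * C * m%:R * L)) * m%:R.

Lemma ode_growth_ge0 : 0 <= ode_growth.
Proof. by rewrite mulr_ge0// sqrtr_ge0. Qed.

Let entry_le (b : 'M[R]_m) i j : energy b <= expR (2 * C * m%:R * L) * m%:R ^+ 2 -> `|b i j| <= ode_growth.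
Proof.
move=> h; rewrite -(@ler_pXn2r _ 2) ?nnegrE ?ode_growth_ge0// real_normK ?num_real//.
rewrite exprMn sqr_sqrtr ?expR_ge0//; exact: le_trans (entry_energy b i j) h.
Qed.

Lemma fundamental_le x i j : x \in `[0, L] -> `|a x i j| <= ode_growth.
Proof.
move=> xI; apply: entry_le; apply: le_trans (energy_growth C0 cC ca da I0 xI) _.
by rewrite a0 ler_wpM2l ?expR_ge0// energy1_le.
Qed.

(** [a t] times the inverse of [a x] is a solution in [t]. It equals 1 at [x] and the inverse of
    [a x] at 0, so going back from [x] to 0 gives the bound. *)
Lemma fundamental_inv_le x i j : x \in `[0, L] -> `|invmx (a x) i j| <= ode_growth.
Proof.
move=> xI; pose z t := a t *m invmx (a x).
have cz : mx_continuous z by apply: mx_continuousM => //; exact: mx_continuous_cst.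
have dz : mx_derive z (fun t => c t *m z t).
  move=> t k l tI; have d0 : mx_derive (fun=> invmx (a x)) (fun=> 0).
    by move=> s p q _; rewrite mxE; exact: is_derive_cst.
  by have := mx_deriveM da d0 k l tI; rewrite mulmx0 addr0 -mulmxA.
apply: entry_le; have := energy_growth C0 cC cz dz xI I0.
rewrite /z a0 mul1mx mulmxV ?ua// => /le_trans; apply.
by rewrite ler_wpM2l ?expR_ge0// energy1_le.
Qed.

Lemma fundamental_unique z z' h : z 0 = z' 0 -> mx_continuous z -> mx_continuous z' ->
  mx_derive z (fun x => c x *m z x + h x) -> mx_derive z' (fun x => c x *m z' x + h x) ->
  forall x, x \in `[0, L] -> z x = z' x.
Proof.
move=> zz cz cz' dz dz' x xI; apply/eqP; rewrite -subr_eq0; apply/eqP/energy_le_eq0.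
have d : mx_derive (fun x => z x - z' x) (fun x => c x *m (z x - z' x)).
  apply: mx_derive_eq (mx_deriveB dz dz') => t _.
  by rewrite mulmxBr opprD addrACA subrr addr0.
apply: le_trans (energy_growth C0 cC (mx_continuousB cz cz') d I0 xI) _.
by rewrite zz subrr energy0 mulr0.
Qed.

End Fundamental.

End MatrixOde.

(** * Variation of constants *)

Section Variation.
Context {R : realType} (L : R) (L0 : 0 < L) (m : nat).
Local Notation mu := (@lebesgue_measure R).
Implicit Types (a c h y z : R -> 'M[R]_m).

Definition mx_integral h (x : R) : 'M[R]_m := \matrix_(i, j) \int[mu]_(t in `[0, x]) h t i j.

Let I0 : 0 \in `[0, L]. Proof. by rewrite in_itv/= lexx ltW. Qed.

Lemma mx_continuous_L2 h i j : mx_continuous L h -> L2 L (fun x => h x i j).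
Proof. by move=> ch; exact: continuous_L2. Qed.

Lemma mx_continuous_bounded h : mx_continuous L h ->
  exists2 C : R, 0 <= C & forall x i j, x \in `[0, L] -> `|h x i j| <= C.
Proof.
move=> ch; have bd (ij : 'I_m * 'I_m) : exists C : R, 0 <= C /\ forall x, x \in `[0, L] -> `|h x ij.1 ij.2| <= C.
  exact: continuous_bounded.
have [B BP] := choice bd; exists (\sum_ij B ij).
  by apply: sumr_ge0 => ij _; case: (BP ij).
move=> x i j xI; apply: le_trans ((BP (i, j)).2 x xI) _.
by rewrite (bigD1 (i, j))//= lerDl sumr_ge0// => ij _; case: (BP ij).
Qed.

Lemma mx_integral0 h : mx_integral h 0 = 0.
Proof. by apply/matrixP => i j; rewrite !mxE set_itv1 Rintegral_set1. Qed.

Lemma mx_integral_le h C x i j : mx_continuous L h -> (forall t, t \in `[0, L] -> `|h t i j| <= C) ->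
  x \in `[0, L] -> `|mx_integral h x i j| <= C * L.
Proof.
move=> ch hC xI; rewrite mxE; apply: integral0_le_bound => //; exact: mx_continuous_L2.
Qed.

Lemma mx_integral_holder h C i j : mx_continuous L h -> (forall t, t \in `[0, L] -> `|h t i j| <= C) ->
  forall (x y : R), x \in `[0, L] -> y \in `[0, L] ->
  `|mx_integral h y i j - mx_integral h x i j| <= C * Num.sqrt L * Num.sqrt `|y - x|.
Proof.
move=> ch hC x y xI yI; rewrite !mxE; apply: integral_holder => //; exact: mx_continuous_L2.
Qed.

Lemma mx_integral_continuous h : mx_continuous L h -> mx_continuous L (mx_integral h).
Proof.
move=> ch i j; have [C C0 hC] := mx_continuous_bounded ch.
apply: (@holder_half_continuous _ L (C * (L + Num.sqrt L))); split => [x xI|x y xI yI].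
  apply: le_trans (mx_integral_le ch (fun t => @hC t i j) xI) _.
  by rewrite ler_wpM2l// lerDl sqrtr_ge0.
apply: le_trans (mx_integral_holder ch (fun t => @hC t i j) xI yI) _.
by rewrite ler_wpM2r ?sqrtr_ge0// ler_wpM2l// lerDr ltW.
Qed.

Lemma mx_integral_derive h : mx_continuous L h -> mx_derive L (mx_integral h) h.
Proof.
move=> ch x i j xI; have [x0 xL] : 0 < x /\ x < L by move: xI; rewrite in_itv => /andP[].
have ih : mu.-integrable `[0, L] (EFin \o (fun t => h t i j)) by exact/L2_integrable/mx_continuous_L2.
have cx : {for x, continuous (fun t => h t i j)}.
  by have [cx _ _] := (continuous_within_itvP _ L0).1 (ch i j); exact: cx.
have [d e] := continuous_FTC1_closed xL ih x0 cx.
rewrite (_ : (fun t => _) = fun t => \int[mu]_(s in `[0, t]) h s i j).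
  by apply: DeriveDef; [exact: d|rewrite -derive1E].
by apply/funext => t; rewrite mxE.
Qed.

Lemma mx_integralB h k x : mx_continuous L h -> mx_continuous L k -> x \in `[0, L] ->
  mx_integral (fun t => h t - k t) x = mx_integral h x - mx_integral k x.
Proof.
move=> ch ck; rewrite in_itv/= => /andP[x0 xL]; apply/matrixP => i j; rewrite !mxE.
under eq_Rintegral do rewrite !mxE.
by rewrite RintegralB//; apply: (@integrable_sub _ L) => //; exact: mx_continuous_L2.
Qed.

Lemma mx_integral_eq h k x : x \in `[0, L] -> (forall t, t \in `[0, L] -> h t = k t) ->
  mx_integral h x = mx_integral k x.
Proof.
rewrite in_itv/= => /andP[x0 xL] hk; apply/matrixP => i j; rewrite !mxE.
apply: eq_Rintegral => t /set_mem/=; rewrite in_itv/= => /andP[t0 tx].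
by rewrite hk// in_itv/= t0 (le_trans tx).
Qed.

Lemma entry_mul_le (b d : 'M[R]_m) (B D : R) i j : 0 <= D -> (forall i j, `|b i j| <= B) ->
  (forall i j, `|d i j| <= D) -> `|(b *m d) i j| <= m%:R * (B * D).
Proof.
move=> D0 bB dD; rewrite mulmx_entry; apply: le_trans (ler_norm_sum _ _ _) _.
apply: (@le_trans _ _ (\sum_(k < m) B * D)); last by rewrite sumr_const card_ord mulr_natl.
by apply: ler_sum => k _; rewrite normrM; apply: ler_pM.
Qed.

Lemma invmx_sub (b d : 'M[R]_m) : b \in unitmx -> d \in unitmx ->
  invmx d - invmx b = - (invmx d *m (d - b) *m invmx b).
Proof.
by move=> ub ud; rewrite mulmxBr mulVmx// mulmxBl mul1mx -mulmxA mulmxV// mulmx1 opprB.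
Qed.

Section Fundamental.
Variables (c a : R -> 'M[R]_m) (C : R).
Hypothesis cC : forall i j, holder_half L C (fun x => c x i j).
Hypothesis C0 : 0 <= C.
Hypothesis ca : mx_continuous L a.
Hypothesis da : mx_derive L a (fun x => c x *m a x).
Hypothesis a0 : a 0 = 1%:M.
Hypothesis ua : forall x, x \in `[0, L] -> a x \in unitmx.

Let cb x i j : x \in `[0, L] -> `|c x i j| <= C.
Proof. by case: (cC i j) => + _; exact. Qed.

Let cc : mx_continuous L c.
Proof. by move=> i j; exact: holder_half_continuous (cC i j). Qed.

Local Notation G := (ode_growth L m C).

Let G0 : 0 <= G. Proof. exact: ode_growth_ge0. Qed.

Let aG x i j : x \in `[0, L] -> `|a x i j| <= G.
Proof. exact: (fundamental_le L0 C0 cb ca da a0). Qed.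

Let qG x i j : x \in `[0, L] -> `|invmx (a x) i j| <= G.
Proof. exact: (fundamental_inv_le L0 C0 cb ca da a0 ua). Qed.

(** Both sides have derivative [c a] and value 1 at 0, and uniqueness is applied with zero
    coefficient. The integral form yields the Hoelder bound of [a] up to the end points. *)
Lemma fundamental_integral x : x \in `[0, L] -> a x = 1%:M + mx_integral (fun t => c t *m a t) x.
Proof.
move=> xI; have cca := mx_continuousM cc ca.
refine (@fundamental_unique _ L L0 m (fun=> 0) 0 (lexx 0) _ a (fun x => 1%:M + mx_integral (fun t => c t *m a t) x)
  (fun t => c t *m a t) _ ca _ _ _ x xI).
- by move=> t i j _; rewrite mxE normr0.
- by rewrite mx_integral0 addr0.
- have := mx_continuousB (mx_integral_continuous cca) (@mx_continuous_cst _ L m (- 1%:M)).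
  by under [X in mx_continuous L X -> _]eq_fun do rewrite opprK addrC.
- by apply: mx_derive_eq da => t _; rewrite mul0mx add0r.
- have d1 : mx_derive L (fun=> - 1%:M : 'M[R]_m) (fun=> 0).
    by move=> s p q _; rewrite [X in is_derive _ _ _ X]mxE; exact: is_derive_cst.
  have := mx_deriveB (mx_integral_derive cca) d1.
  under [X in mx_derive L X _ -> _]eq_fun do rewrite opprK addrC.
  by apply: mx_derive_eq => t _; rewrite mul0mx add0r subr0.
Qed.

Definition fundamental_bound : R := G + m%:R * (C * G) * Num.sqrt L.

Lemma fundamental_bound_ge : G <= fundamental_bound.
Proof. by rewrite lerDl !mulr_ge0// sqrtr_ge0. Qed.

Lemma fundamental_holder i j : holder_half L fundamental_bound (fun x => a x i j).
Proof.
split => [x xI|x y xI yI]; first exact: le_trans (aG i j xI) fundamental_bound_ge.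
rewrite (fundamental_integral xI) (fundamental_integral yI) !mxE opprD addrACA subrr add0r.
have := @mx_integral_holder (fun t => c t *m a t) (m%:R * (C * G)) i j (mx_continuousM cc ca) _ x y xI yI.
rewrite !mxE => /(_ _)/le_trans; apply => [t tI|].
  by apply: entry_mul_le => // k l; [exact: cb|exact: aG].
by rewrite ler_wpM2r ?sqrtr_ge0// lerDr.
Qed.

Definition fundamental_inv_bound : R := G + m%:R * (m%:R * (G * fundamental_bound) * G).

Lemma fundamental_inv_holder i j : holder_half L fundamental_inv_bound (fun x => invmx (a x) i j).
Proof.
have F0 : 0 <= fundamental_bound by exact: le_trans G0 fundamental_bound_ge.
split => [x xI|x y xI yI].
  by apply: le_trans (qG i j xI) _; rewrite lerDl !mulr_ge0.
have -> : invmx (a y) i j - invmx (a x) i j = (invmx (a y) - invmx (a x)) i j by rewrite !mxE.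
rewrite invmx_sub ?ua// mxE normrN; set s := Num.sqrt _; have s0 : 0 <= s by exact: sqrtr_ge0.
apply: (@le_trans _ _ (m%:R * (m%:R * (G * (fundamental_bound * s)) * G))).
  apply: entry_mul_le => // k l; [|exact: qG].
  apply: entry_mul_le => [|k' l'|k' l']; [by rewrite mulr_ge0|exact: qG|].
  rewrite !mxE; case: (fundamental_holder k' l') => _; exact.
have -> : m%:R * (m%:R * (G * (fundamental_bound * s)) * G) = m%:R * (m%:R * (G * fundamental_bound) * G) * s by ring.
by rewrite ler_wpM2r// lerDr.
Qed.

Lemma invmx_fundamental_continuous : mx_continuous L (fun x => invmx (a x)).
Proof. by move=> i j; exact: holder_half_continuous (fundamental_inv_holder i j). Qed.

(** Duhamel's formula for the solution of [z' = c z + h] that vanishes at 0. *)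
Definition variation h x := a x *m mx_integral (fun t => invmx (a t) *m h t) x.

Lemma variation_continuous h : mx_continuous L h -> mx_continuous L (variation h).
Proof.
move=> ch; apply: mx_continuousM => //; apply: mx_integral_continuous.
by apply: mx_continuousM => //; exact: invmx_fundamental_continuous.
Qed.

Lemma variation0 h : variation h 0 = 0.
Proof. by rewrite /variation mx_integral0 mulmx0. Qed.

Lemma variation_derive h : mx_continuous L h -> mx_derive L (variation h) (fun x => c x *m variation h x + h x).
Proof.
move=> ch; have ci := mx_continuousM invmx_fundamental_continuous ch.
apply: mx_derive_eq (mx_deriveM da (mx_integral_derive ci)) => x xI.
rewrite /variation !mulmxA mulmxV ?mul1mx// ua//.
by move: xI; rewrite !in_itv/= => /andP[/ltW -> /ltW ->].
Qed.

Lemma variation_unique h z : mx_continuous L h -> mx_continuous L z -> z 0 = 0 ->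
  mx_derive L z (fun x => c x *m z x + h x) -> forall x, x \in `[0, L] -> z x = variation h x.
Proof.
move=> ch cz z0 dz x xI.
apply: (fundamental_unique L0 C0 cb _ cz (variation_continuous ch) dz (variation_derive ch)) => //.
by rewrite z0 variation0.
Qed.

End Fundamental.

End Variation.

(** * Regularity uniform in a parameter *)

Section Families.
Context {R : realType} (L : R) (L0 : 0 < L) (m : nat) (r : R) {I : Type}.
Local Notation Phi := (H10 L m).
Local Notation mu := (@lebesgue_measure R).
Implicit Types (P : set I) (v w : Phi) (G H : I -> Phi -> R -> R) (DG DH : I -> Phi -> Phi -> R -> R).

(** The index is K in the application: one constant for all large K is what makes the decay of [F1]
    uniform. *)
Definition regular P G DG := exists2 A : R, 0 <= A & forall k, P k -> regular_at r A (G k) (DG k).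

Lemma regular_eq P G DG G' DG' :
  (forall k v x, P k -> `|v| < r -> x \in `[0, L] -> G k v x = G' k v x) ->
  (forall k v w x, P k -> `|v| < r -> x \in `[0, L] -> DG k v w x = DG' k v w x) ->
  regular P G DG -> regular P G' DG'.
Proof.
move=> GE DE [A A0 h]; exists A => // k Pk.
by apply: regular_at_eq (h k Pk) => [v x|v w x]; [exact: GE|exact: DE].
Qed.

Lemma regular_fixed P (h : I -> R -> R) (A : R) : 0 <= A -> (forall k, P k -> holder_half L A (h k)) ->
  regular P (fun k _ => h k) (fun _ _ _ _ => 0).
Proof. by move=> A0 hh; exists A => // k Pk; apply: regular_at_fixed => //; exact: hh. Qed.

Lemma holder_half_cst (b : R) : holder_half L `|b| (fun=> b).
Proof. by split => [//|x y _ _]; rewrite subrr normr0 mulr_ge0// sqrtr_ge0. Qed.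

Lemma regular_cst P (b : R) : regular P (fun _ _ _ => b) (fun _ _ _ _ => 0).
Proof. by apply: (regular_fixed (normr_ge0 b)) => k _; exact: holder_half_cst. Qed.

Lemma regularD P G DG H DH : regular P G DG -> regular P H DH ->
  regular P (fun k v x => G k v x + H k v x) (fun k v w x => DG k v w x + DH k v w x).
Proof.
by move=> [A A0 h] [B B0 h']; exists (A + B) => [|k Pk]; [exact: addr_ge0|apply: regular_atD; auto].
Qed.

Lemma regularM P G DG H DH : regular P G DG -> regular P H DH ->
  regular P (fun k v x => G k v x * H k v x)
    (fun k v w x => DG k v w x * H k v x + G k v x * DH k v w x).
Proof.
move=> [A A0 h] [B B0 h']; have M0 : 0 <= Num.max A B by rewrite le_max A0.
exists (Num.max A B ^+ 2 * (4 * (1 + 2 * `|r|))) => [|k Pk].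
  by rewrite !mulr_ge0 ?exprn_ge0// addr_ge0// mulr_ge0.
by apply: regular_atM => //; [apply: regular_at_le (h k Pk)|apply: regular_at_le (h' k Pk)];
  rewrite le_max lexx ?orbT.
Qed.

Lemma regularZ P (b : R) G DG : regular P G DG ->
  regular P (fun k v x => b * G k v x) (fun k v w x => b * DG k v w x).
Proof.
move=> h; apply: regular_eq (regularM (regular_cst P b) h) => // k v w x _ _ _.
by rewrite mul0r add0r.
Qed.

Lemma regularB P G DG H DH : regular P G DG -> regular P H DH ->
  regular P (fun k v x => G k v x - H k v x) (fun k v w x => DG k v w x - DH k v w x).
Proof.
by move=> h h'; apply: regular_eq (regularD h (regularZ (-1) h')) => * /=; rewrite mulN1r.
Qed.

Lemma regular_sum P (T : Type) (s : seq T) (G : T -> I -> Phi -> R -> R) (DG : T -> I -> Phi -> Phi -> R -> R) :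
  (forall l, regular P (G l) (DG l)) ->
  regular P (fun k v x => \sum_(l <- s) G l k v x) (fun k v w x => \sum_(l <- s) DG l k v w x).
Proof.
move=> h; elim: s => [|l s IH].
  by apply: regular_eq (regular_cst P 0) => *; rewrite big_nil.
by apply: regular_eq (regularD (h l) IH) => *; rewrite big_cons.
Qed.

Lemma regular_integral P G DG : regular P G DG ->
  regular P (fun k v x => \int[mu]_(y in `[0, x]) G k v y) (fun k v w x => \int[mu]_(y in `[0, x]) DG k v w y).
Proof.
move=> [A A0 h]; exists (A * (1 + L + Num.sqrt L)) => [|k Pk]; last exact: regular_at_integral (h k Pk).
by rewrite mulr_ge0// !addr_ge0 ?sqrtr_ge0// ltW.
Qed.

End Families.

Section MatrixFamilies.
Context {R : realType} (L : R) (L0 : 0 < L) (m : nat) (r : R) {I : Type}.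
Local Notation Phi := (H10 L m).
Local Notation mu := (@lebesgue_measure R).
Implicit Types (P : set I) (v w : Phi).

Definition regular_mx (p q : nat) P (G : I -> Phi -> R -> 'M[R]_(p, q)) (DG : I -> Phi -> Phi -> R -> 'M[R]_(p, q)) :=
  forall i j, regular r P (fun k v x => G k v x i j) (fun k v w x => DG k v w x i j).

Lemma regular_mx_uniform p q P G DG : @regular_mx p q P G DG ->
  exists2 A : R, 0 <= A & forall i j k, P k ->
    regular_at r A (fun v x => G k v x i j) (fun v w x => DG k v w x i j).
Proof.
move=> h; have bd (ij : 'I_p * 'I_q) : exists A : R, 0 <= A /\ forall k, P k ->
    regular_at r A (fun v x => G k v x ij.1 ij.2) (fun v w x => DG k v w x ij.1 ij.2).
  by have [A A0 hA] := h ij.1 ij.2; exists A.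
have [B BP] := choice bd; exists (\sum_ij B ij).
  by apply: sumr_ge0 => ij _; case: (BP ij).
move=> i j k Pk; apply: regular_at_le ((BP (i, j)).2 k Pk).
by rewrite (bigD1 (i, j))//= lerDl sumr_ge0// => ij _; case: (BP ij).
Qed.

Lemma regular_mx_eq p q P (G G' : I -> Phi -> R -> 'M[R]_(p, q)) DG DG' :
  (forall k v x, P k -> `|v| < r -> x \in `[0, L] -> G k v x = G' k v x) ->
  (forall k v w x, P k -> `|v| < r -> x \in `[0, L] -> DG k v w x = DG' k v w x) ->
  regular_mx P G DG -> regular_mx P G' DG'.
Proof.
move=> GE DE h i j; apply: regular_eq (h i j) => [k v x|k v w x] Pk vr xI.
  by rewrite GE.
by rewrite DE.
Qed.

Lemma regular_mxD p q P (G H : I -> Phi -> R -> 'M[R]_(p, q)) DG DH :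
  regular_mx P G DG -> regular_mx P H DH ->
  regular_mx P (fun k v x => G k v x + H k v x) (fun k v w x => DG k v w x + DH k v w x).
Proof. by move=> h h' i j; apply: regular_eq (regularD (h i j) (h' i j)) => * /=; rewrite mxE. Qed.

Lemma regular_mxB p q P (G H : I -> Phi -> R -> 'M[R]_(p, q)) DG DH :
  regular_mx P G DG -> regular_mx P H DH ->
  regular_mx P (fun k v x => G k v x - H k v x) (fun k v w x => DG k v w x - DH k v w x).
Proof. by move=> h h' i j; apply: regular_eq (regularB (h i j) (h' i j)) => * /=; rewrite !mxE. Qed.

Lemma regular_mxZ p q P (b : R) (G : I -> Phi -> R -> 'M[R]_(p, q)) DG : regular_mx P G DG ->
  regular_mx P (fun k v x => b *: G k v x) (fun k v w x => b *: DG k v w x).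
Proof. by move=> h i j; apply: regular_eq (regularZ b (h i j)) => * /=; rewrite mxE. Qed.

Lemma regular_mulmx p q s P (G : I -> Phi -> R -> 'M[R]_(p, q)) (H : I -> Phi -> R -> 'M[R]_(q, s)) DG DH :
  regular_mx P G DG -> regular_mx P H DH ->
  regular_mx P (fun k v x => G k v x *m H k v x)
    (fun k v w x => DG k v w x *m H k v x + G k v x *m DH k v w x).
Proof.
move=> h h' i j.
apply: regular_eq (regular_sum (index_enum 'I_q) (fun l => regularM (h i l) (h' l j))) => * /=.
  by rewrite mxE.
by rewrite !mxE big_split.
Qed.

Lemma regular_mx_fixed p q P (h : I -> R -> 'M[R]_(p, q)) (A : R) : 0 <= A ->
  (forall k i j, P k -> holder_half L A (fun x => h k x i j)) ->
  regular_mx P (fun k _ => h k) (fun _ _ _ _ => 0).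
Proof.
move=> A0 hh i j.
apply: regular_eq (@regular_fixed _ L m r I P (fun k x => h k x i j) A A0 (fun k Pk => hh k i j Pk)) => // *.
by rewrite mxE.
Qed.

Lemma regular_mx_integral P (G : I -> Phi -> R -> 'M[R]_m) DG : regular_mx P G DG ->
  regular_mx P (fun k v => mx_integral (G k v)) (fun k v w => mx_integral (DG k v w)).
Proof.
by move=> h i j; apply: regular_eq (regular_integral L0 (h i j)) => * /=; rewrite mxE.
Qed.

Lemma regular_mx_comp (p q : nat) P (f : 'cV[R]_m -> 'M[R]_(p, q))
    (G : I -> Phi -> R -> 'cV[R]_m) (DG : I -> Phi -> Phi -> R -> 'cV[R]_m) :
  C2_bounded f -> regular_mx P G DG ->
  regular_mx P (fun k v x => f (G k v x)) (fun k v w x => 'd f (G k v x) (DG k v w x)).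
Proof.
move=> [C C0 fC] /regular_mx_uniform[A A0 hA] i j.
exists (C * (1 + A + A ^+ 2 * (1 + 2 * `|r|) ^+ 2 * 2)).
  by rewrite mulr_ge0// !addr_ge0// !mulr_ge0// exprn_ge0// addr_ge0// mulr_ge0.
by move=> k Pk; apply: regular_at_comp => // l; exact: hA.
Qed.

Lemma regular_linear P (D : I -> Phi -> R -> R) (A : R) : 0 <= A ->
  (forall k b w w' x, P k -> x \in `[0, L] -> D k (b *: w + w') x = b * D k w x + D k w' x) ->
  (forall k w x, P k -> x \in `[0, L] -> `|D k w x| <= A * `|w|) ->
  (forall k w x y, P k -> x \in `[0, L] -> y \in `[0, L] ->
     `|D k w y - D k w x| <= A * `|w| * Num.sqrt `|y - x|) ->
  regular r P D (fun k _ => D k).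
Proof.
move=> A0 lin bd ho; exists (A * (1 + `|r|)) => [|k Pk]; first by rewrite mulr_ge0// addr_ge0.
have A1 : A <= A * (1 + `|r|) by rewrite ler_peMr// lerDl.
have rA (v : Phi) : `|v| < r -> A * `|v| <= A * (1 + `|r|).
  by move=> vr; rewrite ler_wpM2l//; apply: le_trans (ltW vr) _; apply: le_trans (ler_norm r) _; rewrite lerDr.
split.
- by move=> v x vr xI; apply: le_trans (bd k v x Pk xI) (rA v vr).
- by move=> v x y vr xI yI; apply: le_trans (ho k v x y Pk xI yI) _; rewrite ler_wpM2r ?sqrtr_ge0// rA.
- by move=> v b w w' x _ xI; exact: lin.
- by move=> v w x _ xI; apply: le_trans (bd k w x Pk xI) _; rewrite ler_wpM2r.
- by move=> v w x y _ xI yI; apply: le_trans (ho k w x y Pk xI yI) _; rewrite ler_wpM2r ?sqrtr_ge0// ler_wpM2r.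
- move=> v v' x _ _ xI; have -> : D k (v' - v) x = D k v' x - D k v x.
    by rewrite addrC -scaleN1r lin// mulN1r addrC.
  by rewrite subrr normr0 mulr_ge0 ?exprn_ge0// mulr_ge0// addr_ge0.
Qed.

End MatrixFamilies.

(** * Inverses and fundamental matrices depending on the state *)

Section FundamentalFamilies.
Context {R : realType} (L : R) (L0 : 0 < L) (m : nat) (r : R) {I : Type}.
Local Notation Phi := (H10 L m).
Local Notation mu := (@lebesgue_measure R).
Implicit Types (P : set I) (v w : Phi).

(** Pairs of an index and a base point: the derivative at a base point is treated as a family of its
    own, with the base point as a parameter. *)
Definition ball_index P : set (I * Phi) := [set kv | P kv.1 /\ `|kv.2| < r].

(* A linear family is its own derivative, so Hoelder bounds of the derivative of a
   product follow from the product rule for families. *)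
Lemma regular_derivative_linear P (G : I -> Phi -> R -> R) (DG : I -> Phi -> Phi -> R -> R) :
  regular r P G DG ->
  regular r (ball_index P) (fun kv w x => DG kv.1 kv.2 w x) (fun kv _ w x => DG kv.1 kv.2 w x).
Proof.
move=> [A A0 h]; apply: (@regular_linear _ _ _ _ _ _ (fun kv w x => DG kv.1 kv.2 w x) A A0).
- by move=> [k v] b w w' x [/= Pk vr] xI; exact: (reg_lin (h k Pk)).
- by move=> [k v] w x [/= Pk vr] xI; exact: (reg_Dbound (h k Pk)).
- by move=> [k v] w x y [/= Pk vr] xI yI; exact: (reg_Dholder (h k Pk)).
Qed.

(** The product rules supply the bounds of [DG], seen as a linear family; what is left to prove by
    hand for [G] is its Hoelder bound and the Taylor remainder. *)
Lemma regular_of_derivative P (G : I -> Phi -> R -> R) (DG : I -> Phi -> Phi -> R -> R) (A T : R) :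
  0 <= A -> 0 <= T -> (forall k v, P k -> `|v| < r -> holder_half L A (G k v)) ->
  regular r (ball_index P) (fun kv w x => DG kv.1 kv.2 w x) (fun kv _ w x => DG kv.1 kv.2 w x) ->
  (forall k v v' x, P k -> `|v| < r -> `|v'| < r -> x \in `[0, L] ->
    `|G k v' x - G k v x - DG k v (v' - v) x| <= T * `|v' - v| ^+ 2) ->
  regular r P G DG.
Proof.
move=> A0 T0 hG [B B0 hD] hT; exists (A + B + T) => [|k Pk]; first by rewrite !addr_ge0.
have r0 (v : Phi) : `|v| < r -> `|0 : Phi| < r by rewrite normr0; exact: le_lt_trans.
have AT : A <= A + B + T by rewrite -addrA lerDl addr_ge0.
have BT : B <= A + B + T by rewrite addrAC lerDr addr_ge0.
have TT : T <= A + B + T by rewrite lerDr addr_ge0.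
split.
- by move=> v x vr xI; have [h _] := hG k v Pk vr; exact: le_trans (h x xI) AT.
- move=> v x y vr xI yI; have [_ h] := hG k v Pk vr; apply: le_trans (h x y xI yI) _.
  by rewrite ler_wpM2r// sqrtr_ge0.
- by move=> v b w w' x vr xI; exact: (reg_lin (hD (k, v) (conj Pk vr)) b w w' (r0 v vr) xI).
- move=> v w x vr xI; apply: le_trans (reg_Dbound (hD (k, v) (conj Pk vr)) w (r0 v vr) xI) _.
  by rewrite ler_wpM2r.
- move=> v w x y vr xI yI; apply: le_trans (reg_Dholder (hD (k, v) (conj Pk vr)) w (r0 v vr) xI yI) _.
  by rewrite -!mulrA ler_wpM2r// mulr_ge0// sqrtr_ge0.
- move=> v v' x vr v'r xI; apply: le_trans (hT k v v' x Pk vr v'r xI) _.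
  by rewrite ler_wpM2r// exprn_ge0.
Qed.

Lemma regular_mx_invmx P (a : I -> Phi -> R -> 'M[R]_m) (Da : I -> Phi -> Phi -> R -> 'M[R]_m) (Q : R) :
  0 <= Q -> (forall k v x, P k -> `|v| < r -> x \in `[0, L] -> a k v x \in unitmx) ->
  (forall k v i j, P k -> `|v| < r -> holder_half L Q (fun x => invmx (a k v x) i j)) ->
  regular_mx r P a Da ->
  regular_mx r P (fun k v x => invmx (a k v x))
    (fun k v w x => - (invmx (a k v x) *m Da k v w x *m invmx (a k v x))).
Proof.
move=> Q0 ua hQ ha; have [A A0 hA] := regular_mx_uniform ha.
have QE k v x i j : P k -> `|v| < r -> x \in `[0, L] -> `|invmx (a k v x) i j| <= Q.
  by move=> Pk vr xI; case: (hQ k v i j Pk vr) => h _; exact: h.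
pose rr := 1 + 2 * `|r|; have rr0 : 0 <= rr by rewrite addr_ge0// mulr_ge0.
have lip k v v' x i j : P k -> `|v| < r -> `|v'| < r -> x \in `[0, L] ->
    `|(a k v' x - a k v x) i j| <= A * rr * `|v' - v|.
  by move=> Pk vr v'r xI; rewrite !mxE; exact: (reg_lipschitz A0 (hA i j k Pk) vr v'r xI).
pose T := m%:R * (m%:R * ((m%:R * (m%:R * (Q * (A * rr)) * Q)) * (A * rr)) * Q) + m%:R * (m%:R * (Q * A) * Q).
have T0 : 0 <= T by rewrite addr_ge0// !mulr_ge0.
have hD : regular_mx r (ball_index P) (fun kv w x => - (invmx (a kv.1 kv.2 x) *m Da kv.1 kv.2 w x *m invmx (a kv.1 kv.2 x)))
    (fun kv _ w x => - (invmx (a kv.1 kv.2 x) *m Da kv.1 kv.2 w x *m invmx (a kv.1 kv.2 x))).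
  have fx : regular_mx r (ball_index P) (fun kv (_ : Phi) x => invmx (a kv.1 kv.2 x)) (fun _ _ _ _ => 0).
    by apply: (@regular_mx_fixed _ L m r _ m m (ball_index P) (fun kv x => invmx (a kv.1 kv.2 x)) Q Q0) => -[k v] i j [/= Pk vr]; exact: hQ.
  have lin : regular_mx r (ball_index P) (fun kv w x => Da kv.1 kv.2 w x) (fun kv _ w x => Da kv.1 kv.2 w x).
    by move=> i j; exact: (regular_derivative_linear (ha i j)).
  apply: regular_mx_eq (regular_mxZ (-1) (regular_mulmx (regular_mulmx fx lin) fx)) => kv v.
    by move=> *; rewrite scaleN1r.
  by move=> *; rewrite scaleN1r mul0mx add0r mulmx0 addr0.
move=> i j; apply: (@regular_of_derivative P _ _ Q T Q0 T0 _ (hD i j)) => [k v Pk vr|k v v' x Pk vr v'r xI].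
  exact: hQ.
set d := `|v' - v|; have d0 : 0 <= d by exact: normr_ge0.
have u := ua k v x Pk vr xI; have u' := ua k v' x Pk v'r xI.
have tay p q : `|(a k v' x - a k v x - Da k v (v' - v) x) p q| <= A * d ^+ 2.
  by rewrite !mxE; exact: (reg_taylor (hA p q k Pk) vr v'r xI).
set b := a k v x in u tay *; set b' := a k v' x in u' tay *; set D := Da k v (v' - v) x in tay *.
have dq p q : `|(invmx b' - invmx b) p q| <= m%:R * (m%:R * (Q * (A * rr)) * Q) * d.
  rewrite invmx_sub// mxE normrN.
  have -> : m%:R * (m%:R * (Q * (A * rr)) * Q) * d = m%:R * (m%:R * (Q * (A * rr * d)) * Q) by ring.
  apply: entry_mul_le => // k' l'; last exact: QE.
  apply: entry_mul_le => [|k2 l2|k2 l2]; [by rewrite !mulr_ge0|exact: QE|exact: lip].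
(* Second order expansion of the inverse: beyond the first order term there remain a product of two
   increments and the Taylor remainder of [a]. *)
have -> : invmx b' i j - invmx b i j - (- (invmx b *m D *m invmx b)) i j =
    - ((invmx b' - invmx b) *m (b' - b) *m invmx b) i j - (invmx b *m (b' - b - D) *m invmx b) i j.
  have -> : invmx b' i j - invmx b i j - (- (invmx b *m D *m invmx b)) i j =
    ((invmx b' - invmx b) + invmx b *m D *m invmx b) i j by rewrite !mxE opprK.
  have -> : - ((invmx b' - invmx b) *m (b' - b) *m invmx b) i j - (invmx b *m (b' - b - D) *m invmx b) i j =
    (- ((invmx b' - invmx b) *m (b' - b) *m invmx b) - (invmx b *m (b' - b - D) *m invmx b)) i j by rewrite !mxE.
  congr ((_ : 'M[R]_m) i j); rewrite {1}invmx_sub//.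
  have alg (X Y V : 'M[R]_m) : - X + V = - (X - Y) - (Y - V) by rewrite !opprB [RHS]addrC addrA subrK addrC.
  by rewrite (mulmxBr _ (b' - b) D) !mulmxBl; set e := b' - b; exact: alg.
apply: le_trans (ler_normB _ _) _; rewrite normrN /T mulrDl; apply: lerD.
  have -> : m%:R * (m%:R * (m%:R * (m%:R * (Q * (A * rr)) * Q) * (A * rr)) * Q) * d ^+ 2 =
    m%:R * (m%:R * (m%:R * (m%:R * (Q * (A * rr)) * Q) * d * (A * rr * d)) * Q) by ring.
  apply: entry_mul_le => // k' l'; last exact: QE.
  by apply: entry_mul_le => [|k2 l2|k2 l2]; [rewrite !mulr_ge0|exact: dq|exact: lip].
have -> : m%:R * (m%:R * (Q * A) * Q) * d ^+ 2 = m%:R * (m%:R * (Q * (A * d ^+ 2)) * Q) by ring.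
apply: entry_mul_le => // k' l'; last exact: QE.
by apply: entry_mul_le => [|k2 l2|k2 l2]; [rewrite mulr_ge0// exprn_ge0|exact: QE|exact: tay].
Qed.

Section Gauge.
Variables (P : set I) (c a : I -> Phi -> R -> 'M[R]_m) (Dc : I -> Phi -> Phi -> R -> 'M[R]_m).
Hypothesis hc : regular_mx r P c Dc.
Hypothesis ha : forall k v, P k -> `|v| < r ->
  [/\ a k v 0 = 1%:M, mx_continuous L (a k v), mx_derive L (a k v) (fun x => c k v x *m a k v x) &
      forall x, x \in `[0, L] -> a k v x \in unitmx].

(** Differentiating [a' = c a] in the state gives [y' = c y + Dc a] with [y 0 = 0], which variation
    of constants solves. *)
Definition Dfundamental k v w := variation (a k v) (fun t => Dc k v w t *m a k v t).

Lemma regular_fundamental_bounds : exists F Q : R, [/\ 0 <= F, 0 <= Q &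
  forall k v i j, P k -> `|v| < r -> holder_half L F (fun x => a k v x i j) /\
    holder_half L Q (fun x => invmx (a k v x) i j)].
Proof.
have [C C0 hC] := regular_mx_uniform hc.
have G0 := ode_growth_ge0 L m C.
have F0 : 0 <= fundamental_bound L m C by rewrite addr_ge0// !mulr_ge0// sqrtr_ge0.
exists (fundamental_bound L m C), (fundamental_inv_bound L m C); split => //.
  by rewrite addr_ge0// !mulr_ge0.
move=> k v i j Pk vr; have [a0 ca da ua] := ha Pk vr.
have cC i' j' : holder_half L C (fun x => c k v x i' j') by exact: reg_holder_half (hC i' j' k Pk) vr.
by split; [exact: (fundamental_holder L0 cC C0 ca da a0)|exact: (fundamental_inv_holder L0 cC C0 ca da a0 ua)].
Qed.

Lemma regular_fundamental : regular_mx r P a Dfundamental.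
Proof.
have [F [Q [F0 Q0 FQ]]] := regular_fundamental_bounds; have [C C0 hC] := regular_mx_uniform hc.
have fx : regular_mx r (ball_index P) (fun kv (_ : Phi) x => a kv.1 kv.2 x) (fun _ _ _ _ => 0).
  by apply: (@regular_mx_fixed _ L m r _ m m (ball_index P) (fun kv x => a kv.1 kv.2 x) F F0) => -[k v] i j [/= Pk vr]; case: (FQ k v i j Pk vr).
have fq : regular_mx r (ball_index P) (fun kv (_ : Phi) x => invmx (a kv.1 kv.2 x)) (fun _ _ _ _ => 0).
  by apply: (@regular_mx_fixed _ L m r _ m m (ball_index P) (fun kv x => invmx (a kv.1 kv.2 x)) Q Q0) => -[k v] i j [/= Pk vr]; case: (FQ k v i j Pk vr).
have lin : regular_mx r (ball_index P) (fun kv w x => Dc kv.1 kv.2 w x) (fun kv _ w x => Dc kv.1 kv.2 w x).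
  by move=> i j; exact: (regular_derivative_linear (hc i j)).
have hD : regular_mx r (ball_index P) (fun kv w x => Dfundamental kv.1 kv.2 w x) (fun kv _ w x => Dfundamental kv.1 kv.2 w x).
  apply: regular_mx_eq (regular_mulmx fx (regular_mx_integral L0 (regular_mulmx fq (regular_mulmx lin fx)))) => //.
  move=> kv v w x _ _ xI; rewrite mul0mx add0r; congr (_ *m _); apply: mx_integral_eq xI _ => t tI.
  by rewrite mul0mx add0r mulmx0 addr0.
have FE k v x i j : P k -> `|v| < r -> x \in `[0, L] -> `|a k v x i j| <= F.
  by move=> Pk vr xI; case: (FQ k v i j Pk vr) => -[h _] _; exact: h.
have QE k v x i j : P k -> `|v| < r -> x \in `[0, L] -> `|invmx (a k v x) i j| <= Q.
  by move=> Pk vr xI; case: (FQ k v i j Pk vr) => _ [h _]; exact: h.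
pose rr := 1 + 2 * `|r|; have rr0 : 0 <= rr by rewrite addr_ge0// mulr_ge0.
have cl k v v' x i j : P k -> `|v| < r -> `|v'| < r -> x \in `[0, L] ->
    `|(c k v' x - c k v x) i j| <= C * rr * `|v' - v|.
  by move=> Pk vr v'r xI; rewrite !mxE; exact: (reg_lipschitz C0 (hC i j k Pk) vr v'r xI).
pose B := m%:R * (F * (m%:R * (Q * (m%:R * (C * rr * F))) * L)).
have B0 : 0 <= B by rewrite !mulr_ge0// ltW.
pose T := m%:R * (F * (m%:R * (Q * (m%:R * (C * F) + m%:R * (C * B))) * L)).
have T0 : 0 <= T by rewrite !mulr_ge0 ?addr_ge0 ?mulr_ge0// ltW.
move=> i j; apply: (@regular_of_derivative P _ _ F T F0 T0 _ (hD i j)) => [k v Pk vr|k v v' x Pk vr v'r xI].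
  by case: (FQ k v i j Pk vr).
set d := `|v' - v|; have d0 : 0 <= d by exact: normr_ge0.
have [a0 ca da ua] := ha Pk vr; have [a0' ca' da' ua'] := ha Pk v'r.
have cC i' j' : holder_half L C (fun x => c k v x i' j') by exact: reg_holder_half (hC i' j' k Pk) vr.
have cC' i' j' : holder_half L C (fun x => c k v' x i' j') by exact: reg_holder_half (hC i' j' k Pk) v'r.
have cc : mx_continuous L (c k v) by move=> i' j'; exact: holder_half_continuous (cC i' j').
have cc' : mx_continuous L (c k v') by move=> i' j'; exact: holder_half_continuous (cC' i' j').
have cD : mx_continuous L (Dc k v (v' - v)).
  by move=> i' j'; exact: holder_half_continuous (reg_D_holder_half (v' - v) (hC i' j' k Pk) vr).
have cq : mx_continuous L (fun t => invmx (a k v t)).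
  by move=> i' j'; apply: holder_half_continuous; case: (FQ k v i' j' Pk vr) => _; exact.
have cd : mx_continuous L (fun t => (c k v' t - c k v t) *m a k v' t).
  by apply: mx_continuousM ca'; exact: mx_continuousB.
have ch : mx_continuous L (fun t => Dc k v (v' - v) t *m a k v t) by exact: mx_continuousM.
(* The difference of two fundamental matrices solves the equation of [a k v], forced by the
   difference of the coefficients times [a k v']. *)
have vE y : y \in `[0, L] -> a k v' y - a k v y = variation (a k v) (fun t => (c k v' t - c k v t) *m a k v' t) y.
  move=> yI; apply: (@variation_unique _ L L0 m (c k v) (a k v) C cC C0 ca da a0 ua _ (fun x => a k v' x - a k v x) cd _ _ _ y yI).
  - exact: mx_continuousB.
  - by rewrite a0 a0' subrr.
  - apply: mx_derive_eq (mx_deriveB da' da) => t _.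
    by rewrite mulmxBr mulmxBl [RHS]addrC subrKA.
have dl y p q : y \in `[0, L] -> `|(a k v' y - a k v y) p q| <= B * d.
  move=> yI; rewrite vE//.
  have -> : B * d = m%:R * (F * (m%:R * (Q * (m%:R * (C * rr * d * F))) * L)) by rewrite /B; ring.
  apply: entry_mul_le => [|k' l'|k' l']; [by rewrite !mulr_ge0// ltW|exact: FE|].
  apply: mx_integral_le (mx_continuousM cq cd) _ yI => // t tI.
  apply: entry_mul_le => [|k2 l2|k2 l2]; [by rewrite !mulr_ge0|exact: QE|].
  by apply: entry_mul_le => // k3 l3; [exact: cl|exact: FE].
have -> : a k v' x i j - a k v x i j - Dfundamental k v (v' - v) x i j =
    (a k v' x - a k v x - Dfundamental k v (v' - v) x) i j by rewrite !mxE.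
rewrite vE// /Dfundamental /variation -mulmxBr -(mx_integralB (mx_continuousM cq cd) (mx_continuousM cq ch) xI).
have -> : T * d ^+ 2 = m%:R * (F * (m%:R * (Q * (m%:R * (C * d ^+ 2 * F) + m%:R * (C * d * (B * d)))) * L)).
  by rewrite /T; ring.
have p0 : 0 <= m%:R * (C * d ^+ 2 * F) + m%:R * (C * d * (B * d)).
  exact: (addr_ge0 (mulr_ge0 (ler0n _ _) (mulr_ge0 (mulr_ge0 C0 (exprn_ge0 2 d0)) F0))
                   (mulr_ge0 (ler0n _ _) (mulr_ge0 (mulr_ge0 C0 d0) (mulr_ge0 B0 d0)))).
apply: entry_mul_le => [|k' l'|k' l']; [by rewrite !mulr_ge0// ltW|exact: FE|].
apply: mx_integral_le => // [|t tI]; first by apply: mx_continuousB; exact: mx_continuousM.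
rewrite -mulmxBr; apply: entry_mul_le => // k2 l2; first exact: QE.
(* Both resulting terms are quadratic: the Taylor remainder of [c], and the first order change of
   [c] times the change of [a]. *)
have -> : (c k v' t - c k v t) *m a k v' t - Dc k v (v' - v) t *m a k v t =
    (c k v' t - c k v t - Dc k v (v' - v) t) *m a k v' t + Dc k v (v' - v) t *m (a k v' t - a k v t).
  by rewrite mulmxBr [in RHS]mulmxBl subrKA.
rewrite mxE; apply: le_trans (ler_normD _ _) _; apply: lerD.
  apply: entry_mul_le => // k3 l3; last exact: FE.
  by rewrite !mxE; exact: (reg_taylor (hC k3 l3 k Pk) vr v'r tI).
apply: entry_mul_le => [|k3 l3|k3 l3]; [exact: mulr_ge0| |exact: dl].
exact: (reg_Dbound (hC k3 l3 k Pk) (v' - v) vr tI).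
Qed.

Lemma regular_fundamental_inv : regular_mx r P (fun k v x => invmx (a k v x))
  (fun k v w x => - (invmx (a k v x) *m Dfundamental k v w x *m invmx (a k v x))).
Proof.
have [F [Q [F0 Q0 FQ]]] := regular_fundamental_bounds.
apply: (regular_mx_invmx Q0 _ _ regular_fundamental) => [k v x Pk vr|k v i j Pk vr].
  by have [_ _ _] := ha Pk vr; exact.
by case: (FQ k v i j Pk vr).
Qed.

End Gauge.

End FundamentalFamilies.

(** * Square integrable families *)

Section SquareIntegrable.
Context {R : realType} (L : R) (L0 : 0 < L).
Local Notation mu := (@lebesgue_measure R).
Implicit Types h k : R -> R.

Definition n2 h : R := Num.sqrt (ip L h h).

Lemma n2_ge0 h : 0 <= n2 h. Proof. exact: sqrtr_ge0. Qed.

Lemma n2_sqr h : n2 h ^+ 2 = ip L h h.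
Proof. by rewrite sqr_sqrtr// ip_ge0. Qed.

Lemma n2_CS h k : L2 L h -> L2 L k -> `|ip L h k| <= n2 h * n2 k.
Proof.
move=> Lh Lk; rewrite -sqrtrM ?ip_ge0// -sqrtr_sqr ler_wsqrtr//; exact: ip_CS.
Qed.

Lemma n2D h k : L2 L h -> L2 L k -> n2 (fun x => h x + k x) <= n2 h + n2 k.
Proof.
move=> Lh Lk; rewrite -(@ler_pXn2r _ 2) ?nnegrE ?addr_ge0 ?n2_ge0// n2_sqr.
have := ip_sqrD 1 Lh Lk.
have -> : ip L (fun x => 1 * h x + k x) (fun x => 1 * h x + k x) = ip L (fun x => h x + k x) (fun x => h x + k x).
  by apply: eq_Rintegral => x _; rewrite mul1r.
move=> ->; rewrite sqrrD !n2_sqr expr1n !mul1r mulr1.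
have := le_trans (ler_norm _) (n2_CS Lh Lk); rewrite mulr2n; lra.
Qed.

Lemma n2_le h k : L2 L h -> L2 L k -> (forall x, x \in `[0, L] -> `|h x| <= `|k x|) -> n2 h <= n2 k.
Proof. by move=> Lh Lk hk; rewrite ler_wsqrtr//; apply: ip_le => // x; exact: hk. Qed.

Lemma n2Z (b : R) h : L2 L h -> n2 (fun x => b * h x) = `|b| * n2 h.
Proof.
move=> Lh; rewrite /n2 ipZ//; last exact: L2Z.
by rewrite ipC ipZ// mulrA -expr2 sqrtrM ?sqr_ge0// sqrtr_sqr.
Qed.

Lemma L2M h k : {within `[0, L], continuous h} -> L2 L k -> L2 L (fun x => h x * k x).
Proof.
move=> ch Lk; have [B [B0 hB]] := continuous_bounded ch.
by apply: (@L2M_bounded _ _ _ _ B) => //; exact: subspace_continuous_measurable_fun.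
Qed.

Lemma n2M_le h k (B : R) : {within `[0, L], continuous h} -> L2 L k ->
  (forall x, x \in `[0, L] -> `|h x| <= B) -> n2 (fun x => h x * k x) <= B * n2 k.
Proof.
move=> ch Lk hB; have B0 : 0 <= B.
  by apply: le_trans (hB 0 _); rewrite // in_itv/= lexx ltW.
rewrite -{1}(ger0_norm B0) -n2Z//; apply: n2_le; [exact: L2M|exact: L2Z|].
by move=> x xI; rewrite !normrM (ger0_norm B0) ler_wpM2r// hB.
Qed.

Lemma n2_bounded_le h (B : R) : {within `[0, L], continuous h} ->
  (forall x, x \in `[0, L] -> `|h x| <= B) -> n2 h <= B * n2 (fun=> 1).
Proof.
move=> ch hB; have h1 := n2M_le ch (L2_cst 1) hB; apply: le_trans h1.
rewrite le_eqVlt; apply/orP; left; apply/eqP; congr (Num.sqrt _).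
by apply: eq_Rintegral => x _; rewrite !mulr1.
Qed.

Lemma n2_sum (T : Type) (s : seq T) (h : T -> R -> R) (B : T -> R) :
  (forall l, L2 L (h l)) -> (forall l, n2 (h l) <= B l) ->
  L2 L (fun x => \sum_(l <- s) h l x) /\ n2 (fun x => \sum_(l <- s) h l x) <= \sum_(l <- s) B l.
Proof.
move=> Lh hB; elim: s => [|l s [IH1 IH2]].
  have -> : (fun x => \sum_(l <- [::]) h l x) = fun=> 0 by apply/funext => x; rewrite big_nil.
  by split; [exact: L2_0|rewrite big_nil /n2 ip0l sqrtr0].
have -> : (fun x => \sum_(j <- l :: s) h j x) = fun x => h l x + \sum_(j <- s) h j x.
  by apply/funext => x; rewrite big_cons.
split; first exact: L2D.
by rewrite big_cons; apply: le_trans (n2D (Lh l) IH1) _; exact: lerD.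
Qed.

End SquareIntegrable.

Section SquareRegular.
Context {R : realType} (L : R) (L0 : 0 < L) (m : nat) (r : R) {I : Type}.
Local Notation Phi := (H10 L m).
Local Notation mu := (@lebesgue_measure R).
Implicit Types (P : set I) (v w : Phi).

(* Families with values in L^2(0, L); the derivative is only linear almost everywhere,
   which is expressed by duality. *)
Record square_regular_at (A : R) (H : Phi -> R -> R) (DH : Phi -> Phi -> R -> R) : Prop := SquareRegularAt {
  sq_L2 : forall v, `|v| < r -> L2 L (H v);
  sq_DL2 : forall v w, `|v| < r -> L2 L (DH v w);
  sq_bound : forall v, `|v| < r -> n2 L (H v) <= A;
  sq_Dbound : forall v w, `|v| < r -> n2 L (DH v w) <= A * `|w|;
  sq_lin : forall v (b : R) w w' k, `|v| < r -> L2 L k ->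
    ip L (DH v (b *: w + w')) k = b * ip L (DH v w) k + ip L (DH v w') k;
  sq_taylor : forall v v', `|v| < r -> `|v'| < r ->
    n2 L (fun x => H v' x - H v x - DH v (v' - v) x) <= A * `|v' - v| ^+ 2 }.

Definition square_regular P (H : I -> Phi -> R -> R) (DH : I -> Phi -> Phi -> R -> R) :=
  exists2 A : R, 0 <= A & forall k, P k -> square_regular_at A (H k) (DH k).

Lemma square_regularD P H DH K DK : square_regular P H DH -> square_regular P K DK ->
  square_regular P (fun k v x => H k v x + K k v x) (fun k v w x => DH k v w x + DK k v w x).
Proof.
move=> [A A0 hA] [B B0 hB]; exists (A + B) => [|k Pk]; first exact: addr_ge0.
have [h1 h2 h3 h4 h5 h6] := hA k Pk; have [k1 k2 k3 k4 k5 k6] := hB k Pk; split.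
- by move=> v vr; apply: L2D; auto.
- by move=> v w vr; apply: L2D; auto.
- by move=> v vr; apply: le_trans (n2D (h1 v vr) (k1 v vr)) (lerD (h3 v vr) (k3 v vr)).
- move=> v w vr; rewrite mulrDl.
  by apply: le_trans (n2D (h2 v w vr) (k2 v w vr)) (lerD (h4 v w vr) (k4 v w vr)).
- move=> v b w w' g vr Lg; rewrite !ipD//; [|exact: h2|exact: k2|exact: h2|exact: k2|exact: h2|exact: k2].
  by rewrite h5// k5//; ring.
- move=> v v' vr v'r; rewrite mulrDl.
  have l1 : L2 L (fun x => H k v' x - H k v x - DH k v (v' - v) x) by apply: L2B; [apply: L2B; auto|auto].
  have l2 : L2 L (fun x => K k v' x - K k v x - DK k v (v' - v) x) by apply: L2B; [apply: L2B; auto|auto].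
  apply: le_trans (lerD (h6 v v' vr v'r) (k6 v v' vr v'r)); apply: le_trans (n2D l1 l2).
  rewrite le_eqVlt; apply/orP; left; apply/eqP; congr (n2 L _); apply/funext => x; ring.
Qed.

Lemma regular_square P (G : I -> Phi -> R -> R) (DG : I -> Phi -> Phi -> R -> R) :
  regular r P G DG -> square_regular P G DG.
Proof.
move=> [A A0 hA]; exists (A * (1 + n2 L (fun=> 1))) => [|k Pk].
  by rewrite mulr_ge0// addr_ge0// n2_ge0.
have h := hA k Pk; have n0 := n2_ge0 L (fun=> 1).
have le1 (B : R) : 0 <= B -> B * n2 L (fun=> 1) <= B * (1 + n2 L (fun=> 1)).
  by move=> B0; rewrite ler_wpM2l// lerDr.
have cG v : `|v| < r -> {within `[0, L], continuous (G k v)}.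
  by move=> vr; exact: holder_half_continuous (reg_holder_half h vr).
have cD v w : `|v| < r -> {within `[0, L], continuous (DG k v w)}.
  by move=> vr; exact: holder_half_continuous (reg_D_holder_half w h vr).
split.
- by move=> v vr; exact/continuous_L2/cG.
- by move=> v w vr; exact/continuous_L2/cD.
- move=> v vr; apply: le_trans (le1 A A0); apply: n2_bounded_le => //; first exact: cG.
  by move=> x xI; exact: (reg_bound h).
- move=> v w vr; rewrite mulrAC; apply: le_trans (le1 (A * `|w|) (mulr_ge0 A0 (normr_ge0 _))).
  by apply: n2_bounded_le => //; [exact: cD|move=> x xI; exact: (reg_Dbound h)].
- move=> v b w w' g vr Lg; rewrite -ip_lin//; [|exact/continuous_L2/cD..].
  by apply: eq_Rintegral => x /set_mem xI; rewrite (reg_lin h).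
- move=> v v' vr v'r; rewrite mulrAC; apply: le_trans (le1 (A * `|v' - v| ^+ 2) (mulr_ge0 A0 (exprn_ge0 2 (normr_ge0 _)))).
  have cT : {within `[0, L], continuous (fun x => G k v' x - G k v x - DG k v (v' - v) x)}.
    by move=> x; apply: cvgB; [apply: cvgB; exact: cG|exact: cD].
  by apply: (n2_bounded_le L0 cT) => x xI; exact: (reg_taylor h).
Qed.

Lemma square_regularM P (G : I -> Phi -> R -> R) (DG : I -> Phi -> Phi -> R -> R) H DH :
  regular r P G DG -> square_regular P H DH ->
  square_regular P (fun k v x => G k v x * H k v x)
    (fun k v w x => DG k v w x * H k v x + G k v x * DH k v w x).
Proof.
move=> [A A0 hA] [B B0 hB]; set rr := 1 + 2 * `|r|.
have rr0 : 0 <= rr by rewrite addr_ge0// mulr_ge0.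
exists (A * B * (4 + rr)) => [|k Pk]; first by rewrite !mulr_ge0// addr_ge0.
have h := hA k Pk; have [k1 k2 k3 k4 k5 k6] := hB k Pk.
have AB0 : 0 <= A * B by exact: mulr_ge0.
have cG v : `|v| < r -> {within `[0, L], continuous (G k v)}.
  by move=> vr; exact: holder_half_continuous (reg_holder_half h vr).
have cD v w : `|v| < r -> {within `[0, L], continuous (DG k v w)}.
  by move=> vr; exact: holder_half_continuous (reg_D_holder_half w h vr).
have LD v w : `|v| < r -> L2 L (fun x => DG k v w x * H k v x) by move=> vr; apply: L2M; [exact: cD|exact: k1].
have LG v w : `|v| < r -> L2 L (fun x => G k v x * DH k v w x) by move=> vr; apply: L2M; [exact: cG|exact: k2].
split.
- by move=> v vr; apply: L2M; [exact: cG|exact: k1].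
- by move=> v w vr; apply: L2D; auto.
- move=> v vr; apply: (@le_trans _ _ (A * n2 L (H k v))).
    by apply: n2M_le => //; [exact: cG|exact: k1|move=> x xI; exact: (reg_bound h)].
  apply: (@le_trans _ _ (A * B)); first by rewrite ler_wpM2l// k3.
  by rewrite ler_peMr//; lra.
- move=> v w vr; apply: le_trans (n2D (LD v w vr) (LG v w vr)) _.
  apply: (@le_trans _ _ (A * `|w| * B + A * (B * `|w|))).
    apply: lerD.
      apply: (@le_trans _ _ (A * `|w| * n2 L (H k v))); last by rewrite ler_wpM2l ?mulr_ge0// k3.
      by apply: n2M_le => //; [exact: cD|exact: k1|move=> x xI; exact: (reg_Dbound h)].
    apply: (@le_trans _ _ (A * n2 L (DH k v w))); last by rewrite ler_wpM2l// k4.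
    by apply: n2M_le => //; [exact: cG|exact: k2|move=> x xI; exact: (reg_bound h)].
  have -> : A * `|w| * B + A * (B * `|w|) = A * B * 2 * `|w| by ring.
  by rewrite ler_wpM2r// ler_wpM2l//; lra.
- move=> v b w w' g vr Lg; rewrite !ipD//; try by auto.
  (* The multiplier is moved to the test function, since the derivative of the second factor is
     linear in the dual sense only. *)
  have GE u : ip L (fun x => G k v x * DH k v u x) g = ip L (DH k v u) (fun x => G k v x * g x).
    by apply: eq_Rintegral => x _; rewrite mulrCA mulrA.
  rewrite !GE k5//; last exact: L2M (cG v vr) Lg.
  have -> : ip L (fun x => DG k v (b *: w + w') x * H k v x) g =
    b * ip L (fun x => DG k v w x * H k v x) g + ip L (fun x => DG k v w' x * H k v x) g.
    rewrite -ip_lin//; [|exact: LD..].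
    by apply: eq_Rintegral => x /set_mem xI; rewrite (reg_lin h)//; ring.
  ring.
- move=> v v' vr v'r; set d := v' - v.
  have cT : {within `[0, L], continuous (fun x => G k v' x - G k v x - DG k v d x)}.
    by move=> x; apply: cvgB; [apply: cvgB; exact: cG|exact: cD].
  have LT : L2 L (fun x => H k v' x - H k v x - DH k v d x) by apply: L2B; [apply: L2B; exact: k1|exact: k2].
  have LH : L2 L (fun x => H k v' x - H k v x) by apply: L2B; exact: k1.
  have t1 : L2 L (fun x => (G k v' x - G k v x - DG k v d x) * H k v' x) by apply: L2M => //; exact: k1.
  have t2 : L2 L (fun x => DG k v d x * (H k v' x - H k v x)) by apply: L2M => //; exact: cD.
  have t3 : L2 L (fun x => G k v x * (H k v' x - H k v x - DH k v d x)) by apply: L2M => //; exact: cG.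
  have Hl : n2 L (fun x => H k v' x - H k v x) <= B * rr * `|d|.
    have -> : (fun x => H k v' x - H k v x) = fun x => (H k v' x - H k v x - DH k v d x) + DH k v d x.
      by apply/funext => x; rewrite subrK.
    apply: le_trans (n2D LT (k2 v d vr)) _; apply: le_trans (lerD (k6 v v' vr v'r) (k4 v d vr)) _.
    have dr : `|d| <= 2 * `|r|.
      apply: le_trans (ler_normB _ _) _; rewrite mulr2n mulrDl mul1r.
      by apply: lerD; [exact: (ltW (lt_le_trans v'r (ler_norm r)))|exact: (ltW (lt_le_trans vr (ler_norm r)))].
    rewrite expr2 mulrA -mulrDl ler_wpM2r// /rr mulrDr mulr1 addrC lerD2l.
    by rewrite ler_wpM2l.
  apply: (@le_trans _ _ (n2 L (fun x => (G k v' x - G k v x - DG k v d x) * H k v' x +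
      DG k v d x * (H k v' x - H k v x) + G k v x * (H k v' x - H k v x - DH k v d x)))).
    rewrite le_eqVlt; apply/orP; left; apply/eqP; congr (n2 L _); apply/funext => x; ring.
  apply: le_trans (n2D (L2D t1 t2) t3) _; apply: le_trans (lerD (n2D t1 t2) (lexx _)) _.
  apply: (@le_trans _ _ (A * `|d| ^+ 2 * B + A * `|d| * (B * rr * `|d|) + A * (B * `|d| ^+ 2))).
    apply: lerD; [apply: lerD|].
    + apply: (@le_trans _ _ (A * `|d| ^+ 2 * n2 L (H k v'))); last by rewrite ler_wpM2l ?mulr_ge0 ?exprn_ge0// k3.
      by apply: (n2M_le L0 cT (k1 v' v'r)) => x xI; exact: (reg_taylor h).
    + apply: (@le_trans _ _ (A * `|d| * n2 L (fun x => H k v' x - H k v x))); last by rewrite ler_wpM2l ?mulr_ge0.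
      by apply: (n2M_le L0 (cD v d vr) LH) => x xI; exact: (reg_Dbound h).
    + apply: (@le_trans _ _ (A * n2 L (fun x => H k v' x - H k v x - DH k v d x))); last by rewrite ler_wpM2l ?k6.
      by apply: (n2M_le L0 (cG v vr) LT) => x xI; exact: (reg_bound h).
  have -> : A * `|d| ^+ 2 * B + A * `|d| * (B * rr * `|d|) + A * (B * `|d| ^+ 2) = A * B * (2 + rr) * `|d| ^+ 2 by ring.
  apply: ler_wpM2r; first exact: exprn_ge0.
  by apply: ler_wpM2l; [exact: AB0|rewrite lerD2r ler_nat].
Qed.

Lemma square_regular_sum P (T : Type) (s : seq T) (H : T -> I -> Phi -> R -> R) (DH : T -> I -> Phi -> Phi -> R -> R) :
  (forall l, square_regular P (H l) (DH l)) ->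
  square_regular P (fun k v x => \sum_(l <- s) H l k v x) (fun k v w x => \sum_(l <- s) DH l k v w x).
Proof.
move=> h; elim: s => [|l s IH].
  have := regular_square (@regular_cst _ L m r _ P 0); congr (square_regular P _ _).
    by do 3!apply/funext => ?; rewrite big_nil.
  by do 4!apply/funext => ?; rewrite big_nil.
have := square_regularD (h l) IH; congr (square_regular P _ _).
  by do 3!apply/funext => ?; rewrite big_cons.
by do 4!apply/funext => ?; rewrite big_cons.
Qed.

(** Pairing with a fixed function gives scalars that depend regularly on the state, with no x left.
    In this way [f(u) u'], which is only in L^2, enters the finite sum for the projected time
    derivative. *)
Lemma square_regular_pairing P H DH (g : R -> R) : L2 L g -> square_regular P H DH ->
  regular r P (fun k v _ => ip L (H k v) g) (fun k v w _ => ip L (DH k v w) g).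
Proof.
move=> Lg [A A0 hA]; have n0 := n2_ge0 L g; exists (A * n2 L g) => [|k Pk]; first exact: mulr_ge0.
have [h1 h2 h3 h4 h5 h6] := hA k Pk; split.
- by move=> v x vr _; apply: le_trans (n2_CS (h1 v vr) Lg) _; rewrite ler_wpM2r// h3.
- by move=> *; rewrite subrr normr0 !mulr_ge0// sqrtr_ge0.
- by move=> v b w w' x vr _; exact: h5.
- move=> v w x vr _; apply: le_trans (n2_CS (h2 v w vr) Lg) _.
  by rewrite mulrAC ler_wpM2r// h4.
- by move=> *; rewrite subrr normr0 !mulr_ge0// sqrtr_ge0.
- move=> v v' x vr v'r _; have L1 := L2B (h1 v' v'r) (h1 v vr); rewrite -(ipB (h1 v' v'r) (h1 v vr) Lg) -(ipB L1 (h2 v (v' - v) vr) Lg).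
  apply: le_trans (n2_CS (L2B L1 (h2 v (v' - v) vr)) Lg) _.
  by rewrite mulrAC ler_wpM2r// h6.
Qed.

End SquareRegular.

(** * Families with values in H^1_0 *)

Section H1Families.
Context {R : realType} (L : R) (L0 : 0 < L) (m : nat) (m0 : (0 < m)%N) (r : R) {I : Type}.
Local Notation Phi := (H10 L m).
Local Notation mu := (@lebesgue_measure R).
Implicit Types (P : set I) (v w : Phi) (W : I -> Phi -> Phi) (DW : I -> Phi -> Phi -> Phi).

Definition regularH P W DW := exists2 A : R, 0 <= A & forall k, P k ->
  [/\ forall v, `|v| < r -> `|W k v| <= A,
      forall v (b : R) w w', `|v| < r -> DW k v (b *: w + w') = b *: DW k v w + DW k v w',
      forall v w, `|v| < r -> `|DW k v w| <= A * `|w| &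
      forall v v', `|v| < r -> `|v'| < r -> `|W k v' - W k v - DW k v (v' - v)| <= A * `|v' - v| ^+ 2].

Lemma regularH_id P : regularH P (fun _ v => v) (fun _ _ w => w).
Proof.
exists (`|r| + 1) => [|k Pk]; first by rewrite addr_ge0.
split => // [v vr|v w vr|v v' vr v'r].
- by apply: le_trans (ltW vr) _; apply: le_trans (ler_norm r) _; rewrite lerDl.
- by rewrite ler_peMl// lerDr.
- by rewrite subrr normr0 mulr_ge0 ?exprn_ge0// addr_ge0.
Qed.

Lemma projH_lin n (b : R) w w' : projH n (b *: w + w') = b *: projH n w + projH n w'.
Proof.
have fr := H10_hilbert_frame L0 m0; apply: (frame_inj fr) => j.
rewrite (frame_linear fr) !(hcoef_projH L0 m0); case: ifP => _; last by rewrite mulr0 addr0.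
exact: (frame_linear fr).
Qed.

Lemma projH_le n w : `|projH n w| <= `|w|.
Proof.
have fr := H10_hilbert_frame L0 m0.
rewrite -(ler_sqr (normr_ge0 _) (normr_ge0 _)); apply: (frame_norm_le fr) (exprn_ge0 2 (normr_ge0 _)) _.
move=> J; apply: le_trans (frame_bessel fr w J); apply: ler_sum => j _.
rewrite hcoef_projH//; case: ifP => _ //; rewrite expr0n mulr0 mulr_ge0 ?sqr_ge0//.
exact: ltW (frame_gt0 fr j).
Qed.

Lemma regularH_projH P W DW (n : I -> nat) : regularH P W DW ->
  regularH P (fun k v => projH (n k) (W k v)) (fun k v w => projH (n k) (DW k v w)).
Proof.
move=> [A A0 h]; exists A; [exact: A0|move=> k Pk]; have [h1 h2 h3 h4] := h k Pk; split.
- by move=> v vr; exact: le_trans (projH_le _ _) (h1 v vr).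
- by move=> v b w w' vr; rewrite h2// projH_lin.
- by move=> v w vr; exact: le_trans (projH_le _ _) (h3 v w vr).
- move=> v v' vr v'r.
  have B (a b : Phi) : projH (n k) (a - b) = projH (n k) a - projH (n k) b.
    by rewrite addrC -scaleN1r projH_lin scaleN1r addrC.
  by rewrite -!B; exact: le_trans (projH_le _ _) (h4 v v' vr v'r).
Qed.

Lemma H10_valD w w' x i : (w + w') x i 0 = w x i 0 + w' x i 0.
Proof. by rewrite [LHS]mxE. Qed.

Lemma H10_valZ (b : R) w x i : (b *: w) x i 0 = b * w x i 0.
Proof. by rewrite [LHS]mxE. Qed.

Lemma H10_valB w w' x i : (w - w') x i 0 = w x i 0 - w' x i 0.
Proof. by rewrite H10_valD -scaleN1r H10_valZ mulN1r. Qed.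

Lemma regularH_value P W DW : regularH P W DW ->
  regular_mx r P (fun k v x => W k v x) (fun k v w x => DW k v w x).
Proof.
move=> [A A0 h] i j; rewrite (ord1 j); exists (A * (1 + Num.sqrt L)) => [|k Pk].
  by rewrite mulr_ge0// addr_ge0// sqrtr_ge0.
have [h1 h2 h3 h4] := h k Pk; have s0 := sqrtr_ge0 L.
have val (z : Phi) x (B : R) : `|z| <= B -> `|z x i 0| <= B * (1 + Num.sqrt L).
  move=> zB; apply: le_trans (H10_value_le L0 z x i) _; rewrite mulrC; apply: ler_pM => //.
  by rewrite lerDr.
have hol (z : Phi) x y (B : R) : `|z| <= B -> x \in `[0, L] -> y \in `[0, L] ->
    `|z y i 0 - z x i 0| <= B * (1 + Num.sqrt L) * Num.sqrt `|y - x|.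
  move=> zB xI yI; apply: le_trans (H10_holder z i xI yI) _; rewrite mulrC ler_wpM2r ?sqrtr_ge0//.
  have B0 := le_trans (normr_ge0 z) zB; by apply: le_trans zB _; rewrite ler_peMr ?lerDl.
split.
- by move=> v x vr _; apply: val; exact: h1.
- by move=> v x y vr xI yI; apply: hol => //; exact: h1.
- by move=> v b w w' x vr _; rewrite h2// H10_valD H10_valZ.
- by move=> v w x vr _; rewrite mulrAC; apply: val; exact: h3.
- by move=> v w x y vr xI yI; rewrite [X in X * Num.sqrt _]mulrAC; apply: hol => //; exact: h3.
- by move=> v v' x vr v'r _; rewrite mulrAC -!H10_valB; apply: val; exact: h4.
Qed.

(** [dx] selects a representative of the weak derivative, and the selected representatives add up
    almost everywhere only. *)
Lemma dx_lin_ae (b : R) w w' i : {ae mu, forall x, x \in `[0, L] ->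
  dx L (b *: w + w') x i 0 = b * dx L w x i 0 + dx L w' x i 0}.
Proof.
have h := weak_derivative_uniq i (dxP (b *: w + w')) (weak_derivative_lin b (dxP w) (dxP w')).
apply: filterS h; first exact: (ae_filter_ringOfSetsType mu).
by move=> x + xI => /(_ xI) ->; rewrite [LHS]mxE [X in X + _]mxE.
Qed.

Lemma dx_n2 w i : n2 L (fun x => dx L w x i 0) <= `|w|.
Proof.
rewrite -(@ler_pXn2r _ 2) ?nnegrE ?n2_ge0// n2_sqr; exact: H10_component_derivative_le.
Qed.

Lemma dx_sub_n2 w w' i : n2 L (fun x => dx L w' x i 0 - dx L w x i 0) <= `|w' - w|.
Proof.
have Ld (z : Phi) : L2 L (fun x => dx L z x i 0) by exact: (L2v_dx z i).
apply: le_trans (dx_n2 (w' - w) i); rewrite le_eqVlt; apply/orP; left; apply/eqP.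
have e : {ae mu, forall x, x \in `[0, L] -> dx L w' x i 0 - dx L w x i 0 = dx L (w' - w) x i 0}.
  apply: filterS (dx_lin_ae (-1) w w' i); first exact: (ae_filter_ringOfSetsType mu).
  by move=> x + xI => /(_ xI); rewrite mulN1r scaleN1r addrC => ->; rewrite addrC.
have L1 : L2 L (fun x => dx L w' x i 0 - dx L w x i 0) by apply: L2B.
congr (Num.sqrt _); rewrite (ip_ae L1 (Ld (w' - w)) L1 e) ipC.
exact: (ip_ae L1 (Ld (w' - w)) (Ld (w' - w)) e).
Qed.

Lemma dx_taylor_n2 w w' w1 i :
  n2 L (fun x => dx L w' x i 0 - dx L w x i 0 - dx L w1 x i 0) <= `|w' - w - w1|.
Proof.
have Ld (z : Phi) : L2 L (fun x => dx L z x i 0) by exact: (L2v_dx z i).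
apply: le_trans (dx_sub_n2 w1 (w' - w) i); rewrite le_eqVlt; apply/orP; left; apply/eqP.
have e : {ae mu, forall x, x \in `[0, L] -> dx L w' x i 0 - dx L w x i 0 - dx L w1 x i 0 =
    dx L (w' - w) x i 0 - dx L w1 x i 0}.
  apply: filterS (dx_lin_ae (-1) w w' i); first exact: (ae_filter_ringOfSetsType mu).
  by move=> x + xI => /(_ xI); rewrite mulN1r scaleN1r addrC => ->; rewrite [- _ + _]addrC.
have L1 : L2 L (fun x => dx L w' x i 0 - dx L w x i 0 - dx L w1 x i 0) by do 2!apply: L2B => //.
have L2' : L2 L (fun x => dx L (w' - w) x i 0 - dx L w1 x i 0) by apply: L2B.
congr (Num.sqrt _); rewrite (ip_ae L1 L2' L1 e) ipC.
exact: (ip_ae L1 L2' L2' e).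
Qed.

Lemma regularH_dx P W DW i : regularH P W DW ->
  square_regular r P (fun k v x => dx L (W k v) x i 0) (fun k v w x => dx L (DW k v w) x i 0).
Proof.
move=> [A A0 h]; exists A; [exact: A0|move=> k Pk]; have [h1 h2 h3 h4] := h k Pk.
have Ld (z : Phi) : L2 L (fun x => dx L z x i 0) by exact: (L2v_dx z i).
split.
- by move=> v _; exact: Ld.
- by move=> v w _; exact: Ld.
- by move=> v vr; exact: le_trans (dx_n2 _ i) (h1 v vr).
- by move=> v w vr; exact: le_trans (dx_n2 _ i) (h3 v w vr).
- move=> v b w w' g vr Lg; rewrite h2// -ip_lin//; apply: ip_ae => //; first by apply: L2_lin.
  exact: dx_lin_ae.
- by move=> v v' vr v'r; exact: le_trans (dx_taylor_n2 _ _ _ i) (h4 v v' vr v'r).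
Qed.

End H1Families.

Lemma bounded_linear_functional_continuous (R : realType) (E : normedModType R) (l : {linear E -> R}) (C : R) :
  0 <= C -> (forall z, `|l z| <= C * `|z|) -> continuous l.
Proof.
move=> C0 lC z; apply/cvgrPdist_le => e e0; near=> t.
rewrite -linearB; apply: le_trans (lC _) _.
have h : `|z - t| <= e / (1 + C).
  near: t; have : \forall t \near z, ball z (e / (1 + C)) t by apply: nbhsx_ballx; rewrite divr_gt0// ltr_wpDr.
  by apply: filterS => t; rewrite -ball_normE /= => /ltW.
apply: (@le_trans _ _ ((1 + C) * (e / (1 + C)))); first by apply: ler_pM => //; rewrite lerDr.
by rewrite mulrC divfK// gt_eqF// ltr_wpDr.
Unshelve. all: by end_near. Qed.

Lemma convex_lt (R : realType) (p q r t : R) : p < r -> q < r -> 0 <= t <= 1 -> (1 - t) * p + t * q < r.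
Proof.
move=> pr qr /andP[t0 t1]; have [M [Mr pM qM]] : exists M : R, [/\ M < r, p <= M & q <= M].
  by exists (Num.max p q); split; rewrite ?gt_max ?pr// le_max lexx ?orbT.
by apply: le_lt_trans Mr; nra.
Qed.

Lemma le_of_sqr_le (R : realType) (y C D : R) : 0 <= y -> y ^+ 2 <= C * y -> 0 <= C -> C <= D -> y <= D.
Proof.
move=> y0 yC C0 CD; apply: le_trans CD; have [->//|y1] := eqVneq y 0.
by rewrite -(@ler_pM2r _ y) ?lt_def ?y1// -expr2.
Qed.

(** * From iterated derivatives to Taylor remainders *)

Section SmoothFamilies.
Context {R : realType} (L : R) (L0 : 0 < L) (m : nat) (m0 : (0 < m)%N) (r : R).
Local Notation Phi := (H10 L m).
Implicit Types (v w : Phi).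

Definition H1pair (y z : Phi) : R := H1dot z y.

Lemma H1pair_is_linear y : linear (H1pair y).
Proof. by move=> b u v; rewrite /H1pair H1dot_lin. Qed.

HB.instance Definition _ y := GRing.isLinear.Build R Phi R *:%R (H1pair y) (H1pair_is_linear y).

Lemma H1pair_le y z : `|H1pair y z| <= `|y| * `|z|.
Proof.
have pos (t : Phi) : H1pair y t <= `|y| * `|t| by rewrite mulrC; exact: (H1dot_CS t y).
rewrite ler_norml pos andbT lerNl.
by rewrite -[leRHS](congr1 (fun s => `|y| * s) (normrN z)) -(linearN (H1pair y)); exact: pos.
Qed.

Lemma H1pair_continuous y : continuous (H1pair y).
Proof.
exact: (bounded_linear_functional_continuous (normr_ge0 y) (H1pair_le y)).
Qed.

Lemma ball0E v : ball (0 : Phi) r v <-> `|v| < r.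
Proof. by rewrite -ball_normE /ball_/= sub0r normrN. Qed.

(** The Taylor remainder [y] is tested with itself: [taylor_functional] for the inner product with
    [y] gives [|y|^2 <= C |d|^2 |y|]. *)
Lemma regularH_smooth (P : set nat) (U : nat -> Phi -> Phi) :
  (forall K, P K -> smooth_on (ball (0 : Phi) r) (U K)) ->
  (forall n, exists C : R, forall K, P K -> forall vs : seq Phi, size vs = n ->
     forall v, ball (0 : Phi) r v -> `|iter_derive vs (U K) v| <= C * \prod_(w <- vs) `|w|) ->
  regularH r P U (fun K v w => 'D_w (U K) v).
Proof.
move=> sU bU; have [C0 h0] := bU 0%N; have [C1 h1] := bU 1%N; have [C2 h2] := bU 2%N.
exists (`|C0| + `|C1| + `|C2|) => [|K PK]; first by rewrite !addr_ge0.
have dU v : `|v| < r -> differentiable (U K) v by move=> vr; exact: (sU K PK [::] v ((ball0E v).2 vr)).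
have c0 : `|C0| <= `|C0| + `|C1| + `|C2| by rewrite -addrA lerDl addr_ge0.
have c1 : `|C1| <= `|C0| + `|C1| + `|C2| by rewrite addrAC lerDr addr_ge0.
have c2 : `|C2| <= `|C0| + `|C1| + `|C2| by rewrite lerDr addr_ge0.
split.
- move=> v vr; have := h0 K PK [::] erefl v ((ball0E v).2 vr); rewrite big_nil mulr1 /=.
  by move=> /le_trans; apply; apply: le_trans (ler_norm _) c0.
- by move=> v b w w' vr; rewrite !deriveE ?linearP//; exact: dU.
- move=> v w vr; have := h1 K PK [:: w] erefl v ((ball0E v).2 vr); rewrite big_seq1/=.
  move=> /le_trans; apply; rewrite ler_wpM2r//; exact: le_trans (ler_norm _) c1.
move=> v v' vr v'r; set d := v' - v.
set y := U K v' - U K v - 'D_d (U K) v.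
have seg (t : R) : 0 <= t <= 1 -> `|v + t *: d| < r.
  move=> t01; have -> : v + t *: d = (1 - t) *: v + t *: v'.
    by rewrite /d scalerBr scalerBl scale1r addrA addrAC.
  apply: le_lt_trans (ler_normD _ _) _; rewrite !normrZ.
  have [t0 t1] := andP t01; rewrite (ger0_norm t0) (@ger0_norm _ (1 - t)) ?subr_ge0//.
  exact: (convex_lt vr v'r t01).
have C : 0 <= `|C2| * `|d| ^+ 2 by rewrite mulr_ge0// exprn_ge0.
have : `|H1pair y (U K v' - U K v - 'D_d (U K) v)| <= `|C2| * `|d| ^+ 2 * `|y|.
  apply: (taylor_functional (H1pair_continuous (y := y))) => [t t01|t t01].
    split; first exact: dU (seg t t01).
    exact: (sU K PK [:: d] (v + t *: d) ((ball0E _).2 (seg t t01))).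
  apply: le_trans (H1pair_le _ _) _; rewrite mulrC ler_wpM2r//.
  have := h2 K PK [:: d; d] erefl (v + t *: d) ((ball0E _).2 (seg t t01)).
  rewrite big_cons big_seq1 -expr2 => /le_trans; apply; rewrite ler_wpM2r ?exprn_ge0//.
  exact: ler_norm.
rewrite -/y /H1pair -(sqr_sqrtr (H1dot_ge0 y)) -[Num.sqrt (H1dot y y)]/(`|y|) ger0_norm ?sqr_ge0//.
move=> h; apply: (le_of_sqr_le (normr_ge0 y) h C).
by apply: ler_wpM2r; [exact: exprn_ge0|exact: c2].
Qed.

End SmoothFamilies.

(** * The transformed nonlinearities *)

Section GaugeFamilies.
Context {R : realType} (L : R) (L0 : 0 < L) (m : nat) (m0 : (0 < m)%N) (r : R) (K0 : nat).
Context (f : 'cV[R]_m -> 'M[R]_m) (g : 'cV[R]_m -> 'cV[R]_m).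
Hypotheses (sf : smooth f) (kf : compactly_supported f) (sg : smooth g) (kg : compactly_supported g).
Hypothesis Ud : U_diffeo L f r K0.
Local Notation Phi := (H10 L m).
Local Notation mu := (@lebesgue_measure R).
Implicit Types (v w : Phi) (K : nat).

(** Positivity of K allows dividing by its square root. *)
Definition large : set nat := [set K | (K0 <= K)%N /\ (0 < K)%N].

Lemma gaugeP K v : large K -> `|v| < r -> is_gauge L f K v (gauge L f K v).
Proof.
move=> [KK _] vr; have [h _ _] := Ud.
by have [ex _] := h K KK v ((ball0E _ _).2 vr); exact: (xgetPex _ ex).
Qed.

Lemma pairing_eq (w1 w2 : R -> 'cV[R]_m) (h : R -> R) :
  (forall x, x \in `[0, L] -> w1 x = w2 x) -> pairing L w1 h = pairing L w2 h.
Proof.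
move=> e; apply/colP => i; rewrite !mxE; apply: eq_Rintegral => x /set_mem xI.
by rewrite e.
Qed.

Lemma proj_eq K (w1 w2 : R -> 'cV[R]_m) (x : R) :
  (forall x, x \in `[0, L] -> w1 x = w2 x) -> Defs.proj L K w1 x = Defs.proj L K w2 x.
Proof. by move=> e; apply: eq_bigr => k _; rewrite (pairing_eq _ e). Qed.

Lemma embed0 (w : R -> 'cV[R]_m) : (forall x, w x = 0) -> embed L w = 0.
Proof.
move=> w0; have E x : x \in `[0, L] -> embed L w x = w x.
  apply: (@embed_val _ L L0 m w (fun=> 0)) => i; split.
  - by have := L2_cst (L := L) 0; congr (L2 L _); apply/funext => y; rewrite mxE.
  - move=> y _; rewrite w0 mxE.
    rewrite [RHS](_ : _ = \int[mu]_(z in `[0, y]) (0 : R)); first by rewrite Rintegral_cst// mul0r.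
    by apply: eq_Rintegral => z _; rewrite ?mxE.
  - by rewrite w0 mxE.
by apply: H10_ext => // x xI; rewrite E// w0.
Qed.

(** If the product [a v] were not in H^1_0, [embed] would return the default 0. Then
    [v = V(U(v)) = V(0) = 0], and the formula holds all the same. *)
Lemma Umap_val K v x : large K -> `|v| < r -> x \in `[0, L] ->
  Umap f K v x = gauge L f K v x *m v x.
Proof.
move=> PK vr xI; rewrite /Umap /embed /insubd.
case: insubP => [u _ uE|nH] /=.
  by rewrite [u x](congr1 (fun h => h x) uE) patchE mem_set.
have U0 : Umap f K v = 0 by rewrite /Umap /embed /insubd insubN.
have [KK _] := PK; have [_ h _] := Ud; have [_ VU _ _] := h K KK.
have v0 : v = 0.
  rewrite -(VU v ((ball0E _ _).2 vr)) U0; apply: embed0 => y.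
  by rewrite /act /= [X in _ *m X](_ : _ = 0) ?mulmx0.
by rewrite v0 /= [X in _ *m X](_ : _ = 0) ?mulmx0.
Qed.

Definition Dphys K v w : Phi := 'D_w (Umap f K) v.

Lemma regularH_U : regularH r large (fun K => Umap f K) Dphys.
Proof.
have [_ h2 h3] := Ud.
apply: regularH_smooth => // [K [KK _]|n]; first by have [_ _ ? _] := h2 K KK.
by have [C hC] := h3 n; exists C => K [KK _] vs vn v vB; have [+ _] := hC K KK vs vn; exact.
Qed.

Definition low K v : Phi := projH K (Umap f K v).
Definition Dlow K v w : Phi := projH K (Dphys K v w).

Lemma regularH_low : regularH r large low Dlow.
Proof. exact: (regularH_projH L0 m0 (fun K => K) regularH_U). Qed.

Lemma low_proj K v x : large K -> `|v| < r -> x \in `[0, L] ->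
  low K v x = Defs.proj L K (act (gauge L f K v) v) x.
Proof.
move=> PK vr xI; rewrite /low projH_val//; apply: proj_eq => y yI.
by rewrite Umap_val.
Qed.

Definition speed K v (x : R) : 'M[R]_m := 2^-1 *: f (low K v x).
Definition Dspeed K v w (x : R) : 'M[R]_m := 2^-1 *: 'd f (low K v x) (Dlow K v w x).

Lemma regular_f_low : regular_mx r large (fun K v x => f (low K v x)) (fun K v w x => 'd f (low K v x) (Dlow K v w x)).
Proof.
by apply: (regular_mx_comp (C2_bounded_smooth sf kf)); exact: regularH_value regularH_low.
Qed.

Lemma regular_f_phys : regular_mx r large (fun K v x => f (Umap f K v x))
  (fun K v w x => 'd f (Umap f K v x) (Dphys K v w x)).
Proof.
by apply: (regular_mx_comp (C2_bounded_smooth sf kf)); exact: regularH_value regularH_U.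
Qed.

Lemma regular_speed : regular_mx r large speed Dspeed.
Proof. exact: (regular_mxZ _ regular_f_low). Qed.

Local Notation a := (gauge L f).

(** Written with [low], the coefficient depends on the gauge only through [Umap], whose regularity
    is given. The nonlocal problem thus becomes a linear system with a regular coefficient. *)
Lemma gauge_ode K v : large K -> `|v| < r ->
  [/\ a K v 0 = 1%:M, mx_continuous L (a K v), mx_derive L (a K v) (fun x => speed K v x *m a K v x) &
      forall x, x \in `[0, L] -> a K v x \in unitmx].
Proof.
move=> PK vr; have [/ivp_mx[h0 hc hd] hu] := gaugeP PK vr; split => //.
apply: mx_derive_eq hd => x xI; rewrite /speed low_proj ?scalemxAl//.
by move: xI; rewrite !in_itv/= => /andP[/ltW -> /ltW ->].
Qed.

Definition Dgauge := Dfundamental (gauge L f) Dspeed.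

Lemma regular_gauge : regular_mx r large (gauge L f) Dgauge.
Proof. exact: (regular_fundamental L0 regular_speed gauge_ode). Qed.

Definition Dgauge_inv K v w x := - (invmx (a K v x) *m Dgauge K v w x *m invmx (a K v x)).

Lemma regular_gauge_inv : regular_mx r large (fun K v x => invmx (a K v x)) Dgauge_inv.
Proof. exact: (regular_fundamental_inv L0 regular_speed gauge_ode). Qed.

Definition high K v (x : R) : 'M[R]_m := f (low K v x) - f (Umap f K v x).
Definition Dhigh K v w (x : R) : 'M[R]_m :=
  'd f (low K v x) (Dlow K v w x) - 'd f (Umap f K v x) (Dphys K v w x).

Lemma regular_high : regular_mx r large high Dhigh.
Proof. exact: (regular_mxB regular_f_low regular_f_phys). Qed.

Definition DF1 K v w (x : R) : 'M[R]_m :=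
  (Dgauge_inv K v w x *m high K v x + invmx (a K v x) *m Dhigh K v w x) *m a K v x +
  invmx (a K v x) *m high K v x *m Dgauge K v w x.

Lemma F1_eq K v x : large K -> `|v| < r -> x \in `[0, L] ->
  F1 f K v x = invmx (a K v x) *m high K v x *m a K v x.
Proof. by move=> PK vr xI; rewrite /F1 /high -low_proj// -Umap_val. Qed.

Lemma regular_F1 : regular_mx r large (fun K v => F1 f K v) DF1.
Proof.
apply: regular_mx_eq (regular_mulmx (regular_mulmx regular_gauge_inv regular_high) regular_gauge) => //.
by move=> K v x PK vr xI; rewrite F1_eq.
Qed.

Definition decaying (p q : nat) (G : nat -> Phi -> R -> 'M[R]_(p, q)) (DG : nat -> Phi -> Phi -> R -> 'M[R]_(p, q)) :=
  exists2 A : R, 0 <= A & forall K v x i j, large K -> `|v| < r -> x \in `[0, L] ->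
    `|G K v x i j| <= A / Num.sqrt K%:R /\ forall w, `|DG K v w x i j| <= A / Num.sqrt K%:R * `|w|.

(** By [projH_tail] both [U(v)] and its derivative differ from their projections by [O(K^(-1/2))]
    uniformly on [0, L]; the bounds on the first two derivatives of [f] transfer this to [high] and
    [Dhigh]. *)
Lemma decaying_high : decaying high Dhigh.
Proof.
have [C C0 fC] := C2_bounded_smooth sf kf; have [A A0 hA] := regularH_U.
have [B B0 hB] := regularH_low.
pose E := Num.sqrt (2 * L) * A; have E0 : 0 <= E by rewrite mulr_ge0// sqrtr_ge0.
pose D := Num.sqrt L * B; have D0 : 0 <= D by rewrite mulr_ge0// sqrtr_ge0.
exists (C * (E * (E + 1)) + C * (E * D) + C * E).
  by rewrite !addr_ge0// !mulr_ge0// addr_ge0.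
move=> K v x i j PK vr xI; have [_ Kpos] := PK.
have k1 : 1 <= Num.sqrt K%:R :> R by rewrite -[leLHS]sqrtr1; apply: ler_wsqrtr; rewrite ler1n.
have k0 : 0 < Num.sqrt K%:R :> R by exact: lt_le_trans k1.
have [A1 _ A3 _] := hA K PK; have [_ _ B3 _] := hB K PK.
have tail (z : Phi) (M : R) : `|z| <= M -> `|z x - projH K z x| <= Num.sqrt (2 * L) / Num.sqrt K%:R * M.
  move=> zM; have M0 : 0 <= M by apply: le_trans zM.
  apply: mx_norm_le => [|k l]; first by rewrite mulr_ge0// divr_ge0 ?sqrtr_ge0.
  rewrite (ord1 l) mxE [X in _ + X]mxE projH_val//.
  apply: le_trans (projH_tail L0 z k Kpos xI) _.
  by rewrite ler_wpM2l// divr_ge0 ?sqrtr_ge0.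
have pu : `|low K v x - Umap f K v x| <= E / Num.sqrt K%:R.
  by rewrite distrC /E mulrAC; apply: tail; exact: A1.
have puE : `|low K v x - Umap f K v x| <= E.
  by apply: le_trans pu _; rewrite ler_pdivrMr// ler_peMr.
set p := low K v x in pu puE *; set u := Umap f K v x in pu puE *.
have [_ d1 d2 _] := fC u p (p - u) i j.
split.
  have -> : high K v x i j = (f p - f u - 'd f u (p - u)) i j + 'd f u (p - u) i j.
    by rewrite /high mxE [X in _ + X]mxE [in RHS]mxE [X in _ + X + _]mxE [in RHS]mxE [X in _ + X + _ + _]mxE subrK.
  apply: le_trans (ler_normD _ _) _; apply: le_trans (lerD d2 d1) _.
  have -> : C * `|p - u| ^+ 2 + C * `|p - u| = C * (`|p - u| * (`|p - u| + 1)) by ring.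
  apply: (@le_trans _ _ (C * (E / Num.sqrt K%:R * (E + 1)))).
    apply: ler_wpM2l => //; apply: (ler_pM (normr_ge0 _) (addr_ge0 (normr_ge0 _) ler01) pu).
    by rewrite lerD2r.
  have -> : C * (E / Num.sqrt K%:R * (E + 1)) = C * (E * (E + 1)) / Num.sqrt K%:R by ring.
  rewrite ler_wpM2r ?invr_ge0 ?(ltW k0)// -addrA lerDl addr_ge0// !mulr_ge0//.
move=> w; have [_ _ _ d4] := fC u p (Dlow K v w x) i j.
have [_ d5 _ _] := fC u p (Dlow K v w x - Dphys K v w x) i j.
have mB (y z : 'M[R]_m) : (y - z) i j = y i j - z i j by rewrite mxE [X in _ + X]mxE.
have dB (y z : 'cV[R]_m) : 'd f u (y - z) i j = 'd f u y i j - 'd f u z i j.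
  by rewrite linearB mxE [X in _ + X]mxE.
have -> : Dhigh K v w x i j = ('d f p (Dlow K v w x) - 'd f u (Dlow K v w x)) i j +
    'd f u (Dlow K v w x - Dphys K v w x) i j.
  by rewrite dB [X in _ = X + _]mB subrKA mB.
apply: le_trans (ler_normD _ _) _; apply: le_trans (lerD d4 d5) _.
have lw : `|Dlow K v w x| <= D * `|w|.
  apply: mx_norm_le => [|k l]; first by rewrite mulr_ge0.
  rewrite (ord1 l); apply: le_trans (H10_value_le L0 _ _ _) _.
  by rewrite /D -mulrA ler_wpM2l ?sqrtr_ge0// B3.
have dw : `|Dlow K v w x - Dphys K v w x| <= E * `|w| / Num.sqrt K%:R.
  rewrite distrC; have -> : E * `|w| / Num.sqrt K%:R = Num.sqrt (2 * L) / Num.sqrt K%:R * (A * `|w|).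
    by rewrite /E; ring.
  by apply: tail; exact: A3.
apply: (@le_trans _ _ (C * (E / Num.sqrt K%:R) * (D * `|w|) + C * (E * `|w| / Num.sqrt K%:R))).
  apply: lerD; last by rewrite ler_wpM2l.
  by apply: ler_pM => //; [rewrite mulr_ge0|rewrite ler_wpM2l].
have -> : C * (E / Num.sqrt K%:R) * (D * `|w|) + C * (E * `|w| / Num.sqrt K%:R) =
  (C * (E * D) + C * E) / Num.sqrt K%:R * `|w| by ring.
rewrite ler_wpM2r// ler_wpM2r ?invr_ge0 ?(ltW k0)// -addrA lerDr !mulr_ge0// addr_ge0//.
Qed.

(** The small factor survives multiplication by a family that is bounded uniformly in K. *)
Lemma decayingM_l (G H : nat -> Phi -> R -> 'M[R]_m) DG DH : decaying G DG -> regular_mx r large H DH ->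
  decaying (fun K v x => G K v x *m H K v x) (fun K v w x => DG K v w x *m H K v x + G K v x *m DH K v w x).
Proof.
move=> [A A0 hA] /regular_mx_uniform[B B0 hB]; exists (m%:R * (A * B) * 2) => [|K v x i j PK vr xI].
  by rewrite !mulr_ge0.
have [_ Kpos] := PK; have k0 : 0 <= A / Num.sqrt K%:R by rewrite divr_ge0 ?sqrtr_ge0.
have s0 : 0 <= m%:R * (A * B) / Num.sqrt K%:R by rewrite divr_ge0 ?sqrtr_ge0// !mulr_ge0.
split=> [|w].
  apply: (@le_trans _ _ (m%:R * (A / Num.sqrt K%:R * B))).
    apply: entry_mul_le => // i' j'; first by have [] := hA K v x i' j' PK vr xI.
    exact: (reg_bound (hB i' j' K PK)).
  have -> : m%:R * (A / Num.sqrt K%:R * B) = m%:R * (A * B) / Num.sqrt K%:R by ring.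
  have -> : m%:R * (A * B) * 2 / Num.sqrt K%:R = 2 * (m%:R * (A * B) / Num.sqrt K%:R) by ring.
  by move: s0; lra.
rewrite mxE; apply: le_trans (ler_normD _ _) _.
have -> : m%:R * (A * B) * 2 / Num.sqrt K%:R * `|w| = m%:R * (A / Num.sqrt K%:R * `|w| * B) + m%:R * (A / Num.sqrt K%:R * (B * `|w|)).
  by ring.
apply: lerD.
  apply: entry_mul_le => // i' j'; first by have [_] := hA K v x i' j' PK vr xI; exact.
  exact: (reg_bound (hB i' j' K PK)).
apply: entry_mul_le => [|i' j'|i' j']; [exact: mulr_ge0|by have [] := hA K v x i' j' PK vr xI|].
exact: (reg_Dbound (hB i' j' K PK)).
Qed.

Lemma decayingM_r (G H : nat -> Phi -> R -> 'M[R]_m) DG DH : decaying G DG -> regular_mx r large H DH ->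
  decaying (fun K v x => H K v x *m G K v x) (fun K v w x => DH K v w x *m G K v x + H K v x *m DG K v w x).
Proof.
move=> [A A0 hA] /regular_mx_uniform[B B0 hB]; exists (m%:R * (A * B) * 2) => [|K v x i j PK vr xI].
  by rewrite !mulr_ge0.
have [_ Kpos] := PK; have k0 : 0 <= A / Num.sqrt K%:R by rewrite divr_ge0 ?sqrtr_ge0.
have s0 : 0 <= m%:R * (A * B) / Num.sqrt K%:R by rewrite divr_ge0 ?sqrtr_ge0// !mulr_ge0.
split=> [|w].
  apply: (@le_trans _ _ (m%:R * (B * (A / Num.sqrt K%:R)))).
    apply: entry_mul_le => // i' j'; last by have [] := hA K v x i' j' PK vr xI.
    exact: (reg_bound (hB i' j' K PK)).
  have -> : m%:R * (B * (A / Num.sqrt K%:R)) = m%:R * (A * B) / Num.sqrt K%:R by ring.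
  have -> : m%:R * (A * B) * 2 / Num.sqrt K%:R = 2 * (m%:R * (A * B) / Num.sqrt K%:R) by ring.
  by move: s0; lra.
rewrite mxE; apply: le_trans (ler_normD _ _) _.
have -> : m%:R * (A * B) * 2 / Num.sqrt K%:R * `|w| = m%:R * (B * `|w| * (A / Num.sqrt K%:R)) + m%:R * (B * (A / Num.sqrt K%:R * `|w|)).
  by ring.
apply: lerD.
  apply: entry_mul_le => // i' j'; last by have [] := hA K v x i' j' PK vr xI.
  exact: (reg_Dbound (hB i' j' K PK)).
apply: entry_mul_le => [|i' j'|i' j']; [exact: mulr_ge0|exact: (reg_bound (hB i' j' K PK))|].
by have [_] := hA K v x i' j' PK vr xI; exact.
Qed.

Lemma decaying_F1 : decaying (fun K v => F1 f K v) DF1.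
Proof.
have [A A0 h] := decayingM_l (decayingM_r decaying_high regular_gauge_inv) regular_gauge.
exists A => // K v x i j PK vr xI; have [h1 h2] := h K v x i j PK vr xI.
by split; [rewrite F1_eq|exact: h2].
Qed.

End GaugeFamilies.

(** * Regularity for a fixed K *)

Section RegularMaps.
Context {R : realType} (L : R) (L0 : 0 < L) (m : nat) (r : R).
Local Notation Phi := (H10 L m).
Implicit Types (v w : Phi).

(** Here the derivative is hidden and the constant is not tracked. This suffices for [F2], whose
    bounds may depend on K because n is chosen after it. *)
Definition is_regular (p q : nat) (G : Phi -> R -> 'M[R]_(p, q)) :=
  exists DG, regular_mx r [set: unit] (fun _ => G) (fun _ => DG).

Lemma is_regular_member p q (P : set nat) (G : nat -> Phi -> R -> 'M[R]_(p, q)) DG K : P K ->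
  regular_mx r P G DG -> is_regular (G K).
Proof. by move=> PK h; exists (DG K) => i j; have [A A0 hA] := h i j; exists A => // _ _; exact: hA. Qed.

Lemma is_regular_eq p q (G G' : Phi -> R -> 'M[R]_(p, q)) :
  (forall v x, `|v| < r -> x \in `[0, L] -> G v x = G' v x) -> is_regular G -> is_regular G'.
Proof. by move=> GG [DG h]; exists DG; apply: regular_mx_eq h => // _ v x _; exact: GG. Qed.

Lemma is_regularD p q (G H : Phi -> R -> 'M[R]_(p, q)) : is_regular G -> is_regular H ->
  is_regular (fun v x => G v x + H v x).
Proof. by move=> [DG h] [DH h']; eexists; exact: (regular_mxD h h'). Qed.

Lemma is_regularB p q (G H : Phi -> R -> 'M[R]_(p, q)) : is_regular G -> is_regular H ->
  is_regular (fun v x => G v x - H v x).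
Proof. by move=> [DG h] [DH h']; eexists; exact: (regular_mxB h h'). Qed.

Lemma is_regularZ p q (b : R) (G : Phi -> R -> 'M[R]_(p, q)) : is_regular G -> is_regular (fun v x => b *: G v x).
Proof. by move=> [DG h]; eexists; exact: (regular_mxZ b h). Qed.

Lemma is_regularM p q s (G : Phi -> R -> 'M[R]_(p, q)) (H : Phi -> R -> 'M[R]_(q, s)) :
  is_regular G -> is_regular H -> is_regular (fun v x => G v x *m H v x).
Proof. by move=> [DG h] [DH h']; eexists; exact: (regular_mulmx h h'). Qed.

Lemma is_regular_entries p q (G : Phi -> R -> 'M[R]_(p, q)) :
  (forall i j, exists DG, regular r [set: unit] (fun _ v x => G v x i j) (fun _ => DG)) -> is_regular G.
Proof.
move=> h; have [D DP] := choice (fun ij : 'I_p * 'I_q => h ij.1 ij.2).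
exists (fun v w x => \matrix_(i, j) D (i, j) v w x) => i j.
by apply: regular_eq (DP (i, j)) => // *; rewrite mxE.
Qed.

Lemma is_regular_comp p q (f : 'cV[R]_m -> 'M[R]_(p, q)) (G : Phi -> R -> 'cV[R]_m) :
  C2_bounded f -> is_regular G -> is_regular (fun v x => f (G v x)).
Proof. by move=> fC [DG h]; eexists; exact: (regular_mx_comp fC h). Qed.

(** Base point and direction both vary. Expanding the direction in coordinates leaves compositions
    with fixed directional derivatives of [f], which are again smooth with compact support. *)
Lemma is_regular_diff (f : 'cV[R]_m -> 'M[R]_m) (G H : Phi -> R -> 'cV[R]_m) :
  smooth f -> compactly_supported f -> is_regular G -> is_regular H ->
  is_regular (fun v x => 'd f (G v x) (H v x)).
Proof.
move=> sf kf hG [DH hH]; have df z : differentiable f z := sf [::] z I.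
have hl l : is_regular (fun v x => 'D_(delta_mx l 0) f (G v x)).
  apply: (@is_regular_comp m m ('D_(delta_mx l 0) f) G _ hG).
  apply: C2_bounded_smooth; [exact: smooth_derive|exact: compactly_supported_derive].
have [D DP] := choice hl; apply: is_regular_entries => i j.
eexists; apply: regular_eq (regular_sum (index_enum 'I_m) (fun l => regularM (hH l 0) (DP l i j))) => //.
move=> _ v x _ _ _ /=; rewrite -deriveE// (derive_delta_sum _ (df _)) summxE.
by apply: eq_bigr => l _; rewrite mxE.
Qed.

Lemma is_regular_integral (G : Phi -> R -> 'M[R]_m) : is_regular G -> is_regular (fun v => mx_integral (G v)).
Proof. by move=> [DG h]; eexists; exact: (regular_mx_integral L0 h). Qed.

Lemma is_regular_H1 (W : Phi -> Phi) DW : regularH r [set: unit] (fun _ => W) (fun _ => DW) ->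
  is_regular (fun v x => W v x).
Proof. by move=> h; eexists; exact: (regularH_value L0 h). Qed.

Lemma is_regular_continuous p q (G : Phi -> R -> 'M[R]_(p, q)) v i j : is_regular G -> `|v| < r ->
  {within `[0, L], continuous (fun x => G v x i j)}.
Proof.
move=> [DG h] vr; have [A A0 hA] := h i j.
exact: holder_half_continuous (reg_holder_half (hA tt I) vr).
Qed.

Lemma C1_holder_half (p p' : R -> R) : C1 p p' -> exists2 A : R, 0 <= A & holder_half L A p.
Proof.
move=> pp; have [_ cp'] := pp.
have [B [B0 hB]] := continuous_bounded (continuous_within (A := `[0, L]%classic) (C1_continuous pp)).
have [B' [B'0 hB']] := continuous_bounded (continuous_within (A := `[0, L]%classic) cp').
exists (B + B' * Num.sqrt L) => [|]; first by rewrite addr_ge0// mulr_ge0// sqrtr_ge0.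
split => [x xI|x y].
  by apply: le_trans (hB x xI) _; rewrite lerDl mulr_ge0// sqrtr_ge0.
wlog xy : x y / x <= y.
  move=> H xI yI; have [xy|/ltW yx] := leP x y; first exact: H.
  by rewrite distrC [`|y - x|]distrC; exact: H.
move=> xI yI; have Lp : L2 L p' by exact/continuous_L2/continuous_within.
have := integral_holder Lp hB' xI yI.
move: (xI) (yI); rewrite !in_itv/= => /andP[x0 xL] /andP[y0 yL].
rewrite (integral_increment Lp)// (C1_integral pp)// => /le_trans; apply.
by rewrite ler_wpM2r ?sqrtr_ge0// lerDr.
Qed.

(* A finite sum of fixed C^1 profiles with coefficients depending regularly on v. *)
Lemma is_regular_profiles (n : nat) (c : nat -> Phi -> 'cV[R]_m) (e e' : nat -> R -> R) :
  (forall k, (k < n)%N -> C1 (e k) (e' k)) ->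
  (forall k i, exists DG, regular r [set: unit] (fun _ v _ => c k v i 0) (fun _ => DG)) ->
  is_regular (fun v x => \sum_(k < n) e k x *: c k v).
Proof.
move=> ee hc; apply: is_regular_entries => i j; rewrite (ord1 j).
have [D DP] := choice (fun k => hc k i).
have he (k : 'I_n) : regular r [set: unit] (fun _ (_ : Phi) => e k) (fun _ _ _ _ => 0).
  have [A A0 hA] := C1_holder_half (ee k (ltn_ord k)).
  exact: (@regular_fixed _ L m r unit setT (fun _ => e k) A A0).
eexists; apply: regular_eq (regular_sum (index_enum 'I_n) (fun k => regularM (he k) (DP k))) => //.
by move=> _ v x _ _ _; rewrite summxE; apply: eq_bigr => k _; rewrite mxE.
Qed.

End RegularMaps.

(** * Regularity of the second nonlinearity *)

Section SecondNonlinearity.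
Context {R : realType} (L : R) (L0 : 0 < L) (m : nat) (m0 : (0 < m)%N) (r : R) (K0 : nat).
Context (f : 'cV[R]_m -> 'M[R]_m) (g : 'cV[R]_m -> 'cV[R]_m).
Hypotheses (sf : smooth f) (kf : compactly_supported f) (sg : smooth g) (kg : compactly_supported g).
Hypothesis Ud : U_diffeo L f r K0.
Variable K : nat.
Hypothesis PK : large K0 K.
Local Notation Phi := (H10 L m).
Local Notation mu := (@lebesgue_measure R).
Implicit Types (v w : Phi).
Local Notation is_regular := (@is_regular R L m r _ _).
Local Notation u := (@Umap R L m f K).
Local Notation a := (gauge L f K).
Local Notation one := [set: unit].

Lemma interior_mem (x : R) : x \in `]0, L[ -> x \in `[0, L].
Proof. by rewrite !in_itv/= => /andP[/ltW -> /ltW ->]. Qed.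

Let reg_a : is_regular a.
Proof. exact: (is_regular_member PK (regular_gauge L0 m0 sf kf Ud)). Qed.

Let reg_q : is_regular (fun v x => invmx (a v x)).
Proof. exact: (is_regular_member PK (regular_gauge_inv L0 m0 sf kf Ud)). Qed.

Let reg_c : is_regular (speed f K).
Proof. exact: (is_regular_member PK (regular_speed L0 m0 sf kf Ud)). Qed.

Let regH_u : regularH r one (fun _ => u) (fun _ : unit => Dphys f K).
Proof. by have [A A0 h] := regularH_U Ud; exists A => // _ _; exact: h. Qed.

Let reg_u : is_regular (fun v x => u v x).
Proof. exact: (is_regular_H1 L0 regH_u). Qed.

Let reg_low : is_regular (fun v x => low f K v x).
Proof.
have h : regularH r one (fun _ => low f K : Phi -> Phi) (fun _ => Dlow f K).
  by have [A A0 h] := regularH_low L0 m0 Ud; exists A => // _ _; exact: h.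
exact: (is_regular_H1 L0 h).
Qed.

Let reg_fu : is_regular (fun v x => f (u v x)).
Proof. exact: (is_regular_comp (C2_bounded_smooth sf kf) reg_u). Qed.

Let reg_gu : is_regular (fun v x => g (u v x)).
Proof. exact: (is_regular_comp (C2_bounded_smooth sg kg) reg_u). Qed.

Let reg_v : is_regular (fun v x => v x).
Proof. exact: (is_regular_H1 L0 (regularH_id L m r one)). Qed.

Definition scalar_regular (c : Phi -> R) := exists DG, regular r one (fun _ v _ => c v) (fun _ => DG).

Let pairing_regular (G : Phi -> R -> 'cV[R]_m) (h : R -> R) i : is_regular G -> L2 L h ->
  scalar_regular (fun v => ip L (fun x => G v x i 0) h).
Proof. by move=> [DG hG] Lh; eexists; exact: (square_regular_pairing Lh (regular_square L0 (hG i 0))). Qed.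

Let advection_regular (h : R -> R) i : L2 L h ->
  scalar_regular (fun v => ip L (fun x => (f (u v x) *m dx L (u v) x) i 0) h).
Proof.
move=> Lh; have [DF hF] := reg_fu.
have hs := square_regular_sum L0 (index_enum 'I_m) (fun j => square_regularM L0 (hF i j) (regularH_dx j regH_u)).
eexists; apply: regular_eq (square_regular_pairing Lh hs) => // _ v x _ _ _.
by apply: eq_Rintegral => y _; rewrite mxE.
Qed.

(** The derivative in x of [P_K U(v)]. *)
Definition lowd v (x : R) : 'cV[R]_m := \sum_(k < K) defun L k x *: pairing L (u v) (efun L k).

Let reg_lowd : is_regular lowd.
Proof.
apply: (@is_regular_profiles R L m r K (fun k v => pairing L (u v) (efun L k)) (defun L) (fun k x => - eigv L k * efun L k x)).
  by move=> k _; exact: defun_C1.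
move=> k i; have [DG h] := pairing_regular i reg_u (efun_L2 L k).
by eexists; apply: regular_eq h => // _ v x _ _ _; rewrite mxE.
Qed.

Lemma derive1n2_efun k : derive1n 2 (efun L k) = fun x => - eigv L k * efun L k x.
Proof.
have -> : derive1n 2 (efun L k) = derive1 (derive1 (efun L k)) by [].
have -> : derive1 (efun L k) = defun L k.
  by apply/funext => x; rewrite derive1E; case: (is_derive_efun L k x).
by apply/funext => x; rewrite derive1E; case: (is_derive_defun L k x).
Qed.

Let reg_dt : is_regular (fun v => proj_dt L f g K (u v)).
Proof.
pose c k v := pairing L (u v) (derive1n 2 (efun L k))
     - pairing L (fun y => f (u v y) *m dx L (u v) y) (efun L k) - pairing L (g \o u v) (efun L k).
have h : is_regular (fun v x => \sum_(k < K) efun L k x *: c k v).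
  apply: (@is_regular_profiles R L m r K c (efun L) (defun L)) => [k _|k i]; first exact: efun_C1.
  have L2d : L2 L (derive1n 2 (efun L k)) by rewrite derive1n2_efun; apply: L2Z; exact: efun_L2.
  have [D1 h1] := pairing_regular i reg_u L2d.
  have [D2 h2] := advection_regular i (efun_L2 L k).
  have [D3 h3] := pairing_regular i reg_gu (efun_L2 L k).
  by eexists; apply: regular_eq (regularB (regularB h1 h2) h3) => // _ v x _ _ _; rewrite !mxE.
apply: is_regular_eq h => v x _ _; rewrite /proj_dt big_add1/= big_mkord.
by apply: eq_bigr => k _.
Qed.

(** The inhomogeneous term in the equation that defines the time derivative of the gauge. *)
Definition forcing v (x : R) : 'M[R]_m := 2^-1 *: ('d f (low f K v x) (proj_dt L f g K (u v) x) *m a v x).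

Let reg_forcing : is_regular forcing.
Proof. by apply: is_regularZ; apply: is_regularM reg_a; exact: (is_regular_diff sf kf reg_low reg_dt). Qed.

Lemma speed_holder v : `|v| < r -> exists2 C, 0 <= C & forall i j, holder_half L C (fun x => speed f K v x i j).
Proof.
move=> vr; have [C C0 hC] := regular_mx_uniform (regular_speed L0 m0 sf kf Ud).
by exists C => // i j; exact: reg_holder_half (hC i j K PK) vr.
Qed.

(** Variation of constants solves the defining problem, so the selected [dt_gauge] is a genuine
    solution, and uniqueness identifies the two on [0, L]. *)
Lemma dt_gauge_val v x : `|v| < r -> x \in `[0, L] -> dt_gauge f g K v x = variation (a v) (forcing v) x.
Proof.
move=> vr xI; have [a0 ca da ua] := gauge_ode L0 Ud PK vr.
have [C C0 cC] := speed_holder vr.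
have ch : mx_continuous L (forcing v) by move=> i j; exact: is_regular_continuous reg_forcing vr.
have E y (b : 'M[R]_m) : y \in `]0, L[ -> speed f K v y *m b + forcing v y =
    2^-1 *: (f (Defs.proj L K (u v) y) *m b) +
    2^-1 *: ('d f (Defs.proj L K (u v) y) (proj_dt L f g K (u v) y) *m a v y).
  by move=> yI; rewrite /forcing /speed /low !projH_val ?interior_mem// -scalemxAl.
have sol : is_dt_gauge L f g K (u v) (a v) (variation (a v) (forcing v)).
  apply/ivp_mx; split; first exact: variation0.
    exact: (variation_continuous L0 cC C0 ca da a0 ua ch).
  apply: mx_derive_eq (variation_derive L0 cC C0 ca da a0 ua ch) => y yI; exact: E.
have sol' : is_dt_gauge L f g K (u v) (a v) (dt_gauge f g K v) by exact: (xgetPex _ (ex_intro _ _ sol)).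
have /ivp_mx[b0 cb db] := sol'.
apply: (@variation_unique _ L L0 m (speed f K v) (a v) C cC C0 ca da a0 ua (forcing v) (dt_gauge f g K v) ch cb b0 _ x xI).
by apply: mx_derive_eq db => y yI; rewrite E.
Qed.

(** The second derivative of the gauge, with [a' = c a] inserted: [c' a + c c a]. *)
Definition gauge_dd v (x : R) : 'M[R]_m :=
  (2^-1 *: 'd f (low f K v x) (lowd v x)) *m a v x + speed f K v x *m (speed f K v x *m a v x).

Let reg_dd : is_regular gauge_dd.
Proof.
apply: is_regularD; apply: is_regularM => //; last exact: is_regularM.
by apply: is_regularZ; exact: (is_regular_diff sf kf reg_low reg_lowd).
Qed.

Lemma proj_derive v (x : R) : is_derive x (1 : R) (Defs.proj L K (u v)) (lowd v x).
Proof.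
apply/is_derive_mx => i j; rewrite (ord1 j) /lowd summxE.
have -> : (fun y => Defs.proj L K (u v) y i 0) =
    fun y => \sum_(k < K) ip L (fun y => u v y i 0) (efun L k) * efun L k y.
  by apply/funext => y; exact: proj_entry.
apply: is_derive_sum_seq => k; rewrite !mxE mulrC.
exact: (is_deriveZ _ (is_derive_efun L k x)).
Qed.

Lemma speed_derive v : mx_derive L (speed f K v) (fun x => 2^-1 *: 'd f (low f K v x) (lowd v x)).
Proof.
move=> x i j xI; rewrite /low projH_val ?interior_mem//.
have df z : differentiable f z := @sf [::] z I.
have [dp Ep] := proj_derive v x.
have dfp : is_derive x (1 : R) (f \o Defs.proj L K (u v)) ('d f (Defs.proj L K (u v) x) (lowd v x)).
  have dp' : differentiable (Defs.proj L K (u v)) x by apply/derivable1_diffP.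
  split; first by apply: diff_derivable; exact: differentiable_comp.
  rewrite deriveE; last exact: differentiable_comp.
  by rewrite diff_comp//= -Ep deriveE.
have := (is_derive_mx _ _ _).1 dfp i j => de.
rewrite mxE; have dz := is_deriveZ 2^-1 de; apply: near_eq_is_derive dz.
near=> y; rewrite /speed /low projH_val ?mxE//; apply: interior_mem; near: y.
exact: near_in_itvoo.
Unshelve. all: by end_near. Qed.

Lemma gauge_derive2 v x : `|v| < r -> x \in `]0, L[ ->
  derive1 (a v) x = speed f K v x *m a v x /\ derive1n 2 (a v) x = gauge_dd v x.
Proof.
move=> vr xI; have [a0 ca da ua] := gauge_ode L0 Ud PK vr.
have d1 y : y \in `]0, L[ -> derive1 (a v) y = speed f K v y *m a v y.
  by move=> yI; rewrite derive1E; have [_ ->] := (is_derive_mx _ _ _).2 (fun i j => da y i j yI).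
split; first exact: d1.
rewrite -[derive1n 2 (a v)]/(derive1 (derive1 (a v))) derive1E.
have d2 := (is_derive_mx _ _ _).2 (fun i j => mx_deriveM (speed_derive v) da i j xI).
rewrite /gauge_dd; have [_ E2] := d2; rewrite -E2; apply: near_eq_derive; near=> y; apply: d1; near: y.
exact: near_in_itvoo.
Unshelve. all: by end_near. Qed.

Theorem regular_F2 : is_regular (F2 f g K).
Proof.
pose G v x := (invmx (a v x) *m gauge_dd v x - invmx (a v x) *m variation (a v) (forcing v) x -
  invmx (a v x) *m f (u v x) *m (speed f K v x *m a v x)) *m v x - invmx (a v x) *m g (u v x).
have reg_var : is_regular (fun v => variation (a v) (forcing v)).
  apply: is_regularM => //; apply: is_regular_integral => //; exact: is_regularM.
apply: (@is_regular_eq _ L m r _ _ G) => [v x vr xI|]; last first.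
  apply: is_regularB; last exact: is_regularM.
  apply: is_regularM => //; apply: is_regularB; last by apply: is_regularM; exact: is_regularM.
  by apply: is_regularB; exact: is_regularM.
rewrite /F2 /G -(Umap_val L0 Ud PK vr xI) (dt_gauge_val vr xI); congr (_ - _).
(* At the end points the derivatives of the gauge are uncontrolled, but they are multiplied by
   [v x = 0]. *)
have [xo|xo] := boolP (x \in `]0, L[).
  by have [-> ->] := gauge_derive2 vr xo.
by rewrite (H10_vanishing v xo) !mulmx0.
Qed.

End SecondNonlinearity.

(** * The cut-off *)

Section ScalarCutoff.
Context {R : realType}.
Implicit Types s z h : R.

Lemma smooth_taylor (phi : R -> R) (M : R) : smooth phi -> 0 <= M ->
  exists2 B : R, 0 <= B & forall s z, s \in `[0, M] -> z \in `[0, M] ->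
    `|phi z - phi s - (z - s) * 'D_1 phi s| <= B * (z - s) ^+ 2 /\ `|'D_1 phi z - 'D_1 phi s| <= B * `|z - s|.
Proof.
move=> sp M0.
have c2 : continuous ('D_1 ('D_1 phi)).
  by move=> x; apply: differentiable_continuous; exact: (sp [:: 1; 1] x I).
have d1 x : is_derive x (1 : R) phi ('D_1 phi x).
  by apply: DeriveDef => //; apply: diff_derivable; exact: (sp [::] x I).
have d2 x : is_derive x (1 : R) ('D_1 phi) ('D_1 ('D_1 phi) x).
  by apply: DeriveDef => //; apply: diff_derivable; exact: (sp [:: 1] x I).
have [B [B0 hB]] := continuous_bounded (L := M) (continuous_within (A := `[0, M]%classic) c2).
have between s z t : s \in `[0, M] -> z \in `[0, M] -> s <= z -> t \in `[s, z] -> t \in `[0, M].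
  by rewrite !in_itv/= => /andP[s0 _] /andP[_ zM] _ /andP[st tz]; rewrite (le_trans s0)//= (le_trans tz).
have inc s z : s \in `[0, M] -> z \in `[0, M] -> s <= z -> `|'D_1 phi z - 'D_1 phi s| <= B * (z - s).
  move=> sI zI sz; have -> : 'D_1 phi z - 'D_1 phi s = 'D_1 phi z - 'D_1 phi s - (z - s) * 0 by rewrite mulr0 subr0.
  apply: (@mean_value_interval R ('D_1 phi) ('D_1 ('D_1 phi)) s z 0 B sz (fun t _ => d2 t)) => t tI.
  by rewrite subr0; apply: hB; exact: between tI.
have inc' s z : s \in `[0, M] -> z \in `[0, M] -> `|'D_1 phi z - 'D_1 phi s| <= B * `|z - s|.
  move=> sI zI; have [sz|/ltW zs] := leP s z; first by rewrite [`|z - s|]ger0_norm ?subr_ge0//; exact: inc.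
  by rewrite distrC [`|z - s|]distrC [`|s - z|]ger0_norm ?subr_ge0//; exact: inc.
exists B => // s z sI zI; split; last exact: inc'.
have [sz|/ltW zs] := leP s z.
  apply: le_trans (@mean_value_interval R phi ('D_1 phi) s z ('D_1 phi s) (B * (z - s)) sz (fun t _ => d1 t) _) _.
  - move=> t tI; have tM := between s z t sI zI sz tI; move: tI; rewrite in_itv/= => /andP[st tz].
    by apply: le_trans (inc s t sI tM st) _; rewrite ler_wpM2l// lerD2r.
  - by rewrite -mulrA -expr2.
have -> : phi z - phi s - (z - s) * 'D_1 phi s = - (phi s - phi z - (s - z) * 'D_1 phi s) by ring.
rewrite normrN; apply: le_trans (@mean_value_interval R phi ('D_1 phi) z s ('D_1 phi s) (B * (s - z)) zs (fun t _ => d1 t) _) _.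
- move=> t tI; have tM := between z s t zI sI zs tI; move: tI; rewrite in_itv/= => /andP[zt ts].
  by rewrite distrC; apply: le_trans (inc t s tM sI ts) _; rewrite ler_wpM2l// lerB.
- by rewrite -mulrA -expr2 -[(s - z) ^+ 2]sqrrN opprB.
Qed.

(** The function vanishes to the right of [b], so its first derivative is 0 at [b] too; Taylor's
    formula around [b] then gives the two bounds by powers of [b - s]. *)
Lemma cutoff_taylor (phi : R -> R) (b : R) : smooth phi -> (forall z, b <= z -> phi z = 0) -> 0 <= b ->
  exists2 B : R, 0 <= B & forall s z, s \in `[0, b] -> z \in `[0, b] ->
    [/\ `|phi z - phi s - (z - s) * 'D_1 phi s| <= B * (z - s) ^+ 2,
        `|phi s| <= B * (b - s) ^+ 2 & `|'D_1 phi s| <= B * (b - s)].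
Proof.
move=> sp p0 b0; have [B B0 hB] := smooth_taylor sp (addr_ge0 b0 ler01).
have sub s : s \in `[0, b] -> s \in `[0, b + 1].
  by rewrite !in_itv/= => /andP[-> sb]; rewrite (le_trans sb)// lerDl.
have bI : b \in `[0, b] by rewrite in_itv/= b0 lexx.
(* A point [b + h] to the right of [b] is inspected, which is why the constants are taken on
   [[0, b + 1]]. *)
have d0 : 'D_1 phi b = 0.
  apply/eqP; rewrite -normr_le0; apply/ler_addgt0Pr => e e0; rewrite add0r.
  pose h := Num.min 1 (e / (B + 1)).
  have B1 : 0 < B + 1 by rewrite ltr_wpDl.
  have h0 : 0 < h by rewrite lt_min ltr01 divr_gt0.
  have hI : b + h \in `[0, b + 1].
    by rewrite in_itv/= addr_ge0// ?(ltW h0)//= lerD2l ge_min lexx.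
  have [+ _] := hB b (b + h) (sub b bI) hI.
  have -> : b + h - b = h by ring.
  rewrite (p0 b)// (p0 (b + h)) ?lerDl ?(ltW h0)// subrr sub0r normrN normrM (gtr0_norm h0).
  rewrite expr2 mulrA [h * _]mulrC ler_pM2r// => /le_trans; apply.
  apply: (@le_trans _ _ ((B + 1) * (e / (B + 1)))); last by rewrite mulrC divfK// gt_eqF.
  by apply: ler_pM => //; rewrite ?(ltW h0)// ?lerDl// ge_min lexx orbT.
exists B => // s z sI zI; have [h1 _] := hB s z (sub s sI) (sub z zI).
have [h2 h3] := hB b s (sub b bI) (sub s sI); split => //.
- by move: h2; rewrite (p0 b)// d0 mulr0 !subr0 -[(s - b) ^+ 2]sqrrN opprB.
- have sb : s <= b by move: sI; rewrite in_itv/= => /andP[].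
  by move: h3; rewrite d0 subr0 distrC (@ger0_norm _ (b - s)) ?subr_ge0.
Qed.

Lemma square_gap (r p : R) : 0 <= p -> p < r -> 0 <= r ^+ 2 - p ^+ 2 <= 2 * `|r| * (r - p).
Proof. by move=> p0 pr; have r0 := le_lt_trans p0 pr; rewrite (gtr0_norm r0); apply/andP; split; nra. Qed.

Lemma square_lip (r p q d : R) : 0 <= p -> 0 <= q -> p < r -> q < r -> `|q - p| <= d ->
  `|q ^+ 2 - p ^+ 2| <= 2 * `|r| * d.
Proof.
move=> p0 q0 pr qr pq; have r0 := le_lt_trans p0 pr; rewrite (gtr0_norm r0).
rewrite subr_sqr normrM mulrC [`|q + p|]ger0_norm ?addr_ge0//.
by apply: ler_pM => //; [exact: addr_ge0|lra].
Qed.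

(** Applied with squared norms for [s] and [z], inner product [c] and increment norm [e]: the
    quadratic part of the squared norm is moved from the first order term to the remainder. *)
Lemma cutoff_step (fz fs f1 z s c e B b q : R) : 0 <= B -> 0 <= e -> 0 <= q ->
  `|fz - fs - (z - s) * f1| <= B * (z - s) ^+ 2 -> `|f1| <= B * b -> z = s + 2 * c + e ^+ 2 ->
  `|z - s| <= q * e -> `|fz - fs - 2 * f1 * c| <= (B * q ^+ 2 + B * b) * e ^+ 2.
Proof.
move=> B0 e0 q0 h1 h3 E lip.
have -> : fz - fs - 2 * f1 * c = (fz - fs - (z - s) * f1) + f1 * e ^+ 2 by rewrite E; ring.
apply: le_trans (ler_normD _ _) _; rewrite [leRHS]mulrDl; apply: lerD.
  apply: le_trans h1 _; rewrite -mulrA -exprMn ler_wpM2l//.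
  by rewrite -[(z - s) ^+ 2]real_normK ?num_real// lerXn2r ?nnegrE ?mulr_ge0.
by rewrite normrM [X in _ * X]ger0_norm ?exprn_ge0// ler_wpM2r ?exprn_ge0.
Qed.

Lemma gap_le (r p : R) : 0 <= p -> r - p <= `|r|.
Proof. by move=> p0; have := ler_norm r; lra. Qed.

Lemma sqr_step (x C p e : R) : x <= C * p ^+ 2 -> 0 <= p -> p <= e -> 0 <= C -> x <= C * e ^+ 2.
Proof.
move=> xp p0 pe C0; apply: le_trans xp _; rewrite ler_wpM2l// lerXn2r ?nnegrE//.
exact: le_trans pe.
Qed.

Lemma mul_step (x C p e : R) : x <= C * p * e -> p <= e -> 0 <= C -> 0 <= e -> x <= C * e ^+ 2.
Proof. by move=> xp pe C0 e0; apply: le_trans xp _; rewrite expr2 mulrA ler_wpM2r// ler_wpM2l. Qed.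

End ScalarCutoff.

Section Cutoff.
Context {R : realType} (L : R) (L0 : 0 < L) (m : nat) (r : R) (phi : R -> R).
Hypotheses (sp : smooth phi) (p0 : forall z, r ^+ 2 <= z -> phi z = 0).
Local Notation Phi := (H10 L m).
Implicit Types (u v w : Phi).

Definition cut v : R := phi (`|v| ^+ 2).
Definition Dcut v w : R := 2 * 'D_1 phi (`|v| ^+ 2) * H1dot w v.

Lemma H1dot_sqr v w : `|v + w| ^+ 2 = `|v| ^+ 2 + 2 * H1dot w v + `|w| ^+ 2.
Proof.
have nE u : `|u| ^+ 2 = H1dot u u by rewrite -[`|u|]/(H1norm u) sqr_sqrtr ?H1dot_ge0.
rewrite (nE v) (nE w) nE.
have -> : v + w = 1 *: v + w by rewrite scale1r.
by rewrite H1dot_lin ![H1dot _ (1 *: v + w)]H1dotC !H1dot_lin (H1dotC v w); ring.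
Qed.

(** The double zero of [phi] at [r ^+ 2] becomes a double zero in the distance [r - |v|] to the
    sphere, since [r^2 - |v|^2] is at most a multiple of it. *)
Lemma cut_bounds : exists2 C : R, 0 <= C & forall v, `|v| < r ->
  [/\ `|cut v| <= C * (r - `|v|) ^+ 2, forall w, `|Dcut v w| <= C * (r - `|v|) * `|w| &
      forall v', `|v'| < r -> `|cut v' - cut v - Dcut v (v' - v)| <= C * `|v' - v| ^+ 2].
Proof.
have [B B0 hB] := cutoff_taylor sp p0 (sqr_ge0 r).
pose C := B * (2 * `|r|) ^+ 2 + B * (2 * `|r|) * 2 * `|r| + B * r ^+ 2.
have q1 : 0 <= B * (2 * `|r|) ^+ 2 by rewrite mulr_ge0// exprn_ge0// mulr_ge0.
have q2 : 0 <= B * (2 * `|r|) * 2 * `|r| by rewrite !mulr_ge0.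
have q3 : 0 <= B * r ^+ 2 by rewrite mulr_ge0// sqr_ge0.
have C0 : 0 <= C by rewrite /C; lra.
have c1 : B * (2 * `|r|) ^+ 2 <= C by rewrite /C; lra.
have c2 : B * (2 * `|r|) * 2 * `|r| <= C by rewrite /C; lra.
have c3 : B * (2 * `|r|) ^+ 2 + B * r ^+ 2 <= C by rewrite /C; lra.
have I v : `|v| < r -> `|v| ^+ 2 \in `[0, r ^+ 2].
  move=> vr; rewrite in_itv/= exprn_ge0//=.
  by have /andP[+ _] := square_gap (normr_ge0 v) vr; rewrite subr_ge0.
exists C => // v vr; have /andP[g0 g1] := square_gap (normr_ge0 v) vr.
have [_ h2 h3] := hB _ _ (I v vr) (I v vr).
have gap0 : 0 <= r - `|v| by rewrite subr_ge0 ltW.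
have vr' : `|v| <= `|r| by apply: le_trans (ltW vr) (ler_norm r).
have pairle w : `|H1dot w v| <= `|v| * `|w| by exact: (H1pair_le v w).
split.
- apply: le_trans h2 _; apply: (@le_trans _ _ (B * (2 * `|r| * (r - `|v|)) ^+ 2)).
    by rewrite ler_wpM2l// lerXn2r ?nnegrE// (le_trans g0).
  by rewrite exprMn mulrA ler_wpM2r// exprn_ge0.
- move=> w; rewrite /Dcut !normrM ger0_norm//.
  apply: (@le_trans _ _ (2 * (B * (2 * `|r| * (r - `|v|))) * (`|r| * `|w|))).
    apply: ler_pM => //; first by rewrite ler_wpM2l//; apply: le_trans h3 _; rewrite ler_wpM2l.
    by apply: le_trans (pairle w) _; rewrite ler_wpM2r.
  have alg (a b c e : R) : 2 * (a * (2 * b * c)) * (b * e) = a * (2 * b) * 2 * b * (c * e) by ring.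
  rewrite alg.
  by rewrite -[leRHS]mulrA ler_wpM2r// mulr_ge0.
- move=> v' v'r; set d : Phi := v' - v; have [h1 _ _] := hB _ _ (I v vr) (I v' v'r).
  have E : `|v'| ^+ 2 = `|v| ^+ 2 + 2 * H1dot d v + `|d| ^+ 2.
    by rewrite -H1dot_sqr /d addrC subrK.
  have lip : `| (`|v'| ^+ 2 - `|v| ^+ 2)| <= 2 * `|r| * `|d|.
    exact: (square_lip (normr_ge0 v) (normr_ge0 v') vr v'r (ler_dist_dist v' v)).
  have f1 : `|'D_1 phi (`|v| ^+ 2)| <= B * r ^+ 2.
    by apply: le_trans h3 _; rewrite ler_wpM2l// gerBl exprn_ge0.
  apply: le_trans (cutoff_step B0 (normr_ge0 d) (mulr_ge0 (ler0n _ 2) (normr_ge0 r)) h1 f1 E lip) _.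
  by apply: ler_wpM2r; [exact: exprn_ge0|exact: c3].
Qed.

Lemma Dcut_lin v (b : R) w w' : Dcut v (b *: w + w') = b * Dcut v w + Dcut v w'.
Proof. by rewrite /Dcut H1dot_lin; ring. Qed.

Lemma regular_cut : regular r [set: unit] (fun _ v (_ : R) => cut v) (fun _ v w _ => Dcut v w).
Proof.
have [C C0 hC] := cut_bounds; pose D := C * (1 + `|r|) ^+ 2.
have D0 : 0 <= D by rewrite mulr_ge0// sqr_ge0.
have le1 p : 0 <= p -> p < r -> 0 <= r - p /\ r - p <= 1 + `|r|.
  by move=> p0' pr; have := ler_norm r; split; lra.
have r1 : 1 <= 1 + `|r| by rewrite lerDl.
exists D => // _ _; split.
- move=> v x vr _; have [h _ _] := hC v vr; apply: le_trans h _.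
  have [g0 g1] := le1 _ (normr_ge0 v) vr.
  by rewrite ler_wpM2l// lerXn2r ?nnegrE// addr_ge0.
- by move=> *; rewrite subrr normr0 mulr_ge0// sqrtr_ge0.
- by move=> v b w w' x _ _; exact: Dcut_lin.
- move=> v w x vr _; have [_ h _] := hC v vr; apply: le_trans (h w) _; rewrite ler_wpM2r// /D ler_wpM2l//.
  have [g0 g1] := le1 _ (normr_ge0 v) vr; apply: le_trans g1 _; by rewrite expr2 ler_peMr// (le_trans ler01).
- by move=> *; rewrite subrr normr0 !mulr_ge0// sqrtr_ge0.
- move=> v v' x vr v'r _; have [_ _ h] := hC v vr; apply: le_trans (h v' v'r) _; rewrite ler_wpM2r ?exprn_ge0//.
  by rewrite /D ler_peMr// expr_ge1.
Qed.

(* The cut-off vanishes to second order on the sphere, so the truncated family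
   keeps a quadratic Taylor remainder across it. *)
Lemma cut_square_regular (A : R) (H : Phi -> R -> R) (DH : Phi -> Phi -> R -> R) :
  0 <= A -> square_regular_at r A H DH ->
  let G v x := if `|v| < r then cut v * H v x else 0 in
  let DG v w x := if `|v| < r then Dcut v w * H v x + cut v * DH v w x else 0 in
  exists2 T : R, 0 <= T & (forall v, L2 L (G v) /\ n2 L (G v) <= T) /\
    (forall v w, L2 L (DG v w) /\ n2 L (DG v w) <= T * `|w|) /\
    (forall v (b : R) w w' k, L2 L k -> ip L (DG v (b *: w + w')) k = b * ip L (DG v w) k + ip L (DG v w') k) /\
    (forall v v', n2 L (fun x => G v' x - G v x - DG v (v' - v) x) <= T * `|v' - v| ^+ 2).
Proof.
move=> A0 hH G DG.
have hs : square_regular r [set: unit] (fun _ => H) (fun _ => DH) by exists A.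
have [B B0 hB] := square_regularM L0 regular_cut hs.
have [C C0 hC] := cut_bounds.
have [k1 k2 k3 k4 k5 k6] := hB tt I.
have [h1 h2 h3 h4 h5 h6] := hH.
pose T := B + C * A * (2 + `|r|).
have T0 : 0 <= T by rewrite addr_ge0// !mulr_ge0// addr_ge0.
have BT : B <= T by rewrite lerDl !mulr_ge0// addr_ge0.
have n0 : n2 L (fun=> 0) = 0 by rewrite /n2 ip0l sqrtr0.
have CAT (d : R) : 0 <= d -> C * A * d + C * A * d + C * A * (`|r| * d) <= T * d.
  have -> : C * A * d + C * A * d + C * A * (`|r| * d) = C * A * (2 + `|r|) * d by ring.
  by move=> d0; rewrite ler_wpM2r// lerDr.
have CAT1 (d : R) : 0 <= d -> C * d * A <= T * d.
  by move=> d0; apply: le_trans (CAT d d0); rewrite mulrAC -addrA lerDl addr_ge0// !mulr_ge0.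
exists T => //; split; [|split; [|split]].
- move=> v; rewrite /G; case: (boolP (`|v| < r)) => vr; last by rewrite n0; split => //; exact: L2_0.
  by split; [exact: k1|exact: le_trans (k3 v vr) BT].
- move=> v w; rewrite /DG; case: (boolP (`|v| < r)) => vr; last by rewrite n0 mulr_ge0//; split => //; exact: L2_0.
  by split; [exact: k2|apply: le_trans (k4 v w vr) _; rewrite ler_wpM2r].
- move=> v b w w' k Lk; rewrite /DG; case: (boolP (`|v| < r)) => vr; last by rewrite ip0l mulr0 addr0.
  exact: k5.
move=> v v'; rewrite /G /DG; have [vr|vr] := ltP `|v| r; have [v'r|v'r] := ltP `|v'| r.
- by apply: le_trans (k6 v v' vr v'r) _; rewrite ler_wpM2r// exprn_ge0.
- have [c1 c2 _] := hC v vr; set d : Phi := v' - v.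
  (* The sphere separates the two states, so the distance of the inner one to it is at most [|d|];
     every power of that distance in [cut_bounds] becomes a power of [|d|]. *)
  have gd : r - `|v| <= `|d| by exact: (le_trans (lerB v'r (lexx `|v|)) (lerB_dist v' v)).
  clearbody d.
  have g0 : 0 <= r - `|v| by rewrite subr_ge0 ltW.
  have gr : r - `|v| <= `|r| by exact: gap_le (normr_ge0 v).
  have L1 : L2 L (fun x => - cut v * H v x) by apply: L2Z; exact: h1.
  have L2' : L2 L (fun x => - Dcut v d * H v x) by apply: L2Z; exact: h1.
  have L3 : L2 L (fun x => - cut v * DH v d x) by apply: L2Z; exact: h2.
  have -> : (fun x => 0 - cut v * H v x - (Dcut v d * H v x + cut v * DH v d x)) =
      fun x => - cut v * H v x + - Dcut v d * H v x + - cut v * DH v d x.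
    by apply/funext => x; ring.
  apply: le_trans (n2D (L2D L1 L2') L3) _; apply: le_trans (lerD (n2D L1 L2') (lexx _)) _.
  rewrite !n2Z; [|exact: h2|exact: h1|exact: h1]; rewrite !normrN.
  apply: le_trans (CAT _ (exprn_ge0 2 (normr_ge0 d))).
  have X1 : `|cut v| <= C * `|d| ^+ 2.
    exact: sqr_step c1 g0 gd C0.
  have X2 : `|Dcut v d| <= C * `|d| ^+ 2.
    exact: (mul_step (c2 d) gd C0 (normr_ge0 d)).
  have X3 : `|cut v| <= C * (`|r| * `|d|).
    by apply: le_trans c1 _; rewrite expr2 ler_wpM2l//; apply: ler_pM.
  apply: lerD; [apply: lerD|].
  + by rewrite mulrAC; apply: ler_pM => //; [exact: n2_ge0|exact: h3].
  + by rewrite mulrAC; apply: ler_pM => //; [exact: n2_ge0|exact: h3].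
  + have -> : C * A * (`|r| * `|d| ^+ 2) = C * (`|r| * `|d|) * (A * `|d|) by ring.
    by apply: ler_pM => //; [exact: n2_ge0|exact: h4].
- have [c1 _ _] := hC v' v'r; set d : Phi := v' - v.
  have gd : r - `|v'| <= `|d|.
    by apply: le_trans (lerB vr (lexx _)) _; rewrite /d distrC; exact: lerB_dist.
  clearbody d.
  have g0 : 0 <= r - `|v'| by rewrite subr_ge0 ltW.
  have -> : (fun x => cut v' * H v' x - 0 - 0) = fun x => cut v' * H v' x by apply/funext => x; rewrite !subr0.
  rewrite n2Z; last exact: h1.
  apply: (@le_trans _ _ (C * `|d| ^+ 2 * A)).
    apply: ler_pM; [exact: normr_ge0|exact: n2_ge0| |exact: h3].
    exact: sqr_step c1 g0 gd C0.
  exact: (CAT1 _ (exprn_ge0 2 (normr_ge0 d))).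
- have -> : (fun x : R => 0 - 0 - 0 : R) = fun=> 0 by apply/funext => x; rewrite !subr0.
  by rewrite n0 mulr_ge0// exprn_ge0.
Qed.

End Cutoff.

(** * The truncated nonlinearity and the splitting of its derivative *)

Section Truncation.
Context {R : realType} (L : R) (L0 : 0 < L) (m : nat) (m0 : (0 < m)%N) (r : R) (K0 : nat).
Context (f : 'cV[R]_m -> 'M[R]_m) (g : 'cV[R]_m -> 'cV[R]_m) (phi : R -> R).
Hypotheses (sf : smooth f) (kf : compactly_supported f) (sg : smooth g) (kg : compactly_supported g).
Hypothesis Ud : U_diffeo L f r K0.
Hypotheses (sp : smooth phi) (p0 : forall z, r ^+ 2 <= z -> phi z = 0).
Local Notation Phi := (H10 L m).
Local Notation cut := (@cut R L m phi).
Local Notation Dcut := (@Dcut R L m phi).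
Implicit Types (v w : Phi) (i j : 'I_m).

(** [D1] is small from H^1 to L^2 and [D2] is Hoelder in x. Linearity is stated for their sum and by
    duality, because [D1] contains weak derivatives, which are linear almost everywhere only. *)
Record truncated_derivative (N : Phi -> R -> 'cV[R]_m) (D1 D2 : Phi -> Phi -> R -> 'cV[R]_m) (e B : R) : Prop :=
  TruncatedDerivative {
  td_value : forall v i, L2 L (fun x => N v x i 0) /\ n2 L (fun x => N v x i 0) <= B;
  td_small : forall v w i, L2 L (fun x => D1 v w x i 0) /\ n2 L (fun x => D1 v w x i 0) <= e * `|w|;
  td_holder : forall v w i, holder_half L (B * `|w|) (fun x => D2 v w x i 0);
  td_lin : forall v (b : R) w w' k i, L2 L k ->
    ip L (fun x => D1 v (b *: w + w') x i 0 + D2 v (b *: w + w') x i 0) k =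
    b * ip L (fun x => D1 v w x i 0 + D2 v w x i 0) k + ip L (fun x => D1 v w' x i 0 + D2 v w' x i 0) k;
  td_taylor : forall v v' i,
    n2 L (fun x => N v' x i 0 - N v x i 0 - (D1 v (v' - v) x i 0 + D2 v (v' - v) x i 0)) <= B * `|v' - v| ^+ 2 }.

Definition transport K v (x : R) i : R := \sum_j F1 f K v x i j * dx L v x j 0.
Definition Dtransport K v w (x : R) i : R :=
  \sum_j (DF1 f K v w x i j * dx L v x j 0 + F1 f K v x i j * dx L w x j 0).

(** All terms that contain a space derivative of [v] or [w]; the terms coming from [F2] make up the
    Hoelder part. *)
Definition D1 K v w (x : R) : 'cV[R]_m :=
  \col_i (if `|v| < r then Dcut v w * transport K v x i + cut v * Dtransport K v w x i else 0).

Lemma square_regular_transport K i : large K0 K ->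
  square_regular r [set: unit] (fun _ v x => transport K v x i) (fun _ v w x => Dtransport K v w x i).
Proof.
move=> PK; have hF := regular_F1 L0 m0 sf kf Ud.
apply: (square_regular_sum L0) => j.
have hj : regular r [set: unit] (fun _ v x => F1 f K v x i j) (fun _ v w x => DF1 f K v w x i j).
  by have [A A0 hA] := hF i j; exists A => // _ _; exact: hA.
exact: (square_regularM L0 hj (regularH_dx j (regularH_id L m r setT))).
Qed.

Lemma transport_small : exists2 A : R, 0 <= A & forall K v i, large K0 K -> `|v| < r ->
  n2 L (fun x => transport K v x i) <= A / Num.sqrt K%:R /\
  forall w, n2 L (fun x => Dtransport K v w x i) <= A / Num.sqrt K%:R * `|w|.
Proof.
have [A A0 hA] := decaying_F1 L0 m0 sf kf Ud.
exists (m%:R * (A * `|r| + A)) => [|K v i PK vr]; first by rewrite mulr_ge0// addr_ge0// mulr_ge0.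
have [_ Kpos] := PK; set s := Num.sqrt K%:R.
have s0 : 0 <= A / s by rewrite divr_ge0 ?sqrtr_ge0.
have vr' : `|v| <= `|r| by apply: le_trans (ltW vr) (ler_norm r).
have Ld (z : Phi) j : L2 L (fun x => dx L z x j 0) by exact: (L2v_dx z j).
have hF := regular_F1 L0 m0 sf kf Ud.
have cF j : {within `[0, L], continuous (fun x => F1 f K v x i j)}.
  by have [B B0 hB] := hF i j; exact: holder_half_continuous (reg_holder_half (hB K PK) vr).
have cD w j : {within `[0, L], continuous (fun x => DF1 f K v w x i j)}.
  by have [B B0 hB] := hF i j; exact: holder_half_continuous (reg_D_holder_half w (hB K PK) vr).
have t1 (z : Phi) j : n2 L (fun x => F1 f K v x i j * dx L z x j 0) <= A / s * `|z|.
  apply: (@le_trans _ _ (A / s * n2 L (fun x => dx L z x j 0))).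
    by apply: (n2M_le L0 (cF j) (Ld z j)) => x xI; have [h _] := hA K v x i j PK vr xI.
  by rewrite ler_wpM2l// dx_n2.
have t2 w j : n2 L (fun x => DF1 f K v w x i j * dx L v x j 0) <= A / s * `|w| * `|v|.
  apply: (@le_trans _ _ (A / s * `|w| * n2 L (fun x => dx L v x j 0))).
    by apply: (n2M_le L0 (cD w j) (Ld v j)) => x xI; have [_ h] := hA K v x i j PK vr xI; exact: h.
  by rewrite ler_wpM2l ?dx_n2// mulr_ge0.
split=> [|w].
  have [_ h] := n2_sum (index_enum 'I_m) (fun j => L2M (cF j) (Ld v j)) (t1 v).
  apply: le_trans h _; rewrite sumr_const card_ord -[leLHS]mulr_natl -[leRHS]mulrA ler_wpM2l//.
  rewrite mulrDl -[leLHS]addr0; apply: lerD => //.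
  by rewrite [leRHS]mulrAC ler_wpM2l.
have Lj j : L2 L (fun x => DF1 f K v w x i j * dx L v x j 0 + F1 f K v x i j * dx L w x j 0).
  by apply: L2D; exact: L2M.
have bj j : n2 L (fun x => DF1 f K v w x i j * dx L v x j 0 + F1 f K v x i j * dx L w x j 0) <=
    A / s * `|w| * `|v| + A / s * `|w|.
  by apply: le_trans (n2D (L2M (cD w j) (Ld v j)) (L2M (cF j) (Ld w j))) _; exact: lerD (t2 w j) (t1 w j).
have [_ h] := n2_sum (index_enum 'I_m) Lj bj.
apply: le_trans h _; rewrite sumr_const card_ord -[leLHS]mulr_natl -!mulrA ler_wpM2l//.
have -> : (A * `|r| + A) * (s^-1 * `|w|) = A / s * `|w| * `|r| + A / s * `|w| by ring.
rewrite !mulrA; by rewrite lerD2r ler_wpM2l// mulr_ge0.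
Qed.

(** The order of the quantifiers matters: [A] is independent of K, while [B] may depend on it. *)
Theorem truncation_estimates : exists2 A : R, 0 <= A & forall K, large K0 K ->
  exists D2 B, 0 <= B /\ truncated_derivative (cutoff_rhs f g K phi r) (D1 K) D2 (A / Num.sqrt K%:R) B.
Proof.
have [A A0 hA] := transport_small; have hcut := @regular_cut R L m r phi sp p0.
have [C C0 hC] := hcut; exists (C * A + C * A) => [|K PK]; first by rewrite addr_ge0// mulr_ge0.
have I0 : 0 \in `[0, L] by rewrite in_itv/= lexx ltW.
have Xb v : `|v| < r -> `|cut v| <= C by move=> vr; exact: (reg_bound (hC tt I) vr I0).
have DXb v w : `|v| < r -> `|Dcut v w| <= C * `|w| by move=> vr; exact: (reg_Dbound (hC tt I) w vr I0).
have [DF2 hF2] := regular_F2 L0 m0 sf kf sg kg Ud PK.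
pose D2 v w x : 'cV[R]_m := \col_i (if `|v| < r then Dcut v w * F2 f g K v x i 0 + cut v * DF2 v w x i 0 else 0).
pose H i v x := transport K v x i + F2 f g K v x i 0.
pose DH i v w x := Dtransport K v w x i + DF2 v w x i 0.
have hH i : square_regular r [set: unit] (fun _ => H i) (fun _ => DH i).
  exact: (square_regularD (square_regular_transport i PK) (regular_square L0 (hF2 i 0))).
have cutH i : exists T : R, 0 <= T /\
    (forall v, L2 L (fun x => cutoff_rhs f g K phi r v x i 0) /\ n2 L (fun x => cutoff_rhs f g K phi r v x i 0) <= T) /\
    (forall v (b : R) w w' k, L2 L k ->
      ip L (fun x => D1 K v (b *: w + w') x i 0 + D2 v (b *: w + w') x i 0) k =
      b * ip L (fun x => D1 K v w x i 0 + D2 v w x i 0) k + ip L (fun x => D1 K v w' x i 0 + D2 v w' x i 0) k) /\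
    (forall v v', n2 L (fun x => cutoff_rhs f g K phi r v' x i 0 - cutoff_rhs f g K phi r v x i 0 -
      (D1 K v (v' - v) x i 0 + D2 v (v' - v) x i 0)) <= T * `|v' - v| ^+ 2).
  have [B B0 hB] := hH i; have [T T0 [h1 [_ [h3 h4]]]] := cut_square_regular L0 sp p0 B0 (hB tt I).
  have NE v : (fun x => cutoff_rhs f g K phi r v x i 0) = fun x => if `|v| < r then cut v * H i v x else 0.
    apply/funext => x; rewrite /cutoff_rhs; case: ifP => _; last by rewrite mxE.
    by rewrite /H mulrDr mxE [X in X + _]mxE [X in _ + X]mxE /transport [X in _ * X + _]mxE.
  have DE v w : (fun x => D1 K v w x i 0 + D2 v w x i 0) =
      fun x => if `|v| < r then Dcut v w * H i v x + cut v * DH i v w x else 0.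
    apply/funext => x; rewrite mxE [X in _ + X]mxE; case: ifP => _; last by rewrite addr0.
    by rewrite /H /DH !mulrDr addrACA.
  exists T; split => //; split; [|split].
  - by move=> v; rewrite NE; exact: h1.
  - by move=> v b w w' k Lk; rewrite !DE; exact: h3.
  - move=> v v'; have := h4 v v'; congr (n2 L _ <= _); apply/funext => x.
    by rewrite -[X in X - _ - _](congr1 (fun h => h x) (NE v')) -[X in _ - X - _](congr1 (fun h => h x) (NE v))
         -[X in _ - X](congr1 (fun h => h x) (DE v (v' - v))).
have [T TP] := choice cutH.
have hD2 i : exists B : R, 0 <= B /\ forall v w, holder_half L (B * `|w|) (fun x => D2 v w x i 0).
  have [B B0 hB] := regularM hcut (hF2 i 0); exists B; split => // v w.
  have -> : (fun x => D2 v w x i 0) = fun x => if `|v| < r then Dcut v w * F2 f g K v x i 0 + cut v * DF2 v w x i 0 else 0.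
    by apply/funext => x; rewrite mxE.
  case: (boolP (`|v| < r)) => vr; first exact: (reg_D_holder_half w (hB tt I) vr).
  by split => *; rewrite ?subrr normr0 !mulr_ge0// sqrtr_ge0.
have [B BP] := choice hD2.
pose M := \sum_i T i + \sum_i B i.
have sT0 : 0 <= \sum_i T i by apply: sumr_ge0 => i _; case: (TP i).
have sB0 : 0 <= \sum_i B i by apply: sumr_ge0 => i _; case: (BP i).
have TM i : T i <= M.
  apply: (@le_trans _ _ (\sum_i T i)); last by rewrite lerDl.
  by rewrite (bigD1 i)//= lerDl sumr_ge0// => j _; case: (TP j).
have BM i : B i <= M.
  apply: (@le_trans _ _ (\sum_i B i)); last by rewrite lerDr.
  by rewrite (bigD1 i)//= lerDl sumr_ge0// => j _; case: (BP j).
exists D2, M; split; first exact: addr_ge0.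
split.
- by move=> v i; have [_ [h _]] := TP i; have [h1 h2] := h v; split => //; exact: le_trans h2 (TM i).
- move=> v w i.
  have -> : (fun x => D1 K v w x i 0) = fun x => if `|v| < r then Dcut v w * transport K v x i + cut v * Dtransport K v w x i else 0.
    by apply/funext => x; rewrite mxE.
  have s0 : 0 <= (C * A + C * A) / Num.sqrt K%:R by rewrite divr_ge0 ?sqrtr_ge0// addr_ge0// mulr_ge0.
  case: (boolP (`|v| < r)) => vr; last by split; [exact: L2_0|rewrite /n2 ip0l sqrtr0 mulr_ge0].
  have [Q Q0 hQ] := square_regular_transport i PK.
  have LT := sq_L2 (hQ tt I) vr; have LD := sq_DL2 (hQ tt I) w vr.
  have L1 := L2Z (Dcut v w) LT; have L2' := L2Z (cut v) LD.
  split; first exact: L2D.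
  apply: le_trans (n2D L1 L2') _; rewrite !n2Z//.
  have [a1 a2] := hA K v i PK vr.
  have -> : (C * A + C * A) / Num.sqrt K%:R * `|w| =
    C * `|w| * (A / Num.sqrt K%:R) + C * (A / Num.sqrt K%:R * `|w|) by ring.
  by apply: lerD; apply: ler_pM; rewrite ?n2_ge0//; [exact: DXb|exact: Xb].
- move=> v w i; have [_ h] := BP i; have [h1 h2] := h v w.
  have BMw : B i * `|w| <= M * `|w| by rewrite ler_wpM2r.
  split => [x xI|x y xI yI]; first exact: le_trans (h1 x xI) BMw.
  by apply: le_trans (h2 x y xI yI) _; rewrite ler_wpM2r ?sqrtr_ge0.
- by move=> v b w w' k i Lk; have [_ [_ [h _]]] := TP i; exact: h.
- by move=> v v' i; have [_ [_ [_ h]]] := TP i; apply: le_trans (h v v') _; rewrite ler_wpM2r// exprn_ge0.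
Qed.

End Truncation.

(** * The spectral gap condition *)

Section SpectralGap.
Context {R : realType}.
Variables (kap eta : R) (m : nat) (lam : nat -> R).
Hypotheses (kap0 : 0 < kap) (eta0 : 0 < eta) (m0 : (0 < m)%N).
Hypothesis lamE : forall j, lam j = kap * (j %/ m).+1%:R ^+ 2.

(** The admissible L^2 size of the small parts. The quotient in [kap] makes [gap_constant *
    gap_weight_bound n <= eta * gap_width n] hold for all positive [n], so this size does not depend
    on [n]. *)
Definition gap_constant : R := kap ^+ 2 / (4 * kap + 2) * eta.

Lemma gap_constant_gt0 : 0 < gap_constant.
Proof.
have k2 : 0 < 4 * kap + 2 by move: kap0; lra.
by rewrite mulr_gt0// divr_gt0// exprn_gt0.
Qed.

Definition centre (n : nat) : R := kap * (n%:R ^+ 2 + n.+1%:R ^+ 2) / 2.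
Definition gap_width (n : nat) : R := kap * (2 * n%:R + 1).

Lemma gap_width_gt0 n : 0 < gap_width n.
Proof. by rewrite mulr_gt0// ltr_wpDl// mulr_ge0. Qed.

Lemma lam_low n j : (j < n * m)%N -> gap_width n / 2 <= centre n - lam j.
Proof.
rewrite -ltn_divLR// => jn; rewrite lamE /gap_width /centre.
have h : (j %/ m).+1%:R ^+ 2 <= n%:R ^+ 2 :> R by rewrite lerXn2r ?nnegrE// ler_nat.
by have := ler_wpM2l (ltW kap0) h; rewrite -[n.+1%:R]natr1; lra.
Qed.

Lemma lam_high n j : (n * m <= j)%N -> gap_width n / 2 <= lam j - centre n.
Proof.
rewrite -leq_divRL// => jn; rewrite lamE /gap_width /centre.
have h : n.+1%:R ^+ 2 <= (j %/ m).+1%:R ^+ 2 :> R by rewrite lerXn2r ?nnegrE// ler_nat.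
by have := ler_wpM2l (ltW kap0) h; rewrite -[n.+1%:R]natr1; lra.
Qed.

Lemma centre_dist n j : gap_width n / 2 <= `|lam j - centre n|.
Proof.
have [jn|jn] := ltnP j (n * m)%N.
  by apply: le_trans (lam_low jn) _; rewrite distrC ler_norm.
exact: le_trans (lam_high jn) (ler_norm _).
Qed.

Lemma centre_dist_gt0 n j : 0 < `|lam j - centre n|.
Proof. by apply: lt_le_trans (centre_dist n j); rewrite divr_gt0// gap_width_gt0. Qed.

Lemma lam_centre n j : (lam j < centre n) = (j < n * m)%N.
Proof.
have G0 := gap_width_gt0 n; have [jn|jn] := ltnP j (n * m)%N.
  by have := lam_low jn; move: G0; lra.
by apply/negbTE; rewrite -leNgt; have := lam_high jn; move: G0; lra.
Qed.

(** With this [nu], the term [w / (2 nu)] of the gap condition is half of the distance of the mode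
    to the centre, and the other half remains for the rate. *)
Definition gap_weight n j : R := (1 + lam j) / `|lam j - centre n|.
Definition gap_weight_bound n : R := 1 + 2 * (centre n + 1) / gap_width n.

Lemma lam_ge0 j : 0 <= lam j.
Proof. by rewrite lamE mulr_ge0 ?(ltW kap0)// sqr_ge0. Qed.

Lemma centre_ge0 n : 0 <= centre n.
Proof. by rewrite divr_ge0// mulr_ge0 ?(ltW kap0)// addr_ge0// sqr_ge0. Qed.

Lemma gap_weight_gt0 n j : 0 < gap_weight n j.
Proof. by rewrite divr_gt0 ?centre_dist_gt0// ltr_wpDr// lam_ge0. Qed.

Lemma gap_weight_le n j : gap_weight n j <= gap_weight_bound n.
Proof.
have D0 := centre_dist_gt0 n j; have G0 := gap_width_gt0 n; have Dg := centre_dist n j.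
have c0 := centre_ge0 n.
rewrite /gap_weight ler_pdivrMr// /gap_weight_bound mulrDl mul1r.
have h : 1 + lam j <= `|lam j - centre n| + (centre n + 1).
  by have := ler_norm (lam j - centre n); lra.
apply: le_trans h _; rewrite lerD2l.
set D := `|_| in D0 Dg *; set G := gap_width n in G0 Dg *.
have -> : 2 * (centre n + 1) / G * D = (centre n + 1) * (D / (G / 2)) by field; rewrite gt_eqF.
by rewrite ler_peMr ?addr_ge0// ler_pdivlMr ?divr_gt0// mul1r.
Qed.

Lemma gap_weight_bound_le n : (0 < n)%N -> gap_constant * gap_weight_bound n <= eta * gap_width n.
Proof.
move=> n0; have G0 := gap_width_gt0 n; have k2 : 0 < 4 * kap + 2 by move: kap0; lra.
have n1 : 1 <= n%:R :> R by rewrite ler1n.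
rewrite /gap_constant mulrAC [leRHS]mulrC (ler_pM2r eta0) mulrAC ler_pdivrMr//.
rewrite /gap_weight_bound; set G := gap_width n in G0 *.
have -> : kap ^+ 2 * (1 + 2 * (centre n + 1) / G) = kap ^+ 2 * (G + 2 * (centre n + 1)) / G by field; rewrite gt_eqF.
rewrite ler_pdivrMr// /G /gap_width /centre -[n.+1%:R]natr1; set x := n%:R in n1 *.
have e1 : kap * (2 * x + 1) + 2 * (kap * (x ^+ 2 + (x + 1) ^+ 2) / 2 + 1) =
  kap * (2 * x ^+ 2 + 4 * x + 2) + 2 by field.
rewrite e1.
have -> : kap * (2 * x + 1) * (4 * kap + 2) * (kap * (2 * x + 1)) = kap ^+ 2 * ((2 * x + 1) ^+ 2 * (4 * kap + 2)) by ring.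
rewrite ler_wpM2l ?sqr_ge0//.
have x2 : x <= x ^+ 2 by rewrite expr2 ler_peMr// (le_trans ler01).
have -> : (2 * x + 1) ^+ 2 * (4 * kap + 2) = kap * (16 * x ^+ 2 + 16 * x + 4) + (8 * x ^+ 2 + 8 * x + 2) by ring.
apply: lerD; last by move: n1 x2; lra.
by rewrite ler_wpM2l ?(ltW kap0)//; move: n1 x2; lra.
Qed.

Lemma sum_sqr_split (T : nat -> R) (d1 d2 : nat -> R) J : (forall j, 0 <= T j) ->
  \sum_(j < J) T j * (d1 j + d2 j) ^+ 2 <= 2 * (\sum_(j < J) T j * d1 j ^+ 2) + 2 * (\sum_(j < J) T j * d2 j ^+ 2).
Proof.
move=> T0; rewrite !mulr_sumr -big_split/=; apply: ler_sum => j _.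
have -> : 2 * (T j * d1 j ^+ 2) + 2 * (T j * d2 j ^+ 2) = T j * (2 * d1 j ^+ 2 + 2 * d2 j ^+ 2) by ring.
by rewrite ler_wpM2l//; have := sqr_ge0 (d1 j - d2 j); nra.
Qed.

(** [J0] is fixed before [n]. The modes below [J0] stay at distance at least 1 from the centre,
    which keeps their weights below [1 + La], and a wide gap absorbs their bounded contribution. In
    the other modes both parts have the small factor [gap_constant]. *)
Lemma spectral_window (S2 : R) (J0 : nat) : 0 <= S2 -> exists n : nat, (0 < n)%N /\
  forall (d1 d2 : nat -> R) (W : R), 0 <= W ->
    (forall J, \sum_(j < J) d1 j ^+ 2 <= gap_constant * W) ->
    (forall J, \sum_(j < J) d2 j ^+ 2 <= S2 * W) ->
    (forall J, \sum_(j < J | (J0 <= j)%N) d2 j ^+ 2 <= gap_constant * W) ->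
    forall J, \sum_(j < J) gap_weight n j * (d1 j + d2 j) ^+ 2 <= 8 * eta * gap_width n * W.
Proof.
move=> S20; pose La := kap * J0.+1%:R ^+ 2.
have La0 : 0 <= La by rewrite mulr_ge0 ?(ltW kap0)// sqr_ge0.
have LS0 : 0 <= (1 + La) * S2 / eta by rewrite divr_ge0 ?(ltW eta0)// mulr_ge0// addr_ge0.
(* The first summands push the centre above [La + 1]; the last makes [eta * kap * n] exceed
   [(1 + La) * S2]. *)
pose X := (La + 1 + (1 + La) * S2 / eta) / kap.
have X0 : 0 <= X by rewrite divr_ge0 ?(ltW kap0)// !addr_ge0//; exact: LS0.
pose n := (Num.truncn X).+1; exists n; split => // d1 d2 W W0 h1 h2 h3 J.
have nX : X <= n%:R by apply: ltW; exact: truncnS_gt.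
have kn : La + 1 + (1 + La) * S2 / eta <= kap * n%:R by rewrite [leRHS]mulrC -ler_pdivrMr.
have n1 : 1 <= n%:R :> R by rewrite ler1n.
have cn : La + 1 <= centre n.
  apply: (@le_trans _ _ (kap * n%:R)); first by move: kn LS0; lra.
  rewrite /centre -mulrA ler_wpM2l ?(ltW kap0)// -natr1; set x := n%:R in n1 *.
  by nra.
have low j : (j < J0)%N -> gap_weight n j <= 1 + La.
  move=> jJ; have lj : lam j <= La.
    rewrite lamE /La ler_wpM2l ?(ltW kap0)// lerXn2r ?nnegrE// ler_nat ltnS.
    by apply: leq_trans (leq_div _ _) (ltnW jJ).
  rewrite /gap_weight ler_pdivrMr ?centre_dist_gt0//.
  apply: (@le_trans _ _ ((1 + La) * 1)); first by rewrite mulr1 lerD2l.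
  rewrite ler_wpM2l ?addr_ge0//; apply: le_trans (_ : centre n - lam j <= _); first by move: cn lj; lra.
  by rewrite distrC ler_norm.
have w0 j := ltW (gap_weight_gt0 n j).
have bnd0 : 0 <= gap_weight_bound n by exact: le_trans (w0 0) (gap_weight_le n 0).
have bd := gap_weight_bound_le (isT : (0 < n)%N).
have s1 : \sum_(j < J) gap_weight n j * d1 j ^+ 2 <= gap_weight_bound n * (gap_constant * W).
  apply: le_trans (_ : gap_weight_bound n * \sum_(j < J) d1 j ^+ 2 <= _); last by rewrite ler_wpM2l.
  by rewrite mulr_sumr; apply: ler_sum => j _; rewrite ler_wpM2r ?sqr_ge0// gap_weight_le.
have s2 : \sum_(j < J) gap_weight n j * d2 j ^+ 2 <= (1 + La) * (S2 * W) + gap_weight_bound n * (gap_constant * W).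
  rewrite (bigID (fun j : 'I_J => (j < J0)%N))/=; apply: lerD.
    apply: le_trans (_ : (1 + La) * \sum_(j < J) d2 j ^+ 2 <= _); last by rewrite ler_wpM2l// addr_ge0.
    rewrite mulr_sumr [leRHS](bigID (fun j : 'I_J => (j < J0)%N))/= -[leLHS]addr0; apply: lerD.
      by apply: ler_sum => j jJ; rewrite ler_wpM2r ?sqr_ge0// low.
    by apply: sumr_ge0 => j _; rewrite mulr_ge0 ?sqr_ge0// addr_ge0.
  apply: le_trans (_ : gap_weight_bound n * \sum_(j < J | (J0 <= j)%N) d2 j ^+ 2 <= _); last by rewrite ler_wpM2l.
  rewrite mulr_sumr; under eq_bigl do rewrite -leqNgt.
  by apply: ler_sum => j _; rewrite ler_wpM2r ?sqr_ge0// gap_weight_le.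
apply: le_trans (sum_sqr_split d1 d2 J w0) _.
have gW : gap_weight_bound n * (gap_constant * W) <= eta * gap_width n * W.
  by rewrite mulrA [X in X * W]mulrC ler_wpM2r.
have lW : (1 + La) * (S2 * W) <= eta * gap_width n * W.
  rewrite mulrA ler_wpM2r// [leRHS]mulrC -ler_pdivrMr// /gap_width.
  by move: kn La0 n1 kap0; set x := n%:R; set y := (1 + La) * S2 / eta; nra.
have T0 : 0 <= eta * gap_width n * W by rewrite !mulr_ge0 ?(ltW eta0)// ltW// gap_width_gt0.
by move: s1 s2 gW lW T0; lra.
Qed.

End SpectralGap.

(** * From remainder estimates to differentiability *)

Section Differentiability.
Context {R : realType} {E : normedModType R}.
Implicit Types (M : E -> E).

Lemma differentiable_of_remainder M (D : E -> E) (p : E) (B C eps : R) : 0 < eps -> 0 <= B -> 0 <= C ->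
  (forall (a : R) h h', D (a *: h + h') = a *: D h + D h') -> (forall h, `|D h| <= B * `|h|) ->
  (forall q, `|M q - M p - D (q - p)| <= C * `|q - p| `^ eps * `|q - p|) ->
  differentiable M p /\ forall h, 'd M p h = D h.
Proof.
move=> eps0 B0 C0 Dlin DB rem.
pose aux := GRing.isLinear.Build R E E *:%R D Dlin.
pose Dl : {linear E -> E} := HB.pack D aux.
have cD : continuous Dl.
  move=> z; apply/cvgrPdist_le => e e0; near=> t.
  rewrite -linearB; apply: le_trans (DB _) _.
  have h : `|z - t| <= e / (1 + B).
    near: t; have : \forall t \near z, ball z (e / (1 + B)) t by apply: nbhsx_ballx; rewrite divr_gt0// ltr_wpDr.
    by apply: filterS => t; rewrite -ball_normE /= => /ltW.
  apply: (@le_trans _ _ ((1 + B) * (e / (1 + B)))); first by apply: ler_pM => //; rewrite lerDr.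
  by rewrite mulrC divfK// gt_eqF// ltr_wpDr.
have o : M \o shift p = cst (M p) + Dl +o_ 0 id.
  apply/eqaddoP => e e0; near=> h.
  rewrite !fctE /=; have := rem (h + p); rewrite addrK opprD addrA.
  move=> /le_trans; apply; rewrite ler_wpM2r//.
  have hd : `|h| <= (e / (C + 1)) `^ eps^-1.
    near: h; have d0 : 0 < (e / (C + 1)) `^ eps^-1 by rewrite powR_gt0// divr_gt0// ltr_wpDl.
    have : \forall h \near 0, ball (0 : E) ((e / (C + 1)) `^ eps^-1) h by apply: nbhsx_ballx.
    by apply: filterS => h; rewrite -ball_normE /= sub0r normrN => /ltW.
  have hp : `|h| `^ eps <= e / (C + 1).
    have := @ge0_ler_powR R eps (ltW eps0) `|h| ((e / (C + 1)) `^ eps^-1).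
    rewrite -powRrM mulVf ?gt_eqF// powRr1 ?divr_ge0 ?(ltW e0)// ?addr_ge0//; apply => //.
    - by rewrite nnegrE.
    - by rewrite nnegrE powR_ge0.
  apply: (@le_trans _ _ ((C + 1) * (e / (C + 1)))); first by apply: ler_pM; rewrite ?powR_ge0// lerDl.
  by rewrite mulrC divfK// gt_eqF// ltr_wpDl.
have dE : 'd M p = Dl :> (E -> E) by exact: diff_unique cD o.
split; last by move=> h; rewrite dE.
by apply/diff_locallyP; rewrite dE.
Unshelve. all: by end_near. Qed.

Lemma nonexpanding_lipschitz M (A : set E) : (forall p q, `|M p - M q| <= `|p - q|) -> [lipschitz M p | p in A].
Proof.
move=> h; rewrite /lipschitz_on; near=> k => -[p q] _; change (`|M p - M q| <= k * `|p - q|).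
apply: le_trans (h p q) _.
rewrite ler_peMl//; near: k; exact: nbhs_pinfty_ge.
Unshelve. all: by end_near. Qed.

End Differentiability.

Lemma quartic_split (R : realFieldType) (a b d : R) : a * b ^+ 2 * d ^+ 4 = a * (b * d ^+ 2) ^+ 2.
Proof. by ring. Qed.

Lemma quarter_gap_le (R : realFieldType) (k x : R) : 0 < k -> 1 <= x ->
  k * (2 * x + 1) / 8 <= k * (x ^+ 2 + (x + 1) ^+ 2) / 2.
Proof.
move=> k0 x1; have x2 : x <= x ^+ 2 by rewrite expr2 ler_peMr// (le_trans ler01).
by rewrite -!mulrA ler_pM2l//; lra.
Qed.

Lemma rate_split (R : realFieldType) (x : R) : 64 * (8 * (64 * 64)^-1 * x) = x / 8.
Proof. by field. Qed.

Lemma continuous_positive_part (R : realType) (T : topologicalType) (v : R -> T) :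
  {within `[0, +oo[, continuous v} -> continuous (fun s : R => v (Num.max s 0)).
Proof.
move=> cv s; have s0 : `[0, +oo[%classic (Num.max s 0) by rewrite /= in_itv/= andbT le_max lexx orbT.
have cm : {for s, continuous (fun z : R => Num.max z 0)}.
  by apply: (@continuous_max _ _ id (cst 0)); [exact: cvg_id|exact: cvg_cst].
have := cv (Num.max s 0); rewrite /continuous_at/= => cvs.
have cw : v @ within `[0, +oo[ (nbhs (Num.max s 0)) --> v (Num.max s 0).
  by move=> P /cvs; rewrite nbhs_subspace_in.
apply: (cvg_comp _ _ _ cw) => P Pw.
apply: (@filterS _ (nbhs s) _ _ _ _ (cm _ Pw)) => z /= h.
by apply: h; rewrite in_itv/= andbT le_max lexx orbT.
Qed.

(** * From the truncated nonlinearity to the inertial manifold *)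

Section Assembly.
Context {R : realType} (L : R) (L0 : 0 < L) (m : nat) (m0 : (0 < m)%N).
Local Notation Phi := (H10 L m).
Implicit Types (u v w : Phi) (i : 'I_m) (j J : nat).
Variables (N : Phi -> R -> 'cV[R]_m) (D1 D2 : Phi -> Phi -> R -> 'cV[R]_m) (e B : R).
Hypotheses (e0 : 0 <= e) (B0 : 0 <= B).
Hypothesis td : truncated_derivative N D1 D2 e B.

Let kap : R := (pi / L) ^+ 2.
(** Chosen so that 64 times the constant [8 * eta * gap_width] of [spectral_window] is exactly
    [gap_width / 8], the rate [gam] used below. *)
Let eta : R := (64 * 64)^-1.

Let kap0 : 0 < kap. Proof. by rewrite exprn_gt0// divr_gt0// pi_gt0. Qed.
Let eta0 : 0 < eta. Proof. by rewrite invr_gt0 mulr_gt0. Qed.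

Hypothesis small : m%:R * e ^+ 2 <= gap_constant kap eta.

Local Notation c := (hcoef (m := m)).
Local Notation lam := (hlam L m).
Local Notation one := (n2 L (fun=> 1)).

Let fr := H10_hilbert_frame L0 m0.

Let lamE j : lam j = kap * (j %/ m).+1%:R ^+ 2.
Proof. by rewrite /hlam /eigv /kap -exprMn; congr (_ ^+ 2); rewrite [RHS]mulrC mulrA. Qed.

Let lam0 j : 0 <= lam j. Proof. by rewrite lamE mulr_ge0 ?(ltW kap0)// sqr_ge0. Qed.

Let growth (b : R) : exists J0, forall j, (J0 <= j)%N -> b <= lam j.
Proof.
pose k := (Num.truncn (`|b| / kap)).+1; exists (k * m)%N => j kj.
have bk : `|b| / kap <= k%:R by apply: ltW; exact: truncnS_gt.
have kj' : k%:R <= (j %/ m).+1%:R :> R by rewrite ler_nat ltnW// ltnS leq_divRL.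
have k1 : 1 <= (j %/ m).+1%:R :> R by rewrite ler1n.
apply: le_trans (ler_norm b) _; rewrite lamE -ler_pdivrMl// mulrC.
apply: le_trans (le_trans bk kj') _; rewrite expr2 ler_peMr//.
Qed.

Definition mode_value v j : R := lcoef L j (N v).
Definition mode_derivative v w j : R := lcoef L j (D1 v w) + lcoef L j (D2 v w).

Lemma lcoef_sum_le (h : R -> 'cV[R]_m) (b : R) J :
  (forall i, L2 L (fun x => h x i 0) /\ n2 L (fun x => h x i 0) <= b) ->
  \sum_(j < J) lcoef L j h ^+ 2 <= m%:R * b ^+ 2.
Proof.
move=> hb; apply: le_trans (lcoef_bessel L0 m0 J (fun i => (hb i).1)) _.
apply: (@le_trans _ _ (\sum_(i < m) b ^+ 2)); last by rewrite sumr_const card_ord mulr_natl.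
apply: ler_sum => i _; rewrite -[leLHS]/(ip L (fun x => h x i 0) (fun x => h x i 0)) -n2_sqr.
by rewrite lerXn2r ?nnegrE ?n2_ge0//; [exact: le_trans (n2_ge0 L _) (hb i).2|exact: (hb i).2].
Qed.

Let small_part v w i := td_small td v w i.

Let holder_part v w i : L2 L (fun x => D2 v w x i 0) /\ n2 L (fun x => D2 v w x i 0) <= B * one * `|w|.
Proof.
have h := td_holder td v w i; have ch := holder_half_continuous h.
split; first exact: continuous_L2.
by apply: le_trans (n2_bounded_le L0 ch h.1) _; rewrite mulrAC.
Qed.

Let derivative_L2 v w i : L2 L (fun x => D1 v w x i 0 + D2 v w x i 0).
Proof. by apply: L2D; [case: (small_part v w i)|case: (holder_part v w i)]. Qed.

Let mode_derivativeE v w k i : mode_derivative v w (k * m + i)%N =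
  ip L (fun x => D1 v w x i 0 + D2 v w x i 0) (efun L k).
Proof.
rewrite /mode_derivative !(lcoefE _ m0) ipD//; last exact: efun_L2.
  by case: (small_part v w i).
by case: (holder_part v w i).
Qed.

Let DN_lin u (a : R) v v' j : mode_derivative u (a *: v + v') j = a * mode_derivative u v j + mode_derivative u v' j.
Proof.
have [k [i ->]] := hindex m0 j; rewrite !mode_derivativeE; apply: (td_lin td).
exact: efun_L2.
Qed.

Let remainder u v (x : R) : 'cV[R]_m :=
  \col_i (N v x i 0 - N u x i 0 - (D1 u (v - u) x i 0 + D2 u (v - u) x i 0)).

Let remainder_le u v i : L2 L (fun x => remainder u v x i 0) /\ n2 L (fun x => remainder u v x i 0) <= B * `|v - u| ^+ 2.
Proof.
have -> : (fun x => remainder u v x i 0) = fun x => N v x i 0 - N u x i 0 - (D1 u (v - u) x i 0 + D2 u (v - u) x i 0).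
  by apply/funext => x; rewrite mxE.
split; last exact: (td_taylor td).
apply: L2B; last exact: derivative_L2.
by apply: L2B; [case: (td_value td v i)|case: (td_value td u i)].
Qed.

Let quad u v J : \sum_(j < J) (mode_value v j - mode_value u j - mode_derivative u (v - u) j) ^+ 2 <=
  m%:R * B ^+ 2 * `|v - u| ^+ 4.
Proof.
have -> : m%:R * B ^+ 2 * `|v - u| ^+ 4 = m%:R * (B * `|v - u| ^+ 2) ^+ 2.
  exact: quartic_split.
apply: le_trans (lcoef_sum_le J (remainder_le u v)).
rewrite le_eqVlt; apply/orP; left; apply/eqP; apply: eq_bigr => j _; congr (_ ^+ 2).
have [k [i jE]] := hindex m0 j; rewrite jE /mode_value !(lcoefE _ m0) mode_derivativeE.
have Lv := (td_value td v i).1; have Lu := (td_value td u i).1; have Le := efun_L2 L k.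
have LB := L2B Lv Lu; rewrite -(ipB Lv Lu Le) -(ipB LB (derivative_L2 u (v - u) i) Le).
by congr (ip L _ _); apply/funext => x; rewrite mxE.
Qed.

Let sum1 v w J : \sum_(j < J) lcoef L j (D1 v w) ^+ 2 <= gap_constant kap eta * `|w| ^+ 2.
Proof.
apply: le_trans (lcoef_sum_le J (small_part v w)) _.
by rewrite exprMn mulrA ler_wpM2r// exprn_ge0.
Qed.

Let S2 : R := m%:R * (B * one) ^+ 2.

Let S20 : 0 <= S2. Proof. by rewrite mulr_ge0// sqr_ge0. Qed.

Let sum2 v w J : \sum_(j < J) lcoef L j (D2 v w) ^+ 2 <= S2 * `|w| ^+ 2.
Proof. by apply: le_trans (lcoef_sum_le J (holder_part v w)) _; rewrite exprMn mulrA. Qed.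

Let Lp : R := 2 * gap_constant kap eta + 2 * S2.

Let gc0 : 0 < gap_constant kap eta. Proof. exact: gap_constant_gt0. Qed.

Let Lp0 : 0 <= Lp. Proof. by rewrite addr_ge0// mulr_ge0// ltW. Qed.

Let DN_le u v J : \sum_(j < J) mode_derivative u v j ^+ 2 <= Lp * `|v| ^+ 2.
Proof.
have := sum_sqr_split (T := fun=> 1 : R) (fun j => lcoef L j (D1 u v)) (fun j => lcoef L j (D2 u v)) J (fun _ => ler01).
under eq_bigr do rewrite mul1r; under [in X in _ <= X]eq_bigr do rewrite mul1r.
under [X in _ <= _ + 2 * X]eq_bigr do rewrite mul1r.
move=> h; apply: (le_trans h).
have -> : Lp * `|v| ^+ 2 = 2 * (gap_constant kap eta * `|v| ^+ 2) + 2 * (S2 * `|v| ^+ 2).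
  by rewrite [LHS]mulrDl !mulrA.
apply: lerD.
  by apply: ler_wpM2l => //; exact: sum1.
by apply: ler_wpM2l => //; exact: sum2.
Qed.

Let N0_le J : \sum_(j < J) mode_value 0 j ^+ 2 <= m%:R * B ^+ 2.
Proof. exact: lcoef_sum_le (td_value td 0). Qed.

Let C20 : 0 <= m%:R * B ^+ 2. Proof. by rewrite mulr_ge0// sqr_ge0. Qed.

Let N_L2 u : L2v L (N u). Proof. by move=> i; case: (td_value td u i). Qed.

Let vector_le (h : R -> 'cV[R]_m) (b : R) : 0 <= b -> (forall i, n2 L (fun x => h x i 0) <= b) ->
  l2 L h h <= (m%:R * b) ^+ 2.
Proof.
move=> b0 hb; apply: (@le_trans _ _ (\sum_(i < m) b ^+ 2)).
  apply: ler_sum => i _; rewrite -[leLHS]/(ip L (fun x => h x i 0) (fun x => h x i 0)) -n2_sqr.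
  by rewrite lerXn2r ?nnegrE ?n2_ge0// hb.
rewrite sumr_const card_ord -[leLHS]mulr_natl exprMn ler_wpM2r ?sqr_ge0//.
by rewrite expr2 ler_peMr// ler1n.
Qed.

Let N_bound u : l2 L (N u) (N u) <= (m%:R * B) ^+ 2.
Proof. by apply: vector_le => // i; case: (td_value td u i). Qed.

Let Q : R := m%:R * (B + (e + B * one)).

Let one0 : 0 <= one. Proof. exact: n2_ge0. Qed.

Let Q0 : 0 <= Q. Proof. by rewrite mulr_ge0// !addr_ge0// mulr_ge0. Qed.

Let N_lip u v : `|v - u| <= 1 -> l2 L (-1 *: N u + N v) (-1 *: N u + N v) <= Q ^+ 2 * `|v - u| ^+ 2.
Proof.
move=> d1; set d := v - u in d1 *.
rewrite -exprMn /Q -mulrA; apply: vector_le => [|i]; first by rewrite mulr_ge0// !addr_ge0// mulr_ge0.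
have [r1 r2] := remainder_le u v i; have [s1 s2] := small_part u d i; have [h1 h2] := holder_part u d i.
have -> : (fun x => (-1 *: N u + N v) x i 0) = fun x => remainder u v x i 0 + (D1 u d x i 0 + D2 u d x i 0).
  by apply/funext => x; rewrite [remainder _ _ _ _ _]mxE subrK !fctE mxE [X in X + _]mxE mulN1r addrC.
apply: le_trans (n2D r1 (L2D s1 h1)) _; rewrite mulrDl; apply: lerD.
  apply: le_trans r2 _; rewrite ler_wpM2l// -[leRHS]mulr1 expr2 ler_wpM2l//.
by apply: le_trans (n2D s1 h1) _; rewrite mulrDl; exact: lerD.
Qed.

Theorem inertial_manifold_exists : exists St (eps : R) MM,
  [/\ solution_semigroup N St, 0 < eps & inertial_manifold St eps MM].
Proof.
(* Divided by [B ^+ 2 + 1] because the Hoelder constant of [D2 v w] is [B * |w|], whose square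
   multiplies the tail bound. *)
have tail_e : 0 < gap_constant kap eta / (B ^+ 2 + 1) by rewrite divr_gt0// ltr_wpDl// sqr_ge0.
have [J0 hJ0] := lcoef_holder_tail L0 m0 tail_e.
have sum3 v w J : \sum_(j < J | (J0 <= j)%N) lcoef L j (D2 v w) ^+ 2 <= gap_constant kap eta * `|w| ^+ 2.
  apply: le_trans (hJ0 (B * `|w|) (D2 v w) (td_holder td v w) J) _.
  rewrite exprMn mulrA ler_wpM2r ?exprn_ge0// mulrAC ler_pdivrMr ?ltr_wpDl ?sqr_ge0//.
  by rewrite ler_wpM2l ?(ltW gc0)// lerDl.
have [n [n0 hn]] := spectral_window kap0 eta0 m0 lamE J0 S20.
have G0 : 0 < gap_width kap n by exact: gap_width_gt0.
(* Every mode is at least half a gap away from the centre. The weight consumes half of the distance,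
   and [2 * gam], a quarter of the gap, fits into the rest. *)
pose gam : R := gap_width kap n / 8.
have gam0 : 0 < gam by rewrite divr_gt0.
have gamth : gam <= centre kap n.
  have n1 : 1 <= n%:R :> R by rewrite ler1n.
  rewrite /gam /gap_width /centre -[n.+1%:R]natr1; exact: quarter_gap_le.
have nu0 j : 0 < gap_weight kap lam n j by exact: (gap_weight_gt0 kap0 m0 lamE).
have nuK j : gap_weight kap lam n j <= gap_weight_bound kap n by exact: (gap_weight_le kap0 m0 lamE).
pose l2' : R := 8 * eta * gap_width kap n.
have l20 : 0 <= l2' by exact: (mulr_ge0 (mulr_ge0 (ler0n _ 8) (ltW eta0)) (ltW G0)).
have small' : 64 * l2' <= gam.
  have -> : 64 * l2' = gam; last by [].
  exact: rate_split.
have lamn j : (lam j < centre kap n) = (j < n * m)%N by exact: (lam_centre kap0 m0 lamE).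
have gap j : 2 * gam + hweight L m j / (2 * gap_weight kap lam n j) <= `|lam j - centre kap n|.
  have D0 : 0 < `|lam j - centre kap n| by exact: (centre_dist_gt0 kap0 m0 lamE).
  have Dg := centre_dist kap0 m0 lamE n j.
  have w0 : 1 + lam j != 0 by rewrite gt_eqF// ltr_wpDr.
  have -> : hweight L m j / (2 * gap_weight kap lam n j) = `|lam j - centre kap n| / 2.
    rewrite /gap_weight /hweight; set D := `|_| in D0 *; have Dn : D != 0 by rewrite gt_eqF.
    by field; rewrite Dn.
  by rewrite /gam; move: Dg; lra.
have DN_nu u v J : \sum_(j < J) gap_weight kap lam n j * mode_derivative u v j ^+ 2 <= l2' * `|v| ^+ 2.
  exact: (hn (fun j => lcoef L j (D1 u v)) (fun j => lcoef L j (D2 u v)) (`|v| ^+ 2) (exprn_ge0 2 (normr_ge0 v)) (sum1 u v) (sum2 u v) (sum3 u v) J).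
have [S SP] := forward_semigroup fr lam0 (fun=> erefl) growth C20 Lp0 C20 DN_lin quad DN_le N0_le.
have sol u : solution N (S^~ u).
  have [_ [cS mS]] := SP u.
  exact: (modal_is_solution L0 m0 (mulr_ge0 (ler0n _ m) B0) Q0 N_L2 N_bound N_lip cS mS).
have [M [DM [eps [C [[eps0 PM MP ML] [[DMl DMb DMr DMh] [inv trk]]]]]]] :=
  abstract_inertial_manifold fr lam0 (fun=> erefl) growth C20 Lp0 C20 DN_lin quad DN_le N0_le
    (hcoef_projH L0 m0 n) gam0 gamth nu0 nuK l20 small' lamn gap DN_nu SP.
exists S, eps, (range (fun p => projH n p + M p)); split => //.
  split=> [u|v vs t t0]; first by split; [case: (SP u)|exact: sol].
  (* A solution is continuous on the closed half line only; freezing it at negative times makes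
     [forward_uniqueness] applicable. *)
  have [cv dv] := vs; pose v' s := v (Num.max s 0).
  have v'E s : 0 <= s -> v' s = v s by move=> s0; rewrite /v' max_l.
  have cv' : continuous v'.
    exact: continuous_positive_part.
  have [S0 [cS mS]] := SP (v 0); rewrite -(v'E t)//.
  apply: (forward_uniqueness fr lam0 (fun=> erefl) C20 Lp0 DN_lin quad DN_le t0 cv' cS _ _ _ t0 (lexx t)).
  - by rewrite S0 v'E.
  - move=> j s s0 _; have ms := solution_modal L0 m0 vs j s0; rewrite v'E ?(ltW s0)//.
    apply: near_eq_is_derive ms; near=> z; rewrite /= v'E//; near: z.
    by apply: filterS (lt_nbhsr s0) => z /ltW.
  - by move=> j s s0 _; exact: mS.
have MMeq : range (fun p => projH n p + M p) = [set p + M p | p in range (projH n)].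
  apply/seteqP; split => [_ [p _ <-]|_ [_ [p _ <-] <-]].
    by exists (projH n p); [exists p|rewrite MP].
  by exists p => //; rewrite MP.
split; first exact: inv.
  exists n, M; split => //.
  - exact: nonexpanding_lipschitz.
  - have hM : M \o projH n = M by apply/funext => p /=; exact: MP.
    have dM p := differentiable_of_remainder eps0 (ler0n R 3) (normr_ge0 C) (DMl p) (DMb p)
      (fun q => le_trans (DMr p q) (ler_wpM2r (normr_ge0 _) (ler_wpM2r (powR_ge0 _ _) (ler_norm C)))).
    rewrite /C1_Holder hM; split=> [p|p0]; first by case: (dM p).
    exists 1, C; split=> [|p q _ _ w]; first exact: ltr01.
    move: (DMh p q w); have [_ Dp] := dM p; have [_ Dq] := dM q.
    by rewrite -[X in `|X - _|]Dp -[X in `|_ - X|]Dq.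
exists 2, (centre kap n); split => //; first exact: lt_le_trans gamth.
Unshelve. all: by end_near. Qed.

End Assembly.

Theorem theorem4p2 (R : realType) (L : R) (m : nat)
    (f : 'cV[R]_m -> 'M[R]_m) (g : 'cV[R]_m -> 'cV[R]_m)
    (S : R -> H10 L m -> H10 L m) (rad r1 r : R) (K0 : nat) (phi : R -> R) :
  0 < L -> (0 < m)%N ->
  smooth f -> compactly_supported f ->
  smooth g -> compactly_supported g ->
  solution_semigroup (rda_rhs f g) S ->
  absorbing S [set u : H10 L m | `|u| <= rad / 2] ->
  (forall K, (0 < K)%N ->
     Vmap f K @` [set u : H10 L m | `|u| <= rad / 2] `<=` ball 0 r1) ->
  r1 < r ->
  U_diffeo L f r K0 ->
  smooth phi ->
  (forall z, z <= r1 ^+ 2 -> phi z = 1) ->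
  (forall z, r ^+ 2 <= z -> phi z = 0) ->
  exists K1 : nat, forall K : nat, (K1 <= K)%N ->
    exists (St : R -> H10 L m -> H10 L m) (eps : R) (MM : set (H10 L m)),
      [/\ solution_semigroup (cutoff_rhs f g K phi r) St,
          0 < eps & inertial_manifold St eps MM].
Proof.
move=> L0 m0 sf kf sg kg _ _ _ _ Ud sp _ p0.
have [A A0 est] := truncation_estimates L0 m0 sf kf sg kg Ud sp p0.
have gc0 : 0 < gap_constant ((pi / L) ^+ 2) ((64 * 64)^-1 : R).
  by apply: gap_constant_gt0; rewrite ?invr_gt0// exprn_gt0// divr_gt0// pi_gt0.
set gc := gap_constant _ _ in gc0.
(* Beyond this index [m * A ^+ 2 / K] is at most the gap constant, which is the smallness required
   of [D1]; the successor also keeps K positive. *)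
exists (maxn K0 (Num.truncn (m%:R * A ^+ 2 / gc)).+1) => K; rewrite geq_max => /andP[K0K KK].
have K_gt0 : (0 < K)%N by exact: leq_trans KK.
have Kr : 0 < K%:R :> R by rewrite ltr0n.
have [D2 [B [B0 td]]] := est K (conj K0K K_gt0).
have e0 : 0 <= A / Num.sqrt K%:R by rewrite divr_ge0// sqrtr_ge0.
apply: (inertial_manifold_exists L0 m0 e0 B0 td).
have -> : m%:R * (A / Num.sqrt K%:R) ^+ 2 = m%:R * A ^+ 2 / K%:R.
  by rewrite expr_div_n sqr_sqrtr ?mulrA// ltW.
rewrite -[leRHS]/gc ler_pdivrMr// -ler_pdivrMl// mulrC.
by apply: ltW; apply: (lt_le_trans (truncnS_gt _)); rewrite ler_nat.
Qed.
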